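(* Let $a\in(-1,1)$ and let $U$ be a solution of $$\begin{cases}x_{n+1}^a\partial_tU+\operatorname{div}(x_{n+1}^aA(x)\nabla U)=0&\text{in }\mathbb{B}_4^+\times[0,16),\\ \lim_{x_{n+1}\to0^+}x_{n+1}^a\partial_{n+1}U(x,x_{n+1},t)=0&\text{in }B_4\times[0,16),\end{cases}$$ such that $\int_{\mathbb{B}_1^+}x_{n+1}^aU(X,0)^2\,dX>0$, and put $$\theta=\frac{\int_{\mathbb{B}_4^+\times[0,16)}x_{n+1}^aU(X,t)^2\,dX\,dt}{\int_{\mathbb{B}_1^+}x_{n+1}^aU(X,0)^2\,dX}.$$ Then there exists a constant $N=N(n,a,A)>2$ such that $N\log(N\theta)\ge1$ and such that for all $0\le t\le\frac{1}{N\log(N\theta)}$ $$N\int_{\mathbb{B}_2^+}x_{n+1}^aU(X,t)^2\,dX\ \ge\ \int_{\mathbb{B}_1^+}x_{n+1}^aU(X,0)^2\,dX.$$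
   Context: $X=(x,x_{n+1})\in\mathbb{R}^n\times\mathbb{R}$; $\nabla,\operatorname{div}$ are in $X$; $\mathbb{B}_r=\{|X|<r\}$, $\mathbb{B}_r^+=\mathbb{B}_r\cap\{x_{n+1}>0\}$, $B_r=\{x\in\mathbb{R}^n:|x|<r\}$. $A(x)$ is a symmetric $(n+1)\times(n+1)$ matrix-valued function on $\mathbb{R}^n$ with $\Lambda^{-1}\mathbb{I}\le A\le\Lambda\mathbb{I}$, $A(0)=\mathbb{I}_{n+1}$, $a_{(n+1)i}=\delta_{(n+1)i}$ for all $i$, and $|A(x)-A(y)|\le K|x-y|$; the operator $\partial_t-\operatorname{div}_x(A'(x)\nabla_x)$, with $A'$ the upper-left $n\times n$ block, has a global fundamental solution with total mass $1$ in the space variable. Solutions are weak solutions: $U,\nabla U\in L^2(\mathbb{B}_4^+\times(0,16);x_{n+1}^a\,dX\,dt)$ and $\int_{\mathbb{B}_4^+\times(0,16)}x_{n+1}^a(\langle A\nabla U,\nabla\phi\rangle+U\phi_t)\,dX\,dt=0$ for all $\phi\in C_0^\infty(\mathbb{B}_4\times(0,16))$; such $U$ has a representative that is continuous on $\overline{\mathbb{B}_r^+}\times[0,r^2]$ for $r<4$, which is used to define $U(\cdot,t)$, $t\ge0$. *)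

(* Defs.v *)
From HB Require Import structures.
From mathcomp Require Import all_boot all_order all_algebra.
From mathcomp Require Import all_classical all_reals all_analysis.

Set Implicit Arguments.
Unset Strict Implicit.
Unset Printing Implicit Defensive.

Import Order.TTheory GRing.Theory Num.Theory.
Import numFieldNormedType.Exports.

Local Open Scope classical_set_scope.
Local Open Scope ring_scope.

(* A point X = (x, x_{n+1}) of R^n x R is a row vector of 'rV[R]_n.+1 whose
   last coordinate [X 0 ord_max] is x_{n+1}; then x = [col' ord_max X].
   Space-time points (X, t) live in ['rV[R]_m * R]. *)

Section rV_measurable.
Context (R : realType) (m : nat).

Let coord (i : 'I_m) (v : 'rV[R]_m) : R := v 0 i.

Let rV_set0 : g_sigma_preimage coord set0.
Proof. exact: sigma_algebra0. Qed.

Let rV_setC B : g_sigma_preimage coord B -> g_sigma_preimage coord (~` B).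
Proof. exact: sigma_algebraC. Qed.

Let rV_bigcup (F : (set 'rV[R]_m)^nat) :
  (forall i, g_sigma_preimage coord (F i)) ->
  g_sigma_preimage coord (\bigcup_i (F i)).
Proof. exact: sigma_algebra_bigcup. Qed.

Definition rV_display : measure_display. Proof. exact. Qed.

(* Generated by the coordinates, as for tuples: the Borel sigma-algebra. *)
HB.instance Definition _ := @isMeasurable.Build rV_display
  'rV[R]_m (g_sigma_preimage coord) rV_set0 rV_setC rV_bigcup.

End rV_measurable.

Definition rV_snoc (R : realType) (m : nat) (p : 'rV[R]_m * R) : 'rV[R]_m.+1 :=
  \row_(i < m.+1) oapp (fun j => p.1 0 j) p.2 (unlift ord_max i).

Lemma measurable_coord (R : realType) (m : nat) (i : 'I_m) :
  measurable_fun [set: 'rV[R]_m] (fun v => v 0 i).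
Proof.
move=> _ Y mY; rewrite setTI; apply: sub_sigma_algebra => /=.
rewrite -bigcup_seq/=; exists i => /=; first by rewrite mem_index_enum.
by exists Y => //; rewrite setTI.
Qed.

Lemma measurable_fun_rVP d (T : measurableType d) (R : realType) (m : nat)
    (f : T -> 'rV[R]_m) :
  (forall i, measurable_fun [set: T] (fun x => f x 0 i)) ->
  measurable_fun [set: T] f.
Proof.
move=> mf.
have sub : g_sigma_preimage (fun i => (fun v : 'rV[R]_m => v 0 i) \o f)
    `<=` measurable.
  apply: smallest_sub; first exact: sigma_algebra_measurable.
  case: m => [|m] in f mf *; first by rewrite big_ord0.
  rewrite -bigcup_mkord_ord; apply: bigcup_sub => i Ii.
  by move=> B [C mC <-]; exact: mf.
rewrite g_sigma_preimage_comp in sub.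
by move=> _ B mB; apply: sub; exists B.
Qed.

Lemma measurable_rV_snoc (R : realType) (m : nat) :
  measurable_fun [set: 'rV[R]_m * measurableTypeR R] (@rV_snoc R m).
Proof.
apply: measurable_fun_rVP => i.
case: (unliftP ord_max i) => [j|] ->.
  rewrite (_ : (fun x => _) = (fun v : 'rV[R]_m => v 0 j) \o fst); last first.
    by apply/funext => p; rewrite mxE liftK.
  by apply: measurableT_comp => //; exact: measurable_coord.
rewrite (_ : (fun x => _) = snd) //.
by apply/funext => p; rewrite mxE unlift_none.
Qed.

Section rV_snoc_measure.
Local Open Scope ereal_scope.
Context (R : realType) (m : nat) (mu : {measure set 'rV[R]_m -> \bar R}).

Definition rV_snoc_measure : set 'rV[R]_m.+1 -> \bar R :=
  pushforward (mu \x @lebesgue_measure R) (@rV_snoc R m).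

Let snoc0 : rV_snoc_measure set0 = 0.
Proof. by rewrite /rV_snoc_measure /pushforward preimage_set0 measure0. Qed.

Let snoc_ge0 B : 0 <= rV_snoc_measure B.
Proof. by rewrite /rV_snoc_measure /pushforward; exact: measure_ge0. Qed.

Let snoc_sigma_additive : semi_sigma_additive rV_snoc_measure.
Proof.
by apply: measure_semi_sigma_additive; exact: measurable_rV_snoc.
Qed.

HB.instance Definition _ := isMeasure.Build _ _ _
  rV_snoc_measure snoc0 snoc_ge0 snoc_sigma_additive.

End rV_snoc_measure.

Fixpoint lebesgue_rV (R : realType) (m : nat) :
    {measure set 'rV[R]_m -> \bar R} :=
  match m return {measure set 'rV[R]_m -> \bar R} with
  | 0 => \d_ (0 : 'rV[R]_0)
  | k.+1 => rV_snoc_measure (lebesgue_rV R k)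
  end.

Definition lebesgue_rVt (R : realType) (m : nat) :
    {measure set ('rV[R]_m * measurableTypeR R) -> \bar R} :=
  (lebesgue_rV R m \x @lebesgue_measure R)%E.

(* The library norm [`|M|] on matrices is the maximum of the entries. *)
Definition enorm (R : realType) (p q : nat) (M : 'M[R]_(p, q)) : R :=
  Num.sqrt (\sum_i \sum_j M i j ^+ 2).

Definition eball (R : realType) (m : nat) (r : R) : set 'rV[R]_m :=
  [set X | enorm X < r].

Definition eball_plus (R : realType) (n : nat) (r : R) : set 'rV[R]_n.+1 :=
  eball r `&` [set X | 0 < X 0 ord_max].

Definition cyl (R : realType) (m : nat) (B : set 'rV[R]_m) (I : set R) :
    set ('rV[R]_m * R) := B `*` I.

(* All iterated directional derivatives of order <= k exist and are
   continuous; in finite dimension this is the usual class C^k. *)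
Fixpoint is_Ck (R : realType) (V : normedModType R) (k : nat) (f : V -> R) :
    Prop :=
  if k is k'.+1 then
    continuous f /\
    forall v : V, (forall x, derivable f x v) /\ is_Ck k' ('D_v f)
  else continuous f.

Definition smooth (R : realType) (V : normedModType R) (f : V -> R) : Prop :=
  forall k, is_Ck k f.

Definition test_function (R : realType) (V : normedModType R) (D : set V)
    (f : V -> R) : Prop :=
  [/\ smooth f,
      compact (closure [set x | f x != 0]) &
      closure [set x | f x != 0] `<=` D].

Definition dspace (R : realType) (m : nat) (i : 'I_m) (f : 'rV[R]_m * R -> R) :
    'rV[R]_m * R -> R :=
  'D_((delta_mx 0 i, 0) : 'rV[R]_m * R) f.

Definition grad (R : realType) (m : nat) (f : 'rV[R]_m * R -> R)
    (z : 'rV[R]_m * R) : 'rV[R]_m :=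
  \row_i dspace i f z.

Definition dtime (R : realType) (m : nat) (f : 'rV[R]_m * R -> R) :
    'rV[R]_m * R -> R :=
  'D_((0, 1) : 'rV[R]_m * R) f.

Definition is_weak_grad (R : realType) (m : nat) (D : set ('rV[R]_m * R))
    (f : 'rV[R]_m * R -> R) (G : 'rV[R]_m * R -> 'rV[R]_m) : Prop :=
  forall phi, test_function D phi -> forall i,
    \int[lebesgue_rVt R m]_(z in D) (f z * dspace i phi z) =
    - \int[lebesgue_rVt R m]_(z in D) (G z 0 i * phi z).

(* <M u, v> *)
Definition mxform (R : realType) (m : nat) (M : 'M[R]_m) (u v : 'rV[R]_m) : R :=
  (v *m M *m u^T) 0 0.

Definition admissible_coef (R : realType) (n : nat) (Lambda K : R)
    (A : 'rV[R]_n -> 'M[R]_n.+1) : Prop :=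
  [/\ 0 < Lambda,
      forall x, (A x)^T = A x,
      forall x v, Lambda^-1 * enorm v ^+ 2 <= mxform (A x) v v
                  <= Lambda * enorm v ^+ 2 &
   [/\ A 0 = 1%:M,
      forall x i, A x ord_max i = (ord_max == i)%:R &
      forall x y, enorm (A x - A y) <= K * enorm (x - y)]].

Definition tangential (R : realType) (n : nat) (A : 'rV[R]_n -> 'M[R]_n.+1)
    (x : 'rV[R]_n) : 'M[R]_n :=
  row' ord_max (col' ord_max (A x)).

(* [Gamma x t y] is the value at (x, t) of the fundamental solution of
   d_t - div (B grad) with pole (y, 0), the operator being autonomous.  The
   pole and the initial condition are both contained in the identity
   (d_t - div (B grad)) Gamma = delta_(y, 0) in D'(R^m x R), where Gamma is
   extended by 0 to t <= 0; this is why the test functions there are not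
   required to vanish near t = 0. *)
Definition fundamental_solution (R : realType) (m : nat) (B : 'rV[R]_m -> 'M[R]_m)
    (Gamma : 'rV[R]_m -> R -> 'rV[R]_m -> R) : Prop :=
  let mu := lebesgue_rVt R m in
  let D : set ('rV[R]_m * R) := cyl setT `]0, +oo[%classic in
  (forall x t y, 0 < t -> 0 <= Gamma x t y) /\
  forall y, let u z := Gamma z.1 z.2 y in
  exists G : 'rV[R]_m * R -> 'rV[R]_m,
  [/\ forall C : set ('rV[R]_m * R), compact C -> mu.-integrable (C `&` D) (EFin \o u),
      forall C : set ('rV[R]_m * R), compact C -> forall i,
        mu.-integrable (C `&` D) (fun z => (G z 0 i)%:E),
      is_weak_grad D u G &
      forall phi, test_function setT phi ->
        \int[mu]_(z in D) (mxform (B z.1) (G z) (grad phi z)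
                           - u z * dtime phi z) = phi (y, 0)].

Definition total_mass_one (R : realType) (m : nat)
    (Gamma : 'rV[R]_m -> R -> 'rV[R]_m -> R) : Prop :=
  forall t y, 0 < t ->
    (lebesgue_rV R m).-integrable setT (fun x => (Gamma x t y)%:E) /\
    \int[lebesgue_rV R m]_x Gamma x t y = 1.

Definition weight (R : realType) (n : nat) (a : R) (X : 'rV[R]_n.+1) : R :=
  X 0 ord_max `^ a.

Definition weightedL2 (R : realType) (n : nat) (a : R)
    (D : set ('rV[R]_n.+1 * R)) (f : 'rV[R]_n.+1 * R -> R) : Prop :=
  measurable_fun (D : set ('rV[R]_n.+1 * measurableTypeR R)) f /\
  (\int[lebesgue_rVt R n.+1]_(z in D) (weight a z.1 * f z ^+ 2)%:E < +oo)%E.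

(* The test functions need not vanish on {x_{n+1} = 0}: this encodes the
   Neumann condition. *)
Definition weak_solution (R : realType) (n : nat) (a : R)
    (A : 'rV[R]_n -> 'M[R]_n.+1) (U : 'rV[R]_n.+1 * R -> R) : Prop :=
  let Q : set ('rV[R]_n.+1 * R) := cyl (eball_plus 4) `]0, 16[%classic in
  weightedL2 a Q U /\
  exists G : 'rV[R]_n.+1 * R -> 'rV[R]_n.+1,
  [/\ is_weak_grad Q U G,
      forall i, weightedL2 a Q (fun z => G z 0 i) &
      forall phi, test_function (cyl (eball 4) `]0, 16[%classic) phi ->
        \int[lebesgue_rVt R n.+1]_(z in Q)
          (weight a z.1 * (mxform (A (col' ord_max z.1)) (G z) (grad phi z)
                           + U z * dtime phi z)) = 0].

Definition continuous_representative (R : realType) (n : nat)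
    (U : 'rV[R]_n.+1 * R -> R) : Prop :=
  forall r : R, 0 < r < 4 ->
    {within cyl (closure (eball_plus r)) `[0, r ^+ 2]%classic, continuous U}.

Definition mass (R : realType) (n : nat) (a : R) (U : 'rV[R]_n.+1 * R -> R)
    (r t : R) : R :=
  \int[lebesgue_rV R n.+1]_(X in eball_plus r) (weight a X * U (X, t) ^+ 2).

Definition theta (R : realType) (n : nat) (a : R) (U : 'rV[R]_n.+1 * R -> R) : R :=
  (\int[lebesgue_rVt R n.+1]_(z in cyl (eball_plus 4) `[0, 16[%classic)
      (weight a z.1 * U z ^+ 2)) / mass a U 1 0.

(* Main.v *)
(* Energy method with an exponential weight.  Take eta = ((E - m)_+)^2 with
   E = exp (- ((|X|^2 - 1)_+)^2 k(t)), k(t) = exp (- t / T) / (128 Lambda T) and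
   m the value of E at |X| = 2, t = T.  Then eta vanishes for |X| >= 2, and
   eta eta_t - Lambda |grad eta|^2 >= - 2 m / T, so that testing the equation with
   eta^2 U bounds int y^a eta^2 U^2 from below at time T by its value at time 0
   minus (4 m / T) int_0^T int_(B_2) y^a U^2.  Since m = exp (- c / T), this loss
   is absorbed as soon as T <= 1 / (N log (N theta)); averaging the same
   inequality over T in (1/2, 1) bounds theta from below.
   To test with eta^2 U, mollify in x and t only: such a mollification commutes
   with the weight y^a and preserves, height by height, both the equation and the
   Neumann condition, while its commutator with A is small because A is
   Lipschitz. *)
From HB Require Import structures.
Require Import Defs.
From mathcomp Require Import all_boot all_order all_algebra.
From mathcomp Require Import all_classical all_reals all_analysis.
From mathcomp Require Import measurable_realfun ring lra.
Import Order.TTheory GRing.Theory Num.Theory.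
Import numFieldNormedType.Exports.
Set Implicit Arguments.
Unset Strict Implicit.
Unset Printing Implicit Defensive.
Local Open Scope classical_set_scope.
Local Open Scope ring_scope.

(** * Integration *)

(** [U] has no time derivative as a function and its gradient lies only in a weighted L^2, so eta^2
    U is not a test function. The only functions put into the equation are products of a mollifying
    kernel in (x, t) and a smooth function chi of the height y. At a fixed (x, t) they leave a
    one-dimensional equation: the mollified flux y^a U_y has an integrable derivative in y and, chi
    being free at y = 0, vanishes there. The product with eta^2 U is formed afterwards, by Fubini on
    triangles in y and integration by parts in (x, t); hence eta need only be C^1, as the square of
    a positive part is. The equation runs backward in time, so testing it bounds later energies from
    below, and eta has to grow in time where its gradient is large. With s = (|X|^2 - 1)_+ one has
    E_t = (s^2 k / T) E and |grad E|^2 = 16 |X|^2 s^2 k^2 E^2, so that E E_t >= 2 Lambda |grad E|^2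
    on |X| <= 2 follows from 128 Lambda k <= 1 / T. At |X| = 2, s = 3, whence m = exp (- 9 k(T)) and
    c = 9 / (128 e Lambda). *)

Section real_integral.
Context d (T : measurableType d) (R : realType) (mu : {measure set T -> \bar R}).
Implicit Types f g : T -> R.

Lemma intg_measurable f : mu.-integrable setT (EFin \o f) -> measurable_fun setT f.
Proof. by move=> /integrableP[/measurable_EFinP]. Qed.

Lemma intg_le f g : measurable_fun setT f -> mu.-integrable setT (EFin \o g) ->
  (forall x, `|f x| <= g x) -> mu.-integrable setT (EFin \o f).
Proof.
move=> mf ig fg; apply: (le_integrable measurableT _ _ ig).
  exact/measurable_EFinP.
move=> x _; rewrite /= lee_fin (le_trans (fg x))//; exact: ler_norm.
Qed.

Lemma eq_intg f g : (forall x, f x = g x) -> mu.-integrable setT (EFin \o f) ->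
  mu.-integrable setT (EFin \o g).
Proof. by move=> /funext ->. Qed.

Lemma intgD f g : mu.-integrable setT (EFin \o f) -> mu.-integrable setT (EFin \o g) ->
  mu.-integrable setT (EFin \o (fun x => f x + g x)).
Proof.
move=> if1 ig; rewrite (_ : _ \o _ = (EFin \o f) \+ (EFin \o g))%E//.
exact: integrableD.
Qed.

Lemma intgZ k f : mu.-integrable setT (EFin \o f) ->
  mu.-integrable setT (EFin \o (fun x => k * f x)).
Proof.
move=> if1; rewrite (_ : _ \o _ = (fun x => k%:E * (EFin \o f) x))%E//.
exact: integrableZl.
Qed.

Lemma intgN f : mu.-integrable setT (EFin \o f) ->
  mu.-integrable setT (EFin \o (fun x => - f x)).
Proof.
move=> if1; rewrite (_ : (fun x => - f x) = (fun x => (-1) * f x)).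
  exact: intgZ.
by apply/funext => x; rewrite mulN1r.
Qed.

Lemma intgB f g : mu.-integrable setT (EFin \o f) -> mu.-integrable setT (EFin \o g) ->
  mu.-integrable setT (EFin \o (fun x => f x - g x)).
Proof. by move=> if1 ig; apply: intgD => //; exact: intgN. Qed.

Lemma intg_norm f : mu.-integrable setT (EFin \o f) ->
  mu.-integrable setT (EFin \o (fun x => `|f x|)).
Proof. by move=> /integrable_norm. Qed.

Lemma intg0 : mu.-integrable setT (EFin \o (fun=> 0 : R)).
Proof. exact: integrable0. Qed.

Lemma intg_sum (I : finType) (F : I -> T -> R) :
  (forall i, mu.-integrable setT (EFin \o F i)) ->
  mu.-integrable setT (EFin \o (fun x => \sum_i F i x)).
Proof.
move=> iF.
elim: (index_enum I) => [|i s IH].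
  rewrite (_ : (fun x => _) = fun=> 0); first exact: intg0.
  by apply/funext => x; rewrite big_nil.
rewrite (_ : (fun x => _) = (fun x => F i x + \sum_(j <- s) F j x)).
  exact: intgD.
by apply/funext => x; rewrite big_cons.
Qed.

Lemma eq_Rint f g : (forall x, f x = g x) -> \int[mu]_x f x = \int[mu]_x g x.
Proof. by move=> fg; apply: eq_Rintegral => x _; exact: fg. Qed.

Lemma RintD f g : mu.-integrable setT (EFin \o f) -> mu.-integrable setT (EFin \o g) ->
  \int[mu]_x (f x + g x) = \int[mu]_x f x + \int[mu]_x g x.
Proof. exact: RintegralD. Qed.

Lemma RintB f g : mu.-integrable setT (EFin \o f) -> mu.-integrable setT (EFin \o g) ->
  \int[mu]_x (f x - g x) = \int[mu]_x f x - \int[mu]_x g x.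
Proof. exact: RintegralB. Qed.

Lemma RintZ k f : mu.-integrable setT (EFin \o f) ->
  \int[mu]_x (k * f x) = k * \int[mu]_x f x.
Proof. exact: RintegralZl. Qed.

Lemma RintN f : mu.-integrable setT (EFin \o f) ->
  \int[mu]_x (- f x) = - \int[mu]_x f x.
Proof.
move=> if1; rewrite -mulN1r -RintZ//.
by apply: eq_Rint => x; rewrite mulN1r.
Qed.

Lemma Rint0 : \int[mu]_x (0 : R) = 0.
Proof. by rewrite /Rintegral integral0. Qed.

Lemma Rint_sum (I : finType) (F : I -> T -> R) :
  (forall i, mu.-integrable setT (EFin \o F i)) ->
  \int[mu]_x (\sum_i F i x) = \sum_i \int[mu]_x F i x.
Proof.
move=> iF.
suff [] : mu.-integrable setT (EFin \o (fun x => \sum_(i <- index_enum I) F i x)) /\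
  \int[mu]_x (\sum_(i <- index_enum I) F i x) =
  \sum_(i <- index_enum I) \int[mu]_x F i x by [].
elim: (index_enum I) => [|i s [IH1 IH2]].
  rewrite big_nil (_ : (fun x => _) = fun=> 0).
    by split; [exact: intg0|exact: Rint0].
  by apply/funext => x; rewrite big_nil.
rewrite (_ : (fun x => _) = (fun x => F i x + \sum_(j <- s) F j x)).
  by split; [exact: intgD|rewrite RintD// IH2 big_cons].
by apply/funext => x; rewrite big_cons.
Qed.

Lemma le_Rint f g : mu.-integrable setT (EFin \o f) -> mu.-integrable setT (EFin \o g) ->
  (forall x, f x <= g x) -> \int[mu]_x f x <= \int[mu]_x g x.
Proof. by move=> if1 ig fg; apply: le_Rintegral. Qed.

Lemma Rint_ge0 f : (forall x, 0 <= f x) -> 0 <= \int[mu]_x f x.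
Proof. by move=> f0; apply: Rintegral_ge0. Qed.

Lemma le_norm_Rint f g : mu.-integrable setT (EFin \o f) -> mu.-integrable setT (EFin \o g) ->
  (forall x, `|f x| <= g x) -> `|\int[mu]_x f x| <= \int[mu]_x g x.
Proof.
move=> if1 ig fg; apply: le_trans (le_normr_Rintegral _ if1) _ => //.
by apply: le_Rint => //; exact: intg_norm.
Qed.

Lemma Rint_EFin f : mu.-integrable setT (EFin \o f) ->
  (\int[mu]_x f x)%:E = (\int[mu]_x (f x)%:E)%E.
Proof. by move=> if1; rewrite /Rintegral fineK//; exact: integrable_fin_num. Qed.

Lemma Rint_ae f g : measurable_fun setT f -> measurable_fun setT g ->
  {ae mu, forall x, f x = g x} -> \int[mu]_x f x = \int[mu]_x g x.
Proof.
move=> mf mg fg; congr fine; apply: ae_eq_integral => //; [exact/measurable_EFinP..|].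
by case: fg => N [mN N0 sN]; exists N; split => // x /= h; apply: sN => /= e; apply: h => _; rewrite e.
Qed.

Lemma Rint_dct (f_ : nat -> T -> R) f g : (forall n, measurable_fun setT (f_ n)) ->
  mu.-integrable setT (EFin \o g) -> (forall n x, `|f_ n x| <= g x) ->
  (forall x, f_ ^~ x @ \oo --> f x) ->
  mu.-integrable setT (EFin \o f) /\
  (fun n => \int[mu]_x f_ n x) @ \oo --> \int[mu]_x f x.
Proof.
move=> mf ig fg cf.
have mF : measurable_fun setT f.
  by apply: (measurable_fun_cvg mf) => x _; exact: cf.
have [] := @dominated_convergence _ _ _ mu setT measurableT
  (fun n x => (f_ n x)%:E) (EFin \o f) (EFin \o g).
- by move=> n; exact/measurable_EFinP.
- exact/measurable_EFinP.
- by apply: aeW => x _ /=; apply: cvg_EFin; [exact: nearW|exact: cf].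
- exact: ig.
- by apply: aeW => x n _ /=; rewrite lee_fin.
move=> iF _ h; split => //.
by apply: fine_cvg; rewrite fineK//; exact: integrable_fin_num.
Qed.

End real_integral.

(** * Fubini for integrands dominated by a product *)

Section dominated_fubini.
Context d1 d2 (X : measurableType d1) (Y : measurableType d2) (R : realType).
Variables (m1 : {sigma_finite_measure set X -> \bar R})
  (m2 : {sigma_finite_measure set Y -> \bar R}).
Variables (f : X * Y -> R) (h : X -> R) (B : Y -> R).
Hypotheses (mf : measurable_fun setT f)
  (ih : m1.-integrable setT (EFin \o h)) (iB : m2.-integrable setT (EFin \o B))
  (fhB : forall x y, `|f (x, y)| <= h x * B y).

Lemma dom_section1 x : m2.-integrable setT (EFin \o (fun y => f (x, y))).
Proof.
apply: (@intg_le _ _ _ _ _ (fun y => h x * B y)) => //.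
  exact: measurable_fun_pair2 mf.
exact: intgZ.
Qed.

Lemma dom_section2 y : m1.-integrable setT (EFin \o (fun x => f (x, y))).
Proof.
apply: (@intg_le _ _ _ _ _ (fun x => B y * h x)) => //.
- exact: measurable_fun_pair1 mf.
- exact: intgZ.
- by move=> x; rewrite mulrC.
Qed.

Lemma dom_int1 x : `|\int[m2]_y f (x, y)| <= h x * \int[m2]_y B y.
Proof.
rewrite -RintZ//; apply: le_norm_Rint => //; first exact: dom_section1.
exact: intgZ.
Qed.

Lemma dom_int2 y : `|\int[m1]_x f (x, y)| <= B y * \int[m1]_x h x.
Proof.
rewrite -RintZ//; apply: le_norm_Rint => //; first exact: dom_section2.
  exact: intgZ.
by move=> x; rewrite mulrC.
Qed.

(** Tonelli with the bound h(x) B(y). As the bound holds at every point, every section is integrable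
    and the inner integrals are real functions defined everywhere. *)
Lemma dom_product : (m1 \x m2)%E.-integrable setT (EFin \o f).
Proof.
apply/integrable12ltyP; first exact/measurable_EFinP.
have : ((\int[m1]_x (`|h x| * \int[m2]_y `|B y|)%:E) < +oo)%E.
  have : m1.-integrable setT (EFin \o (fun x => (\int[m2]_y `|B y|) * `|h x|)).
    by apply: intgZ; exact: intg_norm.
  move=> /integrableP[_]; apply: le_lt_trans.
  apply: ge0_le_integral => //=.
  - by move=> x _; rewrite lee_fin mulr_ge0// Rint_ge0.
  - apply/measurable_EFinP/measurable_funM => //.
    exact/measurableT_comp/(intg_measurable ih).
  - apply/measurable_EFinP/measurableT_comp => //; apply/measurable_funM => //.
    exact/measurableT_comp/(intg_measurable ih).
  - by move=> x _; rewrite lee_fin mulrC ler_norm.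
apply: le_lt_trans; apply: ge0_le_integral => //=.
- by move=> x _; apply: integral_ge0.
- apply: (@measurable_fun_fubini_tonelli_F _ _ _ _ _ m2 (fun z => `|(f z)%:E|%E)) => //.
  exact/measurableT_comp/measurable_EFinP.
- apply/measurable_EFinP/measurable_funM => //.
  exact/measurableT_comp/(intg_measurable ih).
- move=> x _; rewrite EFinM Rint_EFin; last exact: intg_norm.
  have mB : measurable_fun setT (fun y => `|B y|).
    exact/measurableT_comp/(intg_measurable iB).
  rewrite -ge0_integralZl//=; last exact/measurable_EFinP.
  apply: ge0_le_integral => //=.
  + exact/measurable_EFinP/measurableT_comp/(measurable_fun_pair2 x mf).
  + exact/measurable_EFinP/measurable_funM.
  + move=> y _; rewrite -EFinM lee_fin -normrM (le_trans (fhB x y))//.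
    exact: ler_norm.
Qed.

Lemma dom_measurable1 : measurable_fun setT (fun x => \int[m2]_y f (x, y)).
Proof.
apply/measurable_EFinP.
rewrite (_ : _ \o _ = fubini_F m2 (EFin \o f)).
  exact/measurable_fubini_F/dom_product.
by apply/funext => x; rewrite /= Rint_EFin//; exact: dom_section1.
Qed.

Lemma dom_measurable2 : measurable_fun setT (fun y => \int[m1]_x f (x, y)).
Proof.
apply/measurable_EFinP.
rewrite (_ : _ \o _ = fubini_G m1 (EFin \o f)).
  exact/measurable_fubini_G/dom_product.
by apply/funext => x; rewrite /= Rint_EFin//; exact: dom_section2.
Qed.

Lemma dom_intg1 : m1.-integrable setT (EFin \o (fun x => \int[m2]_y f (x, y))).
Proof.
apply: (@intg_le _ _ _ _ _ (fun x => (\int[m2]_y B y) * h x)).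
- exact: dom_measurable1.
- exact: intgZ.
- by move=> x; rewrite mulrC dom_int1.
Qed.

Lemma dom_intg2 : m2.-integrable setT (EFin \o (fun y => \int[m1]_x f (x, y))).
Proof.
apply: (@intg_le _ _ _ _ _ (fun x => (\int[m1]_x h x) * B x)).
- exact: dom_measurable2.
- exact: intgZ.
- by move=> x; rewrite mulrC dom_int2.
Qed.

Lemma dom_fubini1 : \int[(m1 \x m2)%E]_z f z = \int[m1]_x \int[m2]_y f (x, y).
Proof.
apply: EFin_inj; rewrite (Rint_EFin dom_product) (Rint_EFin dom_intg1).
rewrite -(integral12_prod_meas1 dom_product); apply: eq_integral => x _.
by rewrite Rint_EFin//; exact: dom_section1.
Qed.

Lemma dom_fubini2 : \int[(m1 \x m2)%E]_z f z = \int[m2]_y \int[m1]_x f (x, y).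
Proof.
apply: EFin_inj; rewrite (Rint_EFin dom_product) (Rint_EFin dom_intg2).
rewrite -(integral21_prod_meas1 dom_product); apply: eq_integral => x _.
by rewrite Rint_EFin//; exact: dom_section2.
Qed.

Lemma dom_fubini : \int[m1]_x \int[m2]_y f (x, y) = \int[m2]_y \int[m1]_x f (x, y).
Proof. by rewrite -dom_fubini1 dom_fubini2. Qed.

End dominated_fubini.

(* Transfers continuity to measurability: the sigma-algebra of 'rV[R]_n is
   generated by the coordinates, and the library does not relate it to the
   topology. *)
Definition discretizable d (X : measurableType d) (T : topologicalType)
    (pi : X -> T) :=
  exists (C : countType) (e : nat -> X -> C) (c : nat -> C -> T),
    (forall k u, measurable (e k @^-1` [set u])) /\
    (forall x, (fun k => c k (e k x)) @ \oo --> pi x).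

(** The functions [f (c k (e k x))] take countably many values, each on a measurable set, and
    converge to [f (pi x)] by continuity of [f]. *)
Lemma discretizable_measurable d (X : measurableType d) (T : topologicalType)
    (pi : X -> T) (R : realType) (f : T -> R) :
  discretizable pi -> continuous f -> measurable_fun setT (f \o pi).
Proof.
move=> [C [e [c [me ce]]]] cf.
apply: (@measurable_fun_cvg _ _ _ _ (fun k x => f (c k (e k x)))).
  move=> k _ Y mY; rewrite setTI.
  pose F u := if u \in [set u | Y (f (c k u))] then e k @^-1` [set u] else set0.
  rewrite (_ : _ @^-1` _ = \bigcup_u F u).
    apply: countable_bigcupT_measurable => // u.
    by rewrite /F; case: ifP => _; [exact: me|exact: measurable0].
  apply/seteqP; split => x /=.
    by move=> Yx; exists (e k x) => //; rewrite /F mem_set.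
  by move=> [u _]; rewrite /F; case: ifPn => [/set_mem /= Yu /= eu|//]; rewrite eu.
by move=> x _; exact: cvg_comp (ce x) (cf _).
Qed.

Lemma discretizable_pair d1 d2 (X1 : measurableType d1) (X2 : measurableType d2)
    (T1 T2 : topologicalType) (p1 : X1 -> T1) (p2 : X2 -> T2) :
  discretizable p1 -> discretizable p2 ->
  discretizable (fun z : X1 * X2 => (p1 z.1, p2 z.2) : T1 * T2).
Proof.
move=> [C1 [e1 [c1 [me1 ce1]]]] [C2 [e2 [c2 [me2 ce2]]]].
exists (C1 * C2)%type, (fun k z => (e1 k z.1, e2 k z.2)),
  (fun k u => (c1 k u.1, c2 k u.2)); split.
  move=> k [u1 u2].
  rewrite (_ : _ @^-1` _ = (e1 k @^-1` [set u1]) `*` (e2 k @^-1` [set u2])).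
    exact: measurableX.
  by apply/seteqP; split => -[x1 x2] /=; [case=> -> ->|case=> -> ->].
by move=> [x1 x2] /=; apply: cvg_pair; [exact: ce1|exact: ce2].
Qed.

Section pushm.
Context d1 d2 (X : measurableType d1) (Y : measurableType d2) (R : realType).
Variables (mu : {measure set X -> \bar R}) (f : X -> Y) (mf : measurable_fun setT f).

(** The measurability proof is an argument of the set function, so that the measure structure
    declared below can be inferred from the term alone. *)
Definition pushm (_ : measurable_fun setT f) : set Y -> \bar R := fun A => mu (f @^-1` A).

Let pushm0 : pushm mf set0 = 0%E.
Proof. by rewrite /pushm preimage_set0 measure0. Qed.

Let pushm_ge0 A : (0 <= pushm mf A)%E.
Proof. by rewrite /pushm; exact: measure_ge0. Qed.

Let pushm_sigma_additive : semi_sigma_additive (pushm mf).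
Proof.
suff : semi_sigma_additive (pushforward mu f) by [].
by apply: measure_semi_sigma_additive; exact: mf.
Qed.

HB.instance Definition _ := isMeasure.Build _ _ _ (pushm mf)
  pushm0 pushm_ge0 pushm_sigma_additive.

Definition pushm_measure : {measure set Y -> \bar R} := pushm mf.

End pushm.

(** * Lebesgue measure on R^n and R^n x R: boxes and translations *)

Section lebesgue_box.
Variable R : realType.
Local Notation leb := (@lebesgue_measure R).

(** The translated measure has the same values on half-open intervals, and these determine Lebesgue
    measure. *)
Lemma lebesgue_shift (v : R) (A : set R) : measurable A ->
  leb ((fun x => x + v) @^-1` A) = leb A.
Proof.
move=> mA.
have mf : measurable_fun setT ((fun x => x + v) : measurableTypeR R -> measurableTypeR R).
  by apply: measurable_funD.
apply/esym/(@lebesgue_measure_unique _ (pushm_measure leb mf)) => // _ [[a b] _ <-].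
rewrite /pushm_measure/= /pushm.
rewrite (_ : _ @^-1` _ = `]a - v, b - v]%classic).
  rewrite !lebesgue_measure_itv/= !lte_fin ltrD2r.
  case: ifP => // _.
  by rewrite -!EFinD; congr (_%:E); ring.
by apply/seteqP; split => x /=; rewrite !in_itv/= => /andP[h1 h2]; apply/andP; split; lra.
Qed.

Definition box n (r : R) : set 'rV[R]_n := [set v | forall i, `|v 0 i| <= r].

Lemma measurable_box n r : measurable (@box n r).
Proof.
rewrite (_ : box r = \bigcap_(i : 'I_n) ((fun v : 'rV[R]_n => v 0 i) @^-1` `[-r, r])).
  apply: fin_bigcap_measurable => // i _; rewrite -[X in measurable X]setTI.
  exact: measurable_coord.
apply/seteqP; split => v /= h.
  by move=> i _ /=; rewrite in_itv/= -ler_norml; exact: h.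
by move=> i; have := h i I; rewrite /= in_itv/= -ler_norml.
Qed.

Lemma rV_snoc_box n r :
  @rV_snoc R n @^-1` (box r) = box r `*` `[-r, r]%classic.
Proof.
apply/seteqP; split => -[v y] /=.
  move=> h; split.
    by move=> i; have := h (lift ord_max i); rewrite mxE liftK.
  by have := h ord_max; rewrite mxE unlift_none/= in_itv/= -ler_norml.
rewrite in_itv/= -ler_norml => -[h hy] i; rewrite mxE.
by case: (unliftP ord_max i) => [j _|_] /=; [exact: h|].
Qed.

Lemma lebesgue_rV_box n r : 0 <= r -> lebesgue_rV R n (box r) = ((r *+ 2) ^+ n)%:E.
Proof.
move=> r0; elim: n => [|n IH] /=.
  by rewrite diracE mem_set// => -[] //.
rewrite /rV_snoc_measure /pushforward rV_snoc_box product_measure1E//.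
  have -> := IH.
  rewrite [X in (_ * X)%E](_ : _ = (r *+ 2)%:E); last first.
    transitivity (leb `[- r, r]%classic) => //.
    rewrite lebesgue_measure_itv/= lte_fin; case: ltP => h.
      by rewrite -EFinD mulr2n; congr (_%:E); ring.
    have -> : r = 0 by lra.
    by rewrite mul0rn.
  by rewrite -EFinM exprSr.
exact: measurable_box.
Qed.

Lemma lebesgue_rV_sigma_finite n : sigma_finite setT (lebesgue_rV R n).
Proof.
exists (fun k => @box n k%:R).
  apply/esym; rewrite -subTset => v _; exists (Num.truncn (\sum_i `|v 0 i|)).+1 => // i.
  rewrite (le_trans _ (ltW (truncnS_gt _)))//.
  by rewrite (bigD1 i)//= lerDl sumr_ge0.
move=> k; split; first exact: measurable_box.
by rewrite lebesgue_rV_box// ltry.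
Qed.

(** A name for the recursively defined measure, to which the sigma-finiteness required by Fubini can
    be attached; [lebVt] plays the same role in space-time. *)
Definition lebV n : set 'rV[R]_n -> \bar R := lebesgue_rV R n.

Arguments lebV : clear implicits.
HB.instance Definition _ n := Measure.copy (lebV n) (lebesgue_rV R n).
HB.instance Definition _ n := Measure_isSigmaFinite.Build _ _ _ (lebV n)
  (@lebesgue_rV_sigma_finite n).

Local Notation T n := ('rV[R]_n * measurableTypeR R)%type.

Definition boxT n (r : R) : set (T n) := box r `*` `[-r, r]%classic.

Lemma measurable_boxT n r : measurable (@boxT n r).
Proof. by apply: measurableX => //; exact: measurable_box. Qed.

Lemma lebesgue_rVt_box n r : 0 <= r ->
  lebesgue_rVt R n (boxT r) = ((r *+ 2) ^+ n.+1)%:E.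
Proof.
move=> r0.
have := @lebesgue_rV_box n.+1 r r0.
by rewrite /= /rV_snoc_measure /pushforward rV_snoc_box.
Qed.

Lemma lebesgue_rVt_sigma_finite n : sigma_finite setT (lebesgue_rVt R n).
Proof.
exists (fun k => @boxT n k%:R).
  apply/esym; rewrite -subTset => -[v y] _.
  exists (Num.truncn (\sum_i `|v 0 i| + `|y|)).+1 => //; split => /=.
    move=> i; rewrite (le_trans _ (ltW (truncnS_gt _)))//.
    by rewrite (bigD1 i)//= -addrA lerDl addr_ge0// sumr_ge0.
  rewrite in_itv/= -ler_norml (le_trans _ (ltW (truncnS_gt _)))//.
  by rewrite lerDr sumr_ge0.
move=> k; split; first exact: measurable_boxT.
by rewrite lebesgue_rVt_box// ltry.
Qed.

Definition lebVt n : set (T n) -> \bar R := lebesgue_rVt R n.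
Arguments lebVt : clear implicits.

HB.instance Definition _ n := Measure.copy (lebVt n) (lebesgue_rVt R n).
HB.instance Definition _ n := Measure_isSigmaFinite.Build _ _ _ (lebVt n)
  (@lebesgue_rVt_sigma_finite n).

Lemma measurable_shift n (v : 'rV[R]_n) :
  measurable_fun setT (fun x : 'rV[R]_n => x + v).
Proof.
apply: measurable_fun_rVP => i.
rewrite (_ : (fun x => _) = (fun x : 'rV[R]_n => x 0 i + v 0 i)).
  by apply: measurable_funD => //; exact: measurable_coord.
by apply/funext => x; rewrite mxE.
Qed.

(** The image of the product measure agrees with it on rectangles, and a product measure is
    determined by them. *)
Lemma shift_pair_product d1 d2 (X : measurableType d1) (Y : measurableType d2)
    (m1 : {sigma_finite_measure set X -> \bar R})
    (m2 : {sigma_finite_measure set Y -> \bar R}) (f : X -> X) (g : Y -> Y) :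
  measurable_fun setT f -> measurable_fun setT g ->
  (forall A, measurable A -> m1 (f @^-1` A) = m1 A) ->
  (forall A, measurable A -> m2 (g @^-1` A) = m2 A) ->
  forall A, measurable A ->
    (m1 \x m2)%E ((fun z => (f z.1, g z.2)) @^-1` A) = (m1 \x m2)%E A.
Proof.
move=> mf mg h1 h2 A mA.
have mfg : measurable_fun setT (fun z : X * Y => (f z.1, g z.2)).
  by apply: measurable_fun_pair; [exact: measurableT_comp mf _|exact: measurableT_comp mg _].
apply/esym/(product_measure_unique (m' := pushm_measure (m1 \x m2)%E mfg)) => //.
move=> B C mB mC; rewrite /pushm_measure/= /pushm.
rewrite (_ : _ @^-1` _ = (f @^-1` B) `*` (g @^-1` C)).
  have mfB : measurable (f @^-1` B) by rewrite -[f @^-1` B]setTI; exact: mf.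
  have mgC : measurable (g @^-1` C) by rewrite -[g @^-1` C]setTI; exact: mg.
  by rewrite product_measure1E//; congr (_ * _)%E; [exact: h1|exact: h2].
by apply/seteqP; split.
Qed.

(** By induction on the dimension: through [rV_snoc], a translation of the whole vector is a pair of
    translations, of the first coordinates and of the last one. *)
Lemma lebesgue_rV_shift n (v : 'rV[R]_n) A : measurable A ->
  lebesgue_rV R n ((fun x => x + v) @^-1` A) = lebesgue_rV R n A.
Proof.
elim: n v A => [|n IH] v A mA.
  rewrite /= !diracE; congr ((_ : bool)%:R%:E).
  by rewrite [v]thinmx0; apply/idP/idP => /set_mem /=;
    rewrite ?addr0 => h; apply/mem_set; rewrite /= ?addr0.
rewrite /= /rV_snoc_measure /pushforward.
pose v' : 'rV[R]_n := \row_j v 0 (lift ord_max j).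
have /= <- := @shift_pair_product _ _ _ _ (lebV n) leb
  (fun x => x + v') (fun y => y + v 0 ord_max) _ _ _ _ (@rV_snoc R n @^-1` A).
- congr (product_measure1 _ _ _); apply/seteqP; split => -[x y] /=.
    congr (A _); apply/rowP => i; rewrite !mxE.
    by case: (unliftP ord_max i) => [j ->|->] //=; rewrite !mxE.
  congr (A _); apply/rowP => i; rewrite !mxE.
  by case: (unliftP ord_max i) => [j ->|->] //=; rewrite !mxE.
- exact: measurable_shift.
- exact: measurable_funD.
- by move=> B mB; exact: IH.
- by move=> B mB; exact: lebesgue_shift.
- by rewrite -[X in measurable X]setTI; apply: measurable_rV_snoc.
Qed.

Lemma measurable_shift_T n (tau : T n) :
  measurable_fun setT (fun x : T n => (x.1 + tau.1, x.2 + tau.2) : T n).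
Proof.
apply: measurable_fun_pair.
  by apply: measurableT_comp (measurable_shift _) _.
exact: measurable_funD.
Qed.

Lemma lebVt_shift n (tau : T n) A : measurable A ->
  lebVt n ((fun x => (x.1 + tau.1, x.2 + tau.2)) @^-1` A) = lebVt n A.
Proof.
move=> mA; rewrite /lebVt.
apply: (@shift_pair_product _ _ _ _ (lebV n) leb
  (fun x => x + tau.1) (fun y => y + tau.2)) => //.
- exact: measurable_shift.
- exact: measurable_funD.
- by move=> B mB; exact: lebesgue_rV_shift.
- by move=> B mB; exact: lebesgue_shift.
Qed.

(** Rounding down to multiples of 1 / (k + 1), with an error of at most 1 / (k + 1). *)
Lemma discretizable_R : discretizable (fun x : measurableTypeR R => x : R).
Proof.
exists int, (fun k (x : R) => Num.floor (k.+1%:R * x)),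
  (fun k u => u%:~R / k.+1%:R); split.
  move=> k u; rewrite -[X in measurable X]setTI.
  rewrite (_ : _ @^-1` _ = `[u%:~R / k.+1%:R, (u + 1)%:~R / k.+1%:R[%classic).
    by apply: measurableI.
  apply/seteqP; split => x /=; rewrite in_itv/= ler_pdivrMr// ltr_pdivlMr//.
    by move=> <-; have := floor_itv (k.+1%:R * x); rewrite [k.+1%:R * x]mulrC.
  by move=> h; apply: floor_def; rewrite [k.+1%:R * x]mulrC.
move=> x; apply/cvgrPdist_le => e e0; near=> k.
have k0 : 0 < k.+1%:R :> R by [].
have := floor_le (k.+1%:R * x); have := floorD1_gt (k.+1%:R * x).
set f := Num.floor _; rewrite intrD => h1 h2.
have -> : x - f%:~R / k.+1%:R = (k.+1%:R * x - f%:~R) / k.+1%:R.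
  by field; rewrite gt_eqF// natr1.
rewrite normrM normfV (gtr0_norm k0) ger0_norm ?subr_ge0// ler_pdivrMr//.
apply: (@le_trans _ _ 1); first by rewrite lerBlDr addrC ltW.
rewrite -ler_pdivrMl// mulr1.
apply: (@le_trans _ _ k%:R); last by rewrite ler_nat.
by near: k; exact: nbhs_infty_ger.
Unshelve. all: by end_near. Qed.

End lebesgue_box.

Arguments lebV : clear implicits.
Arguments lebVt : clear implicits.

(** * Measurability of continuous functions, translation of integrals *)

Section continuous_measurable.
Variable R : realType.
Local Notation T n := ('rV[R]_n * measurableTypeR R)%type.

Lemma discretizable_rV n : discretizable (fun x : 'rV[R]_n => x).
Proof.
have [C [e [c [me ce]]]] := discretizable_R R.
exists {ffun 'I_n -> C}, (fun k (x : 'rV[R]_n) => [ffun i => e k (x 0 i)]),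
  (fun k (u : {ffun 'I_n -> C}) => \row_i (c k (u i) : R)); split.
  move=> k u.
  rewrite (_ : _ @^-1` _ =
      \bigcap_(i : 'I_n) ((fun v : 'rV[R]_n => v 0 i) @^-1` (e k @^-1` [set u i]))).
    apply: fin_bigcap_measurable => // i _; rewrite -[X in measurable X]setTI.
    by apply: measurable_coord => //; exact: me.
  apply/seteqP; split => x /=.
    by move=> <- i _ /=; rewrite ffunE.
  by move=> h; apply/ffunP => i; rewrite ffunE; exact: h.
move=> x; apply/cvg_mx_entourageP => A eA.
have h i : \forall k \near \oo, (x 0 i, c k (e k (x 0 i))) \in A.
  have /cvg_app_entourageP/(_ _ eA) := ce (x 0 i).
  by apply: filterS => k /= ?; rewrite inE.
have H : \forall k \near \oo, forall i, (x 0 i, c k (e k (x 0 i))) \in A.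
  exact: filter_forall.
suff : \forall k \near \oo, forall i j, (x i j,
    (\row_i0 (c k ([ffun i1 => e k (x 0 i1)] i0) : R)) i j) \in A by [].
by apply: filterS H => k hk i j; rewrite mxE ffunE ord1; exact: hk.
Qed.

Lemma continuous_measurable_rV n (f : 'rV[R]_n -> R) :
  continuous f -> measurable_fun setT f.
Proof. exact: discretizable_measurable (@discretizable_rV n). Qed.

Lemma discretizable_T n : discretizable (fun z : T n => (z.1, z.2) : 'rV[R]_n * R).
Proof. exact: discretizable_pair (@discretizable_rV n) (discretizable_R R). Qed.

Lemma continuous_measurable_T n (f : 'rV[R]_n * R -> R) :
  continuous f -> measurable_fun setT (f : T n -> R).
Proof.
move=> cf; have := discretizable_measurable (@discretizable_T n) cf.
by rewrite (_ : f \o _ = f)//; apply/funext => -[].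
Qed.

Lemma continuous_measurable_TR n (f : 'rV[R]_n * R * R -> R) :
  continuous f -> measurable_fun setT (f : T n * measurableTypeR R -> R).
Proof.
move=> cf; have := discretizable_measurable
  (discretizable_pair (@discretizable_T n) (discretizable_R R)) cf.
by rewrite (_ : f \o _ = f)//; apply/funext => -[[]].
Qed.

Definition addT n (tau x : T n) : T n := x + tau.

Lemma measurable_addT n (tau : T n) : measurable_fun setT (addT tau).
Proof.
rewrite (_ : addT tau = (fun x : T n => (x.1 + tau.1, x.2 + tau.2) : T n)).
  exact: measurable_shift_T.
by apply/funext => -[].
Qed.

Lemma eq_pushforward_shift n (tau : T n) (f : T n -> \bar R) :
  (\int[pushforward (lebVt R n) (addT tau)]_y f y =
   \int[lebVt R n]_x f x)%E.
Proof.
have E : pushforward (lebVt R n) (addT tau) =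
    (pushm_measure (lebVt R n) (measurable_addT tau) : set (T n) -> \bar R).
  by apply/funext => A.
rewrite E; apply: eq_measure_integral => A mA _.
rewrite /pushm_measure/= /pushm -[RHS](lebVt_shift tau mA).
by congr (lebVt _ _ _); apply/seteqP; split => -[].
Qed.

Lemma ge0_int_shift n (f : T n -> \bar R) (tau : T n) : measurable_fun setT f ->
  (forall x, 0 <= f x)%E ->
  (\int[lebVt R n]_x f (x + tau)%R = \int[lebVt R n]_x f x)%E.
Proof.
move=> mf f0.
have H := ge0_integral_pushforward (measurable_addT tau) (lebVt R n) measurableT mf.
rewrite -[RHS](eq_pushforward_shift tau); apply/esym.
transitivity (\int[lebVt R n]_(x in addT tau @^-1` setT)
  (f \o addT tau) x)%E; first by apply: H => x _; exact: f0.
by rewrite preimage_setT.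
Qed.

Lemma intg_shift n (f : T n -> R) (tau : T n) :
  (lebVt R n).-integrable setT (EFin \o f) ->
  (lebVt R n).-integrable setT (EFin \o (fun x => f (x + tau))).
Proof.
move=> if1; have mf := intg_measurable if1.
have /integrableP[mF foo] := if1; apply/integrableP; split.
  apply/measurable_EFinP.
  exact: (measurableT_comp mf (measurable_addT tau)).
have := @ge0_int_shift n (fun x => `|(f x)%:E|%E) tau.
move=> H; apply: le_lt_trans foo; rewrite le_eqVlt; apply/orP; left; apply/eqP.
by apply: H => //; exact: measurableT_comp.
Qed.

Lemma Rint_shift n (f : T n -> R) (tau : T n) :
  (lebVt R n).-integrable setT (EFin \o f) ->
  \int[lebVt R n]_x f (x + tau) = \int[lebVt R n]_x f x.
Proof.
move=> if1; congr fine.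
have iS := intg_shift tau if1.
have H := @integral_pushforward _ _ _ _ _ _ (measurable_addT tau) (lebVt R n) setT
  (EFin \o f).
rewrite -[RHS](eq_pushforward_shift tau); apply/esym.
transitivity (\int[lebVt R n]_(x in addT tau @^-1` setT)
  ((EFin \o f) \o addT tau) x)%E.
  by apply: H => //; case/integrableP : if1.
by rewrite preimage_setT.
Qed.

End continuous_measurable.

(** * Smooth functions of one variable and the flat function exp (- 1 / x) *)

Section smooth_functions_of_one_variable.
Variable R : realType.
Implicit Types f g : R -> R.

Lemma is_derive_ext (f g : R -> R) (x d d' : R) :
  is_derive x (1 : R) f d -> (forall y, f y = g y) -> d = d' ->
  is_derive x (1 : R) g d'.
Proof. by move=> h /funext <- <-. Qed.

(** A chain of k derivatives, each given as an explicit function through [is_derive]. The rules of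
    calculus then supply the witnesses directly, and [sm_is_Ck] converts the result to [is_Ck]. *)
Fixpoint sm (k : nat) f : Prop :=
  if k is k'.+1 then
    exists f', (forall x : R, is_derive x (1 : R) f (f' x)) /\ sm k' f'
  else True.

Definition smooth1 f := forall k, sm k f.

Lemma smS k f : sm k.+1 f -> sm k f.
Proof.
elim: k f => // k IH f [f' [d s]]; exists f'; split=> //; exact: IH.
Qed.

Lemma sm_continuous k f : sm k.+1 f -> continuous f.
Proof.
move=> [f' [d _]] x; apply: differentiable_continuous.
by apply/derivable1_diffP; exact: ex_derive.
Qed.

Lemma smooth1_continuous f : smooth1 f -> continuous f.
Proof. by move=> /(_ 1%N) /sm_continuous. Qed.

Lemma smD k f g : sm k f -> sm k g -> sm k (fun x => f x + g x).
Proof.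
elim: k f g => // k IH f g [f' [df sf]] [g' [dg sg]].
exists (fun x => f' x + g' x); split; last exact: IH.
by move=> x; apply: is_deriveD.
Qed.

Lemma sm_cst k c : sm k (fun=> c).
Proof.
elim: k c => // k IH c; exists (fun=> 0); split => // x.
exact: is_derive_cst.
Qed.

Lemma smM k f g : sm k f -> sm k g -> sm k (fun x => f x * g x).
Proof.
elim: k f g => // k IH f g sf sg.
have := smS sf; have := smS sg => sg1 sf1.
case: sf => f' [df sf]; case: sg => g' [dg sg].
exists (fun x => f x * g' x + g x * f' x); split.
  by move=> x; apply: is_deriveM.
by apply: smD; exact: IH.
Qed.

Lemma sm_affine k (a b : R) f : sm k f -> sm k (fun x => f (a * x + b)).
Proof.
elim: k f => // k IH f [f' [df sf]].
exists (fun x => f' (a * x + b) * a); split.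
  move=> x.
  apply: (is_derive1_comp (f := f) (g := fun x => a * x + b)) => //.
  have h : is_derive x 1 (fun y => a * y + b) (a *: 1 + 0).
    by apply: is_deriveD.
  by apply: is_derive_ext h _ _ => //; rewrite addr0 /GRing.scale/= mulr1.
by apply: smM; [exact: IH|exact: sm_cst].
Qed.

Lemma smV k f : (forall x, f x != 0) -> sm k f -> sm k (fun x => (f x)^-1).
Proof.
elim: k f => // k IH f f0 sf.
have sf1 := smS sf; case: sf => f' [df sf].
exists (fun x => ((-1) * f' x) * ((f x)^-1 * (f x)^-1)); split.
  move=> x; apply: is_derive_ext (is_deriveV (f0 x) (df x)) _ _ => //.
  by rewrite /GRing.scale/= expr2 invfM; ring.
apply: smM; first by apply: smM => //; exact: sm_cst.
by apply: smM; exact: IH.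
Qed.

Lemma smooth1D f g : smooth1 f -> smooth1 g -> smooth1 (fun x => f x + g x).
Proof. by move=> sf sg k; apply: smD. Qed.

Lemma smooth1M f g : smooth1 f -> smooth1 g -> smooth1 (fun x => f x * g x).
Proof. by move=> sf sg k; apply: smM. Qed.

Lemma smooth1_affine a b f : smooth1 f -> smooth1 (fun x => f (a * x + b)).
Proof. by move=> sf k; apply: sm_affine. Qed.

Lemma smooth1V f : (forall x, f x != 0) -> smooth1 f -> smooth1 (fun x => (f x)^-1).
Proof. by move=> f0 sf k; apply: smV. Qed.

Lemma smooth1_antiderivative f F : (forall x : R, is_derive x (1 : R) F (f x)) ->
  smooth1 f -> smooth1 F.
Proof. by move=> d sf [|k] //; exists f; split => //; exact: sf. Qed.

Lemma smooth1_derivative f f' : (forall x : R, is_derive x (1 : R) f (f' x)) ->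
  smooth1 f -> smooth1 f'.
Proof.
move=> d sf k; have [g [dg sg]] := sf k.+1.
suff -> : f' = g by [].
by apply/funext => x; rewrite -(@derive_val _ _ _ _ _ _ _ (d x)) (derive_val).
Qed.

Lemma is_derive0_quadratic f (C : R) : f 0 = 0 ->
  (forall h, `|h| <= 1 -> `|f h| <= C * h ^+ 2) -> is_derive (0 : R) (1 : R) f 0.
Proof.
move=> f0 hf.
have L : h^-1 *: (f (h *: 1 + 0) - f 0) @[h --> (0:R)^'] --> (0 : R).
  apply/cvgrPdist_le => e e0.
  have C1 : 0 < `|C| + 1 by rewrite ltr_wpDl.
  near=> h.
  have h0 : h != 0 by near: h; exact: nbhs_dnbhs_neq.
  rewrite sub0r normrN addr0 f0 subr0 /GRing.scale/= mulr1 normrM normfV.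
  rewrite ler_pdivrMl ?normr_gt0//.
  have h1 : `|h| <= 1.
    near: h; apply: dnbhs0_le; exact: ltr01.
  have h2 : `|h| <= e / (`|C| + 1).
    near: h; apply: dnbhs0_le; exact: divr_gt0.
  apply: (le_trans (hf _ h1)).
  rewrite -[h ^+ 2]real_normK ?num_real// expr2 mulrCA.
  apply: ler_wpM2l => //.
  rewrite ler_pdivlMr// in h2.
  apply: le_trans h2; rewrite [C * _]mulrC; apply: ler_wpM2l => //.
  by rewrite (le_trans (ler_norm _))// lerDl.
apply: DeriveDef; first by apply/cvg_ex; exists 0.
exact/cvg_lim.
Unshelve. all: by end_near. Qed.

(* derivatives of [exp (-1/x)] keep the form [p(1/x) exp (-1/x)] *)
Definition flat (p : {poly R}) (x : R) : R :=
  if 0 < x then p.[x^-1] * expR (- x^-1) else 0.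

Lemma horner_le (p : {poly R}) u : 1 <= u ->
  `|p.[u]| <= (\sum_(i < size p) `|p`_i|) * u ^+ size p.
Proof.
move=> u1; rewrite horner_coef mulr_suml.
apply: (le_trans (ler_norm_sum _ _ _)); apply: ler_sum => i _.
rewrite normrM ler_wpM2l// normrX ger0_norm ?(le_trans _ u1)//.
by rewrite ler_weXn2l// ltnW.
Qed.

(** With u = 1 / h, the bound u^(s+2) <= (s+2)! exp u absorbs the polynomial, which is O(u^s), and
    leaves a factor h^2. *)
Lemma flat_quadratic p : exists C, forall h, `|h| <= 1 -> `|flat p h| <= C * h ^+ 2.
Proof.
set s := size p; set c := \sum_(i < s) `|p`_i|.
have c0 : 0 <= c by apply: sumr_ge0.
exists (c * (s.+2)`!%:R) => h h1; rewrite /flat; case: ifPn => h0; last first.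
  by rewrite normr0 mulr_ge0 ?sqr_ge0// mulr_ge0.
have u1 : 1 <= h^-1 by rewrite invf_ge1// -(gtr0_norm h0).
rewrite normrM expRN normfV (gtr0_norm (expR_gt0 _)).
rewrite ler_pdivrMr ?expR_gt0//.
apply: (le_trans (horner_le p u1)); rewrite -/c -/s.
have -> : c * (s.+2)`!%:R * h ^+ 2 * expR h^-1 =
  c * ((s.+2)`!%:R * expR h^-1 * h ^+ 2) by ring.
apply: ler_wpM2l => //.
have : (h^-1) ^+ s.+2 <= s.+2`!%:R * expR h^-1.
  rewrite mulrC -ler_pdivrMr ?ltr0n ?fact_gt0//.
  apply: le_trans (expR_ge1Dxn s.+1 _); last by rewrite invr_ge0 ltW.
  by rewrite lerDr.
rewrite -addn2 exprD => H.
by rewrite -ler_pdivrMr ?exprn_gt0// -exprVn.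
Qed.

(** For x > 0 the chain rule contributes 1 / x^2, which is the factor ['X ^+ 2] evaluated at 1 / x.
    At 0 the derivative vanishes because of the quadratic bound. *)
Lemma is_derive_flat p (x : R) :
  is_derive x (1 : R) (flat p) (flat ((p - p^`()) * 'X ^+ 2) x).
Proof.
have [x0|x0|->] := ltgtP x 0.
- have -> : flat ((p - p^`()) * 'X ^+ 2) x = 0 by rewrite /flat ltNge (ltW x0).
  have d0 : is_derive x (1 : R) (cst (0 : R)) 0 by exact: is_derive_cst.
  apply: near_eq_is_derive d0.
  near=> y; rewrite /flat ifF//; apply/negbTE; rewrite -leNgt ltW//.
  by near: y; exact: lt_nbhsl.
- rewrite /flat x0.
  have xn0 : x != 0 by rewrite gt_eqF.
  have dV : is_derive x 1 (fun y : R => y^-1) (- x ^- 2 *: 1).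
    exact: (@is_deriveV _ id).
  have d1 : is_derive x 1 (horner p \o (fun y : R => y^-1)) (p^`().[x^-1] * (- x ^- 2 *: 1)).
    by apply: is_derive1_comp; exact: is_derive_poly.
  have d2 : is_derive x 1 (expR \o (fun y : R => - y^-1)) (expR (- x^-1) * - (- x ^- 2 *: 1)).
    by apply: is_derive1_comp; exact: is_deriveN.
  apply: (near_eq_is_derive (f := (horner p \o (fun y : R => y^-1)) *
      (expR \o (fun y : R => - y^-1)))).
    by near=> y; rewrite ifT//; near: y; exact: lt_nbhsr.
  apply: is_derive_ext (is_deriveM d1 d2) _ _ => //.
  rewrite /GRing.scale/= !hornerE/= ?expr2 ?invfM; ring.
- have -> : flat ((p - p^`()) * 'X ^+ 2) 0 = 0 by rewrite /flat ltxx.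
  have [C hC] := flat_quadratic p.
  by apply: is_derive0_quadratic hC; rewrite /flat ltxx.
Unshelve. all: by end_near. Qed.

Lemma smooth1_flat p : smooth1 (flat p).
Proof.
move=> k; elim: k p => // k IH p.
by exists (flat ((p - p^`()) * 'X ^+ 2)); split; [exact: is_derive_flat|exact: IH].
Qed.

Definition psi (x : R) : R := if 0 < x then expR (- x^-1) else 0.

Lemma smooth1_psi : smooth1 psi.
Proof.
rewrite (_ : psi = flat 1); first exact: smooth1_flat.
by apply/funext => x; rewrite /psi /flat hornerC mul1r.
Qed.

Lemma psi_ge0 x : 0 <= psi x.
Proof. by rewrite /psi; case: ifP => // _; exact: expR_ge0. Qed.

Lemma psi_gt0 x : 0 < x -> 0 < psi x.
Proof. by rewrite /psi => ->; exact: expR_gt0. Qed.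

Lemma psi_le0 x : x <= 0 -> psi x = 0.
Proof. by rewrite /psi ltNge => ->. Qed.

Lemma psi_le1 x : psi x <= 1.
Proof.
rewrite /psi; case: ifP => // x0; rewrite -expR0 ler_expR oppr_le0 invr_ge0.
exact: ltW.
Qed.

(** Steepening [psi] approximates the indicator of the positive half-line; this turns smooth test
    functions into indicators of intervals. *)
Lemma psi_cvg (x : R) : 0 < x -> (fun k : nat => psi (k.+1%:R * x)) @ \oo --> (1 : R).
Proof.
move=> x0.
have -> : (fun k : nat => psi (k.+1%:R * x)) = expR \o (fun k => - (k.+1%:R^-1 * x^-1)).
  by apply/funext => k; rewrite /psi mulr_gt0//= invfM.
have H : (fun k : nat => - ((k.+1%:R : R)^-1 * x^-1)) @ \oo --> - (0 * x^-1 : R).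
  apply: cvgN; apply: cvgM; last exact: cvg_cst.
  exact: cvg_harmonic.
rewrite mul0r oppr0 in H; rewrite -[X in _ --> X]expR0.
exact: cvg_comp H (@continuous_expR R 0).
Qed.

End smooth_functions_of_one_variable.

(** * Smooth functions on normed spaces *)

Section smooth_functions.
Variable R : realType.

(** The two difference quotients coincide. L has to be affine only on the line through x in the
    direction v, so translations, projections and parametrized lines are all covered. *)
Lemma is_derive_affine (V W : normedModType R) (f : W -> R) (L : V -> W)
    (x v : V) (w : W) (df : R) : (forall h : R, L (h *: v + x) = h *: w + L x) ->
  is_derive (L x) w f df -> is_derive x v (f \o L) df.
Proof.
move=> HL [dL <-].
have E : (fun h : R => h^-1 *: ((f \o L) (h *: v + x) - (f \o L) x)) =
    (fun h : R => h^-1 *: (f (h *: w + L x) - f (L x))).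
  by apply/funext => h; rewrite /= HL.
by apply: DeriveDef; rewrite /derivable ?/derive E.
Qed.

Section is_Ck.
Variable V : normedModType R.
Implicit Types f g : V -> R.

Lemma is_CkS k f : is_Ck k.+1 f -> is_Ck k f.
Proof.
elim: k f => [f []//|k IH f [cf df]]; split => // v.
by have [d1 d2] := df v; split => //; exact: IH.
Qed.

Lemma smooth_continuous f : smooth f -> continuous f.
Proof. by move=> /(_ 0%N). Qed.

Lemma smooth_derivable f x v : smooth f -> derivable f x v.
Proof. by move=> /(_ 1%N) [_ /(_ v)[]]. Qed.

Lemma smooth_is_derive f x v : smooth f -> is_derive x v f ('D_v f x).
Proof. by move=> sf; apply: DeriveDef => //; exact: smooth_derivable. Qed.

Lemma smooth_derive f v : smooth f -> smooth ('D_v f).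
Proof. by move=> sf k; have [_ /(_ v)[]] := sf k.+1. Qed.

Lemma is_CkD k f g : is_Ck k f -> is_Ck k g -> is_Ck k (fun x => f x + g x).
Proof.
elim: k f g => [|k IH] f g.
  by move=> cf cg x; apply: continuousD; [exact: cf|exact: cg].
move=> [cf df] [cg dg]; split.
  by move=> x; apply: continuousD; [exact: cf|exact: cg].
move=> v; have [d1 d2] := df v; have [d3 d4] := dg v; split.
  by move=> x; apply: derivableD.
rewrite (_ : 'D_v _ = fun x => 'D_v f x + 'D_v g x); first exact: IH.
by apply/funext => x; rewrite -deriveD.
Qed.

Lemma is_CkM k f g : is_Ck k f -> is_Ck k g -> is_Ck k (fun x => f x * g x).
Proof.
elim: k f g => [|k IH] f g.
  by move=> cf cg x; apply: continuousM; [exact: cf|exact: cg].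
move=> fk gk; have f1 := is_CkS fk; have g1 := is_CkS gk.
case: fk gk => [cf df] [cg dg]; split.
  by move=> x; apply: continuousM; [exact: cf|exact: cg].
move=> v; have [d1 d2] := df v; have [d3 d4] := dg v; split.
  by move=> x; apply: derivableM.
rewrite (_ : 'D_v _ = fun x => f x * 'D_v g x + g x * 'D_v f x).
  by apply: is_CkD; exact: IH.
by apply/funext => x; rewrite -deriveM.
Qed.

Lemma is_Ck_cst k c : is_Ck k (fun _ : V => c).
Proof.
elim: k c => [|k IH] c; first by move=> x; exact: cst_continuous.
split; first by move=> x; exact: cst_continuous.
move=> v; split; first by move=> x; exact: derivable_cst.
rewrite (_ : 'D_v _ = fun=> 0)//; apply/funext => x.
by rewrite (@derive_cst _ _ _ c x v).
Qed.

Lemma smoothM f g : smooth f -> smooth g -> smooth (fun x => f x * g x).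
Proof. by move=> sf sg k; exact: is_CkM. Qed.

Lemma smooth_prod (I : Type) (s : seq I) (F : I -> V -> R) :
  (forall i, smooth (F i)) -> smooth (fun x => \prod_(i <- s) F i x).
Proof.
move=> sF; elim: s => [|i s IH].
  rewrite (_ : (fun x => _) = fun=> 1) => [k|]; first exact: is_Ck_cst.
  by apply/funext => x; rewrite big_nil.
rewrite (_ : (fun x => _) = fun x => F i x * \prod_(i <- s) F i x).
  exact: smoothM.
by apply/funext => x; rewrite big_cons.
Qed.

End is_Ck.

(** L0 is the linear part of L: a derivative of [f \o L] along v is a derivative of f along [L0 v]
    composed with L, so the induction reproduces the form of the statement. *)
Lemma is_Ck_affine (V W : normedModType R) (L : V -> W) (L0 : V -> W) k (f : W -> R) :
  continuous L -> (forall x v (h : R), L (h *: v + x) = h *: L0 v + L x) ->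
  is_Ck k f -> is_Ck k (f \o L).
Proof.
move=> cL HL; elim: k f => [|k IH] f.
  by move=> cf x; apply: continuous_comp; [exact: cL|exact: cf].
move=> [cf df]; split.
  by move=> x; apply: continuous_comp; [exact: cL|exact: cf].
move=> v; have [d1 d2] := df (L0 v).
have H x : is_derive x v (f \o L) ('D_(L0 v) f (L x)).
  by apply: is_derive_affine => //; apply: DeriveDef.
split; first by move=> x; exact: ex_derive.
rewrite (_ : 'D_v _ = 'D_(L0 v) f \o L); first exact: IH.
by apply/funext => x; rewrite derive_val.
Qed.

Lemma smooth_affine (V W : normedModType R) (L : V -> W) (L0 : V -> W) (f : W -> R) :
  continuous L -> (forall x v (h : R), L (h *: v + x) = h *: L0 v + L x) ->
  smooth f -> smooth (f \o L).
Proof. by move=> cL HL sf k; exact: is_Ck_affine HL (sf k). Qed.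

Lemma is_derive_dir (f : R -> R) (x v d : R) :
  is_derive x (1 : R) f d -> is_derive x v f (v * d).
Proof.
move=> [/derivable1_diffP df <-].
apply: DeriveDef; first exact: diff_derivable.
by rewrite !deriveE// -[in LHS](mulr1 v) [LHS]linearZ.
Qed.

Lemma sm_is_Ck k (f : R -> R) : sm k.+1 f -> is_Ck k (f : R^o -> R).
Proof.
elim: k f => [|k IH] f sf; first exact: sm_continuous sf.
split; first exact: sm_continuous sf.
case: sf => f' [df sf] v.
have H (x : R) := is_derive_dir v (df x).
split; first by move=> x; exact: ex_derive.
rewrite (_ : 'D_v _ = fun x => v * f' x).
  by apply: (@is_CkM R^o); [exact: is_Ck_cst|exact: IH].
by apply/funext => x; rewrite (@derive_val _ _ _ _ _ _ _ (H x)).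
Qed.

Lemma smooth1_smooth (f : R -> R) : smooth1 f -> smooth (f : R^o -> R).
Proof. by move=> sf k; exact: sm_is_Ck. Qed.

Lemma cvg_matrix (U : Type) (F : set_system U) (FF : Filter F) m n
    (f : U -> 'M[R]_(m, n)) (l : 'M[R]_(m, n)) :
  (forall i j, (fun x => f x i j) @ F --> l i j) -> f @ F --> l.
Proof.
move=> H; apply/cvg_mx_entourageP => A eA.
suff : \forall x \near F, forall i j, (l i j, f x i j) \in A by [].
have h i : \forall x \near F, forall j, (l i j, f x i j) \in A.
  apply: filter_forall => j.
  have /cvg_app_entourageP/(_ _ eA) := H i j.
  by apply: filterS => x /= ?; rewrite inE.
exact: filter_forall.
Qed.

End smooth_functions.

(** * Weak equations in one variable *)

Section one_dimensional_tools.
Variable R : realType.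
Local Notation leb := (@lebesgue_measure R).
Local Notation Y := (measurableTypeR R).
Implicit Types f g F w : Y -> R.

Lemma measurable_if_lt d (T : measurableType d) (f g h k : T -> R) :
  measurable_fun setT f -> measurable_fun setT g -> measurable_fun setT h ->
  measurable_fun setT k ->
  measurable_fun setT (fun x => if f x < g x then h x else k x).
Proof. by move=> *; apply: measurable_fun_ifT => //; exact: measurable_fun_ltr. Qed.

Lemma measurable_idY : measurable_fun setT (fun u : Y => u : R).
Proof. exact: measurable_id. Qed.

Lemma measurable_upper y f : measurable_fun setT f ->
  measurable_fun setT (fun u : Y => if y < u then f u else 0).
Proof. by move=> mf; apply: measurable_if_lt => //; exact: measurable_idY. Qed.

Lemma intg_upper y f : leb.-integrable setT (EFin \o f) ->
  leb.-integrable setT (EFin \o (fun u : Y => if y < u then f u else 0)).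
Proof.
move=> if1; apply: (intg_le _ (intg_norm if1)).
  by apply: measurable_upper; exact: intg_measurable if1.
by move=> u; case: ifP; rewrite ?normr0.
Qed.

(** Fubini on the triangle y < u. With antiderivatives written as integrals of [if y < u], this is
    integration by parts for functions that are merely integrable. *)
Lemma triangle_fubini F w :
  leb.-integrable setT (EFin \o F) -> leb.-integrable setT (EFin \o w) ->
  [/\ leb.-integrable setT (EFin \o (fun y : Y => F y * \int[leb]_u (if y < u then w u else 0))),
      leb.-integrable setT (EFin \o (fun u : Y => w u * \int[leb]_y (if y < u then F y else 0))) &
      \int[leb]_y (F y * \int[leb]_u (if y < u then w u else 0)) =
      \int[leb]_u (w u * \int[leb]_y (if y < u then F y else 0))].
Proof.
move=> iF iw.
pose k (z : Y * Y) := if z.1 < z.2 then F z.1 * w z.2 else 0.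
have mF := intg_measurable iF; have mw := intg_measurable iw.
have m1 : measurable_fun setT (fst : Y * Y -> Y) by exact: measurable_fst.
have m2 : measurable_fun setT (snd : Y * Y -> Y) by exact: measurable_snd.
have mk : measurable_fun setT k.
  apply: measurable_if_lt => //.
  by apply: measurable_funM; [exact: measurableT_comp mF m1|exact: measurableT_comp mw m2].
have kb x y : `|k (x, y)| <= `|F x| * `|w y|.
  by rewrite /k /=; case: ifP => _; rewrite ?normrM// normr0 mulr_ge0.
have iF' := intg_norm iF; have iw' := intg_norm iw.
have E1 y : \int[leb]_u k (y, u) = F y * \int[leb]_u (if y < u then w u else 0).
  rewrite -RintZ; last exact: intg_upper.
  by apply: eq_Rint => u; rewrite /k /=; case: ifP => _; rewrite ?mulr0.
have E2 u : \int[leb]_y k (y, u) = w u * \int[leb]_y (if y < u then F y else 0).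
  rewrite -RintZ.
    by apply: eq_Rint => y; rewrite /k /=; case: ifP => _; rewrite ?mulr0// mulrC.
  apply: (intg_le _ iF').
    by apply: measurable_if_lt => //; exact: measurable_idY.
  by move=> y; case: ifP; rewrite ?normr0.
split.
- exact: eq_intg E1 (dom_intg1 mk iF' iw' kb).
- exact: eq_intg E2 (dom_intg2 mk iF' iw' kb).
- have := dom_fubini mk iF' iw' kb.
  under eq_Rint do rewrite E1.
  by under [in RHS]eq_Rint do rewrite E2.
Qed.

Lemma ae_neq (y : R) : {ae leb, forall u : Y, u <> y}.
Proof.
exists [set y]; split => //; first exact: lebesgue_measure_set1.
by move=> u /= /contrapT ->.
Qed.

Lemma is_derive_tail w (y : R) : leb.-integrable setT (EFin \o w) ->
  continuous (w : R -> R) ->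
  is_derive y (1 : R) (fun y => \int[leb]_u (if y < u then w u else 0)) (- w y).
Proof.
move=> iw cw.
pose F (x : R) := \int[leb]_(t in `]-oo, x]) w t.
have [dF F'] : derivable F y 1 /\ derive1 F y = w y.
  apply: (@continuous_FTC1 _ w -oo%O y (y + 1)) => //.
  - by rewrite ltrDl.
  - exact: integrableS iw.
  - by rewrite ltNyr.
  - exact: cw.
have EF x : F x = \int[leb]_u (if x < u then 0 else w u).
  rewrite /F Rintegral_mkcond; apply: eq_Rintegral => u _; rewrite patchE.
  have [xu|xu] := ltP x u.
    by rewrite memNset//= in_itv/= => h; move: xu; rewrite ltNge h.
  by rewrite mem_set//= in_itv/=.
have E x : \int[leb]_u (if x < u then w u else 0) = \int[leb]_u w u - F x.
  apply/eqP; rewrite eq_sym subr_eq EF -RintD; last 2 first.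
  - exact: intg_upper.
  - apply: (intg_le _ (intg_norm iw)).
      apply: measurable_if_lt; [exact: measurable_cst|exact: measurable_idY|
        exact: measurable_cst|exact: intg_measurable iw].
    by move=> u; case: ifP; rewrite ?normr0.
  by apply/eqP/eq_Rint => u; case: ifP; rewrite ?addr0 ?add0r.
have dF1 : is_derive y (1 : R) F (w y).
  by apply: DeriveDef; [exact: dF|rewrite -derive1E].
have dc : is_derive y (1 : R) (cst (\int[leb]_u w u) : R -> R) 0 by exact: is_derive_cst.
apply: is_derive_ext (is_deriveB dc dF1) _ _; last by rewrite sub0r.
by move=> x; rewrite E.
Qed.

Definition supp_in (al be : R) f := forall y : R, y <= al \/ be <= y -> f y = 0.

Lemma intg_bounded_supp (al be C : R) f : measurable_fun setT f ->
  supp_in al be f -> (forall y : Y, `|f y| <= C) -> leb.-integrable setT (EFin \o f).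
Proof.
move=> mf sf fC.
apply: (@intg_le _ _ _ _ _ (fun y : Y => C * \1_`[al, be] y)) => //.
  by apply: intgZ; exact: integrable_indic_itv.
move=> y; rewrite indicE.
have [h|h] := boolP (y \in `[al, be]%classic).
  by rewrite /= mulr1.
rewrite sf ?normr0 ?mulr0//.
move: h; rewrite notin_setE/= in_itv/= => /negP; rewrite negb_and -!ltNge.
by case/orP => /ltW; [left|right].
Qed.

Lemma continuous_bounded_supp (al be : R) (f : R -> R) : continuous f ->
  supp_in al be f -> exists2 C, 0 <= C & forall y, `|f y| <= C.
Proof.
move=> cf sf.
have [C hC] : exists C, forall y, y \in `[al, be] -> `|f y| <= C.
  have : bounded_set (f @` `[al, be]).
    apply: compact_bounded; apply: continuous_compact; last exact: segment_compact.
    exact/continuous_subspaceT.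
  move=> [M [Mr hM]]; exists (M + 1) => y hy.
  by apply: (hM (M + 1)); [rewrite ltrDl|exists y].
exists `|C| => // y.
have [hy|hy] := boolP (y \in `[al, be]).
  by rewrite (le_trans (hC _ hy))// ler_norm.
rewrite sf ?normr0//.
move: hy; rewrite in_itv/= negb_and -!ltNge.
by case/orP => /ltW; [left|right].
Qed.

Lemma continuous_measurable_R (f : R -> R) : continuous f ->
  measurable_fun setT (f : Y -> R).
Proof. exact: continuous_measurable_fun. Qed.

Lemma intg_continuous_supp (al be : R) (f : R -> R) : continuous f ->
  supp_in al be f -> leb.-integrable setT (EFin \o (f : Y -> R)).
Proof.
move=> cf sf; have [C _ hC] := continuous_bounded_supp cf sf.
by apply: (intg_bounded_supp _ sf hC); exact: continuous_measurable_R cf.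
Qed.

End one_dimensional_tools.

(** * Fundamental lemma of the calculus of variations on an interval *)

Section fundamental_lemma.
Variable R : realType.
Local Notation leb := (@lebesgue_measure R).
Local Notation Y := (measurableTypeR R).
Implicit Types f g F w : Y -> R.

Definition between (al be u : R) : R := if al < u then (if u < be then 1 else 0) else 0.

(** Written with affine arguments so that [smooth1_affine] applies. It vanishes outside ]al, be[ for
    every k and tends to the indicator of that interval. *)
Definition smooth_between (al be : R) k (u : R) : R :=
  psi (k.+1%:R * u + - (k.+1%:R * al)) * psi (- k.+1%:R * u + k.+1%:R * be).

Lemma smooth_betweenE al be k u :
  smooth_between al be k u = psi (k.+1%:R * (u - al)) * psi (k.+1%:R * (be - u)).
Proof. by congr (psi _ * psi _); ring. Qed.

Lemma smooth1_between al be k : smooth1 (smooth_between al be k).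
Proof. by apply: smooth1M; apply: smooth1_affine; exact: smooth1_psi. Qed.

Lemma supp_smooth_between al be k : supp_in al be (smooth_between al be k).
Proof.
move=> u; rewrite smooth_betweenE => -[h|h].
  by rewrite psi_le0 ?mul0r// mulr_ge0_le0// subr_le0.
by rewrite [X in _ * X]psi_le0 ?mulr0// mulr_ge0_le0// subr_le0.
Qed.

Lemma smooth_between_ge0 al be k u : 0 <= smooth_between al be k u.
Proof. by rewrite mulr_ge0// psi_ge0. Qed.

Lemma smooth_between_le1 al be k u : smooth_between al be k u <= 1.
Proof. by rewrite -[leRHS]mulr1 ler_pM ?psi_ge0// psi_le1. Qed.

Lemma smooth_between_cvg al be u :
  (fun k => smooth_between al be k u) @ \oo --> between al be u.
Proof.
have [h|h] := boolP ((al < u) && (u < be)).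
  have /andP[h1 h2] := h.
  rewrite /between h1 h2 -[X in _ --> X]mulr1.
  rewrite (_ : (fun k => _) = fun k => psi (k.+1%:R * (u - al)) * psi (k.+1%:R * (be - u))).
    by apply: cvgM; apply: psi_cvg; rewrite subr_gt0.
  by apply/funext => k; exact: smooth_betweenE.
have -> : between al be u = 0.
  by move: h; rewrite /between; case: ifP => // _ /=; case: ifP.
rewrite (_ : (fun k => _) = fun=> 0); first exact: cvg_cst.
apply/funext => k; apply: supp_smooth_between.
by move: h; rewrite negb_and -!leNgt => /orP.
Qed.

Lemma smooth1_measurable (f : R -> R) : smooth1 f -> measurable_fun setT (f : Y -> R).
Proof. by move=> /smooth1_continuous; exact: continuous_measurable_R. Qed.

Lemma int_between f al be : leb.-integrable setT (EFin \o f) ->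
  (forall k, \int[leb]_u (f u * smooth_between al be k u) = 0) ->
  \int[leb]_u (f u * between al be u) = 0.
Proof.
move=> if1 H.
have [] := @Rint_dct _ _ _ leb (fun k u => f u * smooth_between al be k u)
  (fun u => f u * between al be u) (fun u => `|f u|).
- move=> k; apply: measurable_funM; first exact: intg_measurable if1.
  by apply: smooth1_measurable; exact: smooth1_between.
- exact: intg_norm.
- move=> k u; rewrite normrM ler_piMr// ger0_norm ?smooth_between_ge0//.
  exact: smooth_between_le1.
- by move=> u; apply: cvgM; [exact: cvg_cst|exact: smooth_between_cvg].
have E : (fun k => \int[leb]_u (f u * smooth_between al be k u)) = fun=> 0.
  by apply/funext => k; exact: H.
rewrite E => _.
by move=> /(cvg_lim (@Rhausdorff R)) <-; rewrite lim_cst.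
Qed.

(** The integral of f over ]al, be] vanishes for all be, and almost everywhere f is its derivative
    in be (Lebesgue differentiation). *)
Lemma ae_eq0_itv f al b : al < b -> leb.-integrable setT (EFin \o f) ->
  (forall be, al < be < b -> \int[leb]_u (f u * between al be u) = 0) ->
  {ae leb, forall y : Y, al < y < b -> f y = 0}.
Proof.
move=> alb if1 H.
have L : locally_integrable setT f.
  by apply: open_integrable_locally => //; exact: openT.
have I y : leb.-integrable [set` Interval (BRight al) (BRight y)] (EFin \o f).
  exact: integrableS if1.
have := @FTC1 R f (BRight al) I L.
apply: filterS; first exact: (ae_filter_ringOfSetsType leb).
move=> x /= hx /andP[ax xb].
have [dF <-] := hx ax.
have Z be : al < be < b -> \int[leb]_(t in `]al, be]) f t = 0.
  move=> h; rewrite -Rintegral_itv_bndo_bndc; last exact: integrableS if1.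
  rewrite -[RHS](H be h) Rintegral_mkcond; apply: eq_Rintegral => u _.
  rewrite patchE /between.
  have [h1|h1] := ltP al u; last first.
    by rewrite memNset ?mulr0//= in_itv/= => /andP[]; rewrite ltNge h1.
  have [h2|h2] := ltP u be; last first.
    by rewrite memNset ?mulr0//= in_itv/= => /andP[_]; rewrite ltNge h2.
  by rewrite mem_set ?mulr1//= in_itv/= h1 h2.
rewrite derive1E (near_eq_derive (g := cst 0)) ?derive_cst//.
near=> z; apply: Z; apply/andP; split; near: z.
  exact: lt_nbhsr.
exact: lt_nbhsl.
Unshelve. all: by end_near. Qed.

Lemma fundamental_lemma f b : leb.-integrable setT (EFin \o f) ->
  (forall (w : R -> R) al be, 0 < al -> be < b -> smooth1 w -> supp_in al be w ->
    \int[leb]_u (f u * w u) = 0) ->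
  {ae leb, forall y : Y, 0 < y < b -> f y = 0}.
Proof.
move=> if1 H; have [b0|b0] := leP b 0.
  by apply: aeW => y /andP[y0 yb]; move: (lt_trans y0 yb); rewrite ltNge b0.
(* Supports of test functions stay away from 0 and b, so the interval is exhausted by the countably
   many ]b / (n + 2), b[. *)
have h n : {ae leb, forall y : Y, b / n.+2%:R < y < b -> f y = 0}.
  have bn : 0 < b / n.+2%:R by rewrite divr_gt0.
  apply: ae_eq0_itv => //.
    by rewrite ltr_pdivrMr// ltr_pMr// ltr1n.
  move=> be /andP[h1 h2]; apply: int_between => // k.
  apply: (H _ (b / n.+2%:R) be) => //; first exact: smooth1_between.
  exact: supp_smooth_between.
have := ae_foralln h; apply: filterS => y /= hy /andP[y0 yb].
(* The integer part n of b / y satisfies b / y < n + 1 < n + 2, that is b / (n + 2) < y. *)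
apply: (hy (Num.truncn (b / y))); rewrite yb andbT ltr_pdivrMr//.
rewrite -ltr_pdivrMl// mulrC (lt_trans (truncnS_gt _))// ltr_nat//.
Qed.

End fundamental_lemma.

Lemma Rint_gt0 d (T : measurableType d) (R : realType)
    (mu : {measure set T -> \bar R}) (f : T -> R) (B : set T) (c : R) :
  mu.-integrable setT (EFin \o f) -> (forall x, 0 <= f x) -> measurable B ->
  (0 < mu B < +oo)%E -> 0 < c -> (forall x, B x -> c <= f x) -> 0 < \int[mu]_x f x.
Proof.
move=> if1 f0 mB /andP[B0 Boo] c0 cf.
have iB : mu.-integrable setT (EFin \o (fun x => c * \1_B x)).
  apply: intgZ; apply/integrableP; split; first exact/measurable_EFinP.
  under eq_integral do rewrite gee0_abs ?lee_fin//.
  by rewrite integral_indic// setIT.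
apply: (@lt_le_trans _ _ (\int[mu]_x (c * \1_B x))); last first.
  apply: le_Rint => // x; rewrite indicE.
  have [xB|xB] := boolP (x \in B); first by rewrite mulr1 cf//; exact/set_mem.
  by rewrite mulr0.
rewrite -lte_fin Rint_EFin//.
under eq_integral do rewrite EFinM.
rewrite ge0_integralZl//; last 2 first.
- exact/measurable_EFinP.
- by rewrite lee_fin ltW.
by rewrite integral_indic// setIT mule_gt0// lte_fin.
Qed.

(** * Product rule for weak derivatives in the height *)

Section vertical_identity.
Variable R : realType.
Local Notation leb := (@lebesgue_measure R).
Local Notation Y := (measurableTypeR R).

Lemma intg_ind (b : R) : leb.-integrable setT (EFin \o (between 0 b : Y -> R)).
Proof.
apply: (@intg_bounded_supp _ 0 b 1).
- apply: measurable_if_lt; [exact: measurable_cst|exact: measurable_idY| |exact: measurable_cst].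
  by apply: measurable_if_lt; [exact: measurable_idY|exact: measurable_cst..].
- move=> y h; rewrite /between; case: ltP => // h1; case: ltP => // h2.
  by case: h => h; lra.
- move=> y; rewrite /between; case: ltP => h1; last by rewrite normr0.
  by case: ltP => h2; rewrite ?normr0 ?normr1.
Qed.

Lemma between_in (b u : R) : 0 < u < b -> between 0 b u = 1.
Proof. by move=> /andP[h1 h2]; rewrite /between h1 h2. Qed.

Lemma psi_homo (x y : R) : x <= y -> psi x <= psi y.
Proof.
move=> xy; have [x0|x0] := leP x 0; first by rewrite psi_le0// psi_ge0.
rewrite /psi x0 (lt_le_trans x0 xy) ler_expR lerN2 lef_pV2// posrE//.
exact: lt_le_trans xy.
Qed.

Lemma int_smooth_between_gt0 (al be : R) : al < be ->
  0 < \int[leb]_u smooth_between al be 0 u.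
Proof.
move=> ab; set e := (be - al) / 4.
have e0 : 0 < e by rewrite divr_gt0// subr_gt0.
apply: (@Rint_gt0 _ _ _ _ _ (`[al + e, be - e]%classic : set Y) (psi e * psi e)).
- apply: intg_continuous_supp (@supp_smooth_between _ _ _ _).
  by apply: smooth1_continuous; exact: smooth1_between.
- exact: smooth_between_ge0.
- exact: measurable_itv.
- suff : (0 < leb `[(al + e)%R, (be - e)%R]%classic < +oo)%E by [].
  rewrite lebesgue_measure_itv/= lte_fin.
  have h : al + e < be - e by rewrite /e; lra.
  by rewrite h -EFinD ltry andbT lte_fin; lra.
- by rewrite mulr_gt0// psi_gt0.
- move=> x /=; rewrite in_itv/= => /andP[h1 h2].
  by rewrite smooth_betweenE !mul1r ler_pM ?psi_ge0// psi_homo//; lra.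
Qed.

(** Equal to 1 for y >= 0 and to 0 for y <= - d. Multiplying by it gives a function of the height a
    compact support below 0 without changing it at positive heights. *)
Definition smooth_step (d y : R) : R := psi (y + d) / (psi (y + d) + psi (- y)).

Lemma smooth_step_den (d y : R) : 0 < d -> psi (y + d) + psi (- y) != 0.
Proof.
move=> d0; apply: lt0r_neq0.
have [h|h] := ltP 0 (y + d); first by rewrite ltr_pwDl ?psi_gt0 ?psi_ge0.
by rewrite ltr_wpDl ?psi_ge0// psi_gt0//; lra.
Qed.

Lemma smooth1_step d : 0 < d -> smooth1 (smooth_step d).
Proof.
move=> d0.
have s1 : smooth1 (fun y : R => psi (y + d)).
  rewrite (_ : (fun y => _) = fun y : R => psi (1 * y + d)).
    by apply: smooth1_affine; exact: smooth1_psi.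
  by apply/funext => y; rewrite mul1r.
have s2 : smooth1 (fun y : R => psi (- y)).
  rewrite (_ : (fun y => _) = fun y : R => psi (-1 * y + 0)).
    by apply: smooth1_affine; exact: smooth1_psi.
  by apply/funext => y; rewrite mulN1r addr0.
apply: smooth1M => //; apply: smooth1V; last exact: smooth1D.
by move=> y; exact: smooth_step_den.
Qed.

Lemma smooth_step_ge0 d y : 0 < d -> 0 <= y -> smooth_step d y = 1.
Proof.
move=> d0 y0; have e0 : psi (- y) = 0 by apply: psi_le0; rewrite oppr_le0.
rewrite /smooth_step e0 addr0 divff//.
by rewrite lt0r_neq0// psi_gt0//; lra.
Qed.

Lemma smooth_step_leN d y : y <= - d -> smooth_step d y = 0.
Proof. by move=> h; rewrite /smooth_step psi_le0 ?mul0r//; lra. Qed.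

Lemma tail_supp (al be : R) (w : Y -> R) y : supp_in al be w -> be <= y ->
  \int[leb]_u (if y < u then w u else 0) = 0.
Proof.
move=> sw h; rewrite -[RHS](@Rint0 _ _ _ leb); apply: eq_Rint => u.
by case: ltP => // yu; apply: sw; right; lra.
Qed.

Lemma tail_supp_low (al be : R) (w : Y -> R) y : supp_in al be w -> y <= al ->
  \int[leb]_u (if y < u then w u else 0) = \int[leb]_u w u.
Proof.
move=> sw h; apply: eq_Rint => u.
by case: ltP => // yu; rewrite sw//; left; lra.
Qed.

(** Functions of the height at a fixed (x, t), all cut to ]0, b[ and later mollified: P is y^a times
    the tangential divergence of the flux plus U_t, r is the vertical flux y^a U_y, g is U_y and p
    is U. Of the products only r g has to be assumed integrable, p being bounded. *)
Variables (b b0 Cp : R) (P r g p : Y -> R).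
Hypotheses (b0_gt0 : 0 < b0) (b0b : b0 < b).
Hypotheses (iP : leb.-integrable setT (EFin \o P))
  (ir : leb.-integrable setT (EFin \o r))
  (ig : leb.-integrable setT (EFin \o g))
  (ip : leb.-integrable setT (EFin \o p)) (bp : forall y, `|p y| <= Cp)
  (irg : leb.-integrable setT (EFin \o (fun y => r y * g y))).
Hypotheses (r0 : forall y, ~~ (0 < y < b) -> r y = 0)
  (P0 : forall y, ~~ (0 < y < b) -> P y = 0)
  (g0 : forall y, ~~ (0 < y < b) -> g y = 0)
  (p0 : forall y, ~~ (0 < y < b) -> p y = 0).
Hypothesis H1 : forall (chi chi' : R -> R) c, c < b -> smooth1 chi ->
  (forall y : R, is_derive y (1 : R) chi (chi' y)) -> supp_in (- c) c chi ->
  \int[leb]_y (P y * chi y) = \int[leb]_y (r y * chi' y).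
Hypothesis H2 : forall (chi chi' : R -> R) al be, 0 < al -> be < b -> smooth1 chi ->
  (forall y : R, is_derive y (1 : R) chi (chi' y)) -> supp_in al be chi ->
  \int[leb]_y (p y * chi' y) = - \int[leb]_y (g y * chi y).

Let b_gt0 : 0 < b. Proof. exact: lt_trans b0b. Qed.

Let S (u : R) : R := \int[leb]_y (if y < u then P y else 0).
Let L (u : R) : R := \int[leb]_y (if y < u then g y else 0).

Let intg_smooth_supp al be (w : R -> R) : smooth1 w -> supp_in al be w ->
  leb.-integrable setT (EFin \o (w : Y -> R)).
Proof. by move=> /smooth1_continuous cw sw; exact: intg_continuous_supp cw sw. Qed.

Let intg_mul_smooth_supp al be (w : R -> R) (f : Y -> R) :
  smooth1 w -> supp_in al be w -> leb.-integrable setT (EFin \o f) ->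
  leb.-integrable setT (EFin \o (fun u => f u * w u)).
Proof.
move=> sw sup if1; have cw := smooth1_continuous sw.
have [C C0 hC] := continuous_bounded_supp cw sup.
apply: (@intg_le _ _ _ _ _ (fun u => C * `|f u|)).
- apply: measurable_funM; first exact: intg_measurable if1.
  exact: continuous_measurable_R cw.
- by apply: intgZ; exact: intg_norm.
- by move=> u; rewrite normrM mulrC ler_wpM2r.
Qed.

(** The test function is the tail integral of an arbitrary w times [smooth_step]: its derivative is
    - w at positive heights, yet it need not vanish at 0. This freedom excludes a constant of
    integration; Fubini on the triangle then exhibits S. *)
Lemma flux_eq : {ae leb, forall y : Y, 0 < y < b -> r y = - S y}.
Proof.
have [_ iS _] := triangle_fubini iP (intg_ind b).
have : {ae leb, forall y : Y, 0 < y < b -> between 0 b y * S y + r y = 0}.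
  apply: fundamental_lemma; first exact: intgD.
  move=> w al be al0 beb sw supw.
  have iw := intg_smooth_supp sw supw.
  pose Om y := \int[leb]_u (if y < u then w u else 0).
  have dOm y : is_derive y (1 : R) Om (- w y).
    by apply: is_derive_tail => //; exact: smooth1_continuous.
  have sOm : smooth1 Om.
    apply: (smooth1_antiderivative dOm).
    move=> k; rewrite (_ : (fun y => - w y) = fun y => (-1) * w y).
      by apply: smM => //; exact: sm_cst.
    by apply/funext => y; rewrite mulN1r.
  have d0 : 0 < b / 2 by rewrite divr_gt0.
  have sc := smooth1_step d0.
  have [c' [dc _]] := sc 1%N.
  pose chi y := Om y * smooth_step (b / 2) y.
  pose chi' y := Om y * c' y + smooth_step (b / 2) y * - w y.
  have dchi y : is_derive y (1 : R) chi (chi' y).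
    exact: is_deriveM.
  have c'0 y : 0 < y -> c' y = 0.
    move=> y0; have d1 := dc y.
    have d2 : is_derive y (1 : R) (smooth_step (b / 2)) 0.
      have dd : is_derive y (1 : R) (cst (1 : R)) 0 by exact: is_derive_cst.
      apply: near_eq_is_derive dd; near=> z.
      rewrite smooth_step_ge0//; near: z.
      by apply: lt_le_nbhsr.
    by rewrite -(@derive_val _ _ _ _ _ _ _ d1) (@derive_val _ _ _ _ _ _ _ d2).
  (* [H1] wants a symmetric interval: the step reaches down to - b / 2 and the tail integral up to
     be, both within the larger of be and b / 2, which is below b. *)
  have supchi : supp_in (- Num.max be (b / 2)) (Num.max be (b / 2)) chi.
    move=> y [h|h]; rewrite /chi.
      have hm : b / 2 <= Num.max be (b / 2) by rewrite le_max lexx orbT.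
      by rewrite smooth_step_leN ?mulr0//; lra.
    rewrite /Om (tail_supp supw) ?mul0r// (le_trans _ h)//.
    by rewrite le_max lexx.
  have mxb : Num.max be (b / 2) < b by rewrite gt_max beb/=; lra.
  have := H1 mxb (smooth1M sOm sc) dchi supchi.
  have -> : \int[leb]_y (P y * (Om y * smooth_step (b / 2) y)) = \int[leb]_y (P y * Om y).
    apply: eq_Rint => y; have [/andP[y0 _]|h] := boolP (0 < y < b).
      by rewrite smooth_step_ge0 ?mulr1// ltW.
    by rewrite P0 ?mul0r.
  have -> : \int[leb]_y (r y * chi' y) = - \int[leb]_y (r y * w y).
    rewrite -RintN; last exact: intg_mul_smooth_supp sw supw ir.
    apply: eq_Rint => y; have [/andP[y0 _]|h] := boolP (0 < y < b).
      by rewrite /chi' c'0// smooth_step_ge0 ?(ltW y0)// mulr0 add0r mul1r mulrN.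
    by rewrite r0 ?mul0r ?oppr0.
  have [_ iwS ->] := triangle_fubini iP iw.
  move=> E.
  transitivity (\int[leb]_u (w u * S u + r u * w u)).
    apply: eq_Rint => u; rewrite mulrDl; congr (_ + _).
    have [h|h] := boolP (0 < u < b); first by rewrite between_in// mul1r mulrC.
    rewrite supw ?mulr0 ?mul0r//.
    by move: h; rewrite negb_and -!leNgt => /orP[h|h]; [left|right]; lra.
  rewrite RintD//; last exact: intg_mul_smooth_supp sw supw ir.
  by rewrite /S E addNr.
apply: filterS => y h yb; have := h yb.
by rewrite between_in// mul1r addrC => /eqP; rewrite addr_eq0 => /eqP.
Unshelve. all: by end_near. Qed.

(** The argument of du Bois-Reymond. Test functions for [H2] vanish near 0, so p is determined by g
    up to a constant only: the mean of p - L against a fixed bump w0. *)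
Lemma potential_eq : exists c, {ae leb, forall y : Y, 0 < y < b -> p y = c + L y}.
Proof.
have [_ iL _] := triangle_fubini ig (intg_ind b).
pose w0 := smooth_between (b / 4) (b / 2) 0.
have bb := b_gt0; have ab4 : b / 4 < b / 2 by lra.
have I0 := int_smooth_between_gt0 ab4; rewrite -/w0 in I0.
set i0 := (X in 0 < X) in I0.
have sw0 : smooth1 w0 by exact: smooth1_between.
have supw0 : supp_in (b / 4) (b / 2) w0 by exact: supp_smooth_between.
pose D u := p u - between 0 b u * L u.
have iD : leb.-integrable setT (EFin \o D) by exact: intgB.
pose c := (\int[leb]_u (D u * w0 u)) / i0.
exists c.
have key (w : R -> R) al be : 0 < al -> be < b -> smooth1 w -> supp_in al be w ->
    \int[leb]_u (D u * w u) = c * \int[leb]_u w u.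
  move=> al0 beb sw supw.
  have iw := intg_smooth_supp sw supw.
  have iw0 := intg_smooth_supp sw0 supw0.
  set k := (\int[leb]_u w u) / i0.
  (* k makes the integral of th vanish, so its tail integral has compact support inside ]0, b[ and
     is admissible in [H2]. *)
  pose th u := w u - k * w0 u.
  have sth : smooth1 th.
    move=> m; rewrite (_ : th = fun u => w u + (- k) * w0 u).
      by apply: smD => //; apply: smM => //; exact: sm_cst.
    by apply/funext => u; rewrite mulNr.
  pose al' := Num.min al (b / 4); pose be' := Num.max be (b / 2).
  have al'0 : 0 < al' by rewrite lt_min al0/=; lra.
  have be'b : be' < b by rewrite gt_max beb/=; lra.
  have h1 : al' <= al by rewrite ge_min lexx.
  have h2 : al' <= b / 4 by rewrite ge_min lexx orbT.
  have h3 : be <= be' by rewrite le_max lexx.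
  have h4 : b / 2 <= be' by rewrite le_max lexx orbT.
  have supth : supp_in al' be' th.
    by move=> u hu; rewrite /th supw ?supw0 ?mulr0 ?subr0//; case: hu => h; [left|right|left|right]; lra.
  have ith := intg_smooth_supp sth supth.
  have th0 : \int[leb]_u th u = 0.
    rewrite RintB//; last exact: intgZ.
    by rewrite RintZ// /k divfK ?subrr// gt_eqF.
  pose Th y := \int[leb]_u (if y < u then th u else 0).
  have dTh y : is_derive y (1 : R) Th (- th y).
    by apply: is_derive_tail => //; exact: smooth1_continuous.
  have sTh : smooth1 Th.
    apply: (smooth1_antiderivative dTh).
    move=> m; rewrite (_ : (fun y => - th y) = fun y => (-1) * th y).
      by apply: smM => //; exact: sm_cst.
    by apply/funext => y; rewrite mulN1r.
  have supTh : supp_in al' be' Th.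
    move=> y [h|h]; first by rewrite /Th (tail_supp_low supth).
    by rewrite /Th (tail_supp supth).
  have := H2 al'0 be'b sTh dTh supTh.
  have [_ ithL ->] := triangle_fubini ig ith.
  have -> : \int[leb]_y (p y * - th y) = - \int[leb]_y (p y * th y).
    rewrite -RintN; last exact: intg_mul_smooth_supp sth supth ip.
    by apply: eq_Rint => y; rewrite mulrN.
  move=> /oppr_inj E.
  have Dth : \int[leb]_u (D u * th u) = 0.
    transitivity (\int[leb]_u (p u * th u - th u * L u)).
      apply: eq_Rint => u; rewrite /D mulrBl; congr (_ - _).
      have [h|h] := boolP (0 < u < b); first by rewrite between_in// mul1r mulrC.
      rewrite supth ?mulr0 ?mul0r//.
      by move: h; rewrite negb_and -!leNgt => /orP[h|h]; [left|right]; lra.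
    rewrite RintB//; last exact: intg_mul_smooth_supp sth supth ip.
    by rewrite E subrr.
  have iDw : leb.-integrable setT (EFin \o (fun u => D u * w u)).
    exact: intg_mul_smooth_supp sw supw iD.
  have iDw0 : leb.-integrable setT (EFin \o (fun u => D u * w0 u)).
    exact: intg_mul_smooth_supp sw0 supw0 iD.
  have : \int[leb]_u (D u * w u) - k * \int[leb]_u (D u * w0 u) = 0.
    rewrite -Dth -RintZ// -RintB//; last exact: intgZ.
    by apply: eq_Rint => u; rewrite /th; ring.
  move=> /eqP; rewrite subr_eq0 => /eqP ->.
  by rewrite /k /c; ring.
have ic : leb.-integrable setT (EFin \o (fun u => D u - c * between 0 b u)).
  by apply: intgB => //; apply: intgZ; exact: intg_ind.
have : {ae leb, forall y : Y, 0 < y < b -> D y - c * between 0 b y = 0}.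
  apply: fundamental_lemma => // w al be al0 beb sw supw.
  have iw := intg_smooth_supp sw supw.
  transitivity (\int[leb]_u (D u * w u - c * w u)).
    apply: eq_Rint => u; rewrite mulrBl; congr (_ - _).
    have [h|h] := boolP (0 < u < b); first by rewrite between_in// mulr1.
    rewrite supw ?mulr0//.
    by move: h; rewrite negb_and -!leNgt => /orP[h|h]; [left|right]; lra.
  rewrite RintB ?RintZ//; last 2 first.
  - exact: intg_mul_smooth_supp sw supw iD.
  - exact: intgZ.
  by rewrite (key _ al be)// subrr.
apply: filterS => y h yb; have := h yb.
rewrite /D between_in// mul1r mulr1 => /eqP; rewrite subr_eq0 => /eqP <-.
by rewrite subrK.
Qed.

Variables (zeta zeta' : R -> R).
Hypotheses (dzeta : forall y : R, is_derive y (1 : R) zeta (zeta' y))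
  (czeta' : continuous zeta')
  (szeta : supp_in (- b0) b0 zeta) (szeta' : supp_in (- b0) b0 zeta').

Let czeta : continuous zeta.
Proof.
move=> x; apply: differentiable_continuous.
by apply/derivable1_diffP; exact: ex_derive.
Qed.

Let izeta' : leb.-integrable setT (EFin \o (zeta' : Y -> R)).
Proof. exact: intg_continuous_supp czeta' szeta'. Qed.

Let intg_mulZ (h : R -> R) (f : Y -> R) : continuous h -> supp_in (- b0) b0 h ->
  leb.-integrable setT (EFin \o f) ->
  leb.-integrable setT (EFin \o (fun u => h u * f u)).
Proof.
move=> ch sh if1.
have [C C0 hC] := continuous_bounded_supp ch sh.
apply: (@intg_le _ _ _ _ _ (fun u => C * `|f u|)).
- apply: measurable_funM; first exact: continuous_measurable_R ch.
  exact: intg_measurable if1.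
- by apply: intgZ; exact: intg_norm.
- by move=> u; rewrite normrM ler_wpM2r.
Qed.

Lemma tail_zeta' y : \int[leb]_u (if y < u then zeta' u else 0) = - zeta y.
Proof.
pose h y := \int[leb]_u (if y < u then zeta' u else 0) + zeta y.
have dh z : is_derive z (1 : R) h 0.
  have := is_deriveD (is_derive_tail z izeta' czeta') (dzeta z).
  by rewrite addNr.
have hb : h b0 = 0.
  rewrite /h (tail_supp szeta' (lexx b0)) add0r; apply: szeta; right; exact: lexx.
have := is_derive_0_is_cst y b0 dh; rewrite hb /h => /eqP.
by rewrite addr_eq0 => /eqP.
Qed.

Let om u := zeta u * g u + zeta' u * p u.

Let iom : leb.-integrable setT (EFin \o om).
Proof. by apply: intgD; exact: intg_mulZ. Qed.

(** The product rule (zeta p)' = zeta g + zeta' p in integrated form, for p = c + L with L an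
    integral of g. The term zeta' L is a double integral over a triangle, to which Fubini applies
    once more. *)
Lemma tail_om : {ae leb, forall y : Y, 0 < y < b ->
  \int[leb]_u (if y < u then om u else 0) = - (zeta y * p y)}.
Proof.
have [c pL] := potential_eq.
apply: filterS (pL) => y hy yb; rewrite hy//.
have /andP[y0 yltb] := yb.
pose W u := if y < u then zeta' u else 0.
have iW : leb.-integrable setT (EFin \o (W : Y -> R)) by exact: intg_upper.
have [_ iWL EWL] := triangle_fubini ig iW.
pose fb u := if y < u then zeta u * g u else 0.
have ib : leb.-integrable setT (EFin \o (fb : Y -> R)).
  by apply: intg_upper; exact: intg_mulZ.
pose fa v := zeta y * (if v < y then g v else 0).
have iLy : leb.-integrable setT (EFin \o (fun v : Y => if v < y then g v else 0)).
  apply: (intg_le _ (intg_norm ig)).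
    apply: measurable_if_lt; [exact: measurable_idY|exact: measurable_cst| |
      exact: measurable_cst].
    exact: intg_measurable ig.
  by move=> u; case: ifP; rewrite ?normr0.
have ia : leb.-integrable setT (EFin \o (fa : Y -> R)) by exact: intgZ.
have Ea : \int[leb]_v fa v = zeta y * L y by exact: RintZ.
(* The tail of zeta' beyond both v and y; it splits the g-integral at v = y into zeta(y) L(y) and
   the tail of zeta g. *)
pose TW v := \int[leb]_u (if v < u then W u else 0).
have ETW v : TW v = - zeta (Num.max v y).
  rewrite -tail_zeta'; apply: eq_Rint => u; rewrite /W gt_max.
  by case: ltP => //= _; case: ltP.
have mTW : measurable_fun setT (TW : Y -> R).
  apply: (@continuous_measurable_R _ TW).
  rewrite (_ : TW = fun v => - zeta (Num.max v y)); last exact/funext.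
  move=> v; apply: continuousN; apply: continuous_comp; last exact: czeta.
  by apply: continuous_max => //; exact: cst_continuous.
have EW : \int[leb]_v (g v * TW v) = - (zeta y * L y) - \int[leb]_u fb u.
  transitivity (\int[leb]_v (- fa v - fb v)); last first.
    by rewrite (RintB (intgN ia) ib) (RintN ia) Ea.
  apply: Rint_ae.
  - by apply: measurable_funM => //; exact: intg_measurable ig.
  - exact: intg_measurable (intgB (intgN ia) ib).
  apply: filterS (ae_neq y) => v vy; rewrite ETW /fa /fb.
  case: (ltgtP v y) => h; last by case: vy.
  - by ring.
  - by rewrite mulr0 oppr0 sub0r; ring.
pose fW u := W u * L u.
have EW2 : \int[leb]_u fW u = - (zeta y * L y) - \int[leb]_u fb u.
  by rewrite -EW EWL.
have iW2 : leb.-integrable setT (EFin \o (fW : Y -> R)) by exact: iWL.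
pose fc u := c * W u.
have ic : leb.-integrable setT (EFin \o (fc : Y -> R)) by exact: intgZ.
have Ec : \int[leb]_u fc u = - (c * zeta y).
  by rewrite (RintZ _ iW) tail_zeta' mulrN.
transitivity (\int[leb]_u (fb u + (fc u + fW u))).
  apply: Rint_ae.
  - exact: intg_measurable (intg_upper _ iom).
  - exact: intg_measurable (intgD ib (intgD ic iW2)).
  apply: filterS pL => u hu; rewrite /fb /fc /fW /W /om.
  case: ltP => yu; last by rewrite !(mulr0,mul0r,addr0).
  have [ub|ub] := ltP u b; last first.
    have bu : b0 <= u by apply: le_trans ub; exact: ltW.
    by rewrite (szeta (or_intror bu)) (szeta' (or_intror bu)); ring.
  by rewrite hu ?(lt_trans y0 yu)//; ring.
rewrite (RintD ib (intgD ic iW2)) (RintD ic iW2) Ec EW2.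
by ring.
Qed.

(* [H1] says that r' = P and, as chi need not vanish at 0, that r vanishes at 0
   (the Neumann condition); [H2] says that p' = g. *)
Lemma vertical_identity :
  \int[leb]_y (P y * (zeta y * p y)) =
  \int[leb]_y (r y * (zeta y * g y + zeta' y * p y)).
Proof.
have [iPK iomS E] := triangle_fubini iP iom.
have izp : leb.-integrable setT (EFin \o (fun y => zeta y * p y)) by exact: intg_mulZ.
have iPzp : leb.-integrable setT (EFin \o (fun y => P y * (zeta y * p y))).
  have [C C0 hC] := continuous_bounded_supp czeta szeta.
  apply: (@intg_le _ _ _ _ _ (fun u => (C * Cp) * `|P u|)).
  - apply: measurable_funM; [exact: intg_measurable iP|exact: intg_measurable izp].
  - by apply: intgZ; exact: intg_norm.
  - by move=> u; rewrite normrM mulrC ler_wpM2r// normrM ler_pM.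
have irom : leb.-integrable setT (EFin \o (fun y => r y * om y)).
  suff i2 : leb.-integrable setT (EFin \o (fun y : Y => zeta' y * (r y * p y))).
    apply: eq_intg (intgD (intg_mulZ czeta szeta irg) i2) => y.
    by rewrite /om; ring.
  apply: intg_mulZ => //.
  apply: (@intg_le _ _ _ _ _ (fun u => Cp * `|r u|)).
  - apply: measurable_funM; [exact: intg_measurable ir|exact: intg_measurable ip].
  - by apply: intgZ; exact: intg_norm.
  - by move=> u; rewrite normrM mulrC ler_wpM2r.
(* zeta p is minus the tail integral of om, so Fubini on the triangle replaces P by its
   antiderivative S, and S = - r almost everywhere. *)
transitivity (- \int[leb]_y (P y * \int[leb]_u (if y < u then om u else 0))).
  rewrite -RintN//; apply: Rint_ae.
  - exact: intg_measurable iPzp.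
  - exact: intg_measurable (intgN iPK).
  apply: filterS tail_om => y hy.
  have [yb|yb] := boolP (0 < y < b); first by rewrite (hy yb); ring.
  by rewrite (P0 yb); ring.
rewrite E -RintN//; apply: Rint_ae.
- exact: intg_measurable (intgN iomS).
- exact: intg_measurable irom.
apply: filterS flux_eq => y hy.
have [yb|yb] := boolP (0 < y < b); first by rewrite (hy yb) -/(S y) /om; ring.
by rewrite (r0 yb) /om (g0 yb) (p0 yb); ring.
Qed.

End vertical_identity.

(** * Mollification in the variables (x, t) *)

(** Integrability of the sections is not assumed: positive and negative parts have measurable
    integrals, and [fine] of their difference is measurable whatever its values. *)
Lemma measurable_Rint_param d1 d2 (X : measurableType d1) (Y : measurableType d2)
    (R : realType) (m2 : {sigma_finite_measure set Y -> \bar R}) (f : X * Y -> R) :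
  measurable_fun setT f -> measurable_fun setT (fun x => \int[m2]_y f (x, y)).
Proof.
move=> mf.
have mF : measurable_fun setT (EFin \o f) by exact/measurable_EFinP.
pose F1 x := (\int[m2]_y ((EFin \o f)^\+ (x, y)))%E.
pose F2 x := (\int[m2]_y ((EFin \o f)^\- (x, y)))%E.
have m1 : measurable_fun setT F1.
  apply: (measurable_fun_fubini_tonelli_F (m2 := m2) ((EFin \o f)^\+)%E) => //.
  exact: measurable_funepos.
have m2' : measurable_fun setT F2.
  apply: (measurable_fun_fubini_tonelli_F (m2 := m2) ((EFin \o f)^\-)%E) => //.
  exact: measurable_funeneg.
rewrite (_ : (fun x => _) = fun x => fine (F1 x - F2 x)%E).
  apply: measurableT_comp; first exact: fine_measurable.
  exact: emeasurable_funB.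
apply/funext => x; rewrite /Rintegral integralE; congr (fine (_ - _)%E).
  by apply: eq_integral => y _; rewrite !funeposE.
by apply: eq_integral => y _; rewrite !funenegE.
Qed.

Section mollifier.
Variables (R : realType) (n : nat).
Local Notation T := ('rV[R]_n * measurableTypeR R)%type.
Local Notation V := ('rV[R]_n * R)%type.
Local Notation nu := (lebVt R n).

Lemma coord_fst_continuous (i : 'I_n) : continuous (fun t : V => t.1 0 i : R).
Proof.
move=> t; apply: (@continuous_comp _ _ _ fst (fun v : 'rV[R]_n => v 0 i)).
  exact: cvg_fst.
exact: coord_continuous.
Qed.

Lemma smooth_coord (f : R -> R) (i : 'I_n) : smooth1 f ->
  smooth (fun t : V => f (t.1 0 i)).
Proof.
move=> /smooth1_smooth sf.
apply: (@smooth_affine _ V R^o (fun t : V => t.1 0 i) (fun t : V => t.1 0 i) _ _ _ sf).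
  exact: coord_fst_continuous.
by move=> x v h /=; rewrite !mxE.
Qed.

Lemma smooth_snd (f : R -> R) : smooth1 f -> smooth (fun t : V => f t.2).
Proof.
move=> /smooth1_smooth sf.
apply: (@smooth_affine _ V R^o (fun t : V => t.2) (fun t : V => t.2) _ _ _ sf) => //.
by move=> x; exact: cvg_snd.
Qed.

Definition bump (e : R) (t : T) : R :=
  (\prod_(i < n) smooth_between (- e) e 0 (t.1 0 i)) * smooth_between (- e) e 0 t.2.

Lemma smooth_bump e : smooth (bump e : V -> R).
Proof.
apply: smoothM; last by apply: smooth_snd; exact: smooth1_between.
by apply: smooth_prod => i; apply: smooth_coord; exact: smooth1_between.
Qed.

Lemma smooth_between_even (e s : R) :
  smooth_between (- e) e 0 (- s) = smooth_between (- e) e 0 s.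
Proof. by rewrite !smooth_betweenE mulrC; congr (psi _ * psi _); ring. Qed.

Lemma bump_even e t : bump e (- t) = bump e t.
Proof.
rewrite /bump; congr (_ * _); last by rewrite -[RHS]smooth_between_even.
by apply: eq_bigr => i _; rewrite -[RHS]smooth_between_even mxE.
Qed.

Lemma bump_ge0 e t : 0 <= bump e t.
Proof. by rewrite mulr_ge0 ?smooth_between_ge0// prodr_ge0// => i _; exact: smooth_between_ge0. Qed.

Lemma notin_boxT e (t : T) : ~ boxT e t -> (exists i, e < `|t.1 0 i|) \/ e < `|t.2|.
Proof.
move=> h; have [h2|h2] := ltP e `|t.2|; first by right.
left; apply: contra_notP h => /forallNP h; split => [i|/=].
  by rewrite leNgt; apply/negP; exact: h.
by rewrite in_itv/= -ler_norml.
Qed.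

Lemma bump_supp e t : ~ boxT e t -> bump e t = 0.
Proof.
have z s : e < `|s| -> smooth_between (- e) e 0 s = 0.
  move=> hs; apply: supp_smooth_between.
  by move: hs; rewrite lter_normr => /orP[h|h]; [right|left]; lra.
move=> /notin_boxT [[i hi]|h]; last by rewrite /bump [X in _ * X]z ?mulr0.
by rewrite /bump (bigD1 i)//= z// !mul0r.
Qed.

Lemma bump_lower e t : 0 < e -> boxT (e / 2) t ->
  (psi (e / 2) * psi (e / 2)) ^+ n.+1 <= bump e t.
Proof.
move=> e0 [h1 h2].
have z s : `|s| <= e / 2 -> psi (e / 2) * psi (e / 2) <= smooth_between (- e) e 0 s.
  rewrite ler_norml => /andP[h3 h4].
  by rewrite smooth_betweenE !mul1r ler_pM ?psi_ge0// psi_homo//; lra.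
have p0 : 0 <= psi (e / 2) * psi (e / 2) by rewrite mulr_ge0// psi_ge0.
rewrite exprSr /bump; apply: ler_pM => //.
- exact: exprn_ge0.
- rewrite -[X in _ ^+ X]card_ord -prodr_const; apply: ler_prod => i _.
  by rewrite p0/= z//; exact: h1.
- by apply: z; move: h2; rewrite /= in_itv/= -ler_norml.
Qed.

Lemma smooth_measurable (f : V -> R) : smooth f -> measurable_fun setT (f : T -> R).
Proof. by move=> /smooth_continuous; exact: continuous_measurable_T. Qed.

Lemma compact_boxT (r : R) : compact (boxT r : set V).
Proof.
have c1 : compact (box r : set 'rV[R]_n).
  have := @rV_compact R n (fun=> `[- r, r]%classic) (fun i => @segment_compact _ _ _).
  rewrite (_ : [set _ | _] = box r)//; apply/seteqP; split => v /= h i.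
    by have := h i; rewrite /= in_itv/= -ler_norml.
  by rewrite in_itv/= -ler_norml; exact: h.
by have := compact_setX c1 (@segment_compact R (- r) r).
Qed.

Lemma continuous_box_bounded (f : V -> R) r : continuous f ->
  exists2 C, 0 <= C & forall t, boxT r t -> `|f t| <= C.
Proof.
move=> cf.
have : bounded_set (f @` boxT r).
  apply: compact_bounded; apply: continuous_compact; last exact: compact_boxT.
  exact: continuous_subspaceT.
move=> [M [Mr hM]]; exists `|M + 1| => // t ht.
apply: (le_trans _ (ler_norm _)).
by apply: (hM (M + 1)); [rewrite ltrDl|exists t].
Qed.

Definition supp_box (r : R) (f : T -> R) := forall t, ~ boxT r t -> f t = 0.

Lemma continuous_supp_bounded (f : V -> R) r : continuous f -> supp_box r f ->
  exists2 C, 0 <= C & forall t, `|f t| <= C.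
Proof.
move=> cf sf; have [C C0 hC] := continuous_box_bounded r cf.
exists C => // t; have [ht|ht] := pselect (boxT r t); first exact: hC.
by rewrite sf ?normr0.
Qed.

Lemma intg_ind_boxT r : nu.-integrable setT (EFin \o (\1_(boxT r) : T -> R)).
Proof.
have mB := @measurable_boxT R n r.
apply/integrableP; split; first exact/measurable_EFinP.
under eq_integral do rewrite gee0_abs ?lee_fin//.
rewrite integral_indic// setIT.
have [r0|r0] := leP 0 r.
  suff : (lebesgue_rVt R n (boxT r) < +oo)%E by [].
  by rewrite lebesgue_rVt_box// ltry.
rewrite (_ : boxT r = set0) ?measure0//.
apply/seteqP; split => // t [_] /=; rewrite in_itv/= => /andP[h1 h2]; lra.
Qed.

Lemma intg_bounded_box (f : T -> R) r C : measurable_fun setT f -> supp_box r f ->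
  (forall t, `|f t| <= C) -> nu.-integrable setT (EFin \o f).
Proof.
move=> mf sf fC; apply: (@intg_le _ _ _ _ _ (fun t => C * \1_(boxT r) t)) => //.
  by apply: intgZ; exact: intg_ind_boxT.
move=> t; rewrite indicE; have [ht|ht] := boolP (t \in boxT r).
  by rewrite mulr1.
by rewrite sf ?normr0 ?mulr0//; move: ht; rewrite notin_setE.
Qed.

Lemma intg_continuous_box (f : V -> R) r : continuous f -> supp_box r f ->
  nu.-integrable setT (EFin \o (f : T -> R)).
Proof.
move=> cf sf; have [C _ hC] := continuous_supp_bounded cf sf.
by apply: (intg_bounded_box _ sf hC); exact: continuous_measurable_T.
Qed.

(** A normalized product of one-dimensional bumps. Evenness gives k(t - s) total mass one in s as
    well as in t; the first serves pointwise bounds, the second preserves integrals. *)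
Lemma mollifier_exists e : 0 < e -> exists k : V -> R,
  [/\ smooth k, forall t, 0 <= k t, forall t, k (- t) = k t,
      supp_box e k & \int[nu]_t k t = 1].
Proof.
move=> e0.
have ib : nu.-integrable setT (EFin \o bump e).
  apply: intg_continuous_box (smooth_continuous (smooth_bump e)) _.
  exact: bump_supp.
have I0 : 0 < \int[nu]_t bump e t.
  apply: (Rint_gt0 (B := boxT (e / 2)) ib (bump_ge0 e) (measurable_boxT _)
    (c := (psi (e / 2) * psi (e / 2)) ^+ n.+1)).
  - suff : (0 < lebesgue_rVt R n (boxT (e / 2)%R) < +oo)%E by [].
    rewrite lebesgue_rVt_box; last by rewrite divr_ge0 ?ltW.
    by rewrite ltry andbT lte_fin exprn_gt0// pmulrn_rgt0// divr_gt0.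
  - by rewrite exprn_gt0// mulr_gt0// psi_gt0// divr_gt0.
  - by move=> t; exact: bump_lower.
set I := (X in 0 < X) in I0.
exists (fun t => I^-1 * bump e t); split.
- by apply: smoothM; [move=> k; exact: is_Ck_cst|exact: smooth_bump].
- by move=> t; rewrite mulr_ge0 ?bump_ge0// invr_ge0 ltW.
- by move=> t; rewrite bump_even.
- by move=> t ht; rewrite bump_supp ?mulr0.
- by rewrite RintZ// mulVf// gt_eqF.
Qed.

End mollifier.

(** * Differentiation under the integral sign *)

Section derive_under_integral.
Variables (R : realType).

Lemma is_derive_slice (V : normedModType R) (g : V -> R) (t v : V) (d : R) :
  is_derive (0 : R) (1 : R) (fun h : R => g (h *: v + t)) d -> is_derive t v g d.
Proof.
move=> [dg <-].
have E : (fun h : R => h^-1 *: (g (h *: v + t) - g t)) =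
    (fun h : R => h^-1 *: (g ((h *: (1 : R) + 0) *: v + t) - g (0 *: v + t))).
  by apply/funext => h; rewrite addr0 scale0r add0r /GRing.scale/= mulr1.
by apply: DeriveDef; rewrite /derivable ?/derive E.
Qed.

Lemma is_derive_line (V : normedModType R) (g g' : V -> R) (t v : V) (s : R) :
  (forall t, is_derive t v g (g' t)) ->
  is_derive s (1 : R) (fun h : R => g (h *: v + t)) (g' (s *: v + t)).
Proof.
move=> dg; apply: (is_derive_affine (f := g) (L := fun h : R => h *: v + t) (w := v)) => //.
by move=> h; rewrite scalerDl addrA; congr (_ *: _ + _ + _); rewrite /GRing.scale/= mulr1.
Qed.

Lemma is_derive_under_integral d (Y : measurableType d)
    (mu : {measure set Y -> \bar R}) (f f' : R -> Y -> R) (G : Y -> R) (a : R) :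
  (forall x y, is_derive x (1 : R) (f ^~ y) (f' x y)) ->
  (forall x, mu.-integrable setT (EFin \o f x)) ->
  mu.-integrable setT (EFin \o G) -> (forall x y, `|f' x y| <= G y) ->
  is_derive a (1 : R) (fun x => \int[mu]_y f x y) (\int[mu]_y f' a y).
Proof.
move=> df if1 iG fG.
have E x y : partial1of2 f x y = f' x y.
  by rewrite partial1of2E derive_val.
have aI : `]a - 1, a + 1[%classic a by rewrite /= in_itv/=; lra.
have G0 y : 0 <= G y by apply: le_trans (fG 0 y).
have df1 x y : `]a - 1, a + 1[%classic x -> setT y -> derivable (f ^~ y) x 1.
  by move=> _ _; exact: ex_derive.
have fG' x y : `]a - 1, a + 1[%classic x -> setT y -> `|partial1of2 f x y| <= G y.
  by move=> _ _; rewrite E.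
apply: DeriveDef.
  exact: (derivable_under_integral measurableT aI (fun x _ => if1 x) df1 G0 iG fG').
rewrite -derive1E.
rewrite (differentiation_under_integral measurableT aI (fun x _ => if1 x) df1 G0 iG fG').
by apply: eq_Rint => y; exact: E.
Qed.

Lemma is_derive_lipschitz (g g' : R -> R) (C h : R) : 0 <= h ->
  (forall s : R, is_derive s (1 : R) g (g' s)) -> (forall s, `|g' s| <= C) ->
  `|g h - g 0| <= C * h.
Proof.
move=> h0 dg gC.
have cg : {within `[0, h], continuous g}.
  by apply: derivable_within_continuous => x _; exact: ex_derive.
have [x _ ->] := MVT_segment h0 (fun x _ => dg x) cg.
by rewrite subr0 normrM (ger0_norm h0) ler_wpM2r.
Qed.

End derive_under_integral.

(** * Convolution in (x, t) and integration by parts *)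

Section convolution.
Variables (R : realType) (n : nat).
Local Notation T := ('rV[R]_n * measurableTypeR R)%type.
Local Notation V := ('rV[R]_n * R)%type.
Local Notation nu := (lebVt R n).

Definition conv (k : V -> R) (f : T -> R) (t : T) : R := \int[nu]_s (k (t - s) * f s).

Section conv.
Variables (k : V -> R) (e : R).
Hypotheses (sk : smooth k) (sup : supp_box e k).

Lemma kernel_bounded : exists2 C, 0 <= C & forall t : V, `|k t| <= C.
Proof. exact: continuous_supp_bounded (smooth_continuous sk) sup. Qed.

Lemma kernel_shift_continuous (t : V) : continuous (fun s : V => k (t - s)).
Proof.
move=> s; apply: continuous_comp; last exact: smooth_continuous.
by apply: continuousB; [exact: cst_continuous|].
Qed.

Lemma kernel_shift_measurable (t : T) : measurable_fun setT (fun s : T => k (t - s)).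
Proof. exact: continuous_measurable_T (@kernel_shift_continuous t). Qed.

Lemma conv_intg (f : T -> R) (t : T) : nu.-integrable setT (EFin \o f) ->
  nu.-integrable setT (EFin \o (fun s : T => k (t - s) * f s)).
Proof.
move=> if1; have [C C0 hC] := kernel_bounded.
apply: (@intg_le _ _ _ _ _ (fun s => C * `|f s|)).
- apply: measurable_funM; first exact: kernel_shift_measurable.
  exact: intg_measurable if1.
- by apply: intgZ; exact: intg_norm.
- by move=> s; rewrite normrM ler_wpM2r.
Qed.

Lemma conv_bound (f : T -> R) C t : nu.-integrable setT (EFin \o f) ->
  (forall t : V, `|k t| <= C) -> `|conv k f t| <= C * \int[nu]_s `|f s|.
Proof.
move=> if1 hC; rewrite -RintZ; last exact: intg_norm.
apply: le_norm_Rint; [exact: conv_intg|by apply: intgZ; exact: intg_norm|].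
by move=> s; rewrite normrM ler_wpM2r.
Qed.

Lemma supp_box_derive v : supp_box e ('D_v k).
Proof.
have cB : closed (boxT e : set V).
  by apply: compact_closed; [exact: norm_hausdorff|exact: compact_boxT].
move=> t ht.
have /= h : \near t, (cst (0 : R)) t = k t.
  have : \near t, (~` (boxT e : set V)) t.
    by apply: open_nbhs_nbhs; split => //; exact: closed_openC.
  by apply: filterS => s hs; rewrite sup.
by rewrite -(near_eq_derive _ h) derive_cst.
Qed.

Lemma kernel_shift_derive v (t s : V) :
  is_derive t v (fun t : V => k (t - s)) ('D_v k (t - s)).
Proof.
apply: (is_derive_affine (f := k) (L := fun t : V => t - s) (w := v)).
  by move=> h; rewrite addrA.
exact: smooth_is_derive.
Qed.

End conv.

Lemma conv_is_derive k e (f : T -> R) (t v : V) : smooth k -> supp_box e k ->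
  nu.-integrable setT (EFin \o f) ->
  is_derive t v (conv k f : V -> R) (conv ('D_v k) f t).
Proof.
move=> sk sup if1; apply: is_derive_slice.
have sk' := smooth_derive v sk; have sup' := supp_box_derive sup v.
have [C C0 hC] := kernel_bounded sk' sup'.
have -> : conv ('D_v k) f t = \int[nu]_s ('D_v k (0 *: v + t - s) * f s).
  by apply: eq_Rint => s; rewrite scale0r add0r.
apply: (@is_derive_under_integral R _ _ nu (fun h s => k (h *: v + t - s) * f s)
  (fun h s => 'D_v k (h *: v + t - s) * f s) (fun s => C * `|f s|)).
- move=> h s.
  have d1 := is_derive_line t h (fun t => kernel_shift_derive sk v t s).
  have d2 : is_derive h (1 : R) (cst (f s) : R -> R) 0 by exact: is_derive_cst.
  apply: is_derive_ext (is_deriveM d1 d2) _ _ => //.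
  by rewrite /GRing.scale/= mulr0 add0r mulrC.
- by move=> h; exact: (conv_intg sk sup _ if1).
- by apply: intgZ; exact: intg_norm.
- by move=> h s; rewrite normrM ler_wpM2r.
Qed.

(* By translation invariance the difference quotients of g have integral 0. *)
Lemma int_derive_eq0 (g g' : T -> R) (v : V) r C :
  (forall t : V, is_derive t v (g : V -> R) (g' t)) -> (forall t, `|g' t| <= C) ->
  nu.-integrable setT (EFin \o g) -> supp_box r g ->
  nu.-integrable setT (EFin \o g') /\ \int[nu]_t g' t = 0.
Proof.
move=> dg gC ig sg.
have [rv hv] : exists rv, boxT rv (v : T).
  exists (\sum_i `|v.1 0 i| + `|v.2|); split => [i|/=].
    by rewrite (bigD1 i)//= -addrA lerDl addr_ge0// sumr_ge0.
  by rewrite in_itv/= -ler_norml lerDr sumr_ge0.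
pose h m : R := m.+1%:R^-1.
have h0 m : 0 < h m by rewrite invr_gt0.
have h1 m : h m <= 1 by rewrite invf_le1// ler1n.
pose q m t := (h m)^-1 * (g (t + h m *: v) - g t).
have iq m : nu.-integrable setT (EFin \o q m).
  by apply: intgZ; apply: intgB => //; exact: intg_shift.
have q0 m : \int[nu]_t q m t = 0.
  rewrite RintZ; last by apply: intgB => //; exact: intg_shift.
  rewrite RintB//; last exact: intg_shift.
  by rewrite Rint_shift// subrr mulr0.
have C0 : 0 <= C by apply: le_trans (gC 0).
(* The step lengths are at most 1, so all difference quotients live in the support box enlarged by
   the size rv of v, and the mean value theorem bounds them by C. *)
have qb m t : `|q m t| <= C * \1_(boxT (r + rv)) t.
  rewrite indicE; have [ht|ht] := boolP (t \in boxT (r + rv)).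
    rewrite mulr1 normrM normfV (gtr0_norm (h0 m)) ler_pdivrMl// mulrC.
    have := is_derive_lipschitz (ltW (h0 m)) (fun s => is_derive_line t s dg)
      (fun s => gC _).
    by rewrite scale0r add0r [in g (_ + t)]addrC.
  move: ht; rewrite notin_setE => ht.
  have nb s : `|s| <= 1 -> g (t + s *: v) = 0.
    move=> s1; apply: sg => -[/= b1 b2]; apply: ht; split => [i|/=].
      have := b1 i; rewrite !mxE => b3.
      have -> : t.1 0 i = (t.1 0 i + s * v.1 0 i) - s * v.1 0 i by ring.
      rewrite (le_trans (ler_normB _ _))// lerD// normrM.
      by rewrite (le_trans (ler_wpM2r _ s1))// mul1r; exact: hv.1.
    move: b2; rewrite !in_itv/= -!ler_norml => b2.
    have -> : t.2 = (t.2 + s * v.2) - s * v.2 by ring.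
    rewrite (le_trans (ler_normB _ _))// lerD// normrM.
    rewrite (le_trans (ler_wpM2r _ s1))// mul1r.
    by have := hv.2; rewrite /= in_itv/= -ler_norml.
  have e1 := nb 0; rewrite normr0 scale0r addr0 in e1.
  by rewrite /q e1 ?ler01// nb ?subr0 ?mulr0 ?normr0// ger0_norm ?h1// ltW.
have cq t : (fun m => q m t) @ \oo --> g' t.
  have [dgt <-] := dg t.
  have /= L : h^-1 *: (g (h *: v + t) - g t) @[h --> (0:R)^'] --> 'D_v (g : V -> R) t.
    exact: dgt.
  have /cvgr_dnbhsP/(_ h) := L.
  have hh : (forall m, h m != 0) /\ h m @[m --> \oo] --> (0 : R).
    by split => [m|]; [rewrite gt_eqF|exact: cvg_harmonic].
  move=> /(_ hh).
  suff -> : (fun m => q m t) = (fun m => (h m)^-1 *: (g (h m *: v + t) - g t)) by [].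
  by apply/funext => m; rewrite /q [h m *: v + t]addrC.
have [] := Rint_dct (fun m => intg_measurable (iq m))
  (intgZ C (@intg_ind_boxT R n (r + rv))) qb cq.
move=> ig' L; split => //.
have E : (fun m => \int[nu]_t q m t) = fun=> 0 by apply/funext.
by move: L; rewrite E => /(cvg_lim (@Rhausdorff R)) <-; rewrite lim_cst.
Qed.

End convolution.

Section convolution_integrals.
Variables (R : realType) (n : nat).
Local Notation T := ('rV[R]_n * measurableTypeR R)%type.
Local Notation V := ('rV[R]_n * R)%type.
Local Notation nu := (lebVt R n).

Definition subT (z : T * T) : T := z.1 - z.2.

Lemma measurable_subT : measurable_fun setT subT.
Proof.
rewrite (_ : subT = fun z : T * T => (z.1.1 - z.2.1, z.1.2 - z.2.2) : T); last first.
  by apply/funext => -[[a b] [c d]].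
have m1 : measurable_fun setT (fst : T * T -> T) by exact: measurable_fst.
have m2 : measurable_fun setT (snd : T * T -> T) by exact: measurable_snd.
apply: measurable_fun_pair.
  apply: measurable_fun_rVP => i.
  rewrite (_ : (fun z => _) = fun z : T * T => z.1.1 0 i - z.2.1 0 i); last first.
    by apply/funext => z; rewrite !mxE.
  apply: measurable_funB.
    apply: (measurableT_comp (@measurable_coord R n i)).
    exact: (measurableT_comp measurable_fst m1).
  apply: (measurableT_comp (@measurable_coord R n i)).
  exact: (measurableT_comp measurable_fst m2).
apply: measurable_funB.
  exact: (measurableT_comp measurable_snd m1).
exact: (measurableT_comp measurable_snd m2).
Qed.

Lemma measurable_kernel (k : V -> R) : smooth k ->
  measurable_fun setT (fun z : T * T => k (z.1 - z.2)).
Proof.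
move=> sk; have := measurableT_comp (smooth_measurable sk) measurable_subT.
by [].
Qed.

Lemma measurable_conv d (Y : measurableType d) (k : V -> R) (F : T * Y -> R) :
  smooth k -> measurable_fun setT F ->
  measurable_fun setT (fun z : T * Y => conv k (fun s => F (s, z.2)) z.1).
Proof.
move=> sk mF.
have m1 : measurable_fun setT (fst : (T * Y) * T -> T * Y) by exact: measurable_fst.
have m2 : measurable_fun setT (snd : (T * Y) * T -> T) by exact: measurable_snd.
have m11 : measurable_fun setT (fst \o fst : (T * Y) * T -> T).
  exact: (measurableT_comp measurable_fst m1).
have m12 : measurable_fun setT (snd \o fst : (T * Y) * T -> Y).
  exact: (measurableT_comp measurable_snd m1).
apply: (measurable_Rint_param nu
  (f := fun w : (T * Y) * T => k (w.1.1 - w.2) * F (w.2, w.1.2))).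
apply: measurable_funM.
  exact: (measurableT_comp (measurable_kernel sk) (measurable_fun_pair m11 m2)).
exact: (measurableT_comp mF (measurable_fun_pair m2 m12)).
Qed.

(** For fixed s, the sum of both integrands is the derivative in t along v of a(t) k(t - s) F(s),
    whose integral over t vanishes. F is never differentiated and is only integrable. *)
Lemma conv_ibp (k : V -> R) e (a a' F : T -> R) (v : V) r Ca :
  smooth k -> supp_box e k ->
  (forall t : V, is_derive t v (a : V -> R) (a' t)) ->
  (forall t, `|a t| <= Ca) -> (forall t, `|a' t| <= Ca) ->
  supp_box r a -> supp_box r a' ->
  measurable_fun setT a -> measurable_fun setT a' ->
  nu.-integrable setT (EFin \o F) ->
  \int[nu]_t (a t * conv ('D_v k) F t) = - \int[nu]_t (a' t * conv k F t).
Proof.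
move=> sk sup da aC a'C sa sa' ma ma' iF.
have sk' := smooth_derive v sk; have sup' := supp_box_derive sup v.
have [C C0 hC] := kernel_bounded sk sup.
have [C' C'0 hC'] := kernel_bounded sk' sup'.
have m1 : measurable_fun setT (fst : T * T -> T) by exact: measurable_fst.
have m2 : measurable_fun setT (snd : T * T -> T) by exact: measurable_snd.
have mF := intg_measurable iF.
have Ca0 : 0 <= Ca by apply: le_trans (aC 0).
pose h (t : T) := Ca * \1_(boxT r) t : R.
have ih : nu.-integrable setT (EFin \o (h : T -> R)) by apply: intgZ; exact: intg_ind_boxT.
have bnd (b : T -> R) (b0 : supp_box r b) (bC : forall t, `|b t| <= Ca) t : `|b t| <= h t.
  rewrite /h indicE; have [ht|ht] := boolP (t \in boxT r); first by rewrite mulr1.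
  by rewrite b0 ?normr0 ?mulr0//; move: ht; rewrite notin_setE.
have iB (D : R) : nu.-integrable setT (EFin \o (fun s => D * `|F s|)).
  by apply: intgZ; exact: intg_norm.
pose f (z : T * T) := a z.1 * ('D_v k (z.1 - z.2) * F z.2).
pose f' (z : T * T) := a' z.1 * (k (z.1 - z.2) * F z.2).
have mf : measurable_fun setT f.
  apply: measurable_funM; first exact: (measurableT_comp ma m1).
  by apply: measurable_funM; [exact: (measurable_kernel sk')|exact: (measurableT_comp mF m2)].
have mf' : measurable_fun setT f'.
  apply: measurable_funM; first exact: (measurableT_comp ma' m1).
  by apply: measurable_funM; [exact: (measurable_kernel sk)|exact: (measurableT_comp mF m2)].
have fb t s : `|f (t, s)| <= h t * (C' * `|F s|).
  by rewrite /f normrM ler_pM ?bnd// normrM ler_wpM2r.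
have fb' t s : `|f' (t, s)| <= h t * (C * `|F s|).
  by rewrite /f' normrM ler_pM ?bnd// normrM ler_wpM2r.
transitivity (\int[nu]_t \int[nu]_s f (t, s)).
  apply: eq_Rint => t; rewrite /f -RintZ//; exact: (conv_intg sk' sup').
transitivity (- \int[nu]_t \int[nu]_s f' (t, s)); last first.
  by congr (- _); apply: eq_Rint => t; rewrite /f' /= RintZ//; exact: (conv_intg sk sup).
rewrite (dom_fubini mf ih (iB _) fb) (dom_fubini mf' ih (iB _) fb').
rewrite -RintN; last exact: (dom_intg2 mf' ih (iB _) fb').
apply: eq_Rint => s.
have i1 := dom_section2 mf ih fb s.
have i2 := dom_section2 mf' ih fb' s.
apply/eqP; rewrite -addr_eq0 -RintD//; apply/eqP.
pose g t := a t * (k (t - s) * F s).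
have dg (t : V) : is_derive t v (g : V -> R) (f (t, s) + f' (t, s)).
  have d1 := kernel_shift_derive sk v t s.
  have d2 : is_derive t v (cst (F s) : V -> R) 0 by exact: is_derive_cst.
  have d3 := is_deriveM (da t) (is_deriveM d1 d2).
  have -> : f (t, s) + f' (t, s) =
    a t *: (k (t - s) *: 0 + F s *: 'D_v k (t - s)) + (k (t - s) * F s) *: a' t.
    by rewrite /f /f' /GRing.scale/=; ring.
  exact: d3.
suff [] : nu.-integrable setT (EFin \o (fun t => f (t, s) + f' (t, s))) /\
  \int[nu]_t (f (t, s) + f' (t, s)) = 0 by [].
apply: (@int_derive_eq0 R n g (fun t => f (t, s) + f' (t, s)) v r
  (Ca * (C' * `|F s|) + Ca * (C * `|F s|)) dg).
- move=> t; rewrite (le_trans (ler_normD _ _))// lerD//.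
    by rewrite /f normrM ler_pM// normrM ler_wpM2r.
  by rewrite /f' normrM ler_pM// normrM ler_wpM2r.
- apply: (@intg_bounded_box _ _ _ r (Ca * (C * `|F s|))).
  + apply: measurable_funM => //; apply: measurable_funM => //.
    have := measurable_fun_pair1 s (measurable_kernel sk).
    by [].
  + by move=> t ht; rewrite /g sa ?mul0r.
  + by move=> t; rewrite /g normrM ler_pM// normrM ler_wpM2r.
- by move=> t ht; rewrite /g sa ?mul0r.
Qed.

Section positive_kernel.
Variables (k : V -> R) (e : R).
Hypotheses (sk : smooth k) (sup : supp_box e k) (k0 : forall t, 0 <= k t)
  (ke : forall t, k (- t) = k t) (k1 : \int[nu]_t k t = 1).

Let ik : nu.-integrable setT (EFin \o (k : T -> R)).
Proof. exact: intg_continuous_box (smooth_continuous sk) sup. Qed.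

Lemma intg_kernel_shift (s : T) : nu.-integrable setT (EFin \o (fun t : T => k (t - s))).
Proof. exact: (intg_shift (- s : T) ik). Qed.

Lemma int_kernel_shift (s : T) : \int[nu]_t k (t - s) = 1.
Proof. by rewrite -k1; exact: (Rint_shift (- s : T) ik). Qed.

Lemma kernel_sym (s t : T) : k (t - s) = k (s - t).
Proof. by rewrite -(ke (t - s)) opprB. Qed.

Lemma int_kernel_shift2 (t : T) : \int[nu]_s k (t - s) = 1.
Proof. by rewrite -(int_kernel_shift t); apply: eq_Rint => s; rewrite kernel_sym. Qed.

Lemma intg_kernel_shift2 (t : T) : nu.-integrable setT (EFin \o (fun s : T => k (t - s))).
Proof. by apply: eq_intg (intg_kernel_shift t) => s; rewrite kernel_sym. Qed.

(** Expand the integral of k(t - s) (f(s) - m)^2 >= 0 with m the convolution at t, using that k(t -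
    s) has mass one in s. *)
Lemma conv_jensen (f : T -> R) (t : T) : nu.-integrable setT (EFin \o f) ->
  nu.-integrable setT (EFin \o (fun s => f s ^+ 2)) ->
  conv k f t ^+ 2 <= conv k (fun s => f s ^+ 2) t.
Proof.
move=> if1 if2; set m := conv k f t.
have i1 := conv_intg sk sup t if1.
have i2 := conv_intg sk sup t if2.
have i3 := intg_kernel_shift2 t.
rewrite -subr_ge0.
suff -> : conv k (fun s => f s ^+ 2) t - m ^+ 2 =
    \int[nu]_s (k (t - s) * f s ^+ 2 + ((- (2 * m)) * (k (t - s) * f s) + m ^+ 2 * k (t - s))).
  apply: Rint_ge0 => s.
  have -> : k (t - s) * f s ^+ 2 + (- (2 * m) * (k (t - s) * f s) + m ^+ 2 * k (t - s))
    = k (t - s) * (f s - m) ^+ 2 by ring.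
  by rewrite mulr_ge0// sqr_ge0.
rewrite (RintD i2 (intgD (intgZ _ i1) (intgZ _ i3))).
rewrite (RintD (intgZ _ i1) (intgZ _ i3)) !RintZ// int_kernel_shift2.
rewrite -/(conv k f t) -/m -/(conv k _ t); ring.
Qed.

(** Fubini, k having mass one. The support of f confines the convolution to a box enlarged by e,
    which supplies the product bound. *)
Lemma int_conv (f : T -> R) r : nu.-integrable setT (EFin \o f) -> supp_box r f ->
  nu.-integrable setT (EFin \o conv k f) /\ \int[nu]_t conv k f t = \int[nu]_t f t.
Proof.
move=> if1 sf.
have mf := intg_measurable if1.
have [C C0 hC] := kernel_bounded sk sup.
have m2 : measurable_fun setT (snd : T * T -> T) by exact: measurable_snd.
pose h (t : T) := C * \1_(boxT (r + e)) t : R.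
have ih : nu.-integrable setT (EFin \o (h : T -> R)) by apply: intgZ; exact: intg_ind_boxT.
pose F (z : T * T) := k (z.1 - z.2) * f z.2.
have mF : measurable_fun setT F.
  by apply: measurable_funM; [exact: (measurable_kernel sk)|exact: (measurableT_comp mf m2)].
have Fb t s : `|F (t, s)| <= h t * `|f s|.
  rewrite /F /h indicE/=.
  have [ht|ht] := boolP (t \in boxT (r + e)); first by rewrite mulr1 normrM ler_wpM2r.
  move: ht; rewrite notin_setE => ht.
  rewrite mulr0 mul0r normr_le0.
  have [hs|hs] := pselect (boxT r s); last by rewrite (sf s hs) mulr0.
  rewrite sup ?mul0r// => hts; apply: ht.
  have -> : t = s + (t - s) by rewrite addrC subrK.
  case: hs => h1 h2; case: hts => h3 h4; split => [i|/=].
    by rewrite mxE (le_trans (ler_normD _ _))// lerD.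
  move: h2 h4; rewrite /= !in_itv/= -!ler_norml => h2 h4.
  by rewrite (le_trans (ler_normD _ _))// lerD.
have inf := intg_norm if1.
split; first exact: (dom_intg1 mF ih inf Fb).
transitivity (\int[nu]_t \int[nu]_s F (t, s)); first by [].
rewrite (dom_fubini mF ih inf Fb); apply: eq_Rint => s.
transitivity (\int[nu]_t (f s * k (t - s))).
  by apply: eq_Rint => t; rewrite /F mulrC.
by rewrite RintZ ?int_kernel_shift ?mulr1//; exact: intg_kernel_shift.
Qed.

End positive_kernel.

End convolution_integrals.

(** * Slices of the weak equation *)

Section vertical_slicing.
Variables (R : realType) (n : nat).
Local Notation leb := (@lebesgue_measure R).
Local Notation Y := (measurableTypeR R).
Local Notation T := ('rV[R]_n * measurableTypeR R)%type.
Local Notation Z := ('rV[R]_n.+1 * measurableTypeR R)%type.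
Local Notation nu := (lebVt R n).

(* Brings the vertical coordinate last: mollification acts on (x, t) only. *)
Definition Phi (w : T * Y) : Z := (rV_snoc (w.1.1, w.2), w.1.2).

Lemma measurable_Phi : measurable_fun setT Phi.
Proof.
have m1 : measurable_fun setT (fst : T * Y -> T) by exact: measurable_fst.
have m2 : measurable_fun setT (snd : T * Y -> Y) by exact: measurable_snd.
have m3 : measurable_fun setT (fun w : T * Y => (w.1.1, w.2) : 'rV[R]_n * Y).
  apply: measurable_fun_pair => //.
  exact: (measurableT_comp measurable_fst m1).
have m4 := measurableT_comp (@measurable_rV_snoc R n) m3.
have m5 : measurable_fun setT (snd \o fst : T * Y -> Y).
  exact: (measurableT_comp measurable_snd m1).
exact: measurable_fun_pair m4 m5.
Qed.

(** Both sides are iterated integrals over x, y and t; Tonelli moves the height past the time. *)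
Lemma ge0_int_Phi (f : Z -> \bar R) : measurable_fun setT f -> (forall z, 0 <= f z)%E ->
  (\int[lebVt R n.+1]_z f z = \int[(nu \x leb)%E]_w f (Phi w))%E.
Proof.
move=> mf f0.
have mfP : measurable_fun setT (f \o Phi) by exact: (measurableT_comp mf measurable_Phi).
pose g (xt : T) := (\int[leb]_y f (Phi (xt, y)))%E.
have mg : measurable_fun setT g.
  by apply: (measurable_fun_fubini_tonelli_F (m2 := leb) (f \o Phi)) => // w; exact: f0.
have g0 xt : (0 <= g xt)%E by apply: integral_ge0 => y _; exact: f0.
transitivity (\int[leb]_t \int[lebV R n.+1]_X f (X, t))%E.
  exact: (fubini_tonelli2 (m1 := lebV R n.+1) (m2 := leb)).
transitivity (\int[leb]_t \int[lebV R n]_x g (x, t))%E; last first.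
  transitivity (\int[(lebV R n \x leb)%E]_xt g xt)%E.
    by apply/esym; exact: (fubini_tonelli2 (m1 := lebV R n) (m2 := leb)).
  apply/esym; apply: (fubini_tonelli1 (m1 := nu) (m2 := leb) (f \o Phi)) => // w.
  exact: f0.
apply: eq_integral => t _.
have mft : measurable_fun setT (fun X : 'rV[R]_n.+1 => f (X, t)).
  exact: measurable_fun_pair1 mf.
transitivity (\int[(lebV R n \x leb)%E]_xy f (rV_snoc xy, t))%E.
  have := ge0_integral_pushforward (@measurable_rV_snoc R n) (lebV R n \x leb)%E
    measurableT mft (fun X _ => f0 (X, t)).
  by rewrite preimage_setT.
apply: (fubini_tonelli1 (m1 := lebV R n) (m2 := leb)
  (fun xy : 'rV[R]_n * Y => f (rV_snoc xy, t))) => //.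
exact: (measurableT_comp mft (@measurable_rV_snoc R n)).
Qed.

Lemma int_Phi (f : Z -> \bar R) : measurable_fun setT f ->
  (\int[lebVt R n.+1]_z f z = \int[(nu \x leb)%E]_w f (Phi w))%E.
Proof.
move=> mf; rewrite integralE [in RHS]integralE.
have := @ge0_int_Phi (f^\+)%E; have := @ge0_int_Phi (f^\-)%E.
move=> -> //; last exact: measurable_funeneg.
move=> -> //; last exact: measurable_funepos.
congr (_ - _)%E.
  by apply: eq_integral => w _; rewrite !funeposE.
by apply: eq_integral => w _; rewrite !funenegE.
Qed.

Lemma Rint_Phi (f : Z -> R) : measurable_fun setT f ->
  \int[lebVt R n.+1]_z f z = \int[(nu \x leb)%E]_w f (Phi w).
Proof. by move=> mf; congr fine; apply: int_Phi; exact/measurable_EFinP. Qed.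

Lemma intg_Phi (f : Z -> R) : measurable_fun setT f ->
  (lebVt R n.+1).-integrable setT (EFin \o f) ->
  (nu \x leb)%E.-integrable setT (EFin \o (f \o Phi)).
Proof.
move=> mf /integrableP[mF foo]; apply/integrableP; split.
  by apply/measurable_EFinP; exact: (measurableT_comp mf measurable_Phi).
move: foo; rewrite (int_Phi (f := fun z => `|(f z)%:E|%E))//.
exact/measurableT_comp.
Qed.

End vertical_slicing.

(** * Product test functions *)

Section test_functions.
Variables (R : realType).

Lemma test_of_box m (D : set ('rV[R]_m * R)) (f : 'rV[R]_m * R -> R)
    (l u : 'I_m -> R) (l' u' : R) :
  smooth f ->
  (forall z : 'rV[R]_m * R, f z != 0 -> (forall i, l i <= z.1 0 i <= u i) /\ l' <= z.2 <= u') ->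
  (forall z : 'rV[R]_m * R, (forall i, l i <= z.1 0 i <= u i) -> l' <= z.2 <= u' -> D z) ->
  test_function D f.
Proof.
move=> sf fB BD.
pose B : set ('rV[R]_m * R) :=
  [set v : 'rV[R]_m | forall i, `[l i, u i]%classic (v ord0 i)] `*` `[l', u']%classic.
have cB : compact B.
  apply: compact_setX; last exact: segment_compact.
  by apply: (@rV_compact R m (fun i => `[l i, u i]%classic)) => i; exact: segment_compact.
have clB : closed B by apply: compact_closed => //; exact: norm_hausdorff.
have sub : closure [set x | f x != 0] `<=` B.
  rewrite closureE => z; apply; split => // x /= /fB[h1 h2].
split => //.
  by apply: (subclosed_compact _ cB) => //; exact: closed_closure.
move=> z /sub [h1 h2]; apply: BD.
  by move=> i; have := h1 i; rewrite /= in_itv/=.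
by move: h2; rewrite /= in_itv/=.
Qed.

Lemma is_deriveNdir (V : normedModType R) (f : V -> R) (x v : V) (d : R) :
  is_derive x v f d -> is_derive x (- v) f (- d).
Proof.
move=> df; apply: is_derive_slice.
have d1 : is_derive (0 : R) (1 : R) (f \o (fun h : R => h *: v + x)) d.
  apply: (@is_derive_affine R R^o V f (fun h : R => h *: v + x) 0 1 v).
    by move=> h; rewrite scalerDl addrA; congr (_ *: _ + _ + _); rewrite /GRing.scale/= mulr1.
  by rewrite scale0r add0r.
have d2 : is_derive (0 : R) (1 : R) (fun h : R => - h) (- 1) by exact: is_deriveN.
have d3 : is_derive (- (0 : R)) (1 : R) (f \o (fun h : R => h *: v + x)) d by rewrite oppr0.
have := @is_derive1_comp R (f \o (fun h : R => h *: v + x)) (fun h : R => - h) 0 _ _ d3 d2.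
move=> d4; apply: is_derive_ext d4 _ _; last by rewrite mulrN1.
by move=> h; rewrite /= scalerN scaleNr.
Qed.

Variable n : nat.
Local Notation V := ('rV[R]_n * R)%type.
Local Notation W := ('rV[R]_n.+1 * R)%type.

(** Forgets the height, leaving (x, t); together with the height it inverts [Phi]. *)
Definition tang (z : W) : V := (\row_j z.1 0 (lift ord_max j), z.2).

Lemma tang_continuous : continuous tang.
Proof.
move=> z.
have H1 : (fun z : W => \row_j z.1 0 (lift ord_max j)) @ z -->
    (\row_j z.1 0 (lift ord_max j) : 'rV[R]_n).
  apply: cvg_matrix => i j.
  rewrite mxE (_ : (fun x : W => _) = fun x : W => x.1 0 (lift ord_max j)); last first.
    by apply/funext => x; rewrite mxE.
  exact: (@coord_fst_continuous R n.+1).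
have H2 : (fun z : W => z.2) @ z --> z.2 by exact: cvg_snd.
exact: (cvg_pair H1 H2).
Qed.

Lemma tang_linear (h : R) (v z : W) : tang (h *: v + z) = h *: tang v + tang z.
Proof. by congr pair; apply/rowP => j; rewrite !mxE. Qed.

(** Testing an integrand with it yields the mollification at t, integrated against chi in the
    height. Since the kernel is evaluated at t - (x, t), derivatives in x and in time fall on k with
    a minus sign. *)
Definition product_test (k : V -> R) (chi : R -> R) (t : V) (z : W) : R :=
  k (t - tang z) * chi (z.1 0 ord_max).

Definition ex (i : 'I_n) : V := (delta_mx 0 i, 0).
Definition et : V := (0, 1).

Section product_test.
Variables (k : V -> R) (chi chi' : R -> R) (t : V).
Hypotheses (sk : smooth k) (schi : smooth1 chi)
  (dchi : forall y : R, is_derive y (1 : R) chi (chi' y)).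

Lemma tang_shift (h : R) (v z : W) :
  t - tang (h *: v + z) = h *: - tang v + (t - tang z).
Proof. by rewrite tang_linear scalerN opprD addrCA. Qed.

Lemma smooth_product_test : smooth (product_test k chi t).
Proof.
apply: smoothM.
  apply: (@smooth_affine R W V (fun z => t - tang z) (fun z => - tang z) k) => //.
    by move=> z; apply: continuousB; [exact: cst_continuous|exact: tang_continuous].
  by move=> x v h; exact: tang_shift.
have := @smooth_coord R n.+1 chi ord_max schi.
by [].
Qed.

Lemma is_derive_product_test (z v : W) d :
  is_derive (t - tang z) (- tang v) k d ->
  is_derive z v (product_test k chi t)
    (d * chi (z.1 0 ord_max) + k (t - tang z) * (v.1 0 ord_max * chi' (z.1 0 ord_max))).
Proof.
move=> dk.
have d1 : is_derive z v (k \o (fun z => t - tang z)) d.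
  apply: (@is_derive_affine R W V k (fun z => t - tang z) z v (- tang v) d) => //.
  by move=> h; exact: tang_shift.
have d2 : is_derive z v (chi \o (fun z : W => z.1 0 ord_max))
    (v.1 0 ord_max * chi' (z.1 0 ord_max)).
  apply: (@is_derive_affine R W R^o chi (fun z : W => z.1 0 ord_max) z v (v.1 0 ord_max)).
    by move=> h; rewrite !mxE.
  exact: is_derive_dir.
have := is_deriveM d1 d2.
by rewrite /GRing.scale/= addrC [d * _]mulrC.
Qed.

Lemma tang_ex (i : 'I_n) : tang (delta_mx 0 (lift ord_max i), 0) = ex i.
Proof.
congr pair; apply/rowP => j; rewrite !mxE eqxx/=; congr ((_ : bool)%:R).
by apply/eqP/eqP => [/lift_inj|->].
Qed.

Lemma dspace_lift_product_test (i : 'I_n) z :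
  dspace (lift ord_max i) (product_test k chi t) z =
  - ('D_(ex i) k (t - tang z) * chi (z.1 0 ord_max)).
Proof.
have H' : is_derive (t - tang z) (- tang (delta_mx 0 (lift ord_max i), 0)) k
    (- 'D_(ex i) k (t - tang z)).
  by rewrite tang_ex; apply: is_deriveNdir; exact: smooth_is_derive.
rewrite /dspace (@derive_val _ _ _ _ _ _ _ (is_derive_product_test H')).
rewrite mxE eqxx/= (_ : (ord_max == lift ord_max i) = false).
  by rewrite mul0r mulr0 addr0 mulNr.
by apply/negbTE; exact: neq_lift.
Qed.

Lemma dspace_max_product_test z :
  dspace ord_max (product_test k chi t) z = k (t - tang z) * chi' (z.1 0 ord_max).
Proof.
have E : tang (delta_mx 0 ord_max, 0) = 0.
  congr pair; apply/rowP => j; rewrite !mxE eqxx/= eq_sym (_ : (_ == _) = false)//.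
  by apply/negbTE; exact: neq_lift.
have H' : is_derive (t - tang z) (- tang (delta_mx 0 ord_max, 0)) k 0.
  by rewrite E oppr0; exact: is_derive0.
rewrite /dspace (@derive_val _ _ _ _ _ _ _ (is_derive_product_test H')).
by rewrite mxE !eqxx/= mul0r add0r mul1r.
Qed.

Lemma dtime_product_test z :
  dtime (product_test k chi t) z = - ('D_et k (t - tang z) * chi (z.1 0 ord_max)).
Proof.
have E : tang (0, 1) = et by congr pair; apply/rowP => j; rewrite !mxE.
have H' : is_derive (t - tang z) (- tang (0, 1)) k (- 'D_et k (t - tang z)).
  by rewrite E; apply: is_deriveNdir; exact: smooth_is_derive.
rewrite /dtime (@derive_val _ _ _ _ _ _ _ (is_derive_product_test H')).
by rewrite mxE mul0r mulr0 addr0 mulNr.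
Qed.

End product_test.

End test_functions.

Section domains.
Variables (R : realType).

Definition sq n (x : 'rV[R]_n) : R := \sum_i x 0 i ^+ 2.

Lemma enorm_lt n (x : 'rV[R]_n) r : 0 < r -> (enorm x < r) = (sq x < r ^+ 2).
Proof.
move=> r0; rewrite /enorm big_ord1 -/(sq x).
have s0 : 0 <= sq x by apply: sumr_ge0 => i _; exact: sqr_ge0.
by rewrite -[in RHS](sqr_sqrtr s0) ltr_pXn2r// ?nnegrE ?sqrtr_ge0// ltW.
Qed.

Lemma sum_snoc n (F : 'I_n.+1 -> R) :
  \sum_i F i = \sum_(j < n) F (lift ord_max j) + F ord_max.
Proof.
rewrite big_ord_recr/=; congr (_ + _); apply: eq_bigr => j _; congr F.
by apply/val_inj; rewrite /= /fintype.bump leqNgt ltn_ord.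
Qed.

Lemma snoc_lift n (x : 'rV[R]_n) y j : rV_snoc (x, y) 0 (lift ord_max j) = x 0 j.
Proof. by rewrite mxE liftK. Qed.

Lemma snoc_max n (x : 'rV[R]_n) y : rV_snoc (x, y) 0 ord_max = y.
Proof. by rewrite mxE unlift_none. Qed.

Lemma col'_snoc n (x : 'rV[R]_n) y : col' ord_max (rV_snoc (x, y)) = x.
Proof. by apply/rowP => j; rewrite !mxE liftK. Qed.

Lemma sq_snoc n (x : 'rV[R]_n) y : sq (rV_snoc (x, y)) = sq x + y ^+ 2.
Proof.
rewrite /sq sum_snoc snoc_max; congr (_ + _).
by apply: eq_bigr => j _; rewrite snoc_lift.
Qed.

Lemma measurable_sq n : measurable_fun setT (@sq n : 'rV[R]_n -> R).
Proof.
have := @measurable_sum _ _ R setT 'I_n (index_enum _) (fun i (x : 'rV[R]_n) => x 0 i ^+ 2).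
apply => i; apply: (@measurable_funX _ _ _ _ (fun x : 'rV[R]_n => x 0 i)).
exact: measurable_coord.
Qed.

Lemma measurable_eball_plus n r : 0 < r -> measurable (@eball_plus R n r).
Proof.
move=> r0.
rewrite (_ : eball_plus r =
    ((@sq n.+1) @^-1` `]-oo, r ^+ 2[) `&` ((fun X : 'rV[R]_n.+1 => X 0 ord_max) @^-1` `]0, +oo[)).
  apply: measurableI.
    by rewrite -[X in measurable X]setTI; exact: measurable_sq.
  by rewrite -[X in measurable X]setTI; exact: measurable_coord.
by apply/seteqP; split => x /=; rewrite !in_itv/= ?andbT -enorm_lt.
Qed.

End domains.

(** * Space-time integrals as integrals over the height *)

Section slicing.
Variables (R : realType) (n : nat).
Local Notation leb := (@lebesgue_measure R).
Local Notation Y := (measurableTypeR R).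
Local Notation T := ('rV[R]_n * measurableTypeR R)%type.
Local Notation V := ('rV[R]_n * R)%type.
Local Notation Z := ('rV[R]_n.+1 * measurableTypeR R)%type.
Local Notation nu := (lebVt R n).

(** [Qs] is the domain of the equation. [Ds] is a smaller cylinder on whose closure the
    representative of U is continuous (radius 3, times up to 3^2), so U is bounded on it. *)
Definition Qs : set Z := cyl (eball_plus 4) `]0, 16[%classic.
Definition Ds : set Z := cyl (eball_plus 3) `]0, 9[%classic.
(* Exceeds the radius 2 of the cut-off, and |x|^2 < 9 / 2, y < b_ give |X| < 3. *)
Definition b_ : R := 21 / 10.

Lemma measurable_Qs : measurable Qs.
Proof. by apply: measurableX => //; exact: measurable_eball_plus. Qed.

Lemma measurable_Ds : measurable Ds.
Proof. by apply: measurableX => //; exact: measurable_eball_plus. Qed.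

Lemma Ds_Qs : Ds `<=` Qs.
Proof.
move=> z [[h1 h2] h3]; split.
  by split => //; rewrite /eball /= (lt_trans h1)// ltr_nat.
move: h3; rewrite /= !in_itv/= => /andP[h3 h4]; lra.
Qed.

Lemma Ds_Phi (s : T) y :
  Ds (Phi (s, y)) <-> [/\ sq s.1 + y ^+ 2 < 9, 0 < y & 0 < s.2 < 9].
Proof.
have e9 : 3 ^+ 2 = 9 :> R by ring.
rewrite /Ds /cyl /Phi/= /eball_plus /eball; split.
  move=> [[/=]]; rewrite enorm_lt// sq_snoc snoc_max e9 => h1 h2.
  by rewrite in_itv/= => h3; split.
move=> [h1 h2 h3]; split; last by rewrite /= in_itv.
by split => /=; rewrite ?enorm_lt// ?sq_snoc ?snoc_max ?e9.
Qed.

Lemma tang_Phi (s : T) y : tang (Phi (s, y)) = s.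
Proof.
case: s => x t; congr pair; apply/rowP => j.
by rewrite mxE snoc_lift.
Qed.

Lemma Phi_tang (z : Z) : Phi (tang z, z.1 0 ord_max) = z.
Proof.
case: z => X t; congr pair; apply/rowP => i; rewrite mxE /=.
by case: (unliftP ord_max i) => [j|] -> /=; rewrite ?mxE.
Qed.

(** Since 9 / 2 + [b_] ^ 2 = 8.91 < 9, a kernel of size e centred at a good t sees only points of
    [Ds] at the heights between 0 and [b_]. *)
Definition good (e : R) (t : T) :=
  forall s : T, boxT e (t - s) -> sq s.1 < 9 / 2 /\ 0 < s.2 < 9.

(** Every slice is integrable, so the real inner integral is the extended one at each height,
    without exceptional set. *)
Lemma Rfubini2 (f : T * Y -> R) : (nu \x leb)%E.-integrable setT (EFin \o f) ->
  (forall y, nu.-integrable setT (EFin \o (fun s => f (s, y)))) ->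
  leb.-integrable setT (EFin \o (fun y => \int[nu]_s f (s, y))) /\
  \int[(nu \x leb)%E]_w f w = \int[leb]_y \int[nu]_s f (s, y).
Proof.
move=> if1 if2.
have E : EFin \o (fun y => \int[nu]_s f (s, y)) = fubini_G nu (EFin \o f).
  by apply/funext => y; rewrite /= Rint_EFin//; exact: if2.
have m : measurable_fun setT (fubini_G nu (EFin \o f)) by exact: (measurable_fubini_G if1).
have I : leb.-integrable setT (EFin \o (fun y => \int[nu]_s f (s, y))).
  rewrite E; apply/integrableP; split => //.
  have mF : measurable_fun setT (EFin \o f) by case/integrableP : if1.
  have : (\int[leb]_y \int[nu]_s `|(EFin \o f) (s, y)| < +oo)%E.
    by apply/integrable21ltyP.
  apply: le_lt_trans; apply: ge0_le_integral => //=.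
  - exact: measurableT_comp.
  - apply: (measurable_fun_fubini_tonelli_G (m1 := nu) (fun z => `|(f z)%:E|%E)) => //.
    exact: measurableT_comp.
  - move=> y _; apply: le_abse_integral => //.
    by case/integrableP : (if2 y).
split => //; apply: EFin_inj; rewrite (Rint_EFin if1) (Rint_EFin I).
rewrite -(integral21_prod_meas1 if1); apply: eq_integral => y _.
by rewrite Rint_EFin//; exact: if2.
Qed.

Lemma intg_Phi_inv (f : Z -> R) : measurable_fun setT f ->
  (nu \x leb)%E.-integrable setT (EFin \o (f \o @Phi R n)) ->
  (lebVt R n.+1).-integrable setT (EFin \o f).
Proof.
move=> mf /integrableP[mF foo]; apply/integrableP; split; first exact/measurable_EFinP.
rewrite (int_Phi (f := fun z => `|(f z)%:E|%E))//.
exact/measurableT_comp/measurable_EFinP.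
Qed.

Lemma null_vertical (N : set Y) : measurable N -> leb N = 0%E ->
  (nu \x leb)%E ((setT : set T) `*` N) = 0%E.
Proof.
move=> mN N0; rewrite product_measure1E// [X in (_ * X)%E](_ : _ = 0%E); last exact: N0.
by rewrite mule0.
Qed.

(** ft is the cut integrand in slice coordinates, altered at a null set N of heights so that all its
    slices are integrable. A set of whole slices is null for the product measure, so the alteration
    changes no integral. *)
Lemma slice_int (f : Z -> R) (ft : T * Y -> R) (N : set Y) (k : V -> R) (th : R -> R)
    (e : R) (t : T) Ck Cth :
  measurable_fun Qs f -> (nu \x leb)%E.-integrable setT (EFin \o ft) ->
  (forall y, nu.-integrable setT (EFin \o (fun s => ft (s, y)))) ->
  measurable N -> leb N = 0%E ->
  (forall w, ~ N w.2 -> ft w = (f \_ Ds) (Phi w)) ->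
  continuous k -> supp_box e k -> (forall s : V, `|k s| <= Ck) ->
  continuous th -> (forall y, b_ <= y -> th y = 0) -> (forall y, `|th y| <= Cth) ->
  good e t ->
  (lebVt R n.+1).-integrable Qs (EFin \o (fun z => f z * (k (t - tang z) * th (z.1 0 ord_max)))) /\
  \int[lebVt R n.+1]_(z in Qs) (f z * (k (t - tang z) * th (z.1 0 ord_max))) =
  \int[leb]_y (th y * conv k (fun s => ft (s, y)) t).
Proof.
move=> mf ift sft mN N0 ftE ck supk kC cth thb thC gt.
pose c z := k (t - tang z) * th (z.1 0 ord_max).
have mtang : measurable_fun setT (fun z : Z => k (t - tang z)).
  apply: continuous_measurable_T => z; apply: continuous_comp; last exact: ck.
  by apply: continuousB; [exact: cst_continuous|exact: tang_continuous].
have mth : measurable_fun setT (fun z : Z => th (z.1 0 ord_max)).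
  apply: continuous_measurable_T => z.
  apply: (@continuous_comp _ _ _ (fun z : 'rV[R]_n.+1 * R => z.1 0 ord_max) th).
    exact: coord_fst_continuous.
  exact: cth.
have mc : measurable_fun setT (c : Z -> R) by exact: measurable_funM.
have mfD : measurable_fun setT (f \_ Ds).
  apply/(measurable_restrictT _ measurable_Ds).
  by apply: measurable_funS mf; [exact: measurable_Qs|exact: Ds_Qs].
(* The kernel confines (x, t) and th the height, so the domain [Qs] may be replaced by [Ds]. *)
have E1 z : ((fun z => f z * c z) \_ Qs) z = (f \_ Ds) z * c z.
  rewrite !patchE.
  have [zD|zD] := boolP (z \in Ds).
    by rewrite mem_set//; apply: Ds_Qs; exact: set_mem.
  rewrite mul0r; case: ifPn => // /set_mem [[z1 z2] z3].
  suff -> : c z = 0 by rewrite mulr0.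
  rewrite /c; have [h|h] := leP b_ (z.1 0 ord_max); first by rewrite thb// mulr0.
  rewrite supk ?mul0r// => hb; move: zD; rewrite notin_setE; apply.
  have [g1 g2] := gt (tang z) hb.
  rewrite -(Phi_tang z); apply/Ds_Phi; split => //.
  have : (z.1 0 ord_max) ^+ 2 < b_ ^+ 2.
    by rewrite ltr_pXn2r// ?nnegrE ?(ltW z2)// /b_ divr_ge0.
  have -> : b_ ^+ 2 = 441 / 100 by rewrite /b_; field.
  by lra.
have mF : measurable_fun setT (fun z : Z => (f \_ Ds) z * c z) by exact: measurable_funM.
have mk1 : measurable_fun setT (fun w : T * Y => k (t - w.1)).
  have h : measurable_fun setT (fun s : T => k (t - s)).
    apply: continuous_measurable_T => s; apply: continuous_comp; last exact: ck.
    by apply: continuousB; [exact: cst_continuous|].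
  exact: (measurableT_comp h measurable_fst).
have mth1 : measurable_fun setT (fun w : T * Y => th w.2).
  exact: (measurableT_comp (continuous_measurable_R cth) measurable_snd).
pose fw (w : T * Y) := ft w * (k (t - w.1) * th w.2).
have Ck0 : 0 <= Ck by apply: le_trans (kC 0).
have ifw : (nu \x leb)%E.-integrable setT (EFin \o fw).
  apply: (@intg_le _ _ _ _ _ (fun w => (Ck * Cth) * `|ft w|)).
  - apply: measurable_funM; first exact: intg_measurable ift.
    exact: measurable_funM.
  - by apply: intgZ; exact: intg_norm.
  - by move=> w; rewrite /fw normrM mulrC ler_wpM2r// normrM ler_pM.
have FE (w : T * Y) : (f \_ Ds) (Phi w) * c (Phi w) =
    (f \_ Ds) (Phi w) * (k (t - w.1) * th w.2).
  by case: w => s y; rewrite /c tang_Phi snoc_max.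
have aeE : {ae (nu \x leb)%E, forall w, (f \_ Ds) (Phi w) * c (Phi w) = fw w}.
  exists ((setT : set T) `*` N); split.
  - exact: measurableX.
  - exact: null_vertical.
  - move=> w /= h; split => //=; apply: contrapT => nN; apply: h.
    by rewrite FE /fw ftE.
have mFP := measurableT_comp mF (@measurable_Phi R n).
have iFP : (nu \x leb)%E.-integrable setT (EFin \o ((fun z => (f \_ Ds) z * c z) \o @Phi R n)).
  apply/integrableP; split; first exact/measurable_EFinP.
  have /integrableP[mfw foo] := ifw; apply: le_lt_trans foo.
  rewrite le_eqVlt; apply/orP; left; apply/eqP; apply: ae_eq_integral => //.
  - by apply: measurableT_comp => //; exact/measurable_EFinP.
  - exact: measurableT_comp.
  case: aeE => M [mM M0 sM]; exists M; split => // w h; apply: sM => /= e1; apply: h => _.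
  by rewrite /= e1.
have iFZ := intg_Phi_inv mF iFP.
split.
  apply/(integrable_mkcond _ measurable_Qs); rewrite restrict_EFin.
  by apply: eq_intg iFZ => z; rewrite E1.
rewrite Rintegral_mkcond; transitivity (\int[lebVt R n.+1]_z ((f \_ Ds) z * c z)).
  by apply: eq_Rint => z; rewrite -E1.
rewrite (Rint_Phi mF).
transitivity (\int[(nu \x leb)%E]_w fw w).
  by apply: Rint_ae aeE => //; exact: intg_measurable ifw.
have sfw y : nu.-integrable setT (EFin \o (fun s => fw (s, y))).
  apply: (@intg_le _ _ _ _ _ (fun s => (Ck * Cth) * `|ft (s, y)|)).
  - exact: (measurable_fun_pair1 y (intg_measurable ifw)).
  - by apply: intgZ; exact: intg_norm (sft y).
  - by move=> s; rewrite /fw normrM mulrC ler_wpM2r// normrM ler_pM.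
have [_ ->] := Rfubini2 ifw sfw; apply: eq_Rint => y.
rewrite /conv -RintZ; first by apply: eq_Rint => s; rewrite /fw /=; ring.
apply: (@intg_le _ _ _ _ _ (fun s => Ck * `|ft (s, y)|)).
- apply: measurable_funM; last exact: intg_measurable (sft y).
  exact: (measurable_fun_pair1 y mk1).
- by apply: intgZ; exact: intg_norm (sft y).
- by move=> s; rewrite normrM ler_wpM2r.
Qed.

End slicing.

(** * The weights y^a and y^(-a) *)

Section power_weight.
Variable R : realType.
Local Notation leb := (@lebesgue_measure R).
Local Notation Y := (measurableTypeR R).

(** Cut at 0 and at 3, a bound of the heights in [Ds], so that the weight is integrable on the
    line. *)
Definition powc (r y : R) : R := if 0 < y then (if y < 3 then y `^ r else 0) else 0.

Lemma measurable_powc r : measurable_fun setT (powc r : Y -> R).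
Proof.
apply: measurable_if_lt; [exact: measurable_cst|exact: measurable_idY| |exact: measurable_cst].
apply: measurable_if_lt; [exact: measurable_idY|exact: measurable_cst| |exact: measurable_cst].
exact: measurable_powR.
Qed.

Lemma powc_ge0 r y : 0 <= powc r y.
Proof. by rewrite /powc; do 2 case: ifP => // _; exact: powR_ge0. Qed.

Lemma powc_in r y : 0 < y < 3 -> powc r y = y `^ r.
Proof. by move=> /andP[h1 h2]; rewrite /powc h1 h2. Qed.

Lemma int_powR_away (r x0 : R) : -1 < r -> 0 < x0 < 3 ->
  (\int[leb]_(y in `[x0, 3%R]) (y `^ r)%:E <= (3 `^ (r + 1) / (r + 1))%R%:E)%E.
Proof.
move=> r1 /andP[x0_gt0 x03].
have rp : 0 < r + 1 by lra.
pose F (y : R) := y `^ (r + 1) / (r + 1).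
have dF (x : R) : 0 < x -> is_derive x (1 : R) F (x `^ r).
  move=> xg.
  have d1 := is_derive1_powR (r + 1) xg.
  have d2 : is_derive x (1 : R) (cst (r + 1)^-1 : R -> R) 0 by exact: is_derive_cst.
  apply: is_derive_ext (is_deriveM d1 d2) _ _ => //.
  rewrite /GRing.scale/= mulr0 add0r addrK mulrA mulVf ?mul1r// gt_eqF//.
have cp (r' x : R) : 0 < x -> {for x, continuous (fun y : R => y `^ r')}.
  move=> xg; apply: differentiable_continuous; apply/derivable1_diffP.
  by have := is_derive1_powR r' xg => -[].
have cF (x : R) : 0 < x -> {for x, continuous F}.
  move=> xg; apply: differentiable_continuous; apply/derivable1_diffP.
  by have [] := dF _ xg.
rewrite (@continuous_FTC2 _ _ F) //.
- rewrite -EFinB lee_fin /F lerBlDr lerDl divr_ge0 ?powR_ge0//; lra.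
- apply: continuous_in_subspaceT => x; rewrite inE/= in_itv/= => /andP[h1 _].
  by apply: cp; exact: lt_le_trans h1.
- split.
  + by move=> x; rewrite in_itv/= => /andP[h1 _]; have [] := dF x (lt_trans x0_gt0 h1).
  + by apply: cvg_at_right_filter; exact: cF.
  + by apply: cvg_at_left_filter; apply: cF; rewrite ltr0n.
- move=> x; rewrite in_itv/= => /andP[h1 _].
  by rewrite derive1E; have [_ ->] := dF x (lt_trans x0_gt0 h1).
Qed.

(** The antiderivative y^(r+1) / (r+1) bounds the integrals over [1 / (k + 1), 3] uniformly in k;
    monotone convergence removes the gap at 0. *)
Lemma intg_powc r : -1 < r -> leb.-integrable setT (EFin \o (powc r : Y -> R)).
Proof.
move=> r1; apply/integrableP; split.
  by apply/measurable_EFinP; exact: measurable_powc.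
under eq_integral do rewrite gee0_abs ?lee_fin ?powc_ge0//.
pose Fk k : set Y := `[k.+1%:R^-1, 3]%classic.
have mp D : measurable_fun D (fun y : Y => (powc r y)%:E).
  by apply/measurable_funTS/measurable_EFinP; exact: measurable_powc.
have nd : nondecreasing_seq Fk.
  apply/nondecreasing_seqP => k; rewrite subsetEset => y; rewrite /Fk/= !in_itv/=.
  move=> /andP[h1 ->]; rewrite andbT (le_trans _ h1)//.
  by rewrite lef_pV2 ?posrE// ler_nat.
have L := @ge0_nondecreasing_set_cvg_integral _ Y R Fk (fun y => (powc r y)%:E) leb
  nd (fun=> measurable_itv _) (fun k => mp (Fk k)) (fun k y _ => powc_ge0 r y).
have U : \bigcup_k Fk k `<=` setT by [].
have EU : (\int[leb]_y (powc r y)%:E = \int[leb]_(y in \bigcup_k Fk k) (powc r y)%:E)%E.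
  rewrite [RHS]integral_mkcond; apply: eq_integral => y _; rewrite patchE.
  case: ifPn => // yF; rewrite /powc; case: ltP => // y0; case: ltP => // y3.
  move: yF => /negP; case; apply/mem_set.
  exists (Num.truncn y^-1) => //; rewrite /Fk/= in_itv/= (ltW y3) andbT.
  by rewrite -[leRHS]invrK lef_pV2 ?posrE ?invr_gt0// ltW// truncnS_gt.
rewrite EU; apply: (@le_lt_trans _ _ (3 `^ (r + 1) / (r + 1))%:E); last by rewrite ltry.
rewrite -(cvg_lim _ L)//; apply: lime_le; first by apply/cvg_ex; eexists; exact: L.
apply: nearW => k.
apply: le_trans (int_powR_away (x0 := k.+1%:R^-1) r1 _); last first.
  rewrite invr_gt0 ltr0Sn/= (@le_lt_trans _ _ 1)//; last by rewrite ltr1n.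
  by rewrite invf_le1// ler1n.
rewrite le_eqVlt; apply/orP; left; apply/eqP.
apply: (@ae_eq_integral _ _ _ leb).
- exact: measurable_itv.
- exact: mp.
- by apply/measurable_funTS/measurable_EFinP; exact: measurable_powR.
exists [set (3 : R)]; split => //; first exact: lebesgue_measure_set1.
move=> y /= h; apply: contrapT => y3; apply: h; rewrite /Fk/= in_itv/= => /andP[h1 h2].
rewrite powc_in//; apply/andP; split; first by apply: lt_le_trans h1; rewrite invr_gt0.
by rewrite lt_neqAle h2 andbT; apply/eqP.
Qed.

Lemma powc_mulN r y : 0 < y < 3 -> powc r y * powc (- r) y = 1.
Proof.
move=> h; rewrite !powc_in// powRN divff// gt_eqF// powR_gt0//.
by case/andP: h.
Qed.

Lemma powc_out r y : ~~ (0 < y < 3) -> powc r y = 0.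
Proof. by rewrite /powc; case: ifP => //; case: ifP. Qed.

End power_weight.

(** * The cut solution and its gradient on slices of constant height *)

Section weak_data.
Variables (R : realType) (n : nat) (a : R).
Local Notation leb := (@lebesgue_measure R).
Local Notation Y := (measurableTypeR R).
Local Notation T := ('rV[R]_n * measurableTypeR R)%type.
Local Notation V := ('rV[R]_n * R)%type.
Local Notation Z := ('rV[R]_n.+1 * measurableTypeR R)%type.
Local Notation nu := (lebVt R n).
Local Notation Phi := (@Phi R n).
Local Notation Qs := (@Qs R n).
Local Notation Ds := (@Ds R n).

Variables (U : Z -> R) (G : Z -> 'rV[R]_n.+1) (M : R).
Hypotheses (ha : -1 < a < 1) (mU : measurable_fun Qs U)
  (mG : forall i, measurable_fun Qs (fun z => G z 0 i))
  (IG : forall i, (\int[lebVt R n.+1]_(z in Qs) (weight a z.1 * (G z 0 i) ^+ 2)%:E < +oo)%E)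
  (UM : forall z, Ds z -> `|U z| <= M).

Definition Wt : Y -> R := powc a.
(** The inverse of the weight; its integrability, from a < 1, turns weighted square integrability of
    the gradient into plain integrability. *)
Definition Wi : Y -> R := powc (- a).
Definition cutU (w : T * Y) : R := (U \_ Ds) (Phi w).
Definition cutG (i : 'I_n.+1) (w : T * Y) : R := ((fun z => G z 0 i) \_ Ds) (Phi w).
Definition E2 (y : Y) : \bar R := (\int[nu]_s (\sum_i cutG i (s, y) ^+ 2)%:E)%E.
(* The heights at which the slice of G is not square integrable, a null set; [g]
   is set to 0 there. *)
Definition Nul : set Y := [set y | E2 y = +oo%E].
Definition g (i : 'I_n.+1) (w : T * Y) : R := if w.2 \in Nul then 0 else cutG i w.
Definition S2 (w : T * Y) : R := \sum_i g i w ^+ 2.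
Definition gn (w : T * Y) : R := Num.sqrt (S2 w).

Lemma intg_Wt : leb.-integrable setT (EFin \o Wt).
Proof. by apply: intg_powc; case/andP: ha. Qed.

Lemma intg_Wi : leb.-integrable setT (EFin \o Wi).
Proof. by apply: intg_powc; case/andP: ha => _ h; rewrite ltrN2. Qed.

Lemma measurable_cutU : measurable_fun setT cutU.
Proof.
apply: (measurableT_comp _ (@measurable_Phi R n)).
apply/(measurable_restrictT _ (@measurable_Ds R n)).
by apply: measurable_funS mU; [exact: measurable_Qs|exact: Ds_Qs].
Qed.

Let mGD i : measurable_fun setT ((fun z => G z 0 i) \_ Ds).
Proof.
apply/(measurable_restrictT _ (@measurable_Ds R n)).
by apply: measurable_funS (mG i); [exact: measurable_Qs|exact: Ds_Qs].
Qed.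

Lemma measurable_cutG i : measurable_fun setT (cutG i).
Proof. exact: (measurableT_comp (mGD i) (@measurable_Phi R n)). Qed.

Lemma Ds_box (s : T) (y : Y) : Ds (Phi (s, y)) -> boxT 9 s /\ 0 < y < 3.
Proof.
move=> /Ds_Phi[h1 h2 h3]; split.
  split => [i|/=]; last by rewrite in_itv/=; lra.
  have h4 : `|s.1 0 i| ^+ 2 < 9.
    rewrite real_normK ?num_real// (le_lt_trans _ h1)//.
    rewrite /sq (bigD1 i)//= -addrA lerDl addr_ge0 ?sqr_ge0//.
    by apply: sumr_ge0 => j _; exact: sqr_ge0.
  have h5 : `|s.1 0 i| ^+ 2 < 3 ^+ 2 by rewrite (_ : 3 ^+ 2 = 9 :> R)//; ring.
  move: h5; rewrite ltr_pXn2r ?nnegrE// => h5; lra.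
rewrite h2/=; have h4 : y ^+ 2 < 3 ^+ 2.
  rewrite (_ : 3 ^+ 2 = 9 :> R); last by ring.
  by rewrite (le_lt_trans _ h1)// lerDr; apply: sumr_ge0 => j _; exact: sqr_ge0.
by move: h4; rewrite ltr_pXn2r ?nnegrE// ltW.
Qed.

Lemma cutU_supp (s : T) (y : Y) : cutU (s, y) != 0 -> boxT 9 s /\ 0 < y < 3.
Proof.
rewrite /cutU patchE; case: ifPn => [h _|_]; last by rewrite eqxx.
by apply: Ds_box; exact: set_mem.
Qed.

Lemma cutG_supp i (s : T) (y : Y) : cutG i (s, y) != 0 -> boxT 9 s /\ 0 < y < 3.
Proof.
rewrite /cutG patchE; case: ifPn => [h _|_]; last by rewrite eqxx.
by apply: Ds_box; exact: set_mem.
Qed.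

Lemma cutU_bound w : `|cutU w| <= `|M|.
Proof.
rewrite /cutU patchE; case: ifPn => [/set_mem h|_]; last by rewrite normr0.
by rewrite (le_trans (UM h))// ler_norm.
Qed.

Let S20 (w : T * Y) : R := \sum_i cutG i w ^+ 2.

Let mS20 : measurable_fun setT S20.
Proof. by apply: measurable_sum => i; apply: measurable_funX; exact: measurable_cutG. Qed.

Let mWt : measurable_fun setT (fun w : T * Y => Wt w.2).
Proof. exact: (measurableT_comp (intg_measurable intg_Wt) measurable_snd). Qed.

Let mWi : measurable_fun setT (fun w : T * Y => Wi w.2).
Proof. exact: (measurableT_comp (intg_measurable intg_Wi) measurable_snd). Qed.

Let weight_Phi i (w : T * Y) : Wt w.2 * cutG i w ^+ 2 =
  ((fun z : Z => weight a z.1 * G z 0 i ^+ 2) \_ Ds) (Phi w).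
Proof.
rewrite /cutG !patchE; case: ifPn => [/set_mem h|_]; last by rewrite expr0n/= mulr0.
case: w h => s y h; rewrite /weight /Wt powc_in; first by rewrite snoc_max.
by have [] := Ds_box h.
Qed.

Lemma intg_Wt_cutG i : (nu \x leb)%E.-integrable setT (EFin \o (fun w => Wt w.2 * cutG i w ^+ 2)).
Proof.
have mF : measurable_fun setT ((fun z : Z => weight a z.1 * G z 0 i ^+ 2) \_ Ds).
  have -> : (fun z : Z => weight a z.1 * G z 0 i ^+ 2) \_ Ds =
    (fun z => weight a z.1 * (((fun z => G z 0 i) \_ Ds) z) ^+ 2).
    by apply/funext => z; rewrite !patchE; case: ifP => // _; rewrite expr0n/= mulr0.
  apply: measurable_funM; last exact: measurable_funX.
  apply: (measurableT_comp (measurable_powR _)).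
  exact: (measurableT_comp (@measurable_coord R n.+1 ord_max) measurable_fst).
suff iF : (lebVt R n.+1).-integrable setT
    (EFin \o ((fun z : Z => weight a z.1 * G z 0 i ^+ 2) \_ Ds)).
  by apply: eq_intg (intg_Phi mF iF) => w; rewrite weight_Phi.
apply/integrableP; split; first exact/measurable_EFinP.
apply: le_lt_trans (IG i); rewrite [leRHS]integral_mkcond.
apply: ge0_le_integral => //.
- exact/measurableT_comp/measurable_EFinP.
- apply/(measurable_restrictT _ (@measurable_Qs R n))/measurable_EFinP.
  apply: measurable_funM; last by apply: measurable_funX; exact: mG.
  apply: measurable_funTS; apply: (measurableT_comp (measurable_powR _)).
  exact: (measurableT_comp (@measurable_coord R n.+1 ord_max) measurable_fst).
move=> z _; rewrite /= !patchE.
have w0 : 0 <= weight a z.1 * G z 0 i ^+ 2 by rewrite mulr_ge0 ?powR_ge0 ?sqr_ge0.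
case: ifPn => [/set_mem/Ds_Qs zQ|_]; last by rewrite normr0; case: ifP.
by rewrite mem_set// ger0_norm.
Qed.

Let iWS20 : (nu \x leb)%E.-integrable setT (EFin \o (fun w => Wt w.2 * S20 w)).
Proof.
apply: eq_intg (intg_sum intg_Wt_cutG) => w.
by rewrite /S20 mulr_sumr.
Qed.

Lemma measurable_Nul : measurable Nul.
Proof.
have mE : measurable_fun setT E2.
  apply: (measurable_fun_fubini_tonelli_G (m1 := nu) (EFin \o S20)) => //.
    exact/measurable_EFinP.
  by move=> w; rewrite lee_fin; apply: sumr_ge0 => i _; exact: sqr_ge0.
rewrite (_ : Nul = E2 @^-1` [set +oo%E]); last by apply/seteqP; split.
by rewrite -[X in measurable X]setTI; exact: mE.
Qed.

(** The weighted integral of [S20] is finite, so almost every weighted slice is integrable. The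
    weight is positive and finite at 0 < y < 3, and at other heights the slice vanishes. *)
Lemma Nul0 : leb Nul = 0%E.
Proof.
have [N0 [mN0 N00 sN0]] := ae_integrable2 iWS20.
apply: (subset_measure0 (B := N0)) => //; first exact: measurable_Nul.
move=> y Ny; apply: sN0 => /= /integrableP[_].
have [y3|y3] := boolP (0 < y < 3).
  have Wp : 0 < Wt y by rewrite /Wt powc_in// powR_gt0//; case/andP: y3.
  rewrite (_ : (\int[nu]_x _)%E = ((Wt y)%:E * E2 y)%E); last first.
    rewrite /E2 -ge0_integralZl//.
    - apply: eq_integral => s _; rewrite -EFinM gee0_abs// lee_fin mulr_ge0 ?(ltW Wp)//.
      by apply: sumr_ge0 => i _; exact: sqr_ge0.
    - by apply/measurable_EFinP; exact: (measurable_fun_pair1 y mS20).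
    - by move=> s _; rewrite lee_fin; apply: sumr_ge0 => i _; exact: sqr_ge0.
    - by rewrite lee_fin ltW.
  by rewrite Ny gt0_muley ?lte_fin// ltxx.
move=> _; move: Ny; rewrite /Nul/= /E2.
rewrite (eq_integral (cst 0%E)) ?integral0// => s _.
rewrite big1// => i _; apply/eqP; rewrite expf_eq0/=; apply/negPn/negP => /cutG_supp[_ h].
by rewrite h in y3.
Qed.

Lemma g_cutG i w : ~ Nul w.2 -> g i w = cutG i w.
Proof. by move=> h; rewrite /g memNset. Qed.

Lemma g_supp i (s : T) (y : Y) : g i (s, y) != 0 -> boxT 9 s /\ 0 < y < 3.
Proof. by rewrite /g; case: ifP; rewrite ?eqxx// => _; exact: cutG_supp. Qed.

Lemma S2_ge0 w : 0 <= S2 w.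
Proof. by apply: sumr_ge0 => i _; exact: sqr_ge0. Qed.

Lemma gn_ge0 w : 0 <= gn w.
Proof. exact: sqrtr_ge0. Qed.

Lemma gn_sq w : gn w ^+ 2 = S2 w.
Proof. by rewrite /gn sqr_sqrtr// S2_ge0. Qed.

Lemma g_le_gn i w : `|g i w| <= gn w.
Proof.
rewrite /gn -sqrtr_sqr.
rewrite ler_sqrt ?S2_ge0// /S2 (bigD1 i)//= lerDl.
by apply: sumr_ge0 => j _; exact: sqr_ge0.
Qed.

Lemma gn_supp (s : T) (y : Y) : gn (s, y) != 0 -> boxT 9 s /\ 0 < y < 3.
Proof.
move=> h; have [h1|h1] := boolP [exists i, g i (s, y) != 0].
  by have /existsP[i] := h1; exact: g_supp.
move: h; rewrite /gn /S2 big1 ?sqrtr0 ?eqxx// => i _.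
by move: h1; rewrite negb_exists => /forallP/(_ i); rewrite negbK => /eqP ->; rewrite expr0n.
Qed.

Lemma measurable_g i : measurable_fun setT (g i).
Proof.
apply: measurable_fun_ifT => //; last exact: measurable_cutG.
apply: (measurable_fun_bool true).
rewrite setTI (_ : _ @^-1` _ = (setT : set T) `*` Nul).
  by apply: measurableX => //; exact: measurable_Nul.
by apply/seteqP; split => -[s y] /=; [move=> /set_mem|move=> [_ /mem_set]].
Qed.

Lemma measurable_S2 : measurable_fun setT S2.
Proof. by apply: measurable_sum => i; apply: measurable_funX; exact: measurable_g. Qed.

Lemma measurable_gn : measurable_fun setT gn.
Proof.
apply: (measurableT_comp _ measurable_S2).
by apply: continuous_measurable_fun; exact: sqrt_continuous.
Qed.

Lemma slice_S2 y : nu.-integrable setT (EFin \o (fun s => S2 (s, y))).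
Proof.
apply/integrableP; split.
  by apply/measurable_EFinP; exact: (measurable_fun_pair1 y measurable_S2).
rewrite (_ : (\int[nu]_s `|(EFin \o (fun s => S2 (s, y))) s|)%E =
    (\int[nu]_s (S2 (s, y))%:E)%E); last first.
  by apply: eq_integral => s _; rewrite /= ger0_norm ?S2_ge0.
have [yN|yN] := pselect (Nul y).
  rewrite (eq_integral (cst 0%E)) ?integral0// => s _.
  by rewrite /S2 big1// => i _; rewrite /g mem_set// expr0n.
rewrite (eq_integral (fun s => (S20 (s, y))%:E)).
  by rewrite ltey; apply/eqP.
by move=> s _; congr (_%:E); apply: eq_bigr => i _; rewrite g_cutG.
Qed.

Lemma intg_WtS2 : (nu \x leb)%E.-integrable setT (EFin \o (fun w => Wt w.2 * S2 w)).
Proof.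
apply: (intg_le _ iWS20).
  by apply: measurable_funM => //; exact: measurable_S2.
move=> w; rewrite ger0_norm ?mulr_ge0 ?S2_ge0 ?powc_ge0//.
apply: ler_wpM2l; first exact: powc_ge0.
by apply: ler_sum => i _; rewrite /g; case: ifP => // _; rewrite expr0n sqr_ge0.
Qed.

Let ind9 : nu.-integrable setT (EFin \o (\1_(boxT 9) : T -> R)).
Proof. exact: intg_ind_boxT. Qed.

Let mind9 : measurable_fun setT (fun w : T * Y => \1_(boxT 9) w.1 : R).
Proof. exact: (measurableT_comp (intg_measurable ind9) measurable_fst). Qed.

Lemma intg_box_Wt : (nu \x leb)%E.-integrable setT (EFin \o (fun w : T * Y => \1_(boxT 9) w.1 * Wt w.2)).
Proof.
apply: (dom_product (h := \1_(boxT 9)) (B := Wt)) => //; last first.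
- by move=> s y; rewrite /= ger0_norm// mulr_ge0// powc_ge0.
- exact: intg_Wt.
- exact: measurable_funM.
Qed.

Lemma intg_box_Wi : (nu \x leb)%E.-integrable setT (EFin \o (fun w : T * Y => \1_(boxT 9) w.1 * Wi w.2)).
Proof.
apply: (dom_product (h := \1_(boxT 9)) (B := Wi)) => //; last first.
- by move=> s y; rewrite /= ger0_norm// mulr_ge0// powc_ge0.
- exact: intg_Wi.
- exact: measurable_funM.
Qed.

(** Expand Wi (1 - Wt gn)^2 >= 0, with Wt Wi = 1 at the heights where gn does not vanish. *)
Lemma gn_le w : gn w <= \1_(boxT 9) w.1 * Wi w.2 + Wt w.2 * S2 w.
Proof.
have r0 : 0 <= \1_(boxT 9) w.1 * Wi w.2 + Wt w.2 * S2 w.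
  by rewrite addr_ge0// mulr_ge0 ?powc_ge0 ?S2_ge0.
have [->//|h] := eqVneq (gn w) 0; case: w h r0 => s y h _.
have [h1 h2] := gn_supp h; rewrite indicE mem_set// mul1r -gn_sq /=.
have e1 := powc_mulN a h2; rewrite -/(Wt y) -/(Wi y) in e1.
have W0 : 0 <= Wi y by exact: powc_ge0.
have : 0 <= Wi y * (1 - Wt y * gn (s, y)) ^+ 2 by rewrite mulr_ge0// sqr_ge0.
have -> : Wi y * (1 - Wt y * gn (s, y)) ^+ 2 =
  Wi y - 2 * (Wt y * Wi y) * gn (s, y) + (Wt y * Wi y) * (Wt y * gn (s, y) ^+ 2) by ring.
rewrite e1 mulr1 mul1r => h3; have := gn_ge0 (s, y); lra.
Qed.

Lemma Wtgn_le w : Wt w.2 * gn w <= \1_(boxT 9) w.1 * Wt w.2 + Wt w.2 * S2 w.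
Proof.
have W0 : 0 <= Wt w.2 by exact: powc_ge0.
have r0 : 0 <= \1_(boxT 9) w.1 * Wt w.2 + Wt w.2 * S2 w.
  by rewrite addr_ge0// mulr_ge0 ?S2_ge0.
have [->|h] := eqVneq (gn w) 0; first by rewrite mulr0.
case: w h r0 W0 => s y h _ W0.
have [h1 h2] := gn_supp h; rewrite indicE mem_set// mul1r -gn_sq /=.
have : 0 <= Wt y * (1 - gn (s, y)) ^+ 2 by rewrite mulr_ge0// sqr_ge0.
have -> : Wt y * (1 - gn (s, y)) ^+ 2 =
  Wt y - 2 * (Wt y * gn (s, y)) + Wt y * gn (s, y) ^+ 2 by ring.
have := mulr_ge0 W0 (gn_ge0 (s, y)); rewrite /=; lra.
Qed.

Lemma intg_gn : (nu \x leb)%E.-integrable setT (EFin \o gn).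
Proof.
apply: (intg_le measurable_gn (intgD intg_box_Wi intg_WtS2)) => w.
by rewrite ger0_norm ?gn_ge0// gn_le.
Qed.

Lemma intg_Wtgn : (nu \x leb)%E.-integrable setT (EFin \o (fun w => Wt w.2 * gn w)).
Proof.
apply: (intg_le _ (intgD intg_box_Wt intg_WtS2)) => [|w].
  by apply: measurable_funM => //; exact: measurable_gn.
by rewrite ger0_norm ?mulr_ge0 ?gn_ge0 ?powc_ge0// Wtgn_le.
Qed.

Lemma slice_gn y : nu.-integrable setT (EFin \o (fun s => gn (s, y))).
Proof.
apply: (intg_le _ (intgD ind9 (slice_S2 y))).
  exact: (measurable_fun_pair1 y measurable_gn).
move=> s; rewrite ger0_norm ?gn_ge0//.
have [->|h] := eqVneq (gn (s, y)) 0; first by rewrite addr_ge0// S2_ge0.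
have [h1 h2] := gn_supp h; rewrite indicE mem_set// -gn_sq.
have : 0 <= (1 - gn (s, y)) ^+ 2 by rewrite sqr_ge0.
have -> : (1 - gn (s, y)) ^+ 2 = 1 - 2 * gn (s, y) + gn (s, y) ^+ 2 by ring.
have := gn_ge0 (s, y); rewrite /=; lra.
Qed.

(** The L^1 norm of the gradient on the slice at height y. Up to a constant it bounds every
    mollified gradient and flux at that height, uniformly in (x, t). *)
Definition mgn (y : Y) : R := \int[nu]_s gn (s, y).

Lemma mgn_ge0 y : 0 <= mgn y.
Proof. by apply: Rint_ge0 => s; exact: gn_ge0. Qed.

Lemma intg_mgn : leb.-integrable setT (EFin \o mgn).
Proof. by have [] := Rfubini2 intg_gn slice_gn. Qed.

Lemma intg_Wt_mgn : leb.-integrable setT (EFin \o (fun y => Wt y * mgn y)).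
Proof.
have [] := Rfubini2 intg_Wtgn (fun y => intgZ (Wt y) (slice_gn y)).
by move=> h _; apply: eq_intg h => y; exact: (RintZ (Wt y) (slice_gn y)).
Qed.

Lemma intg_Wt_E2 : leb.-integrable setT (EFin \o (fun y => Wt y * \int[nu]_s S2 (s, y))).
Proof.
have [] := Rfubini2 intg_WtS2 (fun y => intgZ (Wt y) (slice_S2 y)).
by move=> h _; apply: eq_intg h => y; exact: (RintZ (Wt y) (slice_S2 y)).
Qed.

Let vol : R := \int[nu]_s \1_(boxT 9) s.

Let vol_ge0 : 0 <= vol. Proof. exact: Rint_ge0. Qed.

(** Cauchy-Schwarz on the box that carries the slice: expand the integral of (gn - c)^2 with c = mgn
    / vol. *)
Lemma mgn_sq y : mgn y ^+ 2 <= vol * \int[nu]_s S2 (s, y).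
Proof.
(* Division by vol requires this case apart: here gn <= c + gn^2 / c gives mgn <= E / c, and c = (E
   + 1) / e makes it at most e. *)
have [v0|v0] := eqVneq vol 0.
  rewrite v0 mul0r.
  suff -> : mgn y = 0 by rewrite expr0n.
  have i1 := slice_gn y; have i2 := slice_S2 y.
  apply/eqP; rewrite eq_le mgn_ge0 andbT; apply/ler_addgt0Pr => e e0; rewrite add0r.
  have E0 : 0 <= \int[nu]_s S2 (s, y) by apply: Rint_ge0 => s; exact: S2_ge0.
  set E := \int[nu]_s S2 (s, y) in E0 *.
  pose c := (E + 1) / e.
  have c0 : 0 < c by rewrite divr_gt0//; lra.
  have : mgn y <= c * vol + c^-1 * E.
    rewrite /mgn /vol /E -(RintZ _ ind9) -(RintZ _ i2) -RintD; last 2 first.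
    - exact: intgZ.
    - exact: intgZ.
    apply: le_Rint => //; first by apply: intgD; exact: intgZ.
    move=> s; have [->|h] := eqVneq (gn (s, y)) 0.
      by rewrite addr_ge0// mulr_ge0 ?S2_ge0// ?invr_ge0 ltW.
    have [h1 h2] := gn_supp h; rewrite indicE mem_set// mulr1 -gn_sq.
    have : 0 <= c^-1 * (c - gn (s, y)) ^+ 2 by rewrite mulr_ge0 ?sqr_ge0// invr_ge0 ltW.
    have -> : c^-1 * (c - gn (s, y)) ^+ 2 = c - 2 * gn (s, y) + c^-1 * gn (s, y) ^+ 2.
      by field; rewrite gt_eqF.
    have := gn_ge0 (s, y); lra.
  rewrite v0 mulr0 add0r => h; apply: le_trans h _.
  rewrite /c invf_div mulrAC ler_pdivrMr; last by lra.
  rewrite ler_wpM2l// ?ltW//; lra.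
have vp : 0 < vol by rewrite lt_neqAle eq_sym v0/=.
pose c := mgn y / vol.
have i1 := slice_gn y; have i2 := slice_S2 y.
have : 0 <= \int[nu]_s (S2 (s, y) + ((- (2 * c)) * gn (s, y) + c ^+ 2 * \1_(boxT 9) s)).
  apply: Rint_ge0 => s; have [e|h] := eqVneq (gn (s, y)) 0.
    by rewrite e mulr0 add0r addr_ge0 ?S2_ge0// mulr_ge0// sqr_ge0.
  have [h1 h2] := gn_supp h; rewrite indicE mem_set// mulr1 -gn_sq.
  have -> : gn (s, y) ^+ 2 + (- (2 * c) * gn (s, y) + c ^+ 2) = (gn (s, y) - c) ^+ 2 by ring.
  exact: sqr_ge0.
rewrite (RintD i2 (intgD (intgZ _ i1) (intgZ _ ind9))).
rewrite (RintD (intgZ _ i1) (intgZ _ ind9)) (RintZ _ i1) (RintZ _ ind9) -/(mgn y) -/vol.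
set E := \int[nu]_s S2 (s, y).
have -> : E + (- (2 * c) * mgn y + c ^+ 2 * vol) = E - mgn y ^+ 2 / vol.
  by rewrite /c; field.
by rewrite subr_ge0 ler_pdivrMr// mulrC.
Qed.

Lemma intg_Wt_mgn2 : leb.-integrable setT (EFin \o (fun y => Wt y * mgn y ^+ 2)).
Proof.
apply: (intg_le _ (intgZ vol intg_Wt_E2)).
  apply: measurable_funM; first exact: intg_measurable intg_Wt.
  by apply: measurable_funX; exact: intg_measurable intg_mgn.
move=> y; have W0 : 0 <= Wt y by exact: powc_ge0.
rewrite ger0_norm ?(mulr_ge0 W0 (sqr_ge0 _))//=.
rewrite [vol * _]mulrCA; apply: ler_wpM2l => //; exact: mgn_sq.
Qed.

Lemma slice_cutU y : nu.-integrable setT (EFin \o (fun s => cutU (s, y))).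
Proof.
apply: (@intg_bounded_box _ _ _ 9 `|M|).
- exact: (measurable_fun_pair1 y measurable_cutU).
- move=> s hs; apply/eqP/negPn/negP => /cutU_supp[] //.
- by move=> s; exact: cutU_bound.
Qed.

Lemma intg_cutU : (nu \x leb)%E.-integrable setT (EFin \o cutU).
Proof.
apply: (@dom_product _ _ _ Y R nu leb cutU (fun s => `|M| * \1_(boxT 9) s) (between 0 3)).
- exact: measurable_cutU.
- exact: intgZ.
- exact: intg_ind.
move=> s y; have [->|h] := eqVneq (cutU (s, y)) 0.
  rewrite normr0 !mulr_ge0// /between; do 2 case: ifP => //.
have [h1 h2] := cutU_supp h.
by rewrite indicE mem_set// mulr1 between_in// mulr1 cutU_bound.
Qed.

Lemma intg_Wt_cutU : (nu \x leb)%E.-integrable setT (EFin \o (fun w => Wt w.2 * cutU w)).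
Proof.
apply: (intg_le _ (intgZ `|M| intg_box_Wt)).
  by apply: measurable_funM => //; exact: measurable_cutU.
move=> [s y]; rewrite normrM ger0_norm ?powc_ge0//=.
have W0 : 0 <= Wt y by exact: powc_ge0.
have [->|h] := eqVneq (cutU (s, y)) 0.
  by rewrite normr0 mulr0 !mulr_ge0.
have [h1 h2] := cutU_supp h; rewrite indicE mem_set// mul1r mulrC ler_wpM2r//.
exact: cutU_bound.
Qed.

Lemma slice_g i y : nu.-integrable setT (EFin \o (fun s => g i (s, y))).
Proof.
apply: (intg_le _ (slice_gn y)); first exact: (measurable_fun_pair1 y (measurable_g i)).
by move=> s; exact: g_le_gn.
Qed.

Lemma intg_g i : (nu \x leb)%E.-integrable setT (EFin \o g i).
Proof. by apply: (intg_le (measurable_g i) intg_gn) => w; exact: g_le_gn. Qed.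

End weak_data.

(** * Bounds on the coefficients and on the flux *)

Section coefficients.
Variables (R : realType) (n : nat) (Lambda K : R) (A : 'rV[R]_n -> 'M[R]_n.+1).
Hypothesis HA : admissible_coef Lambda K A.
Local Notation T := ('rV[R]_n * measurableTypeR R)%type.
Local Notation V := ('rV[R]_n * R)%type.

Lemma entry_le_enorm p q (B : 'M[R]_(p, q)) i j : `|B i j| <= enorm B.
Proof.
rewrite -sqrtr_sqr /enorm ler_sqrt; last first.
  by apply: sumr_ge0 => k _; apply: sumr_ge0 => l _; exact: sqr_ge0.
rewrite (bigD1 i)//= (bigD1 j)//= -addrA lerDl addr_ge0//.
  by apply: sumr_ge0 => l _; exact: sqr_ge0.
by apply: sumr_ge0 => k _; apply: sumr_ge0 => l _; exact: sqr_ge0.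
Qed.

Lemma enorm_ge0 p q (B : 'M[R]_(p, q)) : 0 <= enorm B.
Proof. exact: sqrtr_ge0. Qed.

Lemma enorm_box (x : 'rV[R]_n) r : (forall i, `|x 0 i| <= r) -> enorm x <= n%:R * r.
Proof.
move=> xr; have S0 : 0 <= \sum_i `|x 0 i| by exact: sumr_ge0.
apply: (@le_trans _ _ (\sum_i `|x 0 i|)).
  rewrite /enorm big_ord1 -[leRHS]ger0_norm// -sqrtr_sqr ler_sqrt ?sqr_ge0//.
  rewrite expr2 mulr_suml; apply: ler_sum => i _.
  rewrite -real_normK ?num_real// expr2 ler_wpM2l// (bigD1 i)//= lerDl.
  by exact: sumr_ge0.
rewrite -[n in leRHS]card_ord mulr_natl -sumr_const; exact: ler_sum.
Qed.

Lemma coef_lipschitz (x y : 'rV[R]_n) i j r : (forall i, `|(x - y) 0 i| <= r) ->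
  `|A x i j - A y i j| <= `|K| * n%:R * r.
Proof.
have [_ _ _ [_ _ AL]] := HA => xr.
have := entry_le_enorm (A x - A y) i j; rewrite !mxE => /le_trans; apply.
apply: le_trans (AL x y) _; apply: (@le_trans _ _ (`|K| * enorm (x - y))).
  by rewrite ler_wpM2r ?enorm_ge0// ler_norm.
by rewrite -mulrA ler_wpM2l// enorm_box.
Qed.

Lemma coef_continuous i j : continuous (fun x : 'rV[R]_n => A x i j : R).
Proof.
move=> x; apply/(@cvgrPdist_lt R R^o _ (nbhs x) (nbhs_filter x)) => e e0.
pose d := e / (`|K| * n%:R + 1).
have c0 : 0 < `|K| * n%:R + 1 by rewrite ltr_wpDl// mulr_ge0.
have d0 : 0 < d by rewrite divr_gt0.
have B : nbhs x (ball x d) by exact: nbhsx_ballx.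
apply: filterS B => y yB.
have xy k : `|(x - y) 0 k| <= d.
  by rewrite !mxE ltW//; have [_ /(_ 0 k)] := yB; rewrite /ball/=.
apply: le_lt_trans (coef_lipschitz i j xy) _.
have : (`|K| * n%:R + 1) * d = e by rewrite /d mulrC divfK// gt_eqF.
rewrite mulrDl mul1r => h; lra.
Qed.

(** A(0) is the identity, with entries at most 1, and the spatial points of [boxT 9] have norm at
    most 9 n. *)
Definition CA : R := 1 + `|K| * n%:R * 9.

Lemma CA_ge0 : 0 <= CA. Proof. by rewrite addr_ge0// mulr_ge0// mulr_ge0. Qed.

Lemma coef_bound i j (s : T) : boxT 9 s -> `|A s.1 i j| <= CA.
Proof.
move=> [hs _]; have [_ _ _ [A0 _ _]] := HA.
have -> : A s.1 i j = A 0 i j + (A s.1 i j - A 0 i j) by rewrite addrC subrK.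
rewrite (le_trans (ler_normD _ _))// lerD//.
  by rewrite A0 mxE; case: eqP; rewrite ?normr1 ?normr0.
by apply: coef_lipschitz => k; rewrite subr0; exact: hs.
Qed.

Lemma measurable_coef i j : measurable_fun setT (fun s : T => A s.1 i j).
Proof.
have := continuous_measurable_rV (@coef_continuous i j).
move=> mA; exact: (measurableT_comp mA measurable_fst).
Qed.

End coefficients.

Section weak_flux.
Variables (R : realType) (n : nat) (a Lambda K : R) (A : 'rV[R]_n -> 'M[R]_n.+1).
Hypothesis HA : admissible_coef Lambda K A.
Local Notation leb := (@lebesgue_measure R).
Local Notation Y := (measurableTypeR R).
Local Notation T := ('rV[R]_n * measurableTypeR R)%type.
Local Notation V := ('rV[R]_n * R)%type.
Local Notation Z := ('rV[R]_n.+1 * measurableTypeR R)%type.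
Local Notation nu := (lebVt R n).
Local Notation Phi := (@Phi R n).
Local Notation Qs := (@Qs R n).
Local Notation Ds := (@Ds R n).

Variables (U : Z -> R) (G : Z -> 'rV[R]_n.+1) (M : R).
Hypotheses (ha : -1 < a < 1) (mU : measurable_fun Qs U)
  (mG : forall i, measurable_fun Qs (fun z => G z 0 i))
  (IG : forall i, (\int[lebVt R n.+1]_(z in Qs) (weight a z.1 * (G z 0 i) ^+ 2)%:E < +oo)%E)
  (UM : forall z, Ds z -> `|U z| <= M).

Definition flux (i : 'I_n.+1) (w : T * Y) : R := \sum_j A w.1.1 i j * g G j w.

Lemma measurable_flux i : measurable_fun setT (flux i).
Proof.
apply: measurable_sum => j; apply: measurable_funM; last exact: measurable_g.
exact: (measurableT_comp (measurable_coef HA i j) measurable_fst).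
Qed.

Lemma flux_le i w : `|flux i w| <= n.+1%:R * CA n K * gn G w.
Proof.
case: w => s y.
have [h|h] := pselect (boxT 9 s); last first.
  have g0 j : g G j (s, y) = 0.
    by apply/eqP/negPn/negP => /g_supp[h1 _]; exact: h.
  rewrite /flux big1 ?normr0; last by move=> j _; rewrite g0 mulr0.
  by rewrite !mulr_ge0 ?gn_ge0// CA_ge0.
apply: le_trans (ler_norm_sum _ _ _) _.
rewrite -[n.+1 in leRHS]card_ord -mulrA mulr_natl -sumr_const.
apply: ler_sum => j _; rewrite normrM ler_pM// ?g_le_gn//.
exact: (coef_bound HA).
Qed.

(** The last row of A is that of the identity, so the vertical flux involves neither A nor the
    tangential derivatives. *)
Lemma flux_max w : flux ord_max w = g G ord_max w.
Proof.
have [_ _ _ [_ Am _]] := HA.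
rewrite /flux (bigD1 ord_max)//= Am eqxx mul1r big1 ?addr0// => j jm.
by rewrite Am eq_sym (negbTE jm) mul0r.
Qed.

Lemma slice_flux i y : nu.-integrable setT (EFin \o (fun s => flux i (s, y))).
Proof.
apply: (intg_le _ (intgZ (n.+1%:R * CA n K) (slice_gn mG y))).
  exact: (measurable_fun_pair1 y (measurable_flux i)).
by move=> s; exact: flux_le.
Qed.

Lemma intg_Wt_flux i : (nu \x leb)%E.-integrable setT (EFin \o (fun w => Wt a w.2 * flux i w)).
Proof.
have mW : measurable_fun setT (fun w : T * Y => Wt a w.2).
  exact: (measurableT_comp (intg_measurable (intg_Wt ha)) measurable_snd).
apply: (intg_le _ (intgZ (n.+1%:R * CA n K) (intg_Wtgn ha mG IG))).
  by apply: measurable_funM => //; exact: measurable_flux.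
move=> w; have W0 : 0 <= Wt a w.2 by exact: powc_ge0.
rewrite normrM ger0_norm//= mulrCA ler_wpM2l//.
exact: flux_le.
Qed.

End weak_flux.

Lemma Rint_sum_in d (T : measurableType d) (R : realType) (mu : {measure set T -> \bar R})
    (D : set T) (I : finType) (F : I -> T -> R) : measurable D ->
  (forall i, mu.-integrable D (EFin \o F i)) ->
  mu.-integrable D (EFin \o (fun x => \sum_i F i x)) /\
  \int[mu]_(x in D) (\sum_i F i x) = \sum_i \int[mu]_(x in D) F i x.
Proof.
move=> mD iF.
have iF' i : mu.-integrable setT (EFin \o (F i \_ D)).
  by have /(integrable_mkcond _ mD) := iF i; rewrite restrict_EFin.
have E x : \sum_i (F i \_ D) x = ((fun x => \sum_i F i x) \_ D) x.
  rewrite patchE; case: ifPn => xD; first by apply: eq_bigr => i _; rewrite patchE xD.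
  by rewrite big1// => i _; rewrite patchE (negbTE xD).
split.
  apply/(integrable_mkcond _ mD); rewrite restrict_EFin.
  exact: (eq_intg E (intg_sum iF')).
rewrite Rintegral_mkcond.
transitivity (\int[mu]_x \sum_i (F i \_ D) x); first by apply: eq_Rint => x; rewrite E.
rewrite (Rint_sum iF').
by apply: eq_bigr => i _; rewrite [RHS]Rintegral_mkcond.
Qed.

(** * Bounds on mollified slices *)

Section conv_bounds.
Variables (R : realType) (n : nat) (a Lambda K : R) (A : 'rV[R]_n -> 'M[R]_n.+1).
Hypothesis HA : admissible_coef Lambda K A.
Local Notation leb := (@lebesgue_measure R).
Local Notation Y := (measurableTypeR R).
Local Notation T := ('rV[R]_n * measurableTypeR R)%type.
Local Notation V := ('rV[R]_n * R)%type.
Local Notation Z := ('rV[R]_n.+1 * measurableTypeR R)%type.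
Local Notation nu := (lebVt R n).
Local Notation Phi := (@Phi R n).
Local Notation Qs := (@Qs R n).
Local Notation Ds := (@Ds R n).
Local Notation b_ := (b_ R).

Variables (U : Z -> R) (G : Z -> 'rV[R]_n.+1) (M : R).
Hypotheses (ha : -1 < a < 1) (mU : measurable_fun Qs U)
  (mG : forall i, measurable_fun Qs (fun z => G z 0 i))
  (IG : forall i, (\int[lebVt R n.+1]_(z in Qs) (weight a z.1 * (G z 0 i) ^+ 2)%:E < +oo)%E)
  (UM : forall z, Ds z -> `|U z| <= M).

(** The functions 1, mgn and mgn^2 are all integrable against y^a; products of two mollified
    gradients grow no faster than their combination. *)
Lemma intg_Wt_le (F : Y -> R) C : measurable_fun setT F -> 0 <= C ->
  (forall y, `|F y| <= C * (1 + mgn G y) ^+ 2) ->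
  leb.-integrable setT (EFin \o (fun y => Wt a y * F y)).
Proof.
move=> mF C0 FC.
have i1 := intg_Wt ha; have i2 := intg_Wt_mgn ha mG IG; have i3 := intg_Wt_mgn2 ha mG IG.
apply: (intg_le _ (intgZ C (intgD i1 (intgD (intgZ 2 i2) i3)))).
  by apply: measurable_funM => //; exact: intg_measurable i1.
move=> y; have W0 : 0 <= Wt a y by exact: powc_ge0.
rewrite normrM (ger0_norm W0).
have -> : C * (Wt a y + (2 * (Wt a y * mgn G y) + Wt a y * mgn G y ^+ 2)) =
  Wt a y * (C * (1 + mgn G y) ^+ 2) by ring.
by rewrite ler_wpM2l.
Qed.

Variables (k : V -> R) (e : R).
Hypotheses (sk : smooth k) (supk : supp_box e k).

Let measurable_slice (F : T * Y -> R) t : measurable_fun setT F ->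
  measurable_fun setT (fun y : Y => conv k (fun s => F (s, y)) t).
Proof. by move=> mF; have := measurable_fun_pair2 t (measurable_conv sk mF). Qed.

Lemma measurable_conv_g i t : measurable_fun setT (fun y : Y => conv k (fun s => g G i (s, y)) t).
Proof. exact: measurable_slice (measurable_g mG i). Qed.

Lemma measurable_conv_flux i t :
  measurable_fun setT (fun y : Y => conv k (fun s => flux A G i (s, y)) t).
Proof. exact: measurable_slice (measurable_flux HA mG i). Qed.

Lemma measurable_conv_cutU t : measurable_fun setT (fun y : Y => conv k (fun s => cutU U (s, y)) t).
Proof. exact: measurable_slice (measurable_cutU mU). Qed.

(** A bounded kernel turns the L^1 norm of a slice into a uniform bound on its convolution, with one
    constant for all heights and components. *)
Lemma conv_weak_bounds : exists2 C, 0 <= C & [/\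
  forall i t (y : Y), `|conv k (fun s => g G i (s, y)) t| <= C * mgn G y,
  forall t (y : Y), `|conv k (fun s => gn G (s, y)) t| <= C * mgn G y,
  forall i t (y : Y), `|conv k (fun s => flux A G i (s, y)) t| <= C * mgn G y &
  forall t (y : Y), `|conv k (fun s => cutU U (s, y)) t| <= C].
Proof.
have [C C0 hC] := kernel_bounded sk supk.
pose v : R := \int[nu]_s \1_(boxT 9) s.
have v0 : 0 <= v by exact: Rint_ge0.
pose c := n.+1%:R * CA n K.
have c0 : 0 <= c by rewrite mulr_ge0// CA_ge0.
have gen (F : T -> R) t (y : Y) c1 : 0 <= c1 -> nu.-integrable setT (EFin \o F) ->
    (forall s, `|F s| <= c1 * gn G (s, y)) -> `|conv k F t| <= (C * c1) * mgn G y.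
  move=> c10 iF Fb; apply: le_trans (conv_bound sk supk t iF hC) _.
  rewrite -mulrA ler_wpM2l// /mgn -(RintZ c1 (slice_gn mG y)).
  by apply: le_Rint => //; [exact: intg_norm|exact: intgZ (slice_gn mG y)].
pose D := C + C * c + C * (`|M| * v).
have h1 : 0 <= C * c by exact: mulr_ge0.
have h2 : 0 <= C * (`|M| * v) by rewrite !mulr_ge0.
have D1 : C * 1 <= D by rewrite /D; lra.
have D2 : C * c <= D by rewrite /D; lra.
have D3 : C * (`|M| * v) <= D by rewrite /D; lra.
exists D; first by rewrite /D; lra.
have mg0 (y : Y) : 0 <= mgn G y by exact: mgn_ge0.
split.
- move=> i t y; apply: (@le_trans _ _ (C * 1 * mgn G y)); last by rewrite ler_wpM2r.
  apply: gen => //; first exact: (slice_g mG i y).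
  by move=> s; rewrite mul1r g_le_gn.
- move=> t y; apply: (@le_trans _ _ (C * 1 * mgn G y)); last by rewrite ler_wpM2r.
  apply: gen => //; first exact: (slice_gn mG y).
  by move=> s; rewrite mul1r ger0_norm// gn_ge0.
- move=> i t y; apply: (@le_trans _ _ (C * c * mgn G y)); last by rewrite ler_wpM2r.
  apply: gen => //; first exact: (slice_flux HA mG i y).
  by move=> s; exact: (flux_le HA).
- move=> t y; apply: le_trans (conv_bound sk supk t (slice_cutU mU UM y) hC) _.
  apply: le_trans D3.
  rewrite ler_wpM2l// /v -(RintZ _ (@intg_ind_boxT R n 9)).
  apply: le_Rint; first exact: intg_norm (slice_cutU mU UM y).
    exact: intgZ (@intg_ind_boxT R n 9).
  move=> s; have [->|h] := eqVneq (cutU U (s, y)) 0; first by rewrite normr0 mulr_ge0.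
  have [hs _] := cutU_supp h; rewrite indicE mem_set// mulr1.
  exact: (cutU_bound UM).
Qed.

End conv_bounds.

(** * The equation and the weak gradient tested with product functions *)

Section weak_identities.
Variables (R : realType) (n : nat) (a Lambda K : R) (A : 'rV[R]_n -> 'M[R]_n.+1).
Hypothesis HA : admissible_coef Lambda K A.
Local Notation leb := (@lebesgue_measure R).
Local Notation Y := (measurableTypeR R).
Local Notation T := ('rV[R]_n * measurableTypeR R)%type.
Local Notation V := ('rV[R]_n * R)%type.
Local Notation Z := ('rV[R]_n.+1 * measurableTypeR R)%type.
Local Notation nu := (lebVt R n).
Local Notation Phi := (@Phi R n).
Local Notation Qs := (@Qs R n).
Local Notation Ds := (@Ds R n).
Local Notation b_ := (b_ R).

Variables (U : Z -> R) (G : Z -> 'rV[R]_n.+1) (M : R).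
Hypotheses (ha : -1 < a < 1) (mU : measurable_fun Qs U)
  (mG : forall i, measurable_fun Qs (fun z => G z 0 i))
  (IG : forall i, (\int[lebVt R n.+1]_(z in Qs) (weight a z.1 * (G z 0 i) ^+ 2)%:E < +oo)%E)
  (UM : forall z, Ds z -> `|U z| <= M).
Hypotheses (WG : is_weak_grad Qs U G)
  (WS : forall phi, test_function (cyl (eball 4) `]0, 16[%classic) phi ->
    \int[lebVt R n.+1]_(z in Qs)
      (weight a z.1 * (mxform (A (col' ord_max z.1)) (G z) (grad phi z)
                       + U z * dtime phi z)) = 0).

Variables (k : V -> R) (e : R) (t : T).
Hypotheses (sk : smooth k) (supk : supp_box e k) (gt : good e t).

Let gfl := flux A G.

Lemma sq_tang (z : Z) : sq z.1 = sq (tang z).1 + z.1 0 ord_max ^+ 2.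
Proof.
by rewrite /sq sum_snoc; congr (_ + _); apply: eq_bigr => j _; rewrite mxE.
Qed.

Let product_ne0 chi (z : Z) : product_test k chi t z != 0 ->
  boxT e (t - tang z : T) /\ chi (z.1 0 ord_max) != 0.
Proof.
rewrite /product_test mulf_eq0 negb_or => /andP[h1 ->]; split => //.
by apply: contrapT => /supk h; move: h1; rewrite h eqxx.
Qed.

Let test_gen (D : set Z) chi al be : smooth1 chi -> supp_in al be chi ->
  (forall z : Z, al <= z.1 0 ord_max <= be -> boxT e (t - tang z : T) -> D z) ->
  test_function D (product_test k chi t).
Proof.
move=> schi suchi HD.
pose l (i : 'I_n.+1) : R := if unlift ord_max i is Some j then t.1 0 j - e else al.
pose u (i : 'I_n.+1) : R := if unlift ord_max i is Some j then t.1 0 j + e else be.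
apply: (@test_of_box R n.+1 D _ l u (t.2 - e) (t.2 + e)).
- exact: smooth_product_test.
- move=> z /product_ne0 [[h1 h2] h3]; split => [i|]; last first.
    by move: h2; rewrite /= in_itv/=; lra.
  rewrite /l /u; case: (unliftP ord_max i) => [j ->|->].
    by have := h1 j; rewrite !mxE ler_norml; lra.
  apply/andP; split; rewrite leNgt; apply/negP => h4; move: h3; rewrite suchi ?eqxx//.
    by left; exact: ltW.
  by right; exact: ltW.
- move=> z h1 h2; apply: HD.
    by have := h1 ord_max; rewrite /l /u unlift_none.
  split => [j|/=]; last by rewrite in_itv/=; lra.
  have := h1 (lift ord_max j); rewrite /l /u liftK !mxE ler_norml; lra.
Qed.

(** chi may be non-zero at y = 0: the support must only stay in the whole ball, and 9 / 2 + [b_] ^ 2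
    < 16. This is the test that carries the Neumann condition. *)
Let test_full chi c : smooth1 chi -> supp_in (- c) c chi -> c < b_ ->
  test_function (cyl (eball 4) `]0, 16[%classic) (product_test k chi t).
Proof.
move=> schi suchi cb; apply: (test_gen schi suchi) => z h1 h2.
have [h3 h4] := gt h2; split; last by rewrite /= in_itv/=; move: h4; rewrite /tang/=; lra.
rewrite /eball/= enorm_lt// sq_tang.
have : `|z.1 0 ord_max| ^+ 2 <= b_ ^+ 2.
  rewrite lerXn2r ?nnegrE//; first by rewrite /b_ divr_ge0.
  by rewrite ler_norml; lra.
rewrite real_normK ?num_real// (_ : b_ ^+ 2 = 441 / 100); last by rewrite /b_; field.
lra.
Qed.

(** The weak gradient is defined by test functions on the open half cylinder, hence the support in
    heights above al > 0. *)
Let test_plus chi al be : smooth1 chi -> supp_in al be chi -> 0 < al -> be < b_ ->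
  test_function Qs (product_test k chi t).
Proof.
move=> schi suchi al0 beb; apply: (test_gen schi suchi) => z h1 h2.
have [h3 h4] := gt h2; split; last by rewrite /= in_itv/=; move: h4; rewrite /tang/=; lra.
split; last by rewrite /=; lra.
rewrite /eball/= enorm_lt// sq_tang.
have : z.1 0 ord_max ^+ 2 <= b_ ^+ 2.
  by rewrite lerXn2r ?nnegrE//; [lra|rewrite /b_ divr_ge0|lra].
rewrite (_ : b_ ^+ 2 = 441 / 100); last by rewrite /b_; field.
lra.
Qed.

Let mwt : measurable_fun setT (fun z : Z => weight a z.1).
Proof.
apply: (measurableT_comp (measurable_powR _)).
exact: (measurableT_comp (@measurable_coord R n.+1 ord_max) measurable_fst).
Qed.

Let mAz i j : measurable_fun setT (fun z : Z => A (col' ord_max z.1) i j).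
Proof.
have m1 : measurable_fun setT (fun z : Z => col' ord_max z.1).
  apply: measurable_fun_rVP => l.
  rewrite (_ : (fun x => _) = fun z : Z => z.1 0 (lift ord_max l)); last first.
    by apply/funext => z; rewrite mxE.
  exact: (measurableT_comp (@measurable_coord R n.+1 _) measurable_fst).
have m2 := continuous_measurable_rV (@coef_continuous R n Lambda K A HA i j).
exact: (measurableT_comp m2 m1).
Qed.

Let fl i (z : Z) := weight a z.1 * \sum_j A (col' ord_max z.1) i j * G z 0 j.

Let mfl i : measurable_fun Qs (fl i).
Proof.
apply: measurable_funM; first exact: measurable_funTS.
apply: measurable_sum => j; apply: measurable_funM => //.
exact: measurable_funTS.
Qed.

Let mfu : measurable_fun Qs (fun z => weight a z.1 * U z).
Proof. by apply: measurable_funM => //; exact: measurable_funTS. Qed.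

Let Wt_Phi (s : T) (y : Y) : Ds (Phi (s, y)) -> weight a (Phi (s, y)).1 = Wt a y.
Proof. by move=> /Ds_box[_ h]; rewrite /weight snoc_max /Wt powc_in. Qed.

Let flE i (w : T * Y) : ~ Nul G w.2 -> Wt a w.2 * gfl i w = (fl i \_ Ds) (Phi w).
Proof.
case: w => s y h; rewrite patchE; case: ifPn => [/set_mem sD|sD].
  rewrite /fl Wt_Phi//; congr (_ * _); apply: eq_bigr => j _.
  by rewrite col'_snoc g_cutG// /cutG patchE mem_set.
rewrite /gfl /flux big1 ?mulr0// => j _.
by rewrite g_cutG// /cutG patchE (negbTE sD) mulr0.
Qed.

Let fuE (w : T * Y) : Wt a w.2 * cutU U w = ((fun z => weight a z.1 * U z) \_ Ds) (Phi w).
Proof.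
case: w => s y; rewrite /cutU !patchE; case: ifPn => [/set_mem sD|sD]; last by rewrite mulr0.
by rewrite Wt_Phi.
Qed.

Let b_ge0 : 0 <= b_. Proof. by rewrite /b_ divr_ge0. Qed.

(** k' will be k or one of its derivatives, and th will be chi or chi'. The exceptional heights are
    those of [Nul G], where [g] was set to 0. *)
Let fl_slice i (k' : V -> R) (th : R -> R) c c' : smooth k' -> supp_box e k' ->
  continuous th -> supp_in c c' th -> c' < b_ ->
  (lebVt R n.+1).-integrable Qs (EFin \o (fun z => fl i z * (k' (t - tang z) * th (z.1 0 ord_max)))) /\
  \int[lebVt R n.+1]_(z in Qs) (fl i z * (k' (t - tang z) * th (z.1 0 ord_max))) =
  \int[leb]_y (th y * (Wt a y * conv k' (fun s => gfl i (s, y)) t)).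
Proof.
move=> sk' sup' cth suth cb.
have [Ck _ hCk] := kernel_bounded sk' sup'.
have [Cth _ hCth] := continuous_bounded_supp cth suth.
have [|||||||||||||i1 ->] := @slice_int R n (fl i) (fun w => Wt a w.2 * gfl i w)
  (Nul G) k' th e t Ck Cth => //.
- exact: (intg_Wt_flux HA ha mG IG).
- by move=> y; apply: (intgZ (Wt a y)); exact: (slice_flux HA mG).
- exact: (measurable_Nul mG).
- exact: (Nul0 mG IG).
- by move=> w; exact: flE.
- exact: smooth_continuous.
- by move=> y yb; apply: suth; right; exact: le_trans (ltW cb) yb.
split => //; apply: eq_Rint => y; congr (_ * _).
rewrite /conv -RintZ; last exact: (conv_intg sk' sup' _ (slice_flux HA mG i y)).
by apply: eq_Rint => s; rewrite mulrCA.
Qed.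

Let fu_slice (k' : V -> R) (th : R -> R) c c' : smooth k' -> supp_box e k' ->
  continuous th -> supp_in c c' th -> c' < b_ ->
  (lebVt R n.+1).-integrable Qs (EFin \o
    (fun z => (weight a z.1 * U z) * (k' (t - tang z) * th (z.1 0 ord_max)))) /\
  \int[lebVt R n.+1]_(z in Qs) ((weight a z.1 * U z) * (k' (t - tang z) * th (z.1 0 ord_max))) =
  \int[leb]_y (th y * (Wt a y * conv k' (fun s => cutU U (s, y)) t)).
Proof.
move=> sk' sup' cth suth cb.
have [Ck _ hCk] := kernel_bounded sk' sup'.
have [Cth _ hCth] := continuous_bounded_supp cth suth.
have [|||||||||||||i1 ->] := @slice_int R n (fun z => weight a z.1 * U z)
  (fun w => Wt a w.2 * cutU U w) set0 k' th e t Ck Cth => //.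
- exact: (intg_Wt_cutU ha mU UM).
- by move=> y; apply: (intgZ (Wt a y)); exact: (slice_cutU mU UM).
- exact: smooth_continuous.
- by move=> y yb; apply: suth; right; exact: le_trans (ltW cb) yb.
split => //; apply: eq_Rint => y; congr (_ * _).
rewrite /conv -RintZ; last exact: (conv_intg sk' sup' _ (slice_cutU mU UM y)).
by apply: eq_Rint => s; rewrite mulrCA.
Qed.


Let u_slice (k' : V -> R) (th : R -> R) c c' : smooth k' -> supp_box e k' ->
  continuous th -> supp_in c c' th -> c' < b_ ->
  \int[lebVt R n.+1]_(z in Qs) (U z * (k' (t - tang z) * th (z.1 0 ord_max))) =
  \int[leb]_y (th y * conv k' (fun s => cutU U (s, y)) t).
Proof.
move=> sk' sup' cth suth cb.
have [Ck _ hCk] := kernel_bounded sk' sup'.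
have [Cth _ hCth] := continuous_bounded_supp cth suth.
have [|||||||||||||i1 ->] := @slice_int R n U (cutU U) set0 k' th e t Ck Cth => //.
- exact: (intg_cutU mU UM).
- by move=> y; exact: (slice_cutU mU UM).
- exact: smooth_continuous.
- by move=> y yb; apply: suth; right; exact: le_trans (ltW cb) yb.
Qed.

Let g_slice i (k' : V -> R) (th : R -> R) c c' : smooth k' -> supp_box e k' ->
  continuous th -> supp_in c c' th -> c' < b_ ->
  \int[lebVt R n.+1]_(z in Qs) (G z 0 i * (k' (t - tang z) * th (z.1 0 ord_max))) =
  \int[leb]_y (th y * conv k' (fun s => g G i (s, y)) t).
Proof.
move=> sk' sup' cth suth cb.
have [Ck _ hCk] := kernel_bounded sk' sup'.
have [Cth _ hCth] := continuous_bounded_supp cth suth.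
have [|||||||||||||i1 ->] := @slice_int R n (fun z => G z 0 i) (g G i) (Nul G) k' th e t Ck Cth => //.
- exact: (intg_g ha mG IG).
- by move=> y; exact: (slice_g mG).
- exact: (measurable_Nul mG).
- exact: (Nul0 mG IG).
- by move=> w h; rewrite g_cutG.
- exact: smooth_continuous.
- by move=> y yb; apply: suth; right; exact: le_trans (ltW cb) yb.
Qed.

Let ibetween (F : Y -> R) C : 0 <= C -> measurable_fun setT F ->
  (forall y, `|F y| <= C * (1 + mgn G y)) ->
  leb.-integrable setT (EFin \o (fun y => between 0 b_ y * F y)).
Proof.
move=> C0 mF Fb; have iB := @intg_ind R b_.
apply: (intg_le _ (intgZ C (intgD iB (intg_mgn ha mG IG)))).
  by apply: measurable_funM => //; exact: intg_measurable iB.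
move=> y; have g0 : 0 <= mgn G y by exact: mgn_ge0.
rewrite /between; case: ifP => _; last by rewrite mul0r normr0 mulr_ge0// addr_ge0.
by case: ifP => _; [rewrite mul1r|rewrite mul0r normr0 mulr_ge0// addr_ge0].
Qed.

(** The mollification of y^a times the tangential divergence of the flux plus U_t, with all
    derivatives on the kernel. The cut at [b_] discards heights at which the kernel may leave
    [Ds]. *)
Definition divflux (y : Y) : R := between 0 b_ y * (Wt a y *
  (\sum_(i < n) conv ('D_(ex R i) k) (fun s => gfl (lift ord_max i) (s, y)) t +
   conv ('D_(et R n) k) (fun s => cutU U (s, y)) t)).
Definition vflux (y : Y) : R := between 0 b_ y * (Wt a y * conv k (fun s => g G ord_max (s, y)) t).
Definition vgrad (y : Y) : R := between 0 b_ y * conv k (fun s => g G ord_max (s, y)) t.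
Definition vval (y : Y) : R := between 0 b_ y * conv k (fun s => cutU U (s, y)) t.

Let drop_between al be (F th : Y -> R) : supp_in al be th -> be < b_ ->
  (forall y, y <= 0 -> F y = 0) -> 
  \int[leb]_y (between 0 b_ y * F y * th y) = \int[leb]_y (th y * F y).
Proof.
move=> suth beb F0; apply: eq_Rint => y; rewrite /between.
case: ltP => y0; last by rewrite F0// !mulr0 ?mul0r.
case: ltP => yb; first by rewrite mul1r mulrC.
by rewrite suth ?mulr0 ?mul0r//; right; exact: le_trans (ltW beb) yb.
Qed.

Let Wt0 (y : Y) : y <= 0 -> Wt a y = 0.
Proof. by move=> y0; rewrite /Wt powc_out// negb_and -leNgt y0. Qed.

Let pairing (M0 : 'M[R]_n.+1) (u v : 'rV[R]_n.+1) :
  mxform M0 u v = \sum_i v 0 i * \sum_j M0 i j * u 0 j.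
Proof.
rewrite /mxform -mulmxA mxE; apply: eq_bigr => i _; congr (_ * _).
by rewrite mxE; apply: eq_bigr => j _; rewrite mxE.
Qed.

Lemma smooth1_derive_continuous (chi chi' : R -> R) : smooth1 chi ->
  (forall y : R, is_derive y (1 : R) chi (chi' y)) -> continuous chi'.
Proof. by move=> s d; apply: smooth1_continuous; exact: (smooth1_derivative d). Qed.

(** Serves the end points of a support: [supp_in] includes them, and there the derivative is
    computed along the outer side, where chi is constant. *)
Lemma is_derive_zero_along (chi : R -> R) (y d s : R) : s != 0 ->
  is_derive y (1 : R) chi d -> (forall m, chi (s / m.+1%:R + y) = chi y) -> d = 0.
Proof.
move=> s0 [dgt <-] H.
pose h (m : nat) : R := s / m.+1%:R.
have /= L : r^-1 *: (chi (r *: (1 : R) + y) - chi y) @[r --> (0:R)^'] --> 'D_1 chi y.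
  exact: dgt.
have /cvgr_dnbhsP/(_ h) := L.
have hh : (forall m, h m != 0) /\ h m @[m --> \oo] --> (0 : R).
  split => [m|]; first by rewrite mulf_neq0// invr_eq0.
  rewrite -[X in _ --> X](mulr0 s); apply: cvgM; [exact: cvg_cst|exact: cvg_harmonic].
move=> /(_ hh).
rewrite (_ : (fun m => _) = fun=> 0); last first.
  apply/funext => m; rewrite [_ *: (1 : R)]mulr1.
  by rewrite (H m) subrr scaler0.
by move=> /(cvg_lim (@Rhausdorff R)) <-; rewrite lim_cst.
Qed.

Lemma supp_in_derive (chi chi' : R -> R) al be :
  (forall y : R, is_derive y (1 : R) chi (chi' y)) ->
  supp_in al be chi -> supp_in al be chi'.
Proof.
move=> dchi suchi y yab.
have chi0 := suchi y yab.
have m0 (m : nat) : (0 : R) <= m.+1%:R^-1 by rewrite invr_ge0.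
case: yab => h.
  apply: (is_derive_zero_along (s := -1) _ (dchi y)); first by rewrite oppr_eq0 oner_eq0.
  move=> m; rewrite chi0; apply: suchi; left; move: (m.+1%:R^-1) (m0 m) => r r0; lra.
apply: (is_derive_zero_along (s := 1) _ (dchi y)); first by rewrite oner_eq0.
move=> m; rewrite chi0; apply: suchi; right; move: (m.+1%:R^-1) (m0 m) => r r0; lra.
Qed.

(** The weak equation with [product_test k chi t]: the derivatives in x and t fall on k with a minus
    sign, the vertical one on chi, and slicing turns each term into an integral over the height. *)
Lemma weak_vertical (chi chi' : R -> R) c : c < b_ -> smooth1 chi ->
  (forall y : R, is_derive y (1 : R) chi (chi' y)) -> supp_in (- c) c chi ->
  \int[leb]_y (divflux y * chi y) = \int[leb]_y (vflux y * chi' y).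
Proof.
move=> cb schi dchi suchi.
have cchi := smooth1_continuous schi.
have cchi' := smooth1_derive_continuous schi dchi.
have suchi' := supp_in_derive dchi suchi.
rewrite /divflux /vflux (drop_between suchi cb) ?(drop_between suchi' cb); last 2 first.
- by move=> y y0; rewrite Wt0// mul0r.
- by move=> y y0; rewrite Wt0// mul0r.
have := WS (test_full schi suchi cb).
have [i1 E1] := fl_slice ord_max sk supk cchi' suchi' cb.
have H2 i := fl_slice (lift ord_max i) (smooth_derive (ex R i) sk) (supp_box_derive supk (ex R i)) cchi suchi cb.
have [i3 E3] := fu_slice (smooth_derive (et R n) sk) (supp_box_derive supk (et R n)) cchi suchi cb.
have [i2 E2] := Rint_sum_in (@measurable_Qs R n) (fun i => (H2 i).1).
rewrite (_ : (fun z => _) = fun z => fl ord_max z * (k (t - tang z) * chi' (z.1 0 ord_max)) -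
   ((\sum_(i < n) fl (lift ord_max i) z * ('D_(ex R i) k (t - tang z) * chi (z.1 0 ord_max))) +
   (weight a z.1 * U z) * ('D_(et R n) k (t - tang z) * chi (z.1 0 ord_max)))); last first.
  apply/funext => z; rewrite pairing sum_snoc !mxE.
  rewrite (dspace_max_product_test k t dchi) (dtime_product_test t sk dchi).
  pose w0 := weight a z.1; pose Sj i := \sum_j A (col' ord_max z.1) i j * G z 0 j.
  have Ej : w0 * (\sum_(i < n) grad (product_test k chi t) z 0 (lift ord_max i) * Sj (lift ord_max i)) =
    - \sum_(i < n) fl (lift ord_max i) z * ('D_(ex R i) k (t - tang z) * chi (z.1 0 ord_max)).
    rewrite mulr_sumr -sumrN; apply: eq_bigr => i _.
    by rewrite mxE (dspace_lift_product_test t sk dchi) /fl -/(Sj _) -/w0; ring.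
  rewrite /= -/w0 -/(Sj ord_max) mulrDr mulrDr Ej /fl -/w0 -/(Sj ord_max).
  by ring.
rewrite (RintegralB (@measurable_Qs R n) i1); last first.
  exact: (integrableD (@measurable_Qs R n) i2 i3).
have E4 := RintegralD (@measurable_Qs R n) i2 i3.
rewrite E4 E1 E2 E3.
move=> /eqP; rewrite subr_eq0 => /eqP H.
have ic : leb.-integrable setT (EFin \o (chi : Y -> R)) by exact: intg_continuous_supp cchi suchi.
have [Cc Cc0 hCc] := continuous_bounded_supp cchi suchi.
have mchi : measurable_fun setT (chi : Y -> R) by exact: intg_measurable ic.
have ibd (F : Y -> R) C : 0 <= C -> measurable_fun setT F ->
    (forall y, `|F y| <= C * (1 + mgn G y)) ->
    leb.-integrable setT (EFin \o (fun y => chi y * (Wt a y * F y))).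
  move=> C0 mF Fb.
  suff : leb.-integrable setT (EFin \o (fun y => Wt a y * (chi y * F y))).
    by apply: eq_intg => y; rewrite mulrCA.
  apply: (@intg_Wt_le R n a G ha mG IG _ (Cc * C)); [exact: measurable_funM|exact: mulr_ge0|].
  move=> y; have g0 : 0 <= mgn G y by exact: mgn_ge0.
  rewrite normrM -mulrA ler_pM// (le_trans (Fb y))// ler_wpM2l//.
  by rewrite expr2 ler_peMr ?addr_ge0// lerDl.
have ifl i : leb.-integrable setT (EFin \o (fun y => chi y *
    (Wt a y * conv ('D_(ex R i) k) (fun s => gfl (lift ord_max i) (s, y)) t))).
  have [C C0 [_ _ h _]] := conv_weak_bounds HA mU mG UM (smooth_derive (ex R i) sk)
    (supp_box_derive supk (ex R i)).
  apply: (ibd _ C) => //; first exact: (measurable_conv_flux HA mG (smooth_derive (ex R i) sk)).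
  by move=> y; rewrite (le_trans (h _ _ _))// ler_wpM2l// lerDr.
have ifu : leb.-integrable setT (EFin \o (fun y => chi y *
    (Wt a y * conv ('D_(et R n) k) (fun s => cutU U (s, y)) t))).
  have [C C0 [_ _ _ h]] := conv_weak_bounds HA mU mG UM (smooth_derive (et R n) sk)
    (supp_box_derive supk (et R n)).
  apply: (ibd _ C) => //; first exact: (measurable_conv_cutU mU (smooth_derive (et R n) sk)).
  by move=> y; rewrite (le_trans (h _ _))// ler_peMr// lerDl mgn_ge0.
transitivity (\int[leb]_y (\sum_(i < n) chi y *
    (Wt a y * conv ('D_(ex R i) k) (fun s => gfl (lift ord_max i) (s, y)) t) +
    chi y * (Wt a y * conv ('D_(et R n) k) (fun s => cutU U (s, y)) t))).
  by apply: eq_Rint => y; rewrite mulrDr mulrDr !mulr_sumr.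
rewrite (RintD (intg_sum ifl) ifu) (Rint_sum ifl).
transitivity (\int[leb]_y (chi' y * (Wt a y * conv k (fun s => gfl ord_max (s, y)) t))).
  rewrite H; congr (_ + _); apply: eq_bigr => i _.
  exact/esym/(H2 i).2.
apply: eq_Rint => y; congr (_ * (_ * _)); apply: eq_Rint => s.
by rewrite /gfl (flux_max HA).
Qed.



Lemma intg_vgrad : leb.-integrable setT (EFin \o vgrad).
Proof.
have [C C0 [h _ _ _]] := conv_weak_bounds HA mU mG UM sk supk.
apply: (ibetween C0); first exact: (measurable_conv_g mG sk).
by move=> y; rewrite (le_trans (h _ _ _))// ler_wpM2l// lerDr.
Qed.

Lemma intg_vval : leb.-integrable setT (EFin \o vval).
Proof.
have [C C0 [_ _ _ h]] := conv_weak_bounds HA mU mG UM sk supk.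
apply: (ibetween C0); first exact: (measurable_conv_cutU mU sk).
by move=> y; rewrite (le_trans (h _ _))// ler_peMr// lerDl mgn_ge0.
Qed.

Lemma weak_vgrad (chi chi' : R -> R) al be : 0 < al -> be < b_ -> smooth1 chi ->
  (forall y : R, is_derive y (1 : R) chi (chi' y)) -> supp_in al be chi ->
  \int[leb]_y (vval y * chi' y) = - \int[leb]_y (vgrad y * chi y).
Proof.
move=> al0 beb schi dchi suchi.
have cchi := smooth1_continuous schi.
have cchi' := smooth1_derive_continuous schi dchi.
have suchi' := supp_in_derive dchi suchi.
have := WG (test_plus schi suchi al0 beb) ord_max.
rewrite (_ : (fun z => U z * _) = fun z => U z * (k (t - tang z) * chi' (z.1 0 ord_max))); last first.
  by apply/funext => z; rewrite (dspace_max_product_test k t dchi).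
rewrite (u_slice sk supk cchi' suchi' beb) (g_slice ord_max sk supk cchi suchi beb) => H.
transitivity (\int[leb]_y (chi' y * conv k (fun s => cutU U (s, y)) t)).
  apply: eq_Rint => y; rewrite /vval /between; case: ltP => y0.
    case: ltP => yb; first by rewrite mul1r mulrC.
    by rewrite suchi' ?mulr0 ?mul0r//; right; exact: le_trans (ltW beb) yb.
  by rewrite suchi' ?mulr0 ?mul0r//; left; exact: le_trans y0 (ltW al0).
rewrite H; congr (- _); apply: eq_Rint => y; rewrite /vgrad /between; case: ltP => y0.
  case: ltP => yb; first by rewrite mul1r mulrC.
  by rewrite suchi ?mulr0 ?mul0r//; right; exact: le_trans (ltW beb) yb.
by rewrite suchi ?mulr0 ?mul0r//; left; exact: le_trans y0 (ltW al0).
Qed.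

(** Testing with every w in the height identifies both mollifications, and the fundamental lemma
    does so for almost every height only. *)
Lemma weak_tangential (i : 'I_n) : {ae leb, forall y : Y, 0 < y < b_ ->
  conv ('D_(ex R i) k) (fun s => cutU U (s, y)) t =
  conv k (fun s => g G (lift ord_max i) (s, y)) t}.
Proof.
pose F1 (y : Y) := between 0 b_ y * conv ('D_(ex R i) k) (fun s => cutU U (s, y)) t.
pose F2 (y : Y) := between 0 b_ y * conv k (fun s => g G (lift ord_max i) (s, y)) t.
have iF1 : leb.-integrable setT (EFin \o F1).
  have sk' := smooth_derive (ex R i) sk; have supk' := supp_box_derive supk (ex R i).
  have [C C0 [_ _ _ h]] := conv_weak_bounds HA mU mG UM sk' supk'.
  apply: (ibetween C0); first exact: (measurable_conv_cutU mU sk').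
  by move=> y; rewrite (le_trans (h _ _))// ler_peMr// lerDl mgn_ge0.
have iF2 : leb.-integrable setT (EFin \o F2).
  have [C C0 [h _ _ _]] := conv_weak_bounds HA mU mG UM sk supk.
  apply: (ibetween C0); first exact: (measurable_conv_g mG sk).
  by move=> y; rewrite (le_trans (h _ _ _))// ler_wpM2l// lerDr.
have : {ae leb, forall y : Y, 0 < y < b_ -> F1 y - F2 y = 0}.
  apply: fundamental_lemma => [|w al be al0 beb sw suw]; first exact: intgB.
  have [w' [dw _]] := sw 1%N.
  have cw := smooth1_continuous sw.
  have iw := intg_continuous_supp cw suw.
  have [Cw _ hCw] := continuous_bounded_supp cw suw.
  have imul (F : Y -> R) : leb.-integrable setT (EFin \o F) ->
      leb.-integrable setT (EFin \o (fun y => F y * w y)).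
    move=> iF; apply: (intg_le _ (intgZ Cw (intg_norm iF))).
      by apply: measurable_funM; [exact: intg_measurable iF|exact: intg_measurable iw].
    by move=> y; rewrite normrM mulrC ler_wpM2r.
  transitivity (\int[leb]_y (F1 y * w y - F2 y * w y)).
    by apply: eq_Rint => y; rewrite mulrBl.
  rewrite (RintB (imul _ iF1) (imul _ iF2)).
  have := WG (test_plus sw suw al0 beb) (lift ord_max i).
  rewrite (_ : (fun z => U z * _) = fun z => U z *
      ('D_(ex R i) k (t - tang z) * (- w (z.1 0 ord_max)))); last first.
    by apply/funext => z; rewrite (dspace_lift_product_test t sk dw); congr (_ * _); rewrite mulrN.
  have cNw : continuous (fun y => - w y) by move=> y; apply: continuousN; exact: cw.
  have suNw : supp_in al be (fun y => - w y) by move=> y hy; rewrite suw ?oppr0.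
  rewrite (u_slice (smooth_derive (ex R i) sk) (supp_box_derive supk (ex R i)) cNw suNw beb).
  rewrite (g_slice (lift ord_max i) sk supk cw suw beb) => H.
  have E1 : \int[leb]_y (F1 y * w y) =
      - \int[leb]_y (- w y * conv ('D_(ex R i) k) (fun s => cutU U (s, y)) t).
    rewrite -(RintN (mu := leb)); last first.
      apply: eq_intg (intgN (imul _ iF1)) => y; rewrite /F1 /between; case: ltP => y0.
        case: ltP => yb; first by rewrite mul1r mulNr mulrC.
        by rewrite suw ?(mulr0, mul0r, oppr0)//; right; exact: le_trans (ltW beb) yb.
      by rewrite suw ?(mulr0, mul0r, oppr0)//; left; exact: le_trans y0 (ltW al0).
    apply: eq_Rint => y; rewrite /F1 /between; case: ltP => y0.
      case: ltP => yb; first by rewrite mul1r mulNr opprK mulrC.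
      by rewrite suw ?(mulr0, mul0r, oppr0)//; right; exact: le_trans (ltW beb) yb.
    by rewrite suw ?(mulr0, mul0r, oppr0)//; left; exact: le_trans y0 (ltW al0).
  have E2 : \int[leb]_y (F2 y * w y) =
      \int[leb]_y (w y * conv k (fun s => g G (lift ord_max i) (s, y)) t).
    apply: eq_Rint => y; rewrite /F2 /between; case: ltP => y0.
      case: ltP => yb; first by rewrite mul1r mulrC.
      by rewrite suw ?mulr0 ?mul0r//; right; exact: le_trans (ltW beb) yb.
    by rewrite suw ?mulr0 ?mul0r//; left; exact: le_trans y0 (ltW al0).
  by rewrite E1 E2 H opprK subrr.
apply: filterS => y h yb; have := h yb; rewrite /F1 /F2 between_in// !mul1r.
by move=> /eqP; rewrite subr_eq0 => /eqP.
Qed.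

End weak_identities.

(** * The energy inequality *)

Section energy_identity.
Variables (R : realType) (n : nat) (a Lambda K : R) (A : 'rV[R]_n -> 'M[R]_n.+1).
Hypothesis HA : admissible_coef Lambda K A.
Local Notation leb := (@lebesgue_measure R).
Local Notation Y := (measurableTypeR R).
Local Notation T := ('rV[R]_n * measurableTypeR R)%type.
Local Notation V := ('rV[R]_n * R)%type.
Local Notation Z := ('rV[R]_n.+1 * measurableTypeR R)%type.
Local Notation nu := (lebVt R n).
Local Notation Qs := (@Qs R n).
Local Notation Ds := (@Ds R n).
Local Notation b_ := (b_ R).

Variables (U : Z -> R) (G : Z -> 'rV[R]_n.+1) (M : R).
Hypotheses (ha : -1 < a < 1) (mU : measurable_fun Qs U)
  (mG : forall i, measurable_fun Qs (fun z => G z 0 i))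
  (IG : forall i, (\int[lebVt R n.+1]_(z in Qs) (weight a z.1 * (G z 0 i) ^+ 2)%:E < +oo)%E)
  (UM : forall z, Ds z -> `|U z| <= M).

(** The integrands of [Jint] for which both orders of integration are available: at most quadratic
    in the slice norm [mgn] and carried by a fixed box in (x, t). *)
Definition adm (F : T * Y -> R) := [/\ measurable_fun setT F,
  exists2 C, 0 <= C & forall s y, `|F (s, y)| <= C * (1 + mgn G y) ^+ 2 &
  forall s y, ~ boxT 9 s -> F (s, y) = 0].

Definition Jint (F : T * Y -> R) : R := \int[(nu \x leb)%E]_w (Wt a w.2 * F w).

Let dB (C : R) (y : Y) : R := C * (Wt a y * (1 + mgn G y) ^+ 2).

Let idB C : leb.-integrable setT (EFin \o dB C).
Proof.
apply: intgZ.
apply: (intg_Wt_le ha mG IG (C := 1)) => //.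
  apply: measurable_funX; apply: measurable_funD => //.
  exact: intg_measurable (intg_mgn ha mG IG).
by move=> y; rewrite mul1r ger0_norm// sqr_ge0.
Qed.

Let mW : measurable_fun setT (fun w : T * Y => Wt a w.2).
Proof. exact: (measurableT_comp (intg_measurable (intg_Wt ha)) measurable_snd). Qed.

Let adm_dom F : adm F -> exists C, [/\ measurable_fun setT (fun w => Wt a w.2 * F w),
  nu.-integrable setT (EFin \o (\1_(boxT 9) : T -> R)),
  leb.-integrable setT (EFin \o dB C) &
  forall s y, `|Wt a y * F (s, y)| <= \1_(boxT 9) s * dB C y].
Proof.
move=> [mF [C C0 FC] sF]; exists C; split.
- exact: measurable_funM.
- exact: intg_ind_boxT.
- exact: idB.
move=> s y; have W0 : 0 <= Wt a y by exact: powc_ge0.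
have d0 : 0 <= dB C y by rewrite /dB; apply: mulr_ge0 => //; apply: mulr_ge0 => //; exact: sqr_ge0.
have [hs|hs] := pselect (boxT 9 s); last by rewrite sF// mulr0 normr0 mulr_ge0.
rewrite indicE mem_set// mul1r normrM (ger0_norm W0) /dB mulrCA ler_wpM2l//.
Qed.

Lemma adm_intg F : adm F -> (nu \x leb)%E.-integrable setT (EFin \o (fun w => Wt a w.2 * F w)).
Proof. by move=> /adm_dom[C [h1 h2 h3 h4]]; exact: (dom_product h1 h2 h3 h4). Qed.

Lemma adm_section F s : adm F -> leb.-integrable setT (EFin \o (fun y => Wt a y * F (s, y))).
Proof. by move=> /adm_dom[C [h1 h2 h3 h4]]; exact: (dom_section1 h1 h3 h4). Qed.

(** For integrations by parts in x and t, made at a fixed height. *)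
Lemma Jint_eq_y F F' : adm F -> adm F' ->
  (forall y, 0 < y < 3 -> \int[nu]_s F (s, y) = \int[nu]_s F' (s, y)) -> Jint F = Jint F'.
Proof.
move=> aF aF' H.
have key F1 : adm F1 -> Jint F1 = \int[leb]_y (Wt a y * \int[nu]_s F1 (s, y)).
  move=> aF1; have [C [h1 h2 h3 h4]] := adm_dom aF1.
  have E := dom_fubini2 h1 h2 h3 h4.
  rewrite /Jint E; apply: eq_Rint => y /=.
  apply: RintZ; have [mF [C1 C10 FC] sF] := aF1.
  apply: (@intg_bounded_box _ _ _ 9 (C1 * (1 + mgn G y) ^+ 2)).
  - exact: (measurable_fun_pair1 y mF).
  - by move=> s hs; exact: sF.
  - by move=> s; exact: FC.
rewrite (key _ aF) (key _ aF'); apply: eq_Rint => y.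
have [h|h] := boolP (0 < y < 3); first by rewrite H.
by rewrite /Wt powc_out// !mul0r.
Qed.

(** For identities that need integration over the height, at a fixed (x, t). *)
Lemma Jint_eq_t F F' : adm F -> adm F' ->
  (forall s, \int[leb]_y (Wt a y * F (s, y)) = \int[leb]_y (Wt a y * F' (s, y))) ->
  Jint F = Jint F'.
Proof.
move=> aF aF' H.
have key F1 : adm F1 -> Jint F1 = \int[nu]_s \int[leb]_y (Wt a y * F1 (s, y)).
  move=> aF1; have [C [h1 h2 h3 h4]] := adm_dom aF1.
  exact: (dom_fubini1 h1 h2 h3 h4).
by rewrite (key _ aF) (key _ aF'); exact: eq_Rint.
Qed.

Lemma Jint_eq F F' : (forall w, F w = F' w) -> Jint F = Jint F'.
Proof. by move=> /funext ->. Qed.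

Lemma JintD F F' : adm F -> adm F' -> Jint (fun w => F w + F' w) = Jint F + Jint F'.
Proof.
move=> aF aF'; have E := RintD (adm_intg aF) (adm_intg aF').
by rewrite /Jint -E; apply: eq_Rint => w; rewrite mulrDr.
Qed.

Lemma JintZ c F : adm F -> Jint (fun w => c * F w) = c * Jint F.
Proof.
move=> aF; have E := RintZ c (adm_intg aF).
by rewrite /Jint -E; apply: eq_Rint => w; rewrite mulrCA.
Qed.

Lemma JintN F : adm F -> Jint (fun w => - F w) = - Jint F.
Proof.
move=> aF; rewrite -mulN1r -JintZ//.
by apply: Jint_eq => w; rewrite mulN1r.
Qed.

Lemma le_Jint F F' : adm F -> adm F' -> (forall w, 0 < w.2 < 3 -> F w <= F' w) -> Jint F <= Jint F'.
Proof.
move=> aF aF' H; apply: le_Rint; [exact: adm_intg|exact: adm_intg|] => w.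
have [h|h] := boolP (0 < w.2 < 3); first by rewrite ler_wpM2l ?H// powc_ge0.
by rewrite /Wt powc_out// !mul0r.
Qed.

Lemma admD F F' : adm F -> adm F' -> adm (fun w => F w + F' w).
Proof.
move=> [mF [C C0 FC] sF] [mF' [C' C'0 FC'] sF']; split; first exact: measurable_funD.
  exists (C + C'); first exact: addr_ge0.
  by move=> s y; rewrite mulrDl (le_trans (ler_normD _ _))// lerD.
by move=> s y hs; rewrite sF// sF'// addr0.
Qed.

Lemma admZ c F : adm F -> adm (fun w => c * F w).
Proof.
move=> [mF [C C0 FC] sF]; split; first exact: measurable_funM.
  exists (`|c| * C); first exact: mulr_ge0.
  by move=> s y; rewrite normrM -mulrA ler_wpM2l.
by move=> s y hs; rewrite sF// mulr0.
Qed.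

Lemma admN F : adm F -> adm (fun w => - F w).
Proof.
move=> aF; rewrite (_ : (fun w => _) = fun w => (-1) * F w); first exact: admZ.
by apply/funext => w; rewrite mulN1r.
Qed.

Lemma adm0 : adm (fun=> 0).
Proof.
split=> //.
by exists 0 => // s y; rewrite normr0 mul0r.
Qed.

Lemma adm_sum (I : finType) (F : I -> T * Y -> R) : (forall i, adm (F i)) ->
  adm (fun w => \sum_i F i w).
Proof.
move=> aF; elim: (index_enum I) => [|i s IH].
  rewrite (_ : (fun w => _) = fun=> 0); first exact: adm0.
  by apply/funext => w; rewrite big_nil.
rewrite (_ : (fun w => _) = fun w => F i w + \sum_(j <- s) F j w); first exact: admD.
by apply/funext => w; rewrite big_cons.
Qed.

Lemma Jint_sum (I : finType) (F : I -> T * Y -> R) : (forall i, adm (F i)) ->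
  Jint (fun w => \sum_i F i w) = \sum_i Jint (F i).
Proof.
move=> aF; have E := Rint_sum (fun i => adm_intg (aF i)).
by rewrite /Jint -E; apply: eq_Rint => w; rewrite mulr_sumr.
Qed.

(* F = O((1 + mgn)^k) uniformly in (x, t); the weighted integrals converge for
   k <= 2. *)
Definition gro (k : nat) (F : T * Y -> R) := measurable_fun setT F /\
  exists2 C, 0 <= C & forall s y, `|F (s, y)| <= C * (1 + mgn G y) ^+ k.

Lemma groM k l F F' : gro k F -> gro l F' -> gro (k + l) (fun w => F w * F' w).
Proof.
move=> [mF [C C0 FC]] [mF' [C' C'0 FC']]; split; first exact: measurable_funM.
exists (C * C'); first exact: mulr_ge0.
move=> s y; rewrite normrM exprD mulrACA.
by rewrite ler_pM.
Qed.

Lemma groD k F F' : gro k F -> gro k F' -> gro k (fun w => F w + F' w).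
Proof.
move=> [mF [C C0 FC]] [mF' [C' C'0 FC']]; split; first exact: measurable_funD.
exists (C + C'); first exact: addr_ge0.
by move=> s y; rewrite mulrDl (le_trans (ler_normD _ _))// lerD.
Qed.

Lemma gro_le k l F : (k <= l)%N -> gro k F -> gro l F.
Proof.
move=> kl [mF [C C0 FC]]; split => //; exists C => // s y.
apply: le_trans (FC s y) _; rewrite ler_wpM2l// ler_weXn2l// lerDl.
exact: mgn_ge0.
Qed.

Lemma gro_adm F F' : gro 2 F -> (forall w, F' w = F w) ->
  (forall s y, ~ boxT 9 s -> F' (s, y) = 0) -> adm F'.
Proof. by move=> [mF bF] /funext -> sF; split. Qed.

End energy_identity.

Lemma normr_between_le1 (R : realType) (al be u : R) : `|between al be u| <= 1.
Proof.
rewrite /between; case: ltP => _; last by rewrite normr0.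
by case: ltP => _; rewrite ?normr1 ?normr0.
Qed.

(** * The vertical part of the energy identity *)

Section vertical_energy.
Variables (R : realType) (n : nat) (a Lambda K : R) (A : 'rV[R]_n -> 'M[R]_n.+1).
Hypothesis HA : admissible_coef Lambda K A.
Local Notation leb := (@lebesgue_measure R).
Local Notation Y := (measurableTypeR R).
Local Notation T := ('rV[R]_n * measurableTypeR R)%type.
Local Notation V := ('rV[R]_n * R)%type.
Local Notation Z := ('rV[R]_n.+1 * measurableTypeR R)%type.
Local Notation nu := (lebVt R n).
Local Notation Phi := (@Phi R n).
Local Notation Qs := (@Qs R n).
Local Notation Ds := (@Ds R n).
Local Notation b_ := (b_ R).

Variables (U : Z -> R) (G : Z -> 'rV[R]_n.+1) (M : R).
Hypotheses (ha : -1 < a < 1) (mU : measurable_fun Qs U)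
  (mG : forall i, measurable_fun Qs (fun z => G z 0 i))
  (IG : forall i, (\int[lebVt R n.+1]_(z in Qs) (weight a z.1 * (G z 0 i) ^+ 2)%:E < +oo)%E)
  (UM : forall z, Ds z -> `|U z| <= M).
Hypotheses (WG : is_weak_grad Qs U G)
  (WS : forall phi, test_function (cyl (eball 4) `]0, 16[%classic) phi ->
    \int[lebVt R n.+1]_(z in Qs)
      (weight a z.1 * (mxform (A (col' ord_max z.1)) (G z) (grad phi z)
                       + U z * dtime phi z)) = 0).


Variables (k : V -> R) (e : R).
Hypotheses (sk : smooth k) (supk : supp_box e k).

Definition pk (w : T * Y) := conv k (fun s => cutU U (s, w.2)) w.1.
Definition dpk (v : V) (w : T * Y) := conv ('D_v k) (fun s => cutU U (s, w.2)) w.1.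
Definition gk i (w : T * Y) := conv k (fun s => g G i (s, w.2)) w.1.
Definition qk i (w : T * Y) := conv k (fun s => flux A G i (s, w.2)) w.1.
Definition dqk i (v : V) (w : T * Y) := conv ('D_v k) (fun s => flux A G i (s, w.2)) w.1.

Local Notation gro := (gro G).

Lemma gro_pk : gro 0 pk.
Proof.
have [C C0 [_ _ _ h]] := conv_weak_bounds HA mU mG UM sk supk.
split; first exact: (measurable_conv sk (measurable_cutU mU)).
by exists C => // s y; rewrite expr0 mulr1; exact: h.
Qed.

Lemma gro_dpk v : gro 0 (dpk v).
Proof.
have sk' := smooth_derive v sk; have supk' := supp_box_derive supk v.
have [C C0 [_ _ _ h]] := conv_weak_bounds HA mU mG UM sk' supk'.
split; first exact: (measurable_conv sk' (measurable_cutU mU)).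
by exists C => // s y; rewrite expr0 mulr1; exact: h.
Qed.

Lemma gro_gk i : gro 1 (gk i).
Proof.
have [C C0 [h _ _ _]] := conv_weak_bounds HA mU mG UM sk supk.
split; first exact: (measurable_conv sk (measurable_g mG i)).
by exists C => // s y; rewrite expr1 (le_trans (h _ _ _))// ler_wpM2l// lerDr.
Qed.

Lemma gro_qk i : gro 1 (qk i).
Proof.
have [C C0 [_ _ h _]] := conv_weak_bounds HA mU mG UM sk supk.
split; first exact: (measurable_conv sk (measurable_flux HA mG i)).
by exists C => // s y; rewrite expr1 (le_trans (h _ _ _))// ler_wpM2l// lerDr.
Qed.

Lemma gro_dqk i v : gro 1 (dqk i v).
Proof.
have sk' := smooth_derive v sk; have supk' := supp_box_derive supk v.
have [C C0 [_ _ h _]] := conv_weak_bounds HA mU mG UM sk' supk'.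
split; first exact: (measurable_conv sk' (measurable_flux HA mG i)).
by exists C => // s y; rewrite expr1 (le_trans (h _ _ _))// ler_wpM2l// lerDr.
Qed.

Definition gkn (w : T * Y) := conv k (fun s => gn G (s, w.2)) w.1.

Lemma gro_gkn : gro 1 gkn.
Proof.
have [C C0 [_ h _ _]] := conv_weak_bounds HA mU mG UM sk supk.
split; first exact: (measurable_conv sk (measurable_gn mG)).
by exists C => // s y; rewrite expr1 (le_trans (h _ _))// ler_wpM2l// lerDr.
Qed.

(** An instance of [vertical_identity] with b = [b_] and b0 = 2: the cut-off vanishes above the
    radius 2, strictly below the height up to which the equation is known. *)
Lemma vertical_energy (t : T) (zeta zeta' : R -> R) : good e t ->
  (forall y : R, is_derive y (1 : R) zeta (zeta' y)) -> continuous zeta' ->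
  supp_in (- 2) 2 zeta -> supp_in (- 2) 2 zeta' ->
  \int[leb]_y (Wt a y * (zeta y * pk (t, y) *
     (\sum_(i < n) dqk (lift ord_max i) (ex R i) (t, y) + dpk (et R n) (t, y)))) =
  \int[leb]_y (Wt a y * (gk ord_max (t, y) *
     (zeta y * gk ord_max (t, y) + zeta' y * pk (t, y)))).
Proof.
move=> gt dz cz' sz sz'.
have b0 : (0 : R) < 2 by rewrite ltr0n.
have b0b : 2 < b_ by rewrite /b_; lra.
have iB := @intg_ind R b_.
have mB := intg_measurable iB.
have [_ [Cp Cp0 hp]] := gro_pk.
have iWt F : gro 2 F -> leb.-integrable setT (EFin \o (fun y => between 0 b_ y * (Wt a y * F (t, y)))).
  move=> [mF [C C0 FC]].
  suff : leb.-integrable setT (EFin \o (fun y => Wt a y * (between 0 b_ y * F (t, y)))).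
    by apply: eq_intg => y; rewrite mulrCA.
  apply: (intg_Wt_le ha mG IG (C := C)) => //.
    by apply: measurable_funM => //; exact: (measurable_fun_pair2 t mF).
  by move=> y; apply: le_trans (FC t y); rewrite normrM ler_piMl// normr_between_le1.
have iP : leb.-integrable setT (EFin \o divflux a A U G k t).
  have i1 i := iWt _ (gro_le (leqnSn 1) (gro_dqk (lift ord_max i) (ex R i))).
  have i2 := iWt _ (gro_le (leq0n 2) (gro_dpk (et R n))).
  apply: eq_intg (intgD (intg_sum i1) i2) => y.
  by rewrite /divflux !mulrDr !mulr_sumr.
have ir : leb.-integrable setT (EFin \o vflux a G k t).
  exact: (iWt _ (gro_le (leqnSn 1) (gro_gk ord_max))).
have irg : leb.-integrable setT (EFin \o (fun y => vflux a G k t y * vgrad G k t y)).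
  have := iWt _ (groM (gro_gk ord_max) (gro_gk ord_max)).
  apply: eq_intg => y; rewrite /vflux /vgrad /between /gk.
  case: ltP => _; last by rewrite !mul0r.
  by case: ltP => _; rewrite ?mul0r// !mul1r; ring.
have bp y : `|vval U k t y| <= Cp.
  have := hp t y; rewrite expr0 mulr1; apply: le_trans.
  by rewrite /vval normrM ler_piMl// normr_between_le1.
have b0F (F : R -> R) y : ~~ (0 < y < b_) -> between 0 b_ y * F y = 0.
  by move=> h; rewrite /between; case: ltP => h1; rewrite ?mul0r//; case: ltP => h2;
    rewrite ?mul0r//; move: h; rewrite h1 h2.
have v1 y : ~~ (0 < y < b_) -> vflux a G k t y = 0 by move=> h; exact: (b0F (fun=> _) y h).
have v2 y : ~~ (0 < y < b_) -> divflux a A U G k t y = 0 by move=> h; exact: (b0F (fun=> _) y h).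
have v3 y : ~~ (0 < y < b_) -> vgrad G k t y = 0 by move=> h; exact: (b0F (fun=> _) y h).
have v4 y : ~~ (0 < y < b_) -> vval U k t y = 0 by move=> h; exact: (b0F (fun=> _) y h).
have := @vertical_identity R b_ 2 Cp (divflux a A U G k t) (vflux a G k t) (vgrad G k t)
  (vval U k t) b0 b0b iP ir (intg_vgrad HA ha mU mG IG UM t sk supk)
  (intg_vval HA ha mU mG IG UM t sk supk) bp irg
  v1 v2 v3 v4
  (fun chi chi' c cb sc dc suc => weak_vertical HA ha mU mG IG UM WS sk supk gt cb sc dc suc)
  (fun chi chi' al be al0 beb sc dc suc => weak_vgrad ha mU mG IG UM WG sk supk gt al0 beb sc dc suc)
  zeta zeta' dz cz' sz sz'.
have zero (y : R) : ~~ (0 < y < b_) -> Wt a y * zeta y = 0 /\ Wt a y * zeta' y = 0.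
  rewrite negb_and -!leNgt => /orP[h|h].
    by rewrite /Wt powc_out ?mul0r// negb_and -leNgt h.
  by rewrite sz ?sz' ?mulr0//; right; exact: le_trans (ltW b0b) h.
move=> H; transitivity (\int[leb]_y (divflux a A U G k t y * (zeta y * vval U k t y))).
  apply: eq_Rint => y; rewrite /divflux /vval /pk /dqk /dpk /=.
  have [h|h] := boolP (0 < y < b_); first by rewrite between_in// !mul1r; ring.
  by rewrite -!mulrA [LHS]mulrA (zero _ h).1 mul0r !(b0F (fun=> _) y h).
rewrite H; apply: eq_Rint => y.
have [h|h] := boolP (0 < y < b_).
  by rewrite /vflux /vgrad /vval /gk /pk /= between_in// !mul1r mulrA.
have [z1 z2] := zero _ h; rewrite v1// mul0r.
transitivity ((Wt a y * zeta y) * (gk ord_max (t, y) * gk ord_max (t, y)) +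
    (Wt a y * zeta' y) * (gk ord_max (t, y) * pk (t, y))); last by ring.
by rewrite z1 z2 !mul0r addr0.
Qed.

End vertical_energy.

(** * The energy identity for the mollified solution *)

Section energy_equality.
Variables (R : realType) (n : nat) (a Lambda K : R) (A : 'rV[R]_n -> 'M[R]_n.+1).
Hypothesis HA : admissible_coef Lambda K A.
Local Notation leb := (@lebesgue_measure R).
Local Notation Y := (measurableTypeR R).
Local Notation T := ('rV[R]_n * measurableTypeR R)%type.
Local Notation V := ('rV[R]_n * R)%type.
Local Notation Z := ('rV[R]_n.+1 * measurableTypeR R)%type.
Local Notation nu := (lebVt R n).
Local Notation Phi := (@Phi R n).
Local Notation Qs := (@Qs R n).
Local Notation Ds := (@Ds R n).
Local Notation b_ := (b_ R).

Variables (U : Z -> R) (G : Z -> 'rV[R]_n.+1) (M : R).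
Hypotheses (ha : -1 < a < 1) (mU : measurable_fun Qs U)
  (mG : forall i, measurable_fun Qs (fun z => G z 0 i))
  (IG : forall i, (\int[lebVt R n.+1]_(z in Qs) (weight a z.1 * (G z 0 i) ^+ 2)%:E < +oo)%E)
  (UM : forall z, Ds z -> `|U z| <= M).
Hypotheses (WG : is_weak_grad Qs U G)
  (WS : forall phi, test_function (cyl (eball 4) `]0, 16[%classic) phi ->
    \int[lebVt R n.+1]_(z in Qs)
      (weight a z.1 * (mxform (A (col' ord_max z.1)) (G z) (grad phi z)
                       + U z * dtime phi z)) = 0).


Variables (k : V -> R) (e : R).
Hypotheses (sk : smooth k) (supk : supp_box e k).

Local Notation gro := (gro G).
Local Notation adm := (adm G).
Local Notation Jint := (Jint a).
Local Notation pk := (pk U k).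
Local Notation dpk := (dpk U k).
Local Notation gk := (gk G k).
Local Notation qk := (qk A G k).
Local Notation dqk := (dqk A G k).

(** z is the whole cut-off, later om eta^2, with its derivatives in t, y and x_i. By [zsup] it
    vanishes unless the kernel at s stays where the equation is known. *)
Variables (z zt zy : T * Y -> R) (zi : 'I_n -> T * Y -> R).
Hypotheses (gz : gro 0 z) (gzt : gro 0 zt) (gzy : gro 0 zy) (gzi : forall i, gro 0 (zi i)).
Hypotheses
  (dzi : forall i (y : R) (t : V), is_derive t (ex R i) (fun s : V => z (s, y)) (zi i (t, y)))
  (dzt : forall (y : R) (t : V), is_derive t (et R n) (fun s : V => z (s, y)) (zt (t, y)))
  (dzy : forall (t : T) (y : R), is_derive y (1 : R) (fun y : R => z (t, y)) (zy (t, y)))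
  (czy : forall t : T, continuous (fun y : R => zy (t, y)))
  (zsup : forall s, ~ (boxT 9 s /\ good e s) -> forall y : Y,
    [/\ z (s, y) = 0, zt (s, y) = 0, zy (s, y) = 0 & forall i, zi i (s, y) = 0])
  (zy2 : forall t : T, supp_in (- 2) 2 (fun y => z (t, y)))
  (zyy2 : forall t : T, supp_in (- 2) 2 (fun y => zy (t, y))).

Let gp := gro_pk HA mU mG UM sk supk.
Let gdp v := gro_dpk HA mU mG UM sk supk v.
Let gg i := gro_gk HA mU mG UM sk supk i.
Let gq i := gro_qk HA mU mG UM sk supk i.
Let gdq i v := gro_dqk HA mU mG UM sk supk i v.

Let nbox (s : T) : ~ boxT 9 s -> ~ (boxT 9 s /\ good e s).
Proof. by move=> h []. Qed.

Let dpkE (v t : V) (y : Y) : is_derive t v (fun s : V => pk (s, y)) (dpk v (t, y)).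
Proof. exact: (@conv_is_derive R n k e _ t v sk supk (slice_cutU mU UM y)). Qed.

Let aF1 : adm (fun w => z w * pk w * (\sum_(i < n) dqk (lift ord_max i) (ex R i) w + dpk (et R n) w)).
Proof.
have [mS [C C0 hS]] : gro 2 (fun w => \sum_(i < n) dqk (lift ord_max i) (ex R i) w + dpk (et R n) w).
  apply: groD; last exact: gro_le (gdp _).
  elim: (index_enum 'I_n) => [|i s IH].
    split; first by rewrite (_ : (fun w => _) = fun=> 0)//; apply/funext => w; rewrite big_nil.
    by exists 0 => // s y; rewrite big_nil normr0 mul0r.
  rewrite (_ : (fun w => _) = fun w => dqk (lift ord_max i) (ex R i) w +
      \sum_(j <- s) dqk (lift ord_max j) (ex R j) w).
    by apply: groD => //; exact: gro_le (gdq _ _).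
  by apply/funext => w; rewrite big_cons.
apply: (gro_adm (groM (groM gz gp) (conj mS (ex_intro2 _ _ C C0 hS)))) => // s y hs.
by have [-> _ _ _] := zsup (nbox hs) y; rewrite !mul0r.
Qed.

Let a2 i j : adm (fun w => z w * (gk i w * qk j w)).
Proof.
apply: (gro_adm (groM gz (groM (gg i) (gq j)))) => // s y hs.
by have [-> _ _ _] := zsup (nbox hs) y; rewrite !mul0r.
Qed.

Let a2' i : adm (fun w => z w * (gk i w * gk i w)).
Proof.
apply: (gro_adm (groM gz (groM (gg i) (gg i)))) => // s y hs.
by have [-> _ _ _] := zsup (nbox hs) y; rewrite !mul0r.
Qed.

Let a3 i j : adm (fun w => zi i w * (pk w * qk j w)).
Proof.
apply: (gro_adm (gro_le (leqnSn 1) (groM (gzi i) (groM gp (gq j))))) => // s y hs.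
by have [_ _ _ ->] := zsup (nbox hs) y; rewrite !mul0r.
Qed.

Let a3' i : adm (fun w => zy w * (pk w * gk i w)).
Proof.
apply: (gro_adm (gro_le (leqnSn 1) (groM gzy (groM gp (gg i))))) => // s y hs.
by have [_ _ -> _] := zsup (nbox hs) y; rewrite !mul0r.
Qed.

Let a4 : adm (fun w => zt w * (pk w * pk w)).
Proof.
apply: (gro_adm (gro_le (leq0n 2) (groM gzt (groM gp gp)))) => // s y hs.
by have [_ -> _ _] := zsup (nbox hs) y; rewrite !mul0r.
Qed.

Let a5 v : adm (fun w => z w * (pk w * dpk v w)).
Proof.
apply: (gro_adm (gro_le (leq0n 2) (groM gz (groM gp (gdp v))))) => // s y hs.
by have [-> _ _ _] := zsup (nbox hs) y; rewrite !mul0r.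
Qed.

Let a6 i v : adm (fun w => z w * (pk w * dqk i v w)).
Proof.
apply: (gro_adm (gro_le (leqnSn 1) (groM gz (groM gp (gdq i v))))) => // s y hs.
by have [-> _ _ _] := zsup (nbox hs) y; rewrite !mul0r.
Qed.

Let a7 i v : adm (fun w => z w * (dpk v w * qk i w)).
Proof.
apply: (gro_adm (gro_le (leqnSn 1) (groM gz (groM (gdp v) (gq i))))) => // s y hs.
by have [-> _ _ _] := zsup (nbox hs) y; rewrite !mul0r.
Qed.

(** The tangential and time terms are exchanged for the vertical flux at every good (x, t);
    elsewhere the cut-off vanishes on the whole vertical line. *)
Let step_vertical :
  Jint (fun w => z w * pk w * (\sum_(i < n) dqk (lift ord_max i) (ex R i) w + dpk (et R n) w)) =
  Jint (fun w => z w * (gk ord_max w * gk ord_max w) + zy w * (pk w * gk ord_max w)).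
Proof.
apply: (Jint_eq_t ha mG IG aF1 (admD (a2' ord_max) (a3' ord_max))) => s.
have [h|h] := pselect (boxT 9 s /\ good e s); last first.
  by apply: eq_Rint => y; have [-> _ -> _] := zsup h y; rewrite !mul0r addr0.
have := vertical_energy HA ha mU mG IG UM WG WS sk supk h.2 (dzy s) (@czy s) (@zy2 s) (@zyy2 s).
move=> ->; apply: eq_Rint => y; congr (_ * _); ring.
Qed.

Let bnd0 F (y : Y) : gro 0 F -> exists2 C, 0 <= C & forall s, `|F (s, y)| <= C.
Proof.
by move=> [_ [C C0 h]]; exists C => // s; have := h s y; rewrite expr0 mulr1.
Qed.

(** At a fixed height the derivative moves from the kernel of the flux to z p. It lands on p as
    [dpk], still the derivative of the kernel and not yet the weak gradient. *)
Let step_x i : Jint (fun w => z w * (pk w * dqk (lift ord_max i) (ex R i) w)) =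
  Jint (fun w => - (zi i w * (pk w * qk (lift ord_max i) w) +
                    z w * (dpk (ex R i) w * qk (lift ord_max i) w))).
Proof.
apply: (Jint_eq_y ha mG IG (a6 _ _) (admN (admD (a3 _ _) (a7 _ _)))) => y y3.
have [C1 C10 h1] := bnd0 y gz; have [C2 C20 h2] := bnd0 y (gzi i).
have [C3 C30 h3] := bnd0 y gp; have [C4 C40 h4] := bnd0 y (gdp (ex R i)).
pose b (s : T) := z (s, y) * pk (s, y).
pose b' (s : T) := z (s, y) * dpk (ex R i) (s, y) + pk (s, y) * zi i (s, y).
have H := @conv_ibp R n k e b b' (fun s => flux A G (lift ord_max i) (s, y)) (ex R i) 9
  (C1 * C3 + (C1 * C4 + C3 * C2)) sk supk.
have mz := measurable_fun_pair1 y gz.1; have mzi := measurable_fun_pair1 y (gzi i).1.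
have mp := measurable_fun_pair1 y gp.1; have mdp := measurable_fun_pair1 y (gdp (ex R i)).1.
transitivity (\int[nu]_s (b s * conv ('D_(ex R i) k) (fun s => flux A G (lift ord_max i) (s, y)) s)).
  by apply: eq_Rint => s; rewrite /b mulrA.
have db (t : V) : is_derive t (ex R i) (b : V -> R) (b' t).
  exact: (is_deriveM (dzi i y t) (dpkE (ex R i) t y)).
rewrite (H db); last 7 first.
- move=> t; rewrite normrM (@le_trans _ _ (C1 * C3))// ?ler_pM// lerDl.
  by rewrite addr_ge0// mulr_ge0.
- move=> t; rewrite (@le_trans _ _ (C1 * C4 + C3 * C2))//; last by rewrite lerDr mulr_ge0.
  by rewrite (le_trans (ler_normD _ _))// !normrM lerD// ler_pM.
- by move=> t ht; rewrite /b; have [-> _ _ _] := zsup (nbox ht) y; rewrite mul0r.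
- by move=> t ht; rewrite /b'; have [-> _ _ ->] := zsup (nbox ht) y; rewrite mul0r mulr0 addr0.
- exact: measurable_funM.
- by apply: measurable_funD; exact: measurable_funM.
- exact: (slice_flux HA mG).
rewrite -RintN; last first.
  apply: (@intg_le _ _ _ _ _ (fun s => (C1 * C4 + C3 * C2) * `|qk (lift ord_max i) (s, y)| * \1_(boxT 9) s)).
  - apply: measurable_funM; last exact: (measurable_fun_pair1 y (gq (lift ord_max i)).1).
    by apply: measurable_funD; exact: measurable_funM.
  - have [mq [C5 C50 h5]] := gq (lift ord_max i).
    apply: (@intg_bounded_box _ _ _ 9 ((C1 * C4 + C3 * C2) * (C5 * (1 + mgn G y)))).
    + apply: measurable_funM; last exact: (intg_measurable (@intg_ind_boxT R n 9)).
      apply: measurable_funM => //; apply: measurableT_comp => //.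
      exact: (measurable_fun_pair1 y mq).
    + by move=> t ht; rewrite indicE memNset// mulr0.
    + move=> t; have D0 : 0 <= C1 * C4 + C3 * C2 by rewrite addr_ge0// mulr_ge0.
      have h6 := h5 t y; rewrite expr1 in h6.
      rewrite indicE; case: (_ \in _); last first.
        by rewrite mulr0 normr0 mulr_ge0// mulr_ge0// addr_ge0// mgn_ge0.
      by rewrite mulr1 normrM (ger0_norm D0) normr_id ler_wpM2l.
  - move=> s; have [hs|hs] := pselect (boxT 9 s); last first.
      rewrite /b'; have [-> _ _ ->] := zsup (nbox hs) y.
      by rewrite mul0r mulr0 addr0 mul0r normr0 indicE memNset// mulr0.
    rewrite indicE mem_set// mulr1 normrM ler_wpM2r// /b'.
    by rewrite (le_trans (ler_normD _ _))// !normrM lerD// ler_pM.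
by apply: eq_Rint => s; rewrite /b' /qk /=; ring.
Qed.

(** 2 z p p_t + z_t p^2 is the time derivative of z p^2, whose integral vanishes. *)
Let step_t : Jint (fun w => z w * (pk w * dpk (et R n) w)) =
  Jint (fun w => - 2^-1 * (zt w * (pk w * pk w))).
Proof.
apply: (Jint_eq_y ha mG IG (a5 _) (admZ _ a4)) => y y3.
have [C1 C10 h1] := bnd0 y gz; have [C2 C20 h2] := bnd0 y gzt.
have [C3 C30 h3] := bnd0 y gp; have [C4 C40 h4] := bnd0 y (gdp (et R n)).
have mz := measurable_fun_pair1 y gz.1; have mzt := measurable_fun_pair1 y gzt.1.
have mp := measurable_fun_pair1 y gp.1; have mdp := measurable_fun_pair1 y (gdp (et R n)).1.
pose f1 (s : T) := z (s, y) * (pk (s, y) * dpk (et R n) (s, y)).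
pose f2 (s : T) := zt (s, y) * (pk (s, y) * pk (s, y)).
have i1 : nu.-integrable setT (EFin \o f1).
  apply: (@intg_bounded_box _ _ _ 9 (C1 * (C3 * C4))).
  - by apply: measurable_funM => //; exact: measurable_funM.
  - by move=> t ht; rewrite /f1; have [-> _ _ _] := zsup (nbox ht) y; rewrite mul0r.
  - by move=> t; rewrite /f1 !normrM ler_pM// ler_pM.
have i2 : nu.-integrable setT (EFin \o f2).
  apply: (@intg_bounded_box _ _ _ 9 (C2 * (C3 * C3))).
  - by apply: measurable_funM => //; exact: measurable_funM.
  - by move=> t ht; rewrite /f2; have [_ -> _ _] := zsup (nbox ht) y; rewrite mul0r.
  - by move=> t; rewrite /f2 !normrM ler_pM// ler_pM.
pose g0 (s : T) := z (s, y) * (pk (s, y) * pk (s, y)).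
have [] := @int_derive_eq0 R n g0 (fun s => 2 * f1 s + f2 s) (et R n) 9
  (2 * (C1 * (C3 * C4)) + C2 * (C3 * C3)).
- move=> t; have d := is_deriveM (dzt y t) (is_deriveM (dpkE (et R n) t y) (dpkE (et R n) t y)).
  have -> : 2 * f1 t + f2 t = z (t, y) *: (pk (t, y) *: dpk (et R n) (t, y) +
     pk (t, y) *: dpk (et R n) (t, y)) + (pk (t, y) * pk (t, y)) *: zt (t, y).
    by rewrite /f1 /f2 /GRing.scale/=; ring.
  exact: d.
- move=> t; rewrite (le_trans (ler_normD _ _))// lerD// /f1 /f2 !normrM; last by rewrite ler_pM// ler_pM.
  by rewrite ger0_norm// ler_wpM2l// ler_pM// ler_pM.
- apply: (@intg_bounded_box _ _ _ 9 (C1 * (C3 * C3))).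
  + by apply: measurable_funM => //; exact: measurable_funM.
  + by move=> t ht; rewrite /g0; have [-> _ _ _] := zsup (nbox ht) y; rewrite mul0r.
  + by move=> t; rewrite /g0 !normrM ler_pM// ler_pM.
- by move=> t ht; rewrite /g0; have [-> _ _ _] := zsup (nbox ht) y; rewrite mul0r.
move=> _; rewrite (RintD (intgZ 2 i1) i2) (RintZ 2 i1) => E.
rewrite (RintZ (- 2^-1) i2); change (\int[nu]_s f1 s = - 2^-1 * \int[nu]_s f2 s).
move: E; move: (\int[nu]_s f1 s) (\int[nu]_s f2 s) => I1 I2 E; lra.
Qed.

(** The derivative of the mollified U is the mollified gradient at almost every height, which
    suffices under the integral. *)
Let step_ae i : Jint (fun w => z w * (dpk (ex R i) w * qk (lift ord_max i) w)) =
  Jint (fun w => z w * (gk (lift ord_max i) w * qk (lift ord_max i) w)).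
Proof.
apply: (Jint_eq_t ha mG IG (a7 _ _) (a2 _ _)) => s.
have [h|h] := pselect (boxT 9 s /\ good e s); last first.
  by apply: eq_Rint => y; have [-> _ _ _] := zsup h y; rewrite !mul0r.
apply: Rint_ae.
- exact: intg_measurable (adm_section ha mG IG s (a7 _ _)).
- exact: intg_measurable (adm_section ha mG IG s (a2 _ _)).
apply: filterS (weak_tangential HA ha mU mG IG UM WG sk supk h.2 i) => y hy.
have [h1|h1] := boolP (0 < y < b_); first by rewrite /dpk /gk /= (hy h1).
move: h1; rewrite negb_and -!leNgt => /orP[h1|h1].
  by rewrite /Wt powc_out ?mul0r// negb_and -leNgt h1.
have -> : z (s, y) = 0.
  by apply: zy2; right; apply: le_trans h1; rewrite /b_; lra.
by rewrite !mul0r.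
Qed.

(** The mollified equation tested with z p. On the right stands the mollified flux, not A applied to
    the mollified gradient; their difference is the commutator treated below. *)
Lemma energy_equality :
  - 2^-1 * Jint (fun w => zt w * (pk w * pk w)) =
  \sum_(i < n) Jint (fun w => qk (lift ord_max i) w * (zi i w * pk w + z w * gk (lift ord_max i) w)) +
  Jint (fun w => gk ord_max w * (zy w * pk w + z w * gk ord_max w)).
Proof.
have E1 : Jint (fun w => z w * pk w * (\sum_(i < n) dqk (lift ord_max i) (ex R i) w + dpk (et R n) w)) =
    \sum_(i < n) Jint (fun w => z w * (pk w * dqk (lift ord_max i) (ex R i) w)) +
    Jint (fun w => z w * (pk w * dpk (et R n) w)).
  rewrite -(Jint_sum ha mG IG (fun i => a6 (lift ord_max i) (ex R i))).
  rewrite -(JintD ha mG IG (adm_sum (fun i => a6 (lift ord_max i) (ex R i))) (a5 _)).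
  apply: Jint_eq => w; rewrite mulrDr mulr_sumr; congr (_ + _); last by rewrite mulrA.
  by apply: eq_bigr => i _; rewrite mulrA.
have E2 i : Jint (fun w => z w * (pk w * dqk (lift ord_max i) (ex R i) w)) =
    - Jint (fun w => qk (lift ord_max i) w * (zi i w * pk w + z w * gk (lift ord_max i) w)).
  have EN := JintN ha mG IG (admD (a3 i (lift ord_max i)) (a7 (lift ord_max i) (ex R i))).
  rewrite step_x EN; congr (- _).
  rewrite (JintD ha mG IG (a3 _ _) (a7 _ _)) step_ae -(JintD ha mG IG (a3 _ _) (a2 _ _)).
  by apply: Jint_eq => w; ring.
have := step_vertical; rewrite E1 step_t (JintZ ha mG IG _ a4).
under eq_bigr do rewrite E2.
rewrite sumrN => /eqP; rewrite addrC subr_eq => /eqP ->; rewrite addrC; congr (_ + _).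
by apply: Jint_eq => w; ring.
Qed.

End energy_equality.

(** X1 and X2 are the terms of z_t p^2 with om' and with eta_t, X3 is the gradient term, X4 the
    commutator error and X5 its bound free of the kernel. *)
Lemma energy_arith (R : realFieldType) (X1 X2 X3 X4 X5 e : R) : X4 <= e * X5 ->
  - X3 - X4 <= - 2^-1 * (X1 + 2 * X2) -> 2 * (X2 - X3) - e * (2 * X5) <= - X1.
Proof.
have -> : - 2^-1 * (X1 + 2 * X2) = - (2^-1 * X1) - X2 by field.
by rewrite mulrCA; move: (e * X5) => X6 h1 h2; lra.
Qed.

Section quadratic_form.
Variables (R : realType) (m : nat) (B : 'M[R]_m).

Lemma mxformE (u v : 'rV[R]_m) : mxform B u v = \sum_i v 0 i * \sum_j B i j * u 0 j.
Proof.
rewrite /mxform -mulmxA mxE; apply: eq_bigr => i _; congr (_ * _).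
by rewrite mxE; apply: eq_bigr => j _; rewrite mxE.
Qed.

Lemma mxform_sym (u v : 'rV[R]_m) : B^T = B -> mxform B u v = mxform B v u.
Proof.
move=> BT; rewrite /mxform -[in LHS](trmxK (v *m B *m u^T)) [LHS]mxE.
by rewrite !trmx_mul trmxK BT mulmxA.
Qed.

Lemma mxform_lin2 (c d : R) (u v : 'rV[R]_m) : B^T = B ->
  mxform B (c *: u + d *: v) (c *: u + d *: v) =
  c ^+ 2 * mxform B u u + 2 * c * d * mxform B u v + d ^+ 2 * mxform B v v.
Proof.
move=> BT.
have lr (x y z : 'rV[R]_m) (s r : R) : mxform B (s *: x + r *: y) z = s * mxform B x z + r * mxform B y z.
  by rewrite /mxform linearD /= !linearZ /= mulmxDr -!scalemxAr !mxE.
have ll (x y z : 'rV[R]_m) (s r : R) : mxform B z (s *: x + r *: y) = s * mxform B z x + r * mxform B z y.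
  by rewrite /mxform mulmxDl mulmxDl -!scalemxAl !mxE.
by rewrite lr !ll (mxform_sym v u BT); ring.
Qed.

End quadratic_form.

Lemma enorm_rV (R : realType) (m : nat) (v : 'rV[R]_m) : enorm v ^+ 2 = sq v.
Proof.
rewrite /enorm big_ord1 sqr_sqrtr//.
by apply: sumr_ge0 => i _; exact: sqr_ge0.
Qed.

Section energy_coef.
Variables (R : realType) (n : nat) (Lambda K : R) (A : 'rV[R]_n -> 'M[R]_n.+1).
Hypothesis HA : admissible_coef Lambda K A.

(** Completing the square: the form at eta g + p d is non-negative, so the terms containing g are at
    least - p^2 times the form at d, which is at most Lambda |d|^2. *)
Lemma coercive_lower x (g d : 'rV[R]_n.+1) (eta p : R) :
  - (Lambda * p ^+ 2 * sq d) <=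
  \sum_i (\sum_j A x i j * g 0 j) * (2 * eta * p * d 0 i + eta ^+ 2 * g 0 i).
Proof.
have [L0 AT Ael _] := HA.
have -> : \sum_i (\sum_j A x i j * g 0 j) * (2 * eta * p * d 0 i + eta ^+ 2 * g 0 i) =
    eta ^+ 2 * mxform (A x) g g + 2 * eta * p * mxform (A x) g d.
  rewrite !mxformE !mulr_sumr -big_split/=; apply: eq_bigr => i _; ring.
have /andP[h1 _] := Ael x (eta *: g + p *: d).
have /andP[_ h2] := Ael x d.
have h3 : 0 <= mxform (A x) (eta *: g + p *: d) (eta *: g + p *: d).
  by apply: le_trans h1; rewrite mulr_ge0 ?sqr_ge0// invr_ge0 ltW.
rewrite (mxform_lin2 _ _ _ _ (AT x)) in h3.
rewrite enorm_rV in h2.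
have := ler_wpM2l (sqr_ge0 p) h2.
have -> : p ^+ 2 * (Lambda * sq d) = Lambda * p ^+ 2 * sq d by ring.
lra.
Qed.

End energy_coef.

(** * Coercivity and the commutator *)

Section energy_inequality.
Variables (R : realType) (n : nat) (a Lambda K : R) (A : 'rV[R]_n -> 'M[R]_n.+1).
Hypothesis HA : admissible_coef Lambda K A.
Local Notation leb := (@lebesgue_measure R).
Local Notation Y := (measurableTypeR R).
Local Notation T := ('rV[R]_n * measurableTypeR R)%type.
Local Notation V := ('rV[R]_n * R)%type.
Local Notation Z := ('rV[R]_n.+1 * measurableTypeR R)%type.
Local Notation nu := (lebVt R n).
Local Notation Phi := (@Phi R n).
Local Notation Qs := (@Qs R n).
Local Notation Ds := (@Ds R n).
Local Notation b_ := (b_ R).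

Variables (U : Z -> R) (G : Z -> 'rV[R]_n.+1) (M : R).
Hypotheses (ha : -1 < a < 1) (mU : measurable_fun Qs U)
  (mG : forall i, measurable_fun Qs (fun z => G z 0 i))
  (IG : forall i, (\int[lebVt R n.+1]_(z in Qs) (weight a z.1 * (G z 0 i) ^+ 2)%:E < +oo)%E)
  (UM : forall z, Ds z -> `|U z| <= M).
Hypotheses (WG : is_weak_grad Qs U G)
  (WS : forall phi, test_function (cyl (eball 4) `]0, 16[%classic) phi ->
    \int[lebVt R n.+1]_(z in Qs)
      (weight a z.1 * (mxform (A (col' ord_max z.1)) (G z) (grad phi z)
                       + U z * dtime phi z)) = 0).


Local Notation gro := (gro G).
Local Notation adm := (adm G).
Local Notation Jint := (Jint a).

(** om cuts off in time only and keeps the mollification inside t > 0; eta is the weight in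
    space-time, with [etad] its full spatial gradient, the vertical component last. *)
Variables (om om' : R -> R) (eta etat : T * Y -> R) (etad : 'I_n.+1 -> T * Y -> R)
  (t1 t2 : R).
Hypotheses (t1_gt0 : 0 < t1) (t2_lt : t2 < 1) (om_ge0 : forall s, 0 <= om s)
  (dom : forall s : R, is_derive s (1 : R) om (om' s))
  (com' : continuous om') (som : supp_in t1 t2 om) (som' : supp_in t1 t2 om').
Hypotheses (ceta : continuous (eta : V * R -> R)) (cetat : continuous (etat : V * R -> R))
  (cetad : forall i, continuous (etad i : V * R -> R)).
Hypotheses
  (deta : forall (i : 'I_n) (y : R) (t : V),
    is_derive t (ex R i) (fun s : V => eta (s, y)) (etad (lift ord_max i) (t, y)))
  (detat : forall (y : R) (t : V), is_derive t (et R n) (fun s : V => eta (s, y)) (etat (t, y)))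
  (detay : forall (t : T) (y : R),
    is_derive y (1 : R) (fun y : R => eta (t, y)) (etad ord_max (t, y)))
  (eta0 : forall (s : T) (y : R), t1 < s.2 < t2 -> 4 <= sq s.1 + y ^+ 2 -> eta (s, y) = 0)
  (etad0 : forall i (s : T) (y : R), t1 < s.2 < t2 -> 4 <= sq s.1 + y ^+ 2 -> etad i (s, y) = 0).

Definition cut1 (w : T * Y) := om w.1.2 * eta w ^+ 2.
Definition cutd i (w : T * Y) := 2 * om w.1.2 * eta w * etad i w.
Definition cutt (w : T * Y) := om' w.1.2 * eta w ^+ 2 + 2 * om w.1.2 * eta w * etat w.

Let com : continuous om.
Proof.
move=> x; apply: differentiable_continuous.
by apply/derivable1_diffP; exact: ex_derive.
Qed.

Let active (w : T * Y) := t1 < w.1.2 < t2 /\ sq w.1.1 + w.2 ^+ 2 < 4.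

Let inactive w : ~ active w -> om w.1.2 * eta w = 0 /\ om' w.1.2 * eta w = 0.
Proof.
case: w => s y; rewrite /active /= => h.
have [h1|h1] := boolP (t1 < s.2 < t2).
  rewrite eta0 ?mulr0// leNgt; apply/negP => h2; exact: h.
have h2 : s.2 <= t1 \/ t2 <= s.2.
  by move: h1; rewrite negb_and -!leNgt => /orP.
by rewrite som ?som' ?mul0r.
Qed.

Lemma cut_inactive w : ~ active w -> [/\ cut1 w = 0, cutt w = 0 & forall i, cutd i w = 0].
Proof.
move=> /inactive[h1 h2]; split => [||i].
- by rewrite /cut1 expr2 mulrA h1 mul0r.
- by rewrite /cutt expr2 mulrA h2 mul0r add0r -(mulrA 2) h1 mulr0 mul0r.
- by rewrite /cutd -(mulrA 2) h1 mulr0 mul0r.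
Qed.

Let sq_ge0 m (x : 'rV[R]_m) : 0 <= sq x.
Proof. by apply: sumr_ge0 => i _; exact: sqr_ge0. Qed.

Let sq_coord m (x : 'rV[R]_m) i : sq x < 4 -> `|x 0 i| <= 2.
Proof.
move=> h; rewrite -(@ler_pXn2r _ 2)// ?nnegrE// real_normK ?num_real//.
rewrite (_ : 2 ^+ 2 = 4 :> R); last by ring.
rewrite (le_trans _ (ltW h))// /sq (bigD1 i)//= lerDl.
by apply: sumr_ge0 => j _; exact: sqr_ge0.
Qed.

Let active_box w : active w -> boxT 9 w.1 /\ - 2 < w.2 < 2.
Proof.
move=> [h1 h2]; have h4 := sq_ge0 w.1.1; have h3 := sqr_ge0 (w.2 : R).
split; last first.
  rewrite -ltr_norml -(@ltr_pXn2r _ 2)// ?nnegrE// real_normK ?num_real//.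
  rewrite (_ : 2 ^+ 2 = 4 :> R); last by ring.
  by apply: le_lt_trans h2; rewrite lerDr.
have g1 := t1_gt0; have g2 := t2_lt; case/andP: h1 => h1 h1'.
split => [i|/=]; last first.
  by rewrite in_itv/=; apply/andP; split; lra.
have := @sq_coord _ w.1.1 i; lra.
Qed.

Let gro0_cut (f : V * R -> R) : continuous f -> (forall w, ~ active w -> f w = 0) -> gro 0 (f : T * Y -> R).
Proof.
move=> cf f0; split; first exact: continuous_measurable_TR.
have cB : compact (boxT 9 `*` `[- 2, 2]%classic : set (V * R)).
  by apply: compact_setX; [exact: compact_boxT|exact: segment_compact].
have : bounded_set (f @` (boxT 9 `*` `[- 2, 2]%classic)).
  by apply: compact_bounded; apply: continuous_compact => //; exact: continuous_subspaceT.
move=> [M0 [M0r hM]]; exists (`|M0| + 1) => [|s y]; first by rewrite addr_ge0.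
rewrite expr0 mulr1.
have [h|h] := pselect (active (s, y)); last by rewrite f0// normr0 addr_ge0.
have [h1 h2] := active_box h.
apply: hM; first by rewrite (le_lt_trans (ler_norm _))// ltrDl.
by exists (s, y) => //; split => //=; rewrite in_itv/=; move: h2; rewrite /=; lra.
Qed.

Let ct : continuous (fun w : V * R => om w.1.2).
Proof.
move=> w; apply: (@continuous_comp _ _ _ (fun w : V * R => w.1.2) om); last exact: com.
apply: (@continuous_comp _ _ _ (fun w : V * R => w.1) snd); [exact: cvg_fst|exact: cvg_snd].
Qed.

Let ct' : continuous (fun w : V * R => om' w.1.2).
Proof.
move=> w; apply: (@continuous_comp _ _ _ (fun w : V * R => w.1.2) om'); last exact: com'.
apply: (@continuous_comp _ _ _ (fun w : V * R => w.1) snd); [exact: cvg_fst|exact: cvg_snd].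
Qed.

Let cM (f g : V * R -> R) : continuous f -> continuous g -> continuous (fun w => f w * g w).
Proof. by move=> cf cg w; apply: continuousM; [exact: cf|exact: cg]. Qed.

Lemma gro_cut1 : gro 0 cut1.
Proof.
apply: (gro0_cut (f := cut1)); last by move=> w /cut_inactive[].
rewrite (_ : cut1 = fun w => om w.1.2 * (eta w * eta w)); first by do 2 apply: cM => //.
by apply/funext => w; rewrite /cut1 expr2.
Qed.

Lemma gro_cutd i : gro 0 (cutd i).
Proof.
apply: (gro0_cut (f := cutd i)); last by move=> w /cut_inactive[].
by do 3 apply: cM => //; exact: cst_continuous.
Qed.

Let cutt2 (w : T * Y) := 2 * om w.1.2 * eta w * etat w.
Let cutt1 (w : T * Y) := om' w.1.2 * eta w ^+ 2.

Lemma gro_cutt1 : gro 0 cutt1.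
Proof.
apply: (gro0_cut (f := cutt1)).
  rewrite (_ : cutt1 = fun w => om' w.1.2 * (eta w * eta w)); first by do 2 apply: cM => //.
  by apply/funext => w; rewrite /cutt1 expr2.
by move=> w /inactive[_ h]; rewrite /cutt1 expr2 mulrA h mul0r.
Qed.

Lemma gro_cutt2 : gro 0 cutt2.
Proof.
apply: (gro0_cut (f := cutt2)); first by do 3 apply: cM => //; exact: cst_continuous.
by move=> w /inactive[h _]; rewrite /cutt2 -(mulrA 2) h mulr0 mul0r.
Qed.

Lemma gro_cutt : gro 0 cutt.
Proof. exact: groD gro_cutt1 gro_cutt2. Qed.

(** A coordinate in [-2, 2] moved by at most e <= 1 has its square increased by at most 4 e + e^2 <=
    5 e, and 5 n e < 1 / 2 keeps |x|^2 below 4 + 1 / 2. *)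
Lemma active_good e (w : T * Y) : 0 < e -> e < t1 -> e * (10 * n.+1%:R) < 1 -> active w -> good e w.1.
Proof.
move=> e0 et1 en [h1 h2] s [hs1 hs2]; split; last first.
  have /andP[h3 h4] : - e <= w.1.2 - s.2 <= e by move: hs2; rewrite /= in_itv.
  have g2 := t2_lt; case/andP: h1 => h1 h1'.
  by apply/andP; split; lra.
have x4 : sq w.1.1 < 4 by apply: le_lt_trans h2; rewrite lerDl sqr_ge0.
have n0 : 0 <= n%:R * e by rewrite mulr_ge0// ltW.
have en' : 10 * (n%:R * e) + 10 * e < 1.
  by rewrite (_ : _ + _ = e * (10 * n.+1%:R))// -natr1; ring.
have : sq s.1 <= sq w.1.1 + n%:R * (5 * e).
  rewrite -[n in n%:R]card_ord mulr_natl -sumr_const /sq -big_split/=.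
  apply: ler_sum => i _; have := hs1 i; have := @sq_coord _ w.1.1 i x4.
  rewrite !mxE !ler_norml => /andP[h3 h4] /andP[h5 h6].
  set x := w.1.1 0 i in h3 h4 h5 h6 *; set y := s.1 0 i in h5 h6 *.
  have -> : y = x - (x - y) by ring.
  move: (x - y) h5 h6 => d h5 h6.
  have e1 : e <= 1 by lra.
  have h7 : (e - d) * (e + d) >= 0 by rewrite mulr_ge0//; lra.
  have h8 : (2 - x) * (e - d) >= 0 by rewrite mulr_ge0//; lra.
  have h9 : (2 + x) * (e + d) >= 0 by rewrite mulr_ge0//; lra.
  have h10 : e * e <= e by rewrite ger_pMr//.
  nra.
lra.
Qed.

Definition cutg (w : T * Y) := om w.1.2 * \sum_i etad i w ^+ 2.

Lemma cutg_inactive w : ~ active w -> cutg w = 0.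
Proof.
case: w => s y h; have [h1|h1] := boolP (t1 < s.2 < t2).
  rewrite /cutg big1 ?mulr0// => i _; rewrite etad0 ?expr0n// leNgt; apply/negP => h2.
  exact: h.
rewrite /cutg som ?mul0r//=.
by move: h1; rewrite negb_and -!leNgt => /orP.
Qed.

Lemma gro_cutg : gro 0 cutg.
Proof.
apply: (gro0_cut (f := cutg)); last exact: cutg_inactive.
apply: cM => // w.
rewrite (_ : (fun w => _) = fun w => \sum_i (etad i w * etad i w)); last first.
  by apply/funext => v; apply: eq_bigr => i _; rewrite expr2.
have : continuous (fun w : V * R => \sum_i (etad i w * etad i w)).
  elim: (index_enum 'I_n.+1) => [|i r IH].
    rewrite (_ : (fun w => _) = fun=> 0); first by move=> v; exact: cst_continuous.
    by apply/funext => v; rewrite big_nil.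
  rewrite (_ : (fun w => _) = fun w => etad i w * etad i w + \sum_(j <- r) (etad j w * etad j w)).
    move=> v; apply: (@continuousD R R^o (V * R)%type (fun w => etad i w * etad i w)
      (fun w => \sum_(j <- r) (etad j w * etad j w)) v); [exact: cM|exact: IH].
  by apply/funext => v; rewrite big_cons.
exact.
Qed.

Section with_kernel.
Variables (k : V -> R) (e : R).
Hypotheses (sk : smooth k) (supk : supp_box e k) (k0 : forall t, 0 <= k t)
  (ke : forall t, k (- t) = k t) (k1 : \int[nu]_t k t = 1).
Local Notation pk := (pk U k).
Local Notation gk := (gk G k).
Local Notation gkn := (gkn G k).
Local Notation qk := (qk A G k).

Lemma conv_le_norm (f h : T -> R) (t : T) : nu.-integrable setT (EFin \o f) ->
  nu.-integrable setT (EFin \o h) -> (forall s, `|f s| <= h s) -> `|conv k f t| <= conv k h t.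
Proof.
move=> if1 ih fh; apply: le_norm_Rint; [exact: (conv_intg sk supk)|exact: (conv_intg sk supk)|].
by move=> s; rewrite normrM ger0_norm// ler_wpM2l.
Qed.

Lemma pk_le w : `|pk w| <= `|M|.
Proof.
have i1 := intg_kernel_shift2 sk supk ke w.1.
have E : `|M| = \int[nu]_s (`|M| * k (w.1 - s)).
  by rewrite (RintZ _ i1) (int_kernel_shift2 sk supk ke k1) mulr1.
rewrite E; apply: le_norm_Rint.
- exact: (conv_intg sk supk _ (slice_cutU mU UM w.2)).
- exact: intgZ.
- by move=> s; rewrite normrM ger0_norm// mulrC ler_wpM2r// (cutU_bound UM).
Qed.

Lemma gk_le i w : `|gk i w| <= gkn w.
Proof.
apply: conv_le_norm; [exact: (slice_g mG)|exact: (slice_gn mG)|].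
by move=> s; exact: g_le_gn.
Qed.

Lemma gkn_ge0 w : 0 <= gkn w.
Proof. by apply: Rint_ge0 => s; rewrite mulr_ge0// gn_ge0. Qed.

(** On the support of the kernel, A(s) and A(x) differ by at most |K| n e in each entry. The gain e
    is what makes the error vanish in the limit. *)
Lemma qk_commutator i w : 0 <= e ->
  `|qk i w - \sum_j A w.1.1 i j * gk j w| <= n.+1%:R * (`|K| * n%:R) * e * gkn w.
Proof.
move=> e0.
have ig j := conv_intg sk supk w.1 (slice_g mG j w.2).
have iq := conv_intg sk supk w.1 (slice_flux HA mG i w.2).
have iS := intg_sum (fun j => intgZ (A w.1.1 i j) (ig j)).
have -> : \sum_j A w.1.1 i j * gk j w =
    \int[nu]_s \sum_j (A w.1.1 i j * (k (w.1 - s) * g G j (s, w.2))).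
  rewrite (Rint_sum (fun j => intgZ (A w.1.1 i j) (ig j))).
  by apply: eq_bigr => j _; rewrite (RintZ _ (ig j)).
rewrite -[qk i w]/(conv k (fun s => flux A G i (s, w.2)) w.1) /conv -(RintB iq iS).
set c := n.+1%:R * _ * e.
have ign := conv_intg sk supk w.1 (slice_gn mG w.2).
have -> : c * gkn w = \int[nu]_s (c * (k (w.1 - s) * gn G (s, w.2))) by rewrite (RintZ _ ign).
apply: le_norm_Rint; [exact: intgB|exact: intgZ|] => s.
have -> : k (w.1 - s) * flux A G i (s, w.2) - \sum_j A w.1.1 i j * (k (w.1 - s) * g G j (s, w.2)) =
    k (w.1 - s) * \sum_j (A s.1 i j - A w.1.1 i j) * g G j (s, w.2).
  rewrite /flux mulr_sumr mulr_sumr -sumrB; apply: eq_bigr => j _ /=; ring.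
have [hb|hb] := pselect (boxT e (w.1 - s)); last by rewrite supk// !mul0r normr0 mulr0.
rewrite normrM ger0_norm// mulrCA ler_wpM2l//.
apply: le_trans (ler_norm_sum _ _ _) _.
rewrite /c -[n.+1 in leRHS]card_ord -!mulrA mulr_natl -sumr_const.
apply: ler_sum => j _; rewrite normrM !mulrA ler_pM// ?g_le_gn//.
apply: (coef_lipschitz HA) => l; rewrite -normrN.
by have := hb.1 l; rewrite !mxE opprB.
Qed.

Definition boxf (w : T * Y) : R := \1_(boxT 9) w.1.

Lemma gro_boxf : gro 0 boxf.
Proof.
split.
  exact: (measurableT_comp (intg_measurable (@intg_ind_boxT R n 9)) measurable_fst).
exists 1 => // s y; rewrite expr0 mulr1 /boxf indicE; case: (_ \in _); rewrite ?normr1 ?normr0//.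
Qed.

Lemma adm_boxf : adm boxf.
Proof.
apply: (gro_adm (gro_le (leq0n 2) gro_boxf)) => // s y hs.
by rewrite /boxf indicE memNset.
Qed.

Lemma adm_boxf_gkn : adm (fun w => boxf w * gkn w ^+ 2).
Proof.
have gn1 := gro_gkn HA mU mG UM sk supk.
apply: (gro_adm (groM gro_boxf (groM gn1 gn1))) => [w|s y hs]; first by rewrite expr2.
by rewrite /boxf indicE memNset// mul0r.
Qed.

(** Jensen, then conservation of the integral by the mollification, height by height. The bound is
    the weighted energy of the gradient, the same for all kernels. *)
Lemma Jint_gkn_le : Jint (fun w => boxf w * gkn w ^+ 2) <=
  \int[leb]_y (Wt a y * \int[nu]_s S2 G (s, y)).
Proof.
have a1 := adm_boxf_gkn.
have i1 := adm_intg ha mG IG a1.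
have sec y : nu.-integrable setT (EFin \o (fun s => Wt a y * (boxf (s, y) * gkn (s, y) ^+ 2))).
  apply: intgZ; have [m1 [C C0 hC] s1] := a1.
  apply: (@intg_bounded_box _ _ _ 9 (C * (1 + mgn G y) ^+ 2)).
  - exact: (measurable_fun_pair1 y m1).
  - by move=> s hs; exact: s1.
  - by move=> s; exact: hC.
have [i2 E] := Rfubini2 i1 sec.
rewrite /Jint E; apply: le_Rint => //; first exact: (intg_Wt_E2 ha mG IG).
move=> y; have W0 : 0 <= Wt a y by exact: powc_ge0.
have sS : supp_box 9 (fun s => S2 G (s, y)).
  move=> s hs; rewrite -gn_sq; have [->|h] := eqVneq (gn G (s, y)) 0; first by rewrite expr0n.
  by have [h1 _] := gn_supp h.
have [ic <-] := int_conv sk supk k1 (slice_S2 mG y) sS.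
rewrite -(RintZ _ ic); apply: le_Rint; [exact: sec|exact: intgZ|] => s.
rewrite ler_wpM2l//.
have h1 : gkn (s, y) ^+ 2 <= conv k (fun s => S2 G (s, y)) s.
  have := conv_jensen sk supk k0 ke k1 s (slice_gn mG y).
  rewrite (_ : (fun s => gn G (s, y) ^+ 2) = fun s => S2 G (s, y)); last first.
    by apply/funext => s'; rewrite gn_sq.
  by apply; exact: slice_S2.
apply: le_trans h1; rewrite /boxf indicE; case: (_ \in _); rewrite ?mul1r// mul0r sqr_ge0//.
Qed.

End with_kernel.

Lemma cut_bounds : exists2 C, 0 <= C &
  forall w, `|cut1 w| <= C /\ forall i, `|cutd i w| <= C.
Proof.
have [_ [C0 C00 h0]] := gro_cut1.
have /choice [Ci hCi] : forall i, exists C, 0 <= C /\ forall w, `|cutd i w| <= C.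
  move=> i; have [_ [C C0' h]] := gro_cutd i; exists C; split => // -[s y].
  by have := h s y; rewrite expr0 mulr1.
have S0 : 0 <= \sum_i Ci i by apply: sumr_ge0 => i _; have [] := hCi i.
exists (C0 + \sum_i Ci i); first exact: addr_ge0.
move=> w; split => [|i].
  case: w => s y; have := h0 s y; rewrite expr0 mulr1 => h.
  by rewrite (le_trans h)// lerDl.
rewrite (le_trans ((hCi i).2 w))// (bigD1 i)//= addrCA lerDl addr_ge0//.
by apply: sumr_ge0 => j _; have [] := hCi j.
Qed.

Let etadv (w : T * Y) : 'rV[R]_n.+1 := \row_i etad i w.

Let sq_etadv w : sq (etadv w) = \sum_i etad i w ^+ 2.
Proof. by apply: eq_bigr => i _; rewrite mxE. Qed.

(* The term e * C absorbs the commutator of the mollification with A. *)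
Lemma energy_inequality : exists2 C, 0 <= C & forall (k : V -> R) (e : R),
  smooth k -> supp_box e k -> (forall t, 0 <= k t) -> (forall t, k (- t) = k t) ->
  \int[nu]_t k t = 1 -> 0 < e -> e < t1 -> e * (10 * n.+1%:R) < 1 ->
  2 * Jint (fun w => (om w.1.2 * (eta w * etat w) - Lambda * cutg w) * pk U k w ^+ 2) - e * C <=
  - Jint (fun w => om' w.1.2 * eta w ^+ 2 * pk U k w ^+ 2).
Proof.
have [C1 C10 hC1] := cut_bounds.
pose cR : R := n.+1%:R * (`|K| * n%:R).
have cR0 : 0 <= cR by rewrite !mulr_ge0.
(* Each of the n + 1 components has commutator constant cR and a factor bounded by C1 (|M| + gN),
   where |M| + gN <= (|M| + 1) (1 + gN). *)
pose C2 := n.+1%:R * (cR * (C1 * (`|M| + 1))).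
have C20 : 0 <= C2 by rewrite !mulr_ge0// addr_ge0.
(* Bounds the integral of 2 + 2 gN^2 over the box, independently of k and e. *)
pose J0 := 2 * Jint boxf + 2 * \int[leb]_y (Wt a y * \int[nu]_s S2 G (s, y)).
have J00 : 0 <= J0.
  apply: addr_ge0; apply: mulr_ge0 => //; apply: Rint_ge0 => w; apply: mulr_ge0.
  - exact: powc_ge0.
  - by rewrite /boxf indicE ler0n.
  - exact: powc_ge0.
  - by apply: Rint_ge0 => s; exact: S2_ge0.
exists (2 * (C2 * J0)); first by rewrite !mulr_ge0.
move=> k e sk supk k0 ke k1 e0 et1 en.
pose p := pk U k; pose gg := gk G k; pose qq := qk A G k; pose gN := gkn G k.
have gp := gro_pk HA mU mG UM sk supk.
have ggi i := gro_gk HA mU mG UM sk supk i.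
have gqi i := gro_qk HA mU mG UM sk supk i.
have ggN := gro_gkn HA mU mG UM sk supk.
have zsup s : ~ (boxT 9 s /\ good e s) -> forall y : Y,
    [/\ cut1 (s, y) = 0, cutt (s, y) = 0, cutd ord_max (s, y) = 0 &
     forall i : 'I_n, cutd (lift ord_max i) (s, y) = 0].
  move=> hs y; have na : ~ active (s, y).
    move=> ha'; apply: hs; split; first by have [] := active_box ha'.
    exact: (active_good e0 et1 en ha').
  by have [h1 h2 h3] := cut_inactive na; split => // i; exact: h3.
have dom2 (v t : V) : is_derive t v (fun s : V => om s.2) (v.2 * om' t.2).
  apply: (@is_derive_affine R V R^o om (fun s : V => s.2) t v v.2) => //.
  exact: is_derive_dir.
have dz (i : 'I_n) (y : R) (t : V) : is_derive t (ex R i) (fun s : V => cut1 (s, y)) (cutd (lift ord_max i) (t, y)).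
  have d2 := deta i y t.
  have d3 := is_deriveM (dom2 (ex R i) t) (is_deriveM d2 d2).
  have -> : cutd (lift ord_max i) (t, y) =
      om t.2 *: (eta (t, y) *: etad (lift ord_max i) (t, y) + eta (t, y) *: etad (lift ord_max i) (t, y)) +
      (eta (t, y) * eta (t, y)) *: ((ex R i).2 * om' t.2).
    by rewrite /cutd /GRing.scale/=; ring.
  exact: d3.
have dzt (y : R) (t : V) : is_derive t (et R n) (fun s : V => cut1 (s, y)) (cutt (t, y)).
  have d2 := detat y t.
  have d3 := is_deriveM (dom2 (et R n) t) (is_deriveM d2 d2).
  have -> : cutt (t, y) =
      om t.2 *: (eta (t, y) *: etat (t, y) + eta (t, y) *: etat (t, y)) +
      (eta (t, y) * eta (t, y)) *: ((et R n).2 * om' t.2).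
    by rewrite /cutt /GRing.scale/=; ring.
  exact: d3.
have dzy (t : T) (y : R) : is_derive y (1 : R) (fun y : R => cut1 (t, y)) (cutd ord_max (t, y)).
  have d1 : is_derive y (1 : R) (cst (om t.2) : R -> R) 0 by exact: is_derive_cst.
  have d2 := detay t y.
  have d3 := is_deriveM d1 (is_deriveM d2 d2).
  have -> : cutd ord_max (t, y) =
      om t.2 *: (eta (t, y) *: etad ord_max (t, y) + eta (t, y) *: etad ord_max (t, y)) +
      (eta (t, y) * eta (t, y)) *: 0.
    by rewrite /cutd /GRing.scale/=; ring.
  exact: d3.
have czy (t : T) : continuous (fun y : R => cutd ord_max (t, y)).
  have cd : continuous (cutd ord_max : V * R -> R).
    by do 3 apply: cM => //; exact: cst_continuous.
  move=> y; apply: (@continuous_comp _ _ _ (fun y : R => (t, y) : V * R) (cutd ord_max)); last exact: cd.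
  have H1 : (fun _ : R => (t : V)) @ y --> (t : V) by exact: cvg_cst.
  have H2 : (fun y : R => y) @ y --> y by exact: cvg_id.
  exact: (cvg_pair H1 H2).
have far (t : T) (y : R) : y <= - 2 \/ 2 <= y -> ~ active (t, y).
  by move=> h /active_box[_ /=]; case: h => h /andP[h1 h2]; lra.
have EE := energy_equality HA ha mU mG IG UM WG WS sk supk gro_cut1 gro_cutt (gro_cutd ord_max)
  (fun i => gro_cutd (lift ord_max i)) dz dzt dzy czy zsup
  (fun t y h => let: And3 h1 _ _ := cut_inactive (far t y h) in h1)
  (fun t y h => let: And3 _ _ h1 := cut_inactive (far t y h) in h1 ord_max).
have nbox (s : T) (y : Y) : ~ boxT 9 s -> ~ active (s, y) by move=> h /active_box[].
pose F i w := qq i w * (cutd i w * p w + cut1 w * gg i w).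
have aF i : adm (F i).
  apply: (gro_adm (groM (gqi i) (groD (gro_le (leq0n 1) (groM (gro_cutd i) gp))
    (groM gro_cut1 (ggi i))))) => // s y hs.
  have [h1 _ h2] := cut_inactive (nbox s y hs).
  by rewrite /F h1 h2 !mul0r addr0 mulr0.
have agp : adm (fun w => cutg w * p w ^+ 2).
  apply: (gro_adm (gro_le (leq0n 2) (groM gro_cutg (groM gp gp)))) => [w|s y hs]; first by rewrite expr2.
  by rewrite (cutg_inactive (nbox s y hs)) mul0r.
have at1 : adm (fun w => om' w.1.2 * eta w ^+ 2 * p w ^+ 2).
  apply: (gro_adm (gro_le (leq0n 2) (groM gro_cutt1 (groM gp gp)))) => [w|s y hs].
    by rewrite (expr2 (p w)).
  by rewrite expr2 mulrA (inactive (nbox s y hs)).2 !mul0r.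
have at2 : adm (fun w => om w.1.2 * (eta w * etat w) * p w ^+ 2).
  have := admZ 2^-1 (gro_adm (F' := fun w => cutt2 w * (p w * p w)) (gro_le (leq0n 2) (groM gro_cutt2 (groM gp gp))) (fun w => erefl) _).
  rewrite (_ : (fun w => 2^-1 * _) = fun w => om w.1.2 * (eta w * etat w) * p w ^+ 2).
    apply=> s y hs; rewrite /cutt2 -(mulrA 2) (inactive (nbox s y hs)).1.
    by rewrite mulr0 !mul0r.
  by apply/funext => w; rewrite /cutt2; field.
have ab := @adm_boxf; have abN := adm_boxf_gkn sk supk.
(* Pointwise lower bound of the integrand: coercivity applied to A times the mollified gradient,
   minus the commutator error. *)
pose Lo w := - (Lambda * (cutg w * p w ^+ 2)) - (e * C2) * (2 * boxf w + 2 * (boxf w * gN w ^+ 2)).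
have aLo : adm Lo.
  by apply: admD; apply: admN; apply: admZ => //; apply: admD; exact: admZ.
have LoF w : Lo w <= \sum_i F i w.
  have N0 : 0 <= gN w by exact: gkn_ge0.
  have [hw|hw] := pselect (active w); last first.
    have [h1 _ h2] := cut_inactive hw.
    rewrite big1 => [|i _]; last by rewrite /F h1 h2 !mul0r addr0 mulr0.
    rewrite /Lo (cutg_inactive hw) mul0r mulr0 oppr0 add0r oppr_le0.
    rewrite mulr_ge0//; first by rewrite mulr_ge0// ltW.
    by rewrite /boxf indicE addr_ge0// mulr_ge0// mulr_ge0// sqr_ge0.
  have [hb _] := active_box hw.
  pose Dg i := \sum_j A w.1.1 i j * gg j w.
  pose X i := cutd i w * p w + cut1 w * gg i w.
  have main : - (Lambda * (cutg w * p w ^+ 2)) <= \sum_i Dg i * X i.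
    have := coercive_lower HA w.1.1 (\row_i gg i w) (etadv w) (eta w) (p w).
    move=> /(ler_wpM2l (om_ge0 w.1.2)); rewrite sq_etadv [X in _ <= X]mulr_sumr.
    have -> : om w.1.2 * - (Lambda * p w ^+ 2 * \sum_i etad i w ^+ 2) = - (Lambda * (cutg w * p w ^+ 2)).
      by rewrite /cutg; ring.
    move=> /le_trans; apply; rewrite le_eqVlt; apply/orP; left; apply/eqP.
    apply: eq_bigr => i _; rewrite !mxE /X /cutd /cut1.
    have -> : \sum_j A w.1.1 i j * (\row_i gg i w) 0 j = Dg i by apply: eq_bigr => j _; rewrite mxE.
    ring.
  have err i : `|(qq i w - Dg i) * X i| <= cR * e * gN w * (C1 * ((`|M| + 1) * (1 + gN w))).
    rewrite normrM ler_pM//; first exact: (qk_commutator sk supk k0 i w (ltW e0)).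
    have [hc1 hc2] := hC1 w.
    apply: (@le_trans _ _ (C1 * `|M| + C1 * gN w)).
      rewrite (le_trans (ler_normD _ _))// (normrM (cutd i w)) (normrM (cut1 w)) lerD// ler_pM//.
        exact: (pk_le sk supk k0 ke k1).
      exact: (gk_le sk supk k0).
    rewrite -mulrDr ler_wpM2l//.
    have := mulr_ge0 (normr_ge0 M) N0; lra.
  have -> : \sum_i F i w = \sum_i Dg i * X i + \sum_i (qq i w - Dg i) * X i.
    by rewrite -big_split/=; apply: eq_bigr => i _; rewrite /F -/(X i); ring.
  apply: lerD => //.
  have : `|\sum_i (qq i w - Dg i) * X i| <= e * C2 * (gN w * (1 + gN w)).
    apply: le_trans (ler_norm_sum _ _ _) _.
    have -> : e * C2 * (gN w * (1 + gN w)) =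
        n.+1%:R * (cR * e * gN w * (C1 * ((`|M| + 1) * (1 + gN w)))) by rewrite /C2; ring.
    rewrite -[n.+1 in leRHS]card_ord mulr_natl -sumr_const.
    by apply: ler_sum => i _; exact: err.
  rewrite ler_norml => /andP[h _]; apply: le_trans h.
  rewrite lerN2 ler_wpM2l ?mulr_ge0 ?(ltW e0)//.
  rewrite /boxf indicE mem_set// mulr1 mul1r.
  (* It gives gN <= gN^2 + 1 / 4, hence gN (1 + gN) <= 2 + 2 gN^2. *)
  have := sqr_ge0 (gN w - 2^-1).
  have -> : (gN w - 2^-1) ^+ 2 = gN w ^+ 2 - gN w + 4^-1 by field.
  have := sqr_ge0 (gN w); rewrite mulrDr mulr1 -expr2; lra.
have E1 : \sum_(i < n) Jint (fun w => qq (lift ord_max i) w * (cutd (lift ord_max i) w * p w + cut1 w * gg (lift ord_max i) w)) +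
  Jint (fun w => gg ord_max w * (cutd ord_max w * p w + cut1 w * gg ord_max w)) = Jint (fun w => \sum_i F i w).
  have ES := Jint_sum ha mG IG aF.
  rewrite [RHS]ES sum_snoc; congr (_ + _); apply: Jint_eq => w; congr (_ * _).
  by apply: eq_Rint => s; rewrite (flux_max HA).
have := le_Jint ha mG IG aLo (adm_sum aF) (fun w _ => LoF w).
rewrite -E1 -EE.
have ELo : Jint Lo = - (Lambda * Jint (fun w => cutg w * p w ^+ 2)) -
    (e * C2) * (2 * Jint boxf + 2 * Jint (fun w => boxf w * gN w ^+ 2)).
  have b1 := admZ Lambda agp; have b2 := admZ 2 ab; have b3 := admZ 2 abN.
  have b4 := admZ (e * C2) (admD b2 b3).
  rewrite /Lo (JintD ha mG IG (admN b1) (admN b4)) (JintN ha mG IG b1) (JintN ha mG IG b4).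
  rewrite (JintZ ha mG IG Lambda agp) (JintZ ha mG IG (e * C2) (admD b2 b3)).
  by rewrite (JintD ha mG IG b2 b3) (JintZ ha mG IG 2 ab) (JintZ ha mG IG 2 abN).
have Ett : Jint (fun w => cutt w * (p w * p w)) =
    Jint (fun w => om' w.1.2 * eta w ^+ 2 * p w ^+ 2) +
    2 * Jint (fun w => om w.1.2 * (eta w * etat w) * p w ^+ 2).
  rewrite -(JintZ ha mG IG 2 at2) -(JintD ha mG IG at1 (admZ 2 at2)).
  by apply: Jint_eq => w; rewrite /cutt; ring.
have Eg : Jint (fun w => (om w.1.2 * (eta w * etat w) - Lambda * cutg w) * p w ^+ 2) =
    Jint (fun w => om w.1.2 * (eta w * etat w) * p w ^+ 2) - Lambda * Jint (fun w => cutg w * p w ^+ 2).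
  rewrite -(JintZ ha mG IG Lambda agp) -(JintN ha mG IG (admZ Lambda agp)).
  rewrite -(JintD ha mG IG at2 (admN (admZ Lambda agp))).
  by apply: Jint_eq => w; ring.
have hJ : (e * C2) * (2 * Jint boxf + 2 * Jint (fun w => boxf w * gN w ^+ 2)) <= e * (C2 * J0).
  rewrite -mulrA ler_wpM2l ?(ltW e0)// ler_wpM2l// lerD2l ler_wpM2l//.
  exact: (Jint_gkn_le sk supk k0 ke k1).
rewrite ELo Ett Eg; exact: energy_arith.
Qed.

End energy_inequality.

(** * Removal of the mollification *)

Section pointwise_limit.
Variables (R : realType) (n : nat).
Local Notation Y := (measurableTypeR R).
Local Notation T := ('rV[R]_n * measurableTypeR R)%type.
Local Notation V := ('rV[R]_n * R)%type.
Local Notation W := ('rV[R]_n.+1 * R)%type.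
Local Notation nu := (lebVt R n).

Local Notation Ds := (@Ds R n).

Lemma sq_continuous m : continuous (@sq R m : 'rV[R]_m -> R).
Proof.
rewrite /sq; elim: (index_enum 'I_m) => [|i r IH].
  rewrite (_ : (fun x => _) = fun=> 0); first by move=> v; exact: cst_continuous.
  by apply/funext => v; rewrite big_nil.
rewrite (_ : (fun x => _) = fun x : 'rV[R]_m => x 0 i * x 0 i + \sum_(j <- r) x 0 j ^+ 2).
  move=> v; apply: (@continuousD R R^o _ (fun x : 'rV[R]_m => x 0 i * x 0 i)
    (fun x : 'rV[R]_m => \sum_(j <- r) x 0 j ^+ 2) v); last exact: IH.
  by apply: continuousM; exact: coord_continuous.
by apply/funext => v; rewrite big_cons expr2.
Qed.

Lemma open_Ds : open (Ds : set W).
Proof.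
rewrite (_ : (Ds : set W) = [set z : W | sq z.1 < 9] `&` [set z : W | 0 < z.1 0 ord_max] `&`
    ([set z : W | 0 < z.2] `&` [set z : W | z.2 < 9])); last first.
  have e9 : 3 ^+ 2 = 9 :> R by ring.
  apply/seteqP; split => z /=; rewrite /Ds /cyl /eball_plus /eball /=.
    by rewrite in_itv/= enorm_lt// e9 => -[[h1 h2] /andP[h3 h4]].
  by rewrite in_itv/= enorm_lt// e9 => -[[h1 h2] [h3 h4]]; rewrite h3 h4.
have c1 : continuous (fun z : W => sq z.1).
  move=> z; apply: (@continuous_comp _ _ _ (fun z : W => z.1) (@sq R n.+1)).
    exact: cvg_fst.
  exact: sq_continuous.
have c2 := @coord_fst_continuous R n.+1 ord_max.
have c3 : continuous (fun z : W => z.2) by move=> z; exact: cvg_snd.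
apply: openI; apply: openI.
- by have := open_comp (fun z _ => c1 z) (@open_lt R 9).
- by have := open_comp (fun z _ => c2 z) (@open_gt R 0).
- by have := open_comp (fun z _ => c3 z) (@open_gt R 0).
- by have := open_comp (fun z _ => c3 z) (@open_lt R 9).
Qed.

Lemma Phi_continuous (y : R) : continuous (fun s : V => Phi (s, y) : W).
Proof.
move=> s.
have H1 : (fun s : V => rV_snoc (s.1, y)) @ s --> (rV_snoc (s.1, y) : 'rV[R]_n.+1).
  apply: cvg_matrix => i j; rewrite !ord1 {i}.
  case: (unliftP ord_max j) => [l|] ->.
    rewrite (_ : (fun x => _) = fun x : V => x.1 0 l); last by apply/funext => x; rewrite snoc_lift.
    by rewrite snoc_lift; exact: coord_fst_continuous.
  rewrite (_ : (fun x => _) = fun x : V => y); last by apply/funext => x; rewrite snoc_max.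
  by rewrite snoc_max; exact: cvg_cst.
have H2 : (fun s : V => s.2) @ s --> s.2 by exact: cvg_snd.
exact: (cvg_pair H1 H2).
Qed.

Lemma cutU_locally_continuous (U : W -> R) (s : V) (y : R) (d : R) : 0 < d -> Ds (Phi (s, y)) ->
  {for (Phi (s, y) : W), continuous U} ->
  exists2 r, 0 < r & forall s' : V, boxT r (s - s') -> `|cutU U (s', y) - cutU U (s, y)| <= d.
Proof.
move=> d0 sD cU.
have N1 : nbhs s [set s' : V | Ds (Phi (s', y))].
  have : nbhs (Phi (s, y) : W) Ds by apply: open_nbhs_nbhs; split => //; exact: open_Ds.
  exact: Phi_continuous.
have N2 : nbhs s [set s' : V | `|U (Phi (s', y)) - U (Phi (s, y))| < d].
  have c1 : (fun s' : V => U (Phi (s', y))) @ s --> U (Phi (s, y)).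
    by apply: (@continuous_comp _ _ _ (fun s : V => Phi (s, y) : W) U) => //; exact: Phi_continuous.
  have := (@cvgrPdist_lt R R^o _ (nbhs s) (nbhs_filter s) _ _).1 c1 _ d0.
  by apply: filterS => s' /=; rewrite distrC.
have N3 : nbhs s ([set s' : V | Ds (Phi (s', y))] `&` [set s' : V | `|U (Phi (s', y)) - U (Phi (s, y))| < d]).
  exact: filterI.
have [r /= r0 hr] := (@nbhs_ballP R _ s _).1 N3.
exists (r / 2); first by rewrite divr_gt0.
move=> s' [h1 h2].
have [] : [set s' : V | Ds (Phi (s', y))] s' /\ [set s' : V | `|U (Phi (s', y)) - U (Phi (s, y))| < d] s'.
  apply: hr; split => /=.
    split => // i j; rewrite ord1 /ball/=; have := h1 j; rewrite !mxE => h.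
    by rewrite (le_lt_trans h)// ltr_pdivrMr// ltr_pMr// ltr1n.
  rewrite /ball/=; move: h2; rewrite /= in_itv/= -ler_norml => h.
  by rewrite (le_lt_trans h)// ltr_pdivrMr// ltr_pMr// ltr1n.
move=> /= D' h; rewrite /cutU !patchE !mem_set//; exact: ltW.
Qed.

(** Convergence at every point of [Ds], where U is continuous: once the kernel is carried by a box
    on which U varies by at most d, the average differs from the value by at most d. *)
Lemma pk_cvg (U : W -> R) (M : R) (kk : nat -> V -> R) (ee : nat -> R) (s : V) (y : R) :
  measurable_fun (@Qs R n) U -> (forall z, Ds z -> `|U z| <= M) ->
  (forall m, [/\ smooth (kk m), forall t, 0 <= kk m t, forall t, kk m (- t) = kk m t,
      supp_box (ee m) (kk m) & \int[nu]_t kk m t = 1]) ->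
  ee @ \oo --> (0 : R) -> Ds (Phi (s, y)) -> {for (Phi (s, y) : W), continuous U} ->
  (fun m => pk U (kk m) (s, y)) @ \oo --> cutU U (s, y).
Proof.
move=> mU UM hk he sD cU; apply/(@cvgrPdist_le R R^o) => d d0.
have [r r0 hr] := cutU_locally_continuous d0 sD cU.
have ne : \forall m \near \oo, `|0 - ee m| < r by move/(@cvgrPdist_lt R R^o): he; apply.
apply: filterS ne => m; rewrite sub0r normrN => em.
have [sk k0 ke supk k1] := hk m.
have i1 := conv_intg sk supk s (slice_cutU mU UM y).
have i2 := intg_kernel_shift2 sk supk ke s.
have -> : cutU U (s, y) - pk U (kk m) (s, y) =
    \int[nu]_t (cutU U (s, y) * kk m (s - t) - kk m (s - t) * cutU U (t, y)).
  by rewrite (RintB (intgZ _ i2) i1) (RintZ _ i2) (int_kernel_shift2 sk supk ke k1) mulr1.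
have -> : d = \int[nu]_t (d * kk m (s - t)).
  by rewrite (RintZ _ i2) (int_kernel_shift2 sk supk ke k1) mulr1.
apply: le_norm_Rint; [by apply: intgB => //; exact: intgZ|exact: intgZ|] => t.
have [hb|hb] := pselect (boxT (ee m) (s - t : T)); last by rewrite supk// !(mulr0, mul0r) subr0 normr0.
have -> : cutU U (s, y) * kk m (s - t) - kk m (s - t) * cutU U (t, y) =
  - ((cutU U (t, y) - cutU U (s, y)) * kk m (s - t)) by ring.
rewrite normrN normrM (ger0_norm (k0 _)) ler_wpM2r//; apply: hr.
have em' : ee m <= r by rewrite (le_trans (ler_norm _))// ltW.
case: hb => h1 h2; split => [i|]; first exact: le_trans (h1 i) em'.
move: h2; rewrite /= !in_itv/= -!ler_norml => h2; exact: le_trans em'.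
Qed.

End pointwise_limit.

Section limit_inequality.
Variables (R : realType) (n : nat) (a Lambda K : R) (A : 'rV[R]_n -> 'M[R]_n.+1).
Hypothesis HA : admissible_coef Lambda K A.
Local Notation leb := (@lebesgue_measure R).
Local Notation Y := (measurableTypeR R).
Local Notation T := ('rV[R]_n * measurableTypeR R)%type.
Local Notation V := ('rV[R]_n * R)%type.
Local Notation Z := ('rV[R]_n.+1 * measurableTypeR R)%type.
Local Notation nu := (lebVt R n).
Local Notation Phi := (@Phi R n).
Local Notation Qs := (@Qs R n).
Local Notation Ds := (@Ds R n).
Local Notation b_ := (b_ R).

Variables (U : Z -> R) (G : Z -> 'rV[R]_n.+1) (M : R).
Hypotheses (ha : -1 < a < 1) (mU : measurable_fun Qs U)
  (mG : forall i, measurable_fun Qs (fun z => G z 0 i))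
  (IG : forall i, (\int[lebVt R n.+1]_(z in Qs) (weight a z.1 * (G z 0 i) ^+ 2)%:E < +oo)%E)
  (UM : forall z, Ds z -> `|U z| <= M).
Hypotheses (WG : is_weak_grad Qs U G)
  (WS : forall phi, test_function (cyl (eball 4) `]0, 16[%classic) phi ->
    \int[lebVt R n.+1]_(z in Qs)
      (weight a z.1 * (mxform (A (col' ord_max z.1)) (G z) (grad phi z)
                       + U z * dtime phi z)) = 0).


Hypothesis cU : forall z, Ds z -> {for (z : 'rV[R]_n.+1 * R), continuous (U : 'rV[R]_n.+1 * R -> R)}.
Local Notation gro := (gro G).
Local Notation Jint := (Jint a).

Variables (om om' : R -> R) (eta etat : T * Y -> R) (etad : 'I_n.+1 -> T * Y -> R)
  (t1 t2 : R).
Hypotheses (t1_gt0 : 0 < t1) (t2_lt : t2 < 1) (om_ge0 : forall s, 0 <= om s)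
  (dom : forall s : R, is_derive s (1 : R) om (om' s))
  (com' : continuous om') (som : supp_in t1 t2 om) (som' : supp_in t1 t2 om').
Hypotheses (ceta : continuous (eta : V * R -> R)) (cetat : continuous (etat : V * R -> R))
  (cetad : forall i, continuous (etad i : V * R -> R)).
Hypotheses
  (deta : forall (i : 'I_n) (y : R) (t : V),
    is_derive t (ex R i) (fun s : V => eta (s, y)) (etad (lift ord_max i) (t, y)))
  (detat : forall (y : R) (t : V), is_derive t (et R n) (fun s : V => eta (s, y)) (etat (t, y)))
  (detay : forall (t : T) (y : R),
    is_derive y (1 : R) (fun y : R => eta (t, y)) (etad ord_max (t, y)))
  (eta0 : forall (s : T) (y : R), t1 < s.2 < t2 -> 4 <= sq s.1 + y ^+ 2 -> eta (s, y) = 0)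
  (etad0 : forall i (s : T) (y : R), t1 < s.2 < t2 -> 4 <= sq s.1 + y ^+ 2 -> etad i (s, y) = 0).


Let active (w : T * Y) := t1 < w.1.2 < t2 /\ sq w.1.1 + w.2 ^+ 2 < 4.

Lemma active_Ds (w : T * Y) : 0 < w.2 -> active w -> Ds (Phi w).
Proof.
case: w => s y y0 [/= h1 h2]; apply/Ds_Phi.
have g1 := t1_gt0; have g2 := t2_lt; case/andP: h1 => h1 h1'.
split => //; first by apply: lt_trans h2 _; rewrite ltr_nat.
by apply/andP; split; lra.
Qed.

Let kernel_seq : exists (kk : nat -> V -> R) (ee : nat -> R),
  [/\ forall m, [/\ smooth (kk m), forall t, 0 <= kk m t, forall t, kk m (- t) = kk m t,
      supp_box (ee m) (kk m) & \int[nu]_t kk m t = 1], ee @ \oo --> (0 : R) &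
   forall m, [/\ 0 < ee m, ee m < t1 & ee m * (10 * n.+1%:R) < 1]].
Proof.
(* t1 / 2 keeps the kernel inside t > 0; 1 / (20 (n + 1)) gives the product with 10 (n + 1) a value
   of at most 1 / 2. *)
pose e0 := Num.min (t1 / 2) (20 * n.+1%:R)^-1.
have t10 := t1_gt0.
have e00 : 0 < e0 by rewrite lt_min divr_gt0// invr_gt0 mulr_gt0.
pose ee m : R := e0 * m.+1%:R^-1.
have ee0 m : 0 < ee m by rewrite mulr_gt0// invr_gt0.
have eel m : ee m <= e0 by rewrite ler_piMr ?(ltW e00)// invf_le1// ler1n.
have /choice [kk hk] : forall m, exists k : V -> R, [/\ smooth k, forall t, 0 <= k t, forall t, k (- t) = k t,
      supp_box (ee m) k & \int[nu]_t k t = 1] by move=> m; exact: mollifier_exists.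
exists kk, ee; split => // [|m].
  rewrite -[X in _ --> X](mulr0 e0); apply: cvgM; [exact: cvg_cst|exact: cvg_harmonic].
split => //.
  by apply: le_lt_trans (eel m) _; rewrite gt_min; apply/orP; left; lra.
apply: (@le_lt_trans _ _ ((20 * n.+1%:R)^-1 * (10 * n.+1%:R))).
  by rewrite ler_wpM2r// (le_trans (eel m))// ge_min lexx orbT.
rewrite mulrC -ltr_pdivlMr ?invr_gt0 ?mulr_gt0// invrK mul1r ltr_pM2r// ltr_nat//.
Qed.

(** Dominated convergence: mollification preserves the bound |M|, and the weight is integrable over
    the box. *)
Let Jint_cvg (kk : nat -> V -> R) (ee : nat -> R) (F : T * Y -> R) :
  (forall m, [/\ smooth (kk m), forall t, 0 <= kk m t, forall t, kk m (- t) = kk m t,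
      supp_box (ee m) (kk m) & \int[nu]_t kk m t = 1]) -> ee @ \oo --> (0 : R) ->
  gro 0 F -> (forall w, ~ active w -> F w = 0) ->
  (nu \x leb)%E.-integrable setT (EFin \o (fun w => Wt a w.2 * (F w * cutU U w ^+ 2))) /\
  (fun m => Jint (fun w => F w * pk U (kk m) w ^+ 2)) @ \oo --> Jint (fun w => F w * cutU U w ^+ 2).
Proof.
move=> hk he [mF [C C0 hF]] F0.
have mW : measurable_fun setT (fun w : T * Y => Wt a w.2).
  exact: (measurableT_comp (intg_measurable (intg_Wt ha)) measurable_snd).
apply: (@Rint_dct _ _ _ _ (fun m w => Wt a w.2 * (F w * pk U (kk m) w ^+ 2))
  (fun w => Wt a w.2 * (F w * cutU U w ^+ 2))
  (fun w => (C * `|M| ^+ 2) * (\1_(boxT 9) w.1 * Wt a w.2))).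
- move=> m; have [sk k0 ke supk k1] := hk m.
  apply: measurable_funM => //; apply: measurable_funM => //.
  by apply: measurable_funX; exact: (gro_pk HA mU mG UM sk supk).1.
- by apply: intgZ; exact: intg_box_Wt.
- move=> m [s y]; have [sk k0 ke supk k1] := hk m.
  have W0 : 0 <= Wt a y by exact: powc_ge0.
  have [act|act] := pselect (active (s, y)); last first.
    by rewrite F0// mul0r mulr0 normr0 !mulr_ge0// sqr_ge0.
  have hb : boxT 9 s.
    have [|//] := @Ds_box R n s 1; apply/Ds_Phi; case: act => /= /andP[h1 h1'] h2.
    have g1 := t1_gt0; have g2 := t2_lt; have h3 := sqr_ge0 (y : R).
    split => //; last by apply/andP; split; lra.
    by rewrite expr1n; lra.
  rewrite indicE mem_set//= mul1r !normrM (ger0_norm W0) mulrC ler_wpM2r// ler_pM//.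
    by have := hF s y; rewrite expr0 mulr1.
  by rewrite [leRHS]expr2 ler_pM// (pk_le mU UM sk supk k0 ke k1).
- move=> [s y]; have [act|act] := pselect (active (s, y)); last first.
    rewrite F0// mul0r mulr0 (_ : (fun m => _) = fun=> 0); first exact: cvg_cst.
    by apply/funext => m; rewrite mul0r mulr0.
  have [y0|y0] := boolP (0 < y).
    have sD := active_Ds (w := (s, y)) y0 act.
    have c1 := pk_cvg mU UM hk he sD (cU sD).
    apply: cvgM; first exact: cvg_cst.
    apply: cvgM; first exact: cvg_cst.
    by rewrite expr2; exact: (cvgM c1 c1).
  rewrite /Wt powc_out ?negb_and ?y0// mul0r (_ : (fun m => _) = fun=> 0); first exact: cvg_cst.
  by apply/funext => m; rewrite mul0r.
Qed.

(** The gradient of U has been absorbed and only U remains. B is any integrable majorant of y^a U^2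
    on the active region, so that the loss can be expressed by a quantity that does not depend on
    om. *)
Lemma energy_limit (b0 : R) : 0 <= b0 -> (forall s, om s <= 1) ->
  (forall w, active w -> - b0 <= eta w * etat w - Lambda * \sum_i etad i w ^+ 2) ->
  forall B : T * Y -> R,
  (nu \x leb)%E.-integrable setT (EFin \o B) -> (forall w, 0 <= B w) ->
  (forall w, active w -> Wt a w.2 * cutU U w ^+ 2 <= B w) ->
  - (2 * b0 * \int[(nu \x leb)%E]_w B w) <=
  - Jint (fun w => om' w.1.2 * eta w ^+ 2 * cutU U w ^+ 2).
Proof.
move=> b00 om1 hb0 B iB B0 hB.
have [kk [ee [hk he hes]]] := kernel_seq.
have [C C0 EI] := energy_inequality HA ha mU mG IG UM WG WS t1_gt0 t2_lt om_ge0 dom com' som som'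
  ceta cetat cetad deta detat detay eta0 etad0.
pose F1 (w : T * Y) := om w.1.2 * (eta w * etat w) - Lambda * cutg om etad w.
pose F2 (w : T * Y) := om' w.1.2 * eta w ^+ 2.
have g2 : gro 0 F2 by exact: (gro_cutt1 G t1_gt0 t2_lt com' som som' ceta eta0).
have g1 : gro 0 F1.
  have h2 := gro_cutt2 G t1_gt0 t2_lt dom som som' ceta cetat eta0.
  have h3 := gro_cutg G t1_gt0 t2_lt dom som cetad etad0.
  have gc c : gro 0 (fun _ : T * Y => c).
    by split => //; exists `|c| => // s y; rewrite expr0 mulr1.
  have := groD (groM (gc 2^-1) h2) (groM (gc (- Lambda)) h3).
  rewrite (_ : (fun w => _) = F1) => [//|]; apply/funext => w.
  by rewrite /F1 mulNr; congr (_ - _); field.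
have F10 w : ~ active w -> F1 w = 0.
  move=> h; rewrite /F1 (cutg_inactive som etad0 h) mulr0 subr0.
  case: w h => s y; rewrite /active /= => h.
  have [h1|h1] := boolP (t1 < s.2 < t2).
    rewrite eta0 ?(mulr0, mul0r)// leNgt; apply/negP => h2; exact: h.
  rewrite som ?mul0r//.
  by move: h1; rewrite negb_and -!leNgt => /orP.
have F20 w : ~ active w -> F2 w = 0.
  case: w => s y; rewrite /active /F2 /= => h.
  have [h1|h1] := boolP (t1 < s.2 < t2).
    rewrite eta0 ?expr0n ?(mulr0, mul0r)// leNgt; apply/negP => h2; exact: h.
  rewrite som' ?mul0r//.
  by move: h1; rewrite negb_and -!leNgt => /orP.
have [i1 c1] := Jint_cvg hk he g1 F10.
have [i2 c2] := Jint_cvg hk he g2 F20.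
have L : 2 * Jint (fun w => F1 w * cutU U w ^+ 2) <= - Jint (fun w => F2 w * cutU U w ^+ 2).
  have cl : (fun m => 2 * Jint (fun w => F1 w * pk U (kk m) w ^+ 2) - ee m * C) @ \oo -->
      2 * Jint (fun w => F1 w * cutU U w ^+ 2) - 0 * C.
    apply: (@cvgB R R^o); first by apply: cvgM; [exact: cvg_cst|exact: c1].
    by apply: cvgM; [exact: he|exact: cvg_cst].
  have cr : (fun m => - Jint (fun w => F2 w * pk U (kk m) w ^+ 2)) @ \oo -->
      - Jint (fun w => F2 w * cutU U w ^+ 2) by exact: (@cvgN R R^o).
  rewrite mul0r subr0 in cl.
  have LL := ler_cvg_to cl cr; apply: LL; apply: nearW => m.
  have [sk k0 ke supk k1] := hk m; have [e1 e2 e3] := hes m.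
  exact: EI.
apply: le_trans L; rewrite -mulNr.
have -> : - (2 * b0) * \int[(nu \x leb)%E]_w B w = 2 * ((- b0) * \int[(nu \x leb)%E]_w B w) by ring.
rewrite ler_pM2l//.
have E := RintZ (- b0) iB; rewrite -E; apply: le_Rint; [exact: intgZ|exact: i1|] => w.
have W0 : 0 <= Wt a w.2 by exact: powc_ge0.
have [act|act] := pselect (active w); last by rewrite F10// mul0r mulr0 mulNr oppr_le0 mulr_ge0.
have h1 := hB w act; have h2 := hb0 w act.
apply: (@le_trans _ _ (- b0 * (Wt a w.2 * cutU U w ^+ 2))).
  by rewrite !mulNr lerN2 ler_wpM2l.
rewrite mulrCA ler_wpM2l// ler_wpM2r ?sqr_ge0//.
have -> : F1 w = om w.1.2 * (eta w * etat w - Lambda * \sum_i etad i w ^+ 2) by rewrite /F1 /cutg; ring.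
have h3 := om_ge0 w.1.2; have h4 := om1 w.1.2.
apply: (@le_trans _ _ (om w.1.2 * - b0)); last by rewrite ler_wpM2l.
by rewrite mulrN lerN2 ler_piMl.
Qed.

End limit_inequality.

(** * Limits in time *)

Section weak_monotone.
Variable R : realType.
Local Notation leb := (@lebesgue_measure R).
Local Notation Y := (measurableTypeR R).

Lemma unit_bump (al be : R) : al < be -> exists rho : R -> R,
  [/\ continuous rho, forall s, 0 <= rho s, supp_in al be rho,
      leb.-integrable setT (EFin \o (rho : Y -> R)) & \int[leb]_s rho s = 1].
Proof.
move=> ab; have i0 := int_smooth_between_gt0 ab; set i := (X in 0 < X) in i0.
have c0 := smooth1_continuous (smooth1_between al be 0).
have s0 := @supp_smooth_between R al be 0.
have int0 := intg_continuous_supp c0 s0.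
exists (fun s => i^-1 * smooth_between al be 0 s); split.
- by move=> s; apply: cvgM; [exact: cvg_cst|exact: c0].
- by move=> s; rewrite mulr_ge0 ?smooth_between_ge0// invr_ge0 ltW.
- by move=> s hs; rewrite s0// mulr0.
- exact: intgZ.
- by rewrite (RintZ _ int0) mulVf// gt_eqF.
Qed.

Lemma right_limit_ball (F : R -> R) (p l e : R) : F @ p^'+ --> l -> 0 < e ->
  exists2 r, 0 < r & forall t, p < t < p + r -> `|l - F t| <= e.
Proof.
move=> /(@cvgrPdist_le R R^o) h e0.
have N : nbhs (p : R) (fun t => p < t -> `|l - F t| <= e) by exact: (h e e0).
have [r /= r0 hr] := (@nbhs_ballP R _ p _).1 N.
exists r => // t /andP[t1 t2]; apply: hr => //.
by rewrite /ball/= ltr_norml; lra.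
Qed.

Lemma left_limit_ball (F : R -> R) (p l e : R) : F @ p^'- --> l -> 0 < e ->
  exists2 r, 0 < r & forall t, p - r < t < p -> `|l - F t| <= e.
Proof.
move=> /(@cvgrPdist_le R R^o) h e0.
have N : nbhs (p : R) (fun t => t < p -> `|l - F t| <= e) by exact: (h e e0).
have [r /= r0 hr] := (@nbhs_ballP R _ p _).1 N.
exists r => // t /andP[t1 t2]; apply: hr => //.
by rewrite /ball/= ltr_norml; lra.
Qed.

Lemma bump_average (F : Y -> R) (rho : R -> R) (al be l e : R) :
  leb.-integrable setT (EFin \o F) -> continuous rho -> (forall s, 0 <= rho s) ->
  supp_in al be rho -> leb.-integrable setT (EFin \o (rho : Y -> R)) -> \int[leb]_s rho s = 1 ->
  (forall t, al < t < be -> `|l - F t| <= e) ->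
  leb.-integrable setT (EFin \o (fun s => rho s * F s)) /\ `|l - \int[leb]_s (rho s * F s)| <= e.
Proof.
move=> iF crho rho0 srho irho rho1 hF.
have [C C0 hC] := continuous_bounded_supp crho srho.
have irF : leb.-integrable setT (EFin \o (fun s => rho s * F s)).
  apply: (intg_le _ (intgZ C (intg_norm iF))).
    by apply: measurable_funM; [exact: continuous_measurable_R|exact: intg_measurable iF].
  by move=> s; rewrite normrM ler_wpM2r.
split=> //.
have -> : l - \int[leb]_s (rho s * F s) = \int[leb]_s (l * rho s - rho s * F s).
  by rewrite (RintB (intgZ l irho) irF) (RintZ _ irho) rho1 mulr1.
have -> : e = \int[leb]_s (e * rho s) by rewrite (RintZ _ irho) rho1 mulr1.
apply: le_norm_Rint; [by apply: intgB => //; exact: intgZ|exact: intgZ|] => s.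
rewrite mulrC -mulrBr normrM (ger0_norm (rho0 s)) mulrC.
have [h|h] := boolP (al < s < be); first by rewrite ler_wpM2r// hF.
rewrite srho ?mulr0//.
by move: h; rewrite negb_and -!leNgt => /orP.
Qed.

(** om' is taken as p0 - p1, with unit bumps just after 0 and just before tau. The hypothesis then
    compares averages of F near both ends, which approach the one-sided limits. *)
Lemma weak_monotone (F : Y -> R) (tau c F0 F1 : R) : 0 < tau ->
  leb.-integrable setT (EFin \o F) -> (F : R -> R) @ (0 : R)^'+ --> F0 -> (F : R -> R) @ tau^'- --> F1 ->
  (forall (om om' : R -> R) t1 t2, 0 < t1 -> t2 < tau -> (forall s, 0 <= om s) ->
    (forall s, om s <= 1) -> (forall s : R, is_derive s (1 : R) om (om' s)) -> continuous om' ->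
    supp_in t1 t2 om -> supp_in t1 t2 om' -> - c <= - \int[leb]_s (om' s * F s)) ->
  F0 - c <= F1.
Proof.
move=> tau0 iF cF0 cF1 H.
apply/ler_addgt0Pr => e' e'0; pose e := e' / 2.
have e0 : 0 < e by rewrite divr_gt0.
have [r0 r00 hr0] := right_limit_ball cF0 e0.
have [r1 r10 hr1] := left_limit_ball cF1 e0.
(* The bumps live on [d / 2, d] and [tau - d, tau - d / 2]: inside the neighbourhoods where F is
   close to its limits, and disjoint as 4 d <= tau. *)
pose d := Num.min (Num.min r0 r1) tau / 4.
have m0 : 0 < Num.min (Num.min r0 r1) tau by rewrite !lt_min r00 r10.
have d0 : 0 < d by rewrite divr_gt0.
have dr0 : 4 * d <= r0 by rewrite /d mulrC divfK// ge_min ge_min lexx.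
have dr1 : 4 * d <= r1 by rewrite /d mulrC divfK// ge_min ge_min lexx orbT.
have dtau : 4 * d <= tau by rewrite /d mulrC divfK// ge_min lexx orbT.
have ab0 : d / 2 < d by lra.
have ab1 : tau - d < tau - d / 2 by lra.
have [p0 [cp0 p00 sp0 ip0 ep0]] := unit_bump ab0.
have [p1 [cp1 p10 sp1 ip1 ep1]] := unit_bump ab1.
have [|ipF0 h0] := bump_average (l := F0) (e := e) iF cp0 p00 sp0 ip0 ep0.
  by move=> t ht; apply: hr0; lra.
have [|ipF1 h1] := bump_average (l := F1) (e := e) iF cp1 p10 sp1 ip1 ep1.
  by move=> t ht; apply: hr1; lra.
pose w s := p1 s - p0 s.
have iw : leb.-integrable setT (EFin \o (w : Y -> R)) by exact: intgB.
have cw : continuous w by move=> s; apply: (@cvgB R R^o); [exact: cp1|exact: cp0].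
pose om y := \int[leb]_u (if y < u then w u else 0).
pose tl (p : R -> R) y := \int[leb]_u (if y < u then p u else 0).
have omE y : om y = tl p1 y - tl p0 y.
  rewrite /tl -(RintB (intg_upper y ip1) (intg_upper y ip0)); apply: eq_Rint => u.
  by rewrite /w; case: ifP => _; rewrite ?subr0.
have tl01 (p : R -> R) y : (forall s, 0 <= p s) -> leb.-integrable setT (EFin \o (p : Y -> R)) ->
    \int[leb]_s p s = 1 -> 0 <= tl p y <= 1.
  move=> pp ip ep; apply/andP; split; first by apply: Rint_ge0 => u; case: ifP.
  by rewrite -ep; apply: le_Rint => //; [exact: intg_upper|move=> u; case: ifP].
have sw : supp_in (d / 2) (tau - d / 2) w.
  by move=> s hs; rewrite /w sp1 ?sp0 ?subr0//; case: hs => hs; [left|right|left|right]; lra.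
have som : supp_in (d / 2) (tau - d / 2) om.
  move=> y [h|h]; last by rewrite /om (tail_supp sw).
  by rewrite /om (tail_supp_low sw)// (RintB ip1 ip0) ep0 ep1 subrr.
have dom (s : R) : is_derive s (1 : R) om (p0 s - p1 s).
  by have := is_derive_tail s iw cw; rewrite /w opprB.
(* The bumps are ordered: the tail of p1 is still 1 up to tau - d, and beyond it the tail of p0 is
   already 0. *)
have om01 y : 0 <= om y <= 1.
  rewrite omE; have /andP[a1 a2] := tl01 p0 y p00 ip0 ep0; have /andP[b1 b2] := tl01 p1 y p10 ip1 ep1.
  have [h|h] := leP y (tau - d).
    have -> : tl p1 y = 1 by rewrite /tl (tail_supp_low sp1).
    by apply/andP; split; lra.
  have -> : tl p0 y = 0 by rewrite /tl (tail_supp sp0)//; lra.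
  by rewrite subr0; apply/andP; split; lra.
have cNw : continuous (fun s => p0 s - p1 s).
  by move=> s; apply: (@cvgB R R^o); [exact: cp0|exact: cp1].
have sNw : supp_in (d / 2) (tau - d / 2) (fun s => p0 s - p1 s).
  by move=> s hs; have := sw s hs; rewrite /w => /eqP; rewrite subr_eq0 => /eqP ->; rewrite subrr.
have t10 : 0 < d / 2 by lra.
have t2 : tau - d / 2 < tau by lra.
have := H om (fun s => p0 s - p1 s) (d / 2) (tau - d / 2) t10 t2
  (fun y => (andP (om01 y)).1) (fun y => (andP (om01 y)).2) dom cNw som sNw.
have -> : \int[leb]_s ((p0 s - p1 s) * F s) = \int[leb]_s (p0 s * F s) - \int[leb]_s (p1 s * F s).
  by rewrite -(RintB ipF0 ipF1); apply: eq_Rint => s; rewrite mulrBl.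
have e2 : e + e = e' by rewrite /e; lra.
move: h0 h1 e2; clear.
move: (\int[leb]_s (p0 s * F s)) (\int[leb]_s (p1 s * F s)) => X0 X1.
rewrite !ler_norml => /andP[a1 a2] /andP[b1 b2] h1 h2; lra.
Qed.

End weak_monotone.

Lemma between_ge0 (R : realType) (al be u : R) : 0 <= between al be u.
Proof. by rewrite /between; case: ltP => // _; case: ltP. Qed.

Lemma intg_snoc (R : realType) (n : nat) (f : 'rV[R]_n.+1 -> R) : measurable_fun setT f ->
  (lebV R n \x @lebesgue_measure R)%E.-integrable setT (EFin \o (fun xy => f (rV_snoc xy))) ->
  (lebV R n.+1).-integrable setT (EFin \o f).
Proof.
move=> mf /integrableP[_ foo]; apply/integrableP; split; first exact/measurable_EFinP.
have := ge0_integral_pushforward (@measurable_rV_snoc R n) (lebV R n \x @lebesgue_measure R)%E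
  measurableT (f := fun X => `|(f X)%:E|%E).
rewrite preimage_setT => E; apply: le_lt_trans foo; rewrite le_eqVlt; apply/orP; left; apply/eqP.
by apply: E => [|X _]; [exact/measurableT_comp/measurable_EFinP|exact: abse_ge0].
Qed.

(** * Boundedness and continuity of U up to the boundary *)

Section closed_half_ball.
Variables (R : realType) (n : nat).
Local Notation W := ('rV[R]_n.+1 * R)%type.

(** The set provided by [continuous_representative] at r = 3, with 9 = 3^2; compact, and large
    enough to contain [Ds] together with the slice t = 0. *)
Definition Dbar : set W := cyl (closure (eball_plus 3)) `[0, 9]%classic.

Lemma compact_Dbar : compact Dbar.
Proof.
apply: compact_setX; last exact: segment_compact.
have cB := @rV_compact R n.+1 (fun=> `[- 3, 3]%classic) (fun i => @segment_compact _ _ _).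
apply: (subclosed_compact _ cB); first exact: closed_closure.
have clB := compact_closed (@norm_hausdorff _ _) cB.
rewrite closureE => X; apply; split => // x [h1 h2] i /=.
rewrite in_itv/= -ler_norml -(@ler_pXn2r _ 2)// ?nnegrE// real_normK ?num_real//.
move: h1; rewrite /eball/= enorm_lt// => h1; apply: le_trans (ltW h1).
rewrite /sq (bigD1 i)//= lerDl; apply: sumr_ge0 => j _; exact: sqr_ge0.
Qed.

Lemma Ds_Dbar (z : W) : @Ds R n z -> Dbar z.
Proof.
move=> [h1 h2]; split; first exact: subset_closure.
by move: h2; rewrite /= !in_itv/= => /andP[h3 h4]; rewrite !ltW.
Qed.

Variable U : W -> R.
Hypothesis cU : {within Dbar, continuous U}.

Lemma within_bounded : exists M, forall z, @Ds R n z -> `|U z| <= M.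
Proof.
have : bounded_set (U @` Dbar).
  by apply: compact_bounded; apply: continuous_compact => //; exact: compact_Dbar.
move=> [M [Mr hM]]; exists (M + 1) => z zD; apply: hM; first by rewrite ltrDl.
by exists z => //; exact: Ds_Dbar.
Qed.

Lemma within_interior_continuous z : @Ds R n z -> {for z, continuous U}.
Proof.
move=> zD; have h := ((@subspace_continuousP _ _ _ _).1 cU) z (Ds_Dbar zD).
move=> B nB; have N1 : nbhs z [set x | Dbar x -> B (U x)] by exact: h.
have N2 : nbhs z (@Ds R n : set W) by apply: open_nbhs_nbhs; split => //; exact: open_Ds.
apply: filterS (filterI N1 N2) => x [/= h1 h2]; exact/h1/Ds_Dbar.
Qed.

(** Continuity within [Dbar] reaches t0 = 0, a time that [Ds] excludes. *)
Lemma within_time_limit (X : 'rV[R]_n.+1) (u : nat -> R) (t0 : R) : eball_plus 3 X -> 0 <= t0 <= 9 ->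
  u @ \oo --> t0 -> (\forall m \near \oo, 0 <= u m <= 9) ->
  (fun m => U (X, u m)) @ \oo --> U (X, t0).
Proof.
move=> hX ht0 hu nu9.
have D0 : Dbar (X, t0) by split; [exact: subset_closure|rewrite /= in_itv].
have h := ((@subspace_continuousP _ _ _ _).1 cU) _ D0.
move=> B nB; have N1 : nbhs ((X, t0) : W) [set x | Dbar x -> B (U x)] by exact: h.
have H1 : (fun _ : nat => X) @ \oo --> X by exact: cvg_cst.
have N2 : \forall m \near \oo, [set x | Dbar x -> B (U x)] (X, u m) by exact: (cvg_pair H1 hu).
apply: filterS2 N2 nu9 => m /= h1 h2; apply: h1.
by split; [exact: subset_closure|rewrite /= in_itv].
Qed.

End closed_half_ball.

(** * The weighted energy as a function of time *)

Section time_slices.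
Variables (R : realType) (n : nat) (a Lambda K : R) (A : 'rV[R]_n -> 'M[R]_n.+1).
Hypothesis HA : admissible_coef Lambda K A.
Local Notation leb := (@lebesgue_measure R).
Local Notation Y := (measurableTypeR R).
Local Notation T := ('rV[R]_n * measurableTypeR R)%type.
Local Notation V := ('rV[R]_n * R)%type.
Local Notation Z := ('rV[R]_n.+1 * measurableTypeR R)%type.
Local Notation nu := (lebVt R n).
Local Notation Phi := (@Phi R n).
Local Notation Qs := (@Qs R n).
Local Notation Ds := (@Ds R n).
Local Notation b_ := (b_ R).

Variables (U : Z -> R) (G : Z -> 'rV[R]_n.+1) (M : R).
Hypotheses (ha : -1 < a < 1) (mU : measurable_fun Qs U)
  (mG : forall i, measurable_fun Qs (fun z => G z 0 i))
  (IG : forall i, (\int[lebVt R n.+1]_(z in Qs) (weight a z.1 * (G z 0 i) ^+ 2)%:E < +oo)%E)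
  (UM : forall z, Ds z -> `|U z| <= M).
Hypotheses (WG : is_weak_grad Qs U G)
  (WS : forall phi, test_function (cyl (eball 4) `]0, 16[%classic) phi ->
    \int[lebVt R n.+1]_(z in Qs)
      (weight a z.1 * (mxform (A (col' ord_max z.1)) (G z) (grad phi z)
                       + U z * dtime phi z)) = 0).


Hypothesis cU : {within (@Dbar R n), continuous (U : 'rV[R]_n.+1 * R -> R)}.
Local Notation X_ := ('rV[R]_n.+1).
Local Notation leX := (lebV R n.+1).

Definition B2 : set X_ := eball_plus 2.

Let mB2 : measurable B2. Proof. by apply: measurable_eball_plus. Qed.

Definition wB (X : X_) : R := weight a X * \1_B2 X.

Let mweight : measurable_fun setT (fun X : X_ => weight a X).
Proof. exact: (measurableT_comp (measurable_powR _) (@measurable_coord R n.+1 ord_max)). Qed.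

Lemma wB_ge0 X : 0 <= wB X.
Proof. by rewrite mulr_ge0 ?powR_ge0// indicE ler0n. Qed.

Let mwB : measurable_fun setT wB.
Proof. by apply: measurable_funM => //; exact: measurable_indic. Qed.

Lemma intg_wB : leX.-integrable setT (EFin \o wB).
Proof.
apply: intg_snoc => //.
have mb : measurable_fun setT (\1_(box 2) : 'rV[R]_n -> R).
  by apply: measurable_indic; exact: measurable_box.
have ib : (lebV R n).-integrable setT (EFin \o (\1_(box 2) : 'rV[R]_n -> R)).
  apply/integrableP; split; first exact/measurable_EFinP.
  under eq_integral do rewrite gee0_abs ?lee_fin//.
  rewrite integral_indic//; last exact: measurable_box.
  have E : lebV R n (box 2) = ((2 *+ 2) ^+ n)%:E by exact: lebesgue_rV_box.
  have E' : (lebV R n (box 2) < +oo)%E by rewrite E ltry.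
  by rewrite setIT; exact: E'.
apply: (dom_product (h := \1_(box 2)) (B := Wt a)) => //.
- apply: (measurableT_comp mwB); exact: measurable_rV_snoc.
- exact: intg_Wt.
move=> x y; rewrite ger0_norm ?wB_ge0// /wB indicE.
have [h|h] := boolP (_ \in B2); last by rewrite mulr0 mulr_ge0 ?powc_ge0// indicE ler0n.
have [h1 h2] : B2 (rV_snoc (x, y)) by exact: set_mem.
move: h1 h2; rewrite /eball/= enorm_lt// sq_snoc snoc_max => h1 h2.
have e4 : 2 ^+ 2 = 4 :> R by ring.
have sx : sq x <= 4 by rewrite -e4; apply: ltW; apply: le_lt_trans h1; rewrite lerDl sqr_ge0.
have y3 : y < 3.
  rewrite -(@ltr_pXn2r _ 2)// ?nnegrE ?(ltW h2)//.
  have s0 : 0 <= sq x by apply: sumr_ge0 => i _; exact: sqr_ge0.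
  have e9 : 3 ^+ 2 = 9 :> R by ring.
  by rewrite e9; move: h1; rewrite e4; move: (y ^+ 2) => yy; lra.
rewrite mulr1 /weight snoc_max /Wt powc_in ?h2// indicE mem_set ?mul1r// => i.
rewrite -(@ler_pXn2r _ 2)// ?nnegrE// real_normK ?num_real// e4; apply: le_trans sx.
rewrite /sq (bigD1 i)//= lerDl; apply: sumr_ge0 => j _; exact: sqr_ge0.
Qed.

Variable eta : T * Y -> R.
Hypotheses (ceta : continuous (eta : V * R -> R)) (eta1 : forall w, `|eta w| <= 1).

Definition etaZ (z : Z) : R := eta (tang z, z.1 0 ord_max).
(* Zero outside 0 < t < 9. *)
Definition dens (z : Z) : R :=
  wB z.1 * (etaZ z ^+ 2 * ((U \_ Ds) z) ^+ 2).
(** Uses U itself and so makes sense at t = 0 as well, where it is the limit of [dens]. *)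
Definition dens0 (t : R) (X : X_) : R := wB X * (etaZ (X, t) ^+ 2 * U (X, t) ^+ 2).
Definition energy (t : Y) : R := \int[leX]_X dens (X, t).

Lemma etaZ_continuous : continuous (etaZ : 'rV[R]_n.+1 * R -> R).
Proof.
move=> z.
have H1 : (fun z : 'rV[R]_n.+1 * R => tang z) @ z --> (tang z : V) by exact: tang_continuous.
have H2 : (fun z : 'rV[R]_n.+1 * R => z.1 0 ord_max) @ z --> z.1 0 ord_max.
  exact: coord_fst_continuous.
apply: (@continuous_comp _ _ _ (fun z : 'rV[R]_n.+1 * R => (tang z, z.1 0 ord_max) : V * R) eta).
  exact: (cvg_pair H1 H2).
exact: ceta.
Qed.

Let mUD : measurable_fun setT (U \_ Ds).
Proof.
apply/(measurable_restrictT _ (@measurable_Ds R n)).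
by apply: measurable_funS mU; [exact: measurable_Qs|exact: Ds_Qs].
Qed.

Let mdens : measurable_fun setT dens.
Proof.
apply: measurable_funM; first exact: (measurableT_comp mwB measurable_fst).
apply: measurable_funM; apply: measurable_funX => //.
exact: continuous_measurable_T etaZ_continuous.
Qed.

Let UDM z : `|(U \_ Ds) z| <= `|M|.
Proof.
rewrite patchE; case: ifPn => [/set_mem h|_]; last by rewrite normr0.
by rewrite (le_trans (UM h))// ler_norm.
Qed.

Let dens_ge0 z : 0 <= dens z.
Proof. by rewrite /dens mulr_ge0 ?wB_ge0// mulr_ge0// sqr_ge0. Qed.

Let sq_le1 w : eta w ^+ 2 <= 1.
Proof. by rewrite -real_normK ?num_real// exprn_ile1. Qed.

Let sqUDM z : ((U \_ Ds) z) ^+ 2 <= `|M| ^+ 2.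
Proof. by rewrite -real_normK ?num_real// lerXn2r ?nnegrE. Qed.

Let dens_bound (X : X_) (t : Y) : `|dens (X, t)| <= (`|M| ^+ 2 * wB X) * between 0 9 t.
Proof.
rewrite ger0_norm// /dens /=.
have [h|h] := boolP (0 < t < 9).
  rewrite between_in// mulr1 mulrC ler_wpM2r ?wB_ge0//.
  rewrite -[leRHS]mul1r.
  by apply: ler_pM; [exact: sqr_ge0|exact: sqr_ge0|exact: sq_le1|exact: sqUDM].
have -> : (U \_ Ds) (X, t) = 0.
  rewrite patchE; case: ifPn => // /set_mem[_] /=; rewrite in_itv/= => h1.
  by rewrite h1 in h.
rewrite expr0n mulr0 mulr0; apply: mulr_ge0; last exact: between_ge0.
by apply: mulr_ge0; [exact: sqr_ge0|exact: wB_ge0].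
Qed.

Let i9 : leb.-integrable setT (EFin \o (between 0 9 : Y -> R)).
Proof. exact: intg_ind. Qed.

Lemma intg_energy : leb.-integrable setT (EFin \o energy).
Proof. exact: (dom_intg2 mdens (intgZ _ intg_wB) i9 dens_bound). Qed.

Lemma intg_dens : (lebVt R n.+1).-integrable setT (EFin \o dens).
Proof. exact: (dom_product mdens (intgZ _ intg_wB) i9 dens_bound). Qed.

Lemma int_dens_time (om : R -> R) C : measurable_fun setT (om : Y -> R) ->
  (forall s, `|om s| <= C) ->
  \int[lebVt R n.+1]_z (om z.2 * dens z) = \int[leb]_t (om t * energy t).
Proof.
move=> mom omC.
have C0 : 0 <= C by apply: le_trans (omC 0).
have mF : measurable_fun setT (fun z : Z => om z.2 * dens z).
  by apply: measurable_funM => //; exact: (measurableT_comp mom measurable_snd).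
have Fb X t : `|om t * dens (X, t)| <= (C * (`|M| ^+ 2 * wB X)) * between 0 9 t.
  by rewrite normrM -mulrA ler_pM.
have E := dom_fubini2 mF (intgZ C (intgZ (`|M| ^+ 2) intg_wB)) i9 Fb.
rewrite E; apply: eq_Rint => t; rewrite /energy -RintZ//.
exact: (dom_section2 mdens (intgZ (`|M| ^+ 2) intg_wB) dens_bound t).
Qed.

(** Dominated convergence with the bound M^2 times the weight on the half ball. Limits along
    sequences of positive times suffice for both one-sided limits. *)
Lemma energy_cvg (u : nat -> R) (t0 : R) : 0 <= t0 <= 1 -> u @ \oo --> t0 ->
  (\forall m \near \oo, 0 < u m) ->
  leX.-integrable setT (EFin \o dens0 t0) /\
  (fun m => energy (u m)) @ \oo --> \int[leX]_X dens0 t0 X.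
Proof.
move=> /andP[t00 t01] hu u0.
have n9 : \forall m \near \oo, u m < 9.
  have h : t0 < 9 by lra.
  exact: (cvgr_lt t0 hu).
apply: (@Rint_dct _ _ _ _ (fun m X => dens (X, u m)) (dens0 t0) (fun X => `|M| ^+ 2 * wB X)).
- by move=> m; exact: (measurable_fun_pair1 (u m : Y) mdens).
- by apply: intgZ; exact: intg_wB.
- move=> m X; apply: le_trans (dens_bound X (u m)) _; rewrite ler_piMr//.
    by rewrite mulr_ge0 ?wB_ge0// sqr_ge0.
  by rewrite (le_trans (ler_norm _))// normr_between_le1.
move=> X; have [hX|hX] := pselect (B2 X); last first.
  have w0 : wB X = 0 by rewrite /wB indicE memNset// mulr0.
  rewrite /dens0 w0 mul0r (_ : (fun m => _) = fun=> 0); first exact: cvg_cst.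
  by apply/funext => m; rewrite /dens /= w0 mul0r.
have hX3 : eball_plus 3 X.
  by case: hX => h1 h2; split => //; rewrite /eball/= (lt_trans h1)// ltr_nat.
have c1 : (fun m => U (X, u m)) @ \oo --> U (X, t0).
  apply: (within_time_limit cU hX3 _ hu); first by apply/andP; split; lra.
  by apply: filterS2 u0 n9 => m h1 h2; rewrite !ltW.
have c2 : (fun m => etaZ (X, u m)) @ \oo --> etaZ (X, t0).
  have H1 : (fun _ : nat => X) @ \oo --> X by exact: cvg_cst.
  apply: (cvg_comp (fun m => (X, u m)) etaZ (cvg_pair H1 hu)).
  exact: etaZ_continuous.
have c3 : (fun m => wB X * (etaZ (X, u m) ^+ 2 * U (X, u m) ^+ 2)) @ \oo --> dens0 t0 X.
  apply: cvgM; first exact: cvg_cst.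
  by apply: cvgM; rewrite expr2; apply: cvgM.
apply: cvg_trans c3; apply: near_eq_cvg.
apply: filterS2 u0 n9 => m h1 h2; rewrite /dens /= patchE mem_set//.
by split => //=; rewrite in_itv/= h1 h2.
Qed.

Lemma energy_right_limit : (energy : R -> R) @ (0 : R)^'+ --> \int[leX]_X dens0 0 X.
Proof.
apply/cvg_at_rightP => u [u0 hu].
have h01 : 0 <= (0 : R) <= 1 by rewrite lexx ler01.
have nu0 : \forall m \near \oo, 0 < u m by exact: nearW.
by have [] := energy_cvg h01 hu nu0.
Qed.

Lemma energy_left_limit (tau : R) : 0 < tau <= 1 ->
  (energy : R -> R) @ tau^'- --> \int[leX]_X dens0 tau X.
Proof.
move=> /andP[h1 h2]; apply/cvg_at_leftP => u [u0 hu].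
have h01 : 0 <= tau <= 1 by rewrite (ltW h1).
have nu0 : \forall m \near \oo, 0 < u m by exact: (cvgr_gt tau hu).
by have [] := energy_cvg h01 hu nu0.
Qed.

Lemma intg_dens0 (t0 : R) : 0 <= t0 <= 1 -> leX.-integrable setT (EFin \o dens0 t0).
Proof.
move=> /andP[h1 h2].
have hc : (fun m => t0 + m.+1%:R^-1) @ \oo --> t0.
  rewrite -[X in _ --> X]addr0; apply: (@cvgD R R^o); first exact: cvg_cst.
  exact: cvg_harmonic.
have h01 : 0 <= t0 <= 1 by rewrite h1.
have nu0 : \forall m \near \oo, 0 < t0 + m.+1%:R^-1 by apply: nearW => m; rewrite ltr_wpDl// invr_gt0.
by have [] := energy_cvg h01 hc nu0.
Qed.

End time_slices.

Section slice_inequality.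
Variables (R : realType) (n : nat) (a Lambda K : R) (A : 'rV[R]_n -> 'M[R]_n.+1).
Hypothesis HA : admissible_coef Lambda K A.
Local Notation leb := (@lebesgue_measure R).
Local Notation Y := (measurableTypeR R).
Local Notation T := ('rV[R]_n * measurableTypeR R)%type.
Local Notation V := ('rV[R]_n * R)%type.
Local Notation Z := ('rV[R]_n.+1 * measurableTypeR R)%type.
Local Notation nu := (lebVt R n).
Local Notation Phi := (@Phi R n).
Local Notation Qs := (@Qs R n).
Local Notation Ds := (@Ds R n).
Local Notation b_ := (b_ R).

Variables (U : Z -> R) (G : Z -> 'rV[R]_n.+1) (M : R).
Hypotheses (ha : -1 < a < 1) (mU : measurable_fun Qs U)
  (mG : forall i, measurable_fun Qs (fun z => G z 0 i))
  (IG : forall i, (\int[lebVt R n.+1]_(z in Qs) (weight a z.1 * (G z 0 i) ^+ 2)%:E < +oo)%E)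
  (UM : forall z, Ds z -> `|U z| <= M).
Hypotheses (WG : is_weak_grad Qs U G)
  (WS : forall phi, test_function (cyl (eball 4) `]0, 16[%classic) phi ->
    \int[lebVt R n.+1]_(z in Qs)
      (weight a z.1 * (mxform (A (col' ord_max z.1)) (G z) (grad phi z)
                       + U z * dtime phi z)) = 0).


Hypothesis cU : {within (@Dbar R n), continuous (U : 'rV[R]_n.+1 * R -> R)}.
Local Notation X_ := ('rV[R]_n.+1).
Local Notation leX := (lebV R n.+1).

Local Notation one := (fun _ : T * Y => 1 : R).

Lemma cst1_continuous : continuous (fun _ : V * R => 1 : R).
Proof. by move=> w; exact: cst_continuous. Qed.

Lemma normr_one_le (w : T * Y) : `|one w| <= 1.
Proof. by rewrite normr1. Qed.

(* The integral of y^a U^2 over the half ball of radius 2 and times 0 < t < tau. *)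
Definition total_energy (tau : R) : R := \int[leb]_t (between 0 tau t * energy a U one t).

Let ibdens tau : (lebVt R n.+1).-integrable setT
  (EFin \o (fun z : Z => between 0 tau z.2 * dens a U one z)) /\
  \int[lebVt R n.+1]_z (between 0 tau z.2 * dens a U one z) = total_energy tau.
Proof.
have mb := intg_measurable (@intg_ind R tau).
have id1 := intg_dens ha mU UM cst1_continuous normr_one_le.
split.
  apply: (intg_le _ (intg_norm id1)).
    apply: measurable_funM; last exact: intg_measurable id1.
    exact: (measurableT_comp mb measurable_snd).
  by move=> z; rewrite normrM ler_piMl// normr_between_le1.
exact: (int_dens_time ha mU UM cst1_continuous normr_one_le mb (fun s => normr_between_le1 0 tau s)).
Qed.

Let Phi2 (s : T) (y : Y) : 0 < y -> sq s.1 + y ^+ 2 < 4 -> B2 (Phi (s, y)).1.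
Proof.
move=> y0 h; split; last by rewrite /= snoc_max.
by rewrite /eball/= enorm_lt// sq_snoc (_ : 2 ^+ 2 = 4)//; ring.
Qed.

Let Phi2_Ds (s : T) (y : Y) : 0 < y -> sq s.1 + y ^+ 2 < 4 -> 0 < s.2 < 1 -> Ds (Phi (s, y)).
Proof.
move=> y0 h /andP[h1 h2]; apply/Ds_Phi; split => //; first by lra.
by apply/andP; split; lra.
Qed.

Variables (tau b0 : R) (eta etat : T * Y -> R) (etad : 'I_n.+1 -> T * Y -> R).
Hypotheses (tau01 : 0 < tau <= 1) (b0_ge0 : 0 <= b0).
Hypotheses (ceta : continuous (eta : V * R -> R)) (cetat : continuous (etat : V * R -> R))
  (cetad : forall i, continuous (etad i : V * R -> R)) (eta1 : forall w, `|eta w| <= 1).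
Hypotheses
  (deta : forall (i : 'I_n) (y : R) (t : V),
    is_derive t (ex R i) (fun s : V => eta (s, y)) (etad (lift ord_max i) (t, y)))
  (detat : forall (y : R) (t : V), is_derive t (et R n) (fun s : V => eta (s, y)) (etat (t, y)))
  (detay : forall (t : T) (y : R),
    is_derive y (1 : R) (fun y : R => eta (t, y)) (etad ord_max (t, y)))
  (eta0 : forall (s : T) (y : R), 0 < s.2 < tau -> 4 <= sq s.1 + y ^+ 2 -> eta (s, y) = 0)
  (etad0 : forall i (s : T) (y : R), 0 < s.2 < tau -> 4 <= sq s.1 + y ^+ 2 -> etad i (s, y) = 0)
  (barrier : forall (s : T) (y : R), 0 < s.2 < tau -> sq s.1 + y ^+ 2 < 4 ->
    - b0 <= eta (s, y) * etat (s, y) - Lambda * \sum_i etad i (s, y) ^+ 2).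

(** [weak_monotone] applied to the energy weighted by eta^2. The limit inequality says that its
    distributional derivative is bounded below with total loss 2 b0 times the energy of U in the
    half ball of radius 2. *)
Lemma energy_slices : \int[leX]_X dens0 a U eta 0 X - 2 * b0 * total_energy tau <=
  \int[leX]_X dens0 a U eta tau X.
Proof.
have /andP[tau0 tau1] := tau01.
apply: (weak_monotone tau0 (intg_energy ha mU UM ceta eta1)
  (energy_right_limit ha mU UM cU ceta eta1) (energy_left_limit ha mU UM cU ceta eta1 tau01)).
move=> om om' t1 t2 t10 t2tau om0 om1 dom com' som som'.
have t21 : t2 < 1 by exact: lt_le_trans t2tau tau1.
have act t : t1 < t < t2 -> 0 < t < tau.
  by move=> /andP[h1 h2]; rewrite (lt_trans t10 h1) (lt_trans h2 t2tau).
(* The majorant ignores om and [t1, t2], because the loss in [weak_monotone] must be the same for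
   all time cut-offs. *)
pose B (w : T * Y) := between 0 tau (Phi w).2 * dens a U one (Phi w).
have [ib Eb] := ibdens tau.
have mb := intg_measurable ib.
have iB : (nu \x leb)%E.-integrable setT (EFin \o B) by exact: (intg_Phi mb ib).
have EB : \int[(nu \x leb)%E]_w B w = total_energy tau by rewrite -Eb (Rint_Phi mb).
have B0 w : 0 <= B w.
  rewrite /B /dens; apply: mulr_ge0; first exact: between_ge0.
  by apply: mulr_ge0; [exact: wB_ge0|apply: mulr_ge0; exact: sqr_ge0].
have BE (w : T * Y) : t1 < w.1.2 < t2 /\ sq w.1.1 + w.2 ^+ 2 < 4 -> Wt a w.2 * cutU U w ^+ 2 <= B w.
  case: w => s y [/= h1 h2].
  have [y0|y0] := boolP (0 < y); last by rewrite /Wt powc_out ?mul0r ?B0// negb_and y0.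
  have hs := act _ h1.
  have sD : Ds (Phi (s, y)).
    by apply: Phi2_Ds => //; have /andP[h3 h4] := hs; rewrite h3 (lt_le_trans h4).
  rewrite /B /dens /= /cutU !patchE mem_set// between_in// mul1r /etaZ expr1n mul1r.
  have h3 : B2 (rV_snoc (s.1, y)) by exact: (Phi2 y0 h2).
  rewrite /wB indicE mem_set// mulr1 /weight snoc_max /Wt powc_in//.
  by have [] := Ds_box sD.
have bar (w : T * Y) : t1 < w.1.2 < t2 /\ sq w.1.1 + w.2 ^+ 2 < 4 ->
    - b0 <= eta w * etat w - Lambda * \sum_i etad i w ^+ 2.
  by case: w => s y [h1 h2]; exact: (barrier (act _ h1) h2).
have := energy_limit HA ha mU mG IG UM WG WS (within_interior_continuous cU) t10 t21 om0 dom com' som som'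
  ceta cetat cetad deta detat detay (fun s y h => eta0 (act _ h)) (fun i s y h => etad0 i (act _ h))
  b0_ge0 om1 bar iB B0 BE.
rewrite EB => /le_trans; apply; rewrite lerN2.
have mo' : measurable_fun setT (om' : Y -> R) by exact: continuous_measurable_R.
have [C C0 hC] := continuous_bounded_supp com' som'.
rewrite -(int_dens_time ha mU UM ceta eta1 mo' hC).
have id1 := intg_dens ha mU UM ceta eta1.
have mF : measurable_fun setT (fun z : Z => om' z.2 * dens a U eta z).
  apply: measurable_funM; last exact: intg_measurable id1.
  exact: (measurableT_comp mo' measurable_snd).
rewrite (Rint_Phi mF) le_eqVlt; apply/orP; left; apply/eqP; apply: eq_Rint => -[s y] /=.
have [h|h] := boolP (t1 < s.2 < t2); last first.
  by rewrite som' ?(mulr0, mul0r)//; move: h; rewrite negb_and -!leNgt => /orP.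
have hs := act _ h.
have [y0|y0] := boolP (0 < y); last first.
  rewrite /Wt powc_out ?negb_and ?y0// mul0r /dens /wB indicE memNset ?(mulr0, mul0r)//.
  by move=> [_]; rewrite /= snoc_max => y0'; rewrite y0' in y0.
have EZ : etaZ eta (Phi (s, y)) = eta (s, y) by rewrite /etaZ tang_Phi snoc_max.
have [h4|h4] := ltP (sq s.1 + y ^+ 2) 4; last first.
  by rewrite /dens EZ eta0// !(expr0n, mulr0, mul0r).
have sD : Ds (Phi (s, y)).
  by apply: Phi2_Ds => //; have /andP[h3 h5] := hs; rewrite h3 (lt_le_trans h5).
rewrite /dens EZ /cutU !patchE mem_set// /wB indicE mem_set; last exact: Phi2.
rewrite mulr1 /weight snoc_max /Wt powc_in; last by have [] := Ds_box sD.
rewrite /=; ring.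
Qed.

End slice_inequality.

(** * The barrier and the theorem *)

Section positive_square.
Variable R : realType.

(** C^1 with derivative 2 x_+. It is used twice: for the plateau of the weight inside the unit ball,
    and for truncating at the level m. *)
Definition possq (x : R) : R := Num.max x 0 ^+ 2.

Lemma possq_bound (x h : R) : `|possq (x + h) - possq x - 2 * Num.max x 0 * h| <= h ^+ 2.
Proof.
rewrite /possq ler_norml.
have [a|a] := leP (x + h) 0; have [b|b] := leP x 0; rewrite ?expr2; apply/andP; split; nra.
Qed.

Lemma is_derive_possq (x : R) : is_derive x (1 : R) possq (2 * Num.max x 0).
Proof.
have L : (fun h : R => h^-1 *: (possq (h *: (1 : R) + x) - possq x)) @ (0 : R)^' --> 2 * Num.max x 0.
  apply/(@cvgrPdist_le R R^o) => e e0.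
  have N : \forall h \near (0 : R)^', `|h| < e by exact: (dnbhs0_lt e0).
  have N0 : \forall h \near (0 : R)^', h != 0 by exact: nbhs_dnbhs_neq.
  apply: filterS2 N N0 => h he h0.
  rewrite /GRing.scale/= mulr1.
  have -> : 2 * Num.max x 0 - h^-1 * (possq (h + x) - possq x) =
      - (h^-1 * (possq (x + h) - possq x - 2 * Num.max x 0 * h)).
    by rewrite [h + x]addrC; field.
  rewrite normrN normrM normfV ler_pdivrMl ?normr_gt0//.
  apply: le_trans (possq_bound x h) _.
  by rewrite -real_normK ?num_real// expr2 ler_wpM2l// ltW.
apply: DeriveDef; last exact: (cvg_lim (@Rhausdorff R) L).
by apply/cvg_ex; exists (2 * Num.max x 0).
Qed.

Lemma possq_continuous : continuous possq.
Proof.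
move=> x; apply: differentiable_continuous.
by apply/derivable1_diffP; have [] := is_derive_possq x.
Qed.

Lemma is_derive_chain (V : normedModType R) (f : V -> R) (g : R -> R) (x v : V) (d d' : R) :
  is_derive x v f d -> is_derive (f x) (1 : R) g d' -> is_derive x v (g \o f) (d' * d).
Proof.
move=> df dg; apply: is_derive_slice.
have d1 : is_derive (0 : R) (1 : R) (f \o (fun h : R => h *: v + x)) d.
  apply: (@is_derive_affine R R^o V f (fun h : R => h *: v + x) 0 1 v).
    by move=> h; rewrite scalerDl addrA; congr (_ *: _ + _ + _); rewrite /GRing.scale/= mulr1.
  by rewrite scale0r add0r.
have d2 : is_derive ((f \o (fun h : R => h *: v + x)) 0) (1 : R) g d'.
  by rewrite /= scale0r add0r.
have := @is_derive1_comp R g (f \o (fun h : R => h *: v + x)) 0 _ _ d2 d1.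
by [].
Qed.

End positive_square.

(** * The cut-off eta *)

Section barrier.
Variables (R : realType) (n : nat) (Lambda tau : R).
Hypotheses (L0 : 0 < Lambda) (tau0 : 0 < tau).
Local Notation T := ('rV[R]_n * measurableTypeR R)%type.
Local Notation V := ('rV[R]_n * R)%type.
Local Notation Y := (measurableTypeR R).

(* kf' = - kf / tau makes the time derivative of [gauss] dominate 2 Lambda times
   the square of its gradient, up to [level], the bound of [gauss] on |X| >= 2. *)
Definition kf (s : R) : R := expR (- s / tau) / (128 * Lambda * tau).
Definition level : R := expR (- (9 * kf tau)).
Definition gauss (r s : R) : R := expR (- (possq (r - 1) * kf s)).
Definition bar (r s : R) : R := possq (gauss r s - level).
Definition rad (w : T * Y) : R := sq w.1.1 + w.2 ^+ 2.

(* Derivative of [bar] when r and s have derivatives dr and ds. *)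
Definition dbar (r s dr ds : R) : R := 2 * Num.max (gauss r s - level) 0 *
  (gauss r s * (possq (r - 1) * kf s / tau * ds - 2 * Num.max (r - 1) 0 * dr * kf s)).

Definition etab (w : T * Y) : R := bar (rad w) w.1.2.
Definition etabt (w : T * Y) : R := dbar (rad w) w.1.2 0 1.
Definition etabd (i : 'I_n.+1) (w : T * Y) : R :=
  dbar (rad w) w.1.2 (2 * rV_snoc (w.1.1, w.2) 0 i) 0.

Lemma kf_gt0 s : 0 < kf s.
Proof. by rewrite divr_gt0 ?expR_gt0// !mulr_gt0. Qed.

Lemma is_derive_kf (s : R) : is_derive s (1 : R) kf (- (kf s / tau)).
Proof.
have d1 : is_derive s (1 : R) (fun s : R => - s / tau) (- tau^-1).
  apply: (@is_derive_ext R (fun s => s * - tau^-1) (fun s => - s / tau) s (- tau^-1 : R)) => //; last first.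
    by move=> y; ring.
  have a1 : is_derive s (1 : R) (fun s : R => s) 1 by exact: is_derive_id.
  have a2 : is_derive s (1 : R) (cst (- tau^-1) : R -> R) 0 by exact: is_derive_cst.
  apply: is_derive_ext (is_deriveM a1 a2) _ _ => //.
  by rewrite /GRing.scale/= mulr0 add0r mulr1.
have d2 : is_derive (- s / tau) (1 : R) expR (expR (- s / tau)) by exact: is_derive_expR.
have d3 := is_derive_chain (V := R^o) d1 d2.
have a2 : is_derive s (1 : R) (cst (128 * Lambda * tau)^-1 : R -> R) 0 by exact: is_derive_cst.
apply: is_derive_ext (is_deriveM d3 a2) _ _ => //.
by rewrite /GRing.scale/= mulr0 add0r /kf; ring.
Qed.

(** One chain rule for the directions x_i, y and t, which differ only in the derivatives dr of |X|^2
    and ds of t. *)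
Lemma is_derive_bar (W : normedModType R) (fr ft : W -> R) (x v : W) (dr ds : R) :
  is_derive x v fr dr -> is_derive x v ft ds ->
  is_derive x v (fun s => bar (fr s) (ft s)) (dbar (fr x) (ft x) dr ds).
Proof.
move=> hr ht.
have c1 (c : R) : is_derive x v (cst c : W -> R) 0 by exact: is_derive_cst.
have e1 := is_derive_chain (is_deriveD hr (c1 (- 1))) (is_derive_possq _).
have e2 := is_derive_chain ht (is_derive_kf _).
have e3 := is_deriveN (is_deriveM e1 e2).
have e4 := is_derive_chain e3 (is_derive_expR _).
have e5 := is_derive_chain (is_deriveD e4 (c1 (- level))) (is_derive_possq _).
have -> : dbar (fr x) (ft x) dr ds = 2 * Num.max (gauss (fr x) (ft x) - level) 0 *
    (gauss (fr x) (ft x) * - (possq (fr x - 1) *: (- (kf (ft x) / tau) * ds) +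
       kf (ft x) *: (2 * Num.max (fr x - 1) 0 * (dr + 0))) + 0).
  by rewrite /dbar /GRing.scale/=; ring.
exact: e5.
Qed.

Lemma is_derive_quadratic (a b c : R) : is_derive (0 : R) (1 : R) (fun h : R => h ^+ 2 * a + h * b + c) b.
Proof.
have d0 (e : R) : is_derive (0 : R) (1 : R) (cst e : R -> R) 0 by exact: is_derive_cst.
have d1 : is_derive (0 : R) (1 : R) (fun h : R => h) 1 by exact: is_derive_id.
have d2 := is_deriveD (is_deriveD (is_deriveM (is_deriveM d1 d1) (d0 a)) (is_deriveM d1 (d0 b))) (d0 c).
by apply: is_derive_ext d2 _ _ => [//|]; rewrite /GRing.scale/=; ring.
Qed.

Lemma is_derive_rad (y : R) (t v : V) :
  is_derive t v (fun s : V => rad (s, y)) (2 * \sum_j v.1 0 j * t.1 0 j).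
Proof.
apply: is_derive_slice.
apply: is_derive_ext (is_derive_quadratic (sq v.1) (2 * \sum_j v.1 0 j * t.1 0 j) (rad (t, y))) _ _ => // h.
rewrite /rad /= addrA; congr (_ + _); rewrite mulrCA /sq !mulr_sumr -!big_split/=.
by apply: eq_bigr => j _; rewrite !mxE; ring.
Qed.

Lemma is_derive_time (t v : V) : is_derive t v (fun s : V => s.2 : R) v.2.
Proof.
apply: is_derive_slice.
by apply: is_derive_ext (is_derive_quadratic 0 v.2 t.2) _ _ => // h; rewrite mulr0 add0r.
Qed.

Lemma etab_space (i : 'I_n) (y : R) (t : V) :
  is_derive t (ex R i) (fun s : V => etab (s, y)) (etabd (lift ord_max i) (t, y)).
Proof.
have := is_derive_bar (is_derive_rad y t (ex R i)) (is_derive_time t (ex R i)).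
rewrite /etabd snoc_lift (_ : \sum_j _ = t.1 0 i)//.
rewrite (bigD1 i)//= big1 ?addr0 => [|j ji]; first by rewrite mxE !eqxx mul1r.
by rewrite mxE (negbTE ji) andbF mul0r.
Qed.

Lemma etab_time (y : R) (t : V) : is_derive t (et R n) (fun s : V => etab (s, y)) (etabt (t, y)).
Proof.
have := is_derive_bar (is_derive_rad y t (et R n)) (is_derive_time t (et R n)).
by rewrite big1 ?mulr0// => j _; rewrite mxE mul0r.
Qed.

Lemma etab_vertical (t : T) (y : R) :
  is_derive y (1 : R) (fun y : R => etab (t, y)) (etabd ord_max (t, y)).
Proof.
have d1 : is_derive y (1 : R) (fun y : R => rad (t, y)) (2 * y).
  apply: (@is_derive_slice R R^o).
  apply: is_derive_ext (is_derive_quadratic 1 (2 * y) (rad (t, y))) _ _ => // h.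
  by rewrite /rad /GRing.scale/=; ring.
have d2 : is_derive y (1 : R) (fun _ : R => t.2 : R) 0 by exact: is_derive_cst.
by have := is_derive_bar (W := R^o) d1 d2; rewrite /etabd snoc_max.
Qed.

Lemma rad_continuous : continuous (rad : V * R -> R).
Proof.
move=> w; apply: (@cvgD R R^o).
  apply: (@continuous_comp _ _ _ (fun w : V * R => w.1.1) (@sq R n)); last exact: sq_continuous.
  by apply: (@continuous_comp _ _ _ (fun w : V * R => w.1) fst); exact: cvg_fst.
by rewrite expr2; apply: cvgM; exact: cvg_snd.
Qed.

Lemma time_continuous : continuous (fun w : V * R => w.1.2).
Proof. by move=> w; apply: (@continuous_comp _ _ _ (fun w : V * R => w.1) snd); [exact: cvg_fst|exact: cvg_snd]. Qed.

Let ccomp (f : V * R -> R) (g : R -> R) : continuous f -> continuous g -> continuous (fun w => g (f w)).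
Proof. by move=> cf cg w; apply: (@continuous_comp _ _ _ f g); [exact: cf|exact: cg]. Qed.

Let cadd (f g : V * R -> R) : continuous f -> continuous g -> continuous (fun w => f w + g w).
Proof. by move=> cf cg w; apply: (@cvgD R R^o); [exact: cf|exact: cg]. Qed.

Let cmul (f g : V * R -> R) : continuous f -> continuous g -> continuous (fun w => f w * g w).
Proof. by move=> cf cg w; apply: cvgM; [exact: cf|exact: cg]. Qed.

Let cconst (c : R) : continuous (fun _ : V * R => c). Proof. by move=> w; exact: cst_continuous. Qed.

Let cmax : continuous (fun x : R => Num.max x 0).
Proof. by move=> x; apply: continuous_max => //; exact: cst_continuous. Qed.

Let ckf : continuous kf.
Proof.
move=> s; apply: differentiable_continuous.
by apply/derivable1_diffP; have [] := is_derive_kf s.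
Qed.

Let coppr (f : V * R -> R) : continuous f -> continuous (fun w => - f w).
Proof. by move=> cf w; apply: (@cvgN R R^o); exact: cf. Qed.

Let cr1 : continuous (fun w : V * R => rad w - 1).
Proof. by apply: (cadd (f := rad) (g := fun=> - 1)); [exact: rad_continuous|exact: cconst]. Qed.

Let ckt : continuous (fun w : V * R => kf w.1.2).
Proof. by apply: (ccomp (f := fun w : V * R => w.1.2) (g := kf)); [exact: time_continuous|exact: ckf]. Qed.

Let cP : continuous (fun w : V * R => possq (rad w - 1)).
Proof. by apply: (ccomp (f := fun w : V * R => rad w - 1) (g := @possq R)); [exact: cr1|exact: possq_continuous]. Qed.

Let cgauss : continuous (fun w : V * R => gauss (rad w) w.1.2).
Proof.
apply: (ccomp (f := fun w : V * R => - (possq (rad w - 1) * kf w.1.2)) (g := expR)); last exact: continuous_expR.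
by apply: coppr; apply: cmul; [exact: cP|exact: ckt].
Qed.

Let cgm : continuous (fun w : V * R => gauss (rad w) w.1.2 - level).
Proof. by apply: (cadd (g := fun=> - level)); [exact: cgauss|exact: cconst]. Qed.

Lemma etab_continuous : continuous (etab : V * R -> R).
Proof. by apply: (ccomp (g := @possq R)); [exact: cgm|exact: possq_continuous]. Qed.

Let cdbar (fr fs : V * R -> R) : continuous fr -> continuous fs ->
  continuous (fun w : V * R => dbar (rad w) w.1.2 (fr w) (fs w)).
Proof.
move=> cfr cfs; apply: cmul.
  by apply: cmul => //; apply: (ccomp (g := fun x => Num.max x 0)); [exact: cgm|exact: cmax].
apply: cmul => //; apply: cadd; first by apply: cmul => //; apply: cmul => //; exact: cmul.
apply: coppr; apply: cmul => //; apply: cmul => //; apply: cmul => //.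
by apply: (ccomp (g := fun x => Num.max x 0)); [exact: cr1|exact: cmax].
Qed.

Lemma etabt_continuous : continuous (etabt : V * R -> R).
Proof. by apply: (cdbar (fr := fun=> 0) (fs := fun=> 1)); exact: cconst. Qed.

Lemma etabd_continuous i : continuous (etabd i : V * R -> R).
Proof.
apply: (cdbar (fr := fun w : V * R => 2 * rV_snoc (w.1.1, w.2) 0 i) (fs := fun=> 0)); last exact: cconst.
apply: cmul => //; case: (unliftP ord_max i) => [j|] ->.
  rewrite (_ : (fun w => _) = fun w : V * R => w.1.1 0 j); last by apply/funext => w; rewrite snoc_lift.
  move=> w; apply: (@continuous_comp _ _ _ (fun w : V * R => w.1) (fun s : V => s.1 0 j)); first exact: cvg_fst.
  exact: coord_fst_continuous.
rewrite (_ : (fun w => _) = fun w : V * R => w.2); last by apply/funext => w; rewrite snoc_max.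
by move=> w; exact: cvg_snd.
Qed.

Lemma gauss_le1 r s : gauss r s <= 1.
Proof.
rewrite /gauss -expR0 ler_expR oppr_le0 mulr_ge0 ?(ltW (kf_gt0 _))//.
exact: sqr_ge0.
Qed.

Lemma level_gt0 : 0 < level. Proof. exact: expR_gt0. Qed.

Let g01 r s : 0 <= Num.max (gauss r s - level) 0 <= 1.
Proof.
rewrite le_max lexx orbT ge_max ler01 andbT.
have := gauss_le1 r s; have := level_gt0; lra.
Qed.

Lemma etab_le1 w : `|etab w| <= 1.
Proof.
have /andP[h1 h2] := g01 (rad w) w.1.2.
by rewrite /etab /bar /possq ger0_norm ?sqr_ge0// exprn_ile1.
Qed.

(** For |X|^2 >= 4 the factor (|X|^2 - 1)^2 is at least 9, and [kf] decreases, so it is at least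
    [kf tau] up to time tau; hence [gauss] is at most [level]. *)
Let far_zero (s : T) (y : R) : 0 < s.2 < tau -> 4 <= sq s.1 + y ^+ 2 ->
  Num.max (gauss (rad (s, y)) s.2 - level) 0 = 0.
Proof.
move=> /andP[h1 h2] h3; apply: max_r; rewrite subr_le0 /gauss /level ler_expR lerN2.
have t0 := tau0.
apply: ler_pM => //; first exact: ltW (kf_gt0 _).
  rewrite /possq /rad /=.
  have -> : Num.max (sq s.1 + y ^+ 2 - 1) 0 = sq s.1 + y ^+ 2 - 1 by apply: max_l; lra.
  by move: (sq s.1 + y ^+ 2) h3 => r h3; nra.
rewrite /kf ler_pM2r ?invr_gt0 ?mulr_gt0// ler_expR ler_pM2r ?invr_gt0// lerN2.
exact: ltW.
Qed.

Lemma etab_far (s : T) (y : R) : 0 < s.2 < tau -> 4 <= sq s.1 + y ^+ 2 -> etab (s, y) = 0.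
Proof. by move=> h1 h2; rewrite /etab /bar /possq far_zero// expr0n. Qed.

Lemma etabd_far i (s : T) (y : R) : 0 < s.2 < tau -> 4 <= sq s.1 + y ^+ 2 -> etabd i (s, y) = 0.
Proof. by move=> h1 h2; rewrite /etabd /dbar far_zero// mulr0 mul0r. Qed.

Lemma etab_initial (x : 'rV[R]_n) (y : R) : sq x + y ^+ 2 < 1 -> etab ((x, 0), y) = (1 - level) ^+ 2.
Proof.
move=> h; rewrite /etab /bar /possq /gauss /possq /rad /=.
have -> : Num.max (sq x + y ^+ 2 - 1) 0 = 0 by apply: max_r; lra.
rewrite expr0n mul0r oppr0 expR0 max_l// subr_ge0 /level -expR0 ler_expR oppr_le0.
by rewrite mulr_ge0// ltW// kf_gt0.
Qed.

(** Both terms share the factor 2 g^2 H, where H = E h^2 k lies in [0, 1]. What remains is g / t -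
    128 Lambda k E r / 4 >= (g - E) / t >= - m / t; the constant 128 is exactly what r <= 4
    requires. *)
Lemma barrier_arith (g E h k r m t : R) : 0 <= g <= 1 -> 0 <= E -> 0 <= k -> 0 < t -> 0 <= r <= 4 ->
  E - m <= g -> 0 <= m -> E * (h ^+ 2 * k) <= 1 -> 128 * Lambda * k <= t^-1 ->
  - (2 * m / t) <= g ^+ 2 * (2 * g * (E * (h ^+ 2 * k / t))) -
     Lambda * ((2 * g * (E * (2 * h * k))) ^+ 2 * (4 * r)).
Proof.
move=> /andP[g0 g1] E0 k0 t0 /andP[r0 r4] gE m0 EH Lk.
pose H := E * (h ^+ 2 * k); have H0 : 0 <= H.
  by apply: mulr_ge0 => //; apply: mulr_ge0 => //; exact: sqr_ge0.
pose q := t^-1; have q0 : 0 < q by rewrite invr_gt0.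
have -> : g ^+ 2 * (2 * g * (E * (h ^+ 2 * k / t))) = 2 * (g ^+ 2 * H) * (g * q) by rewrite /H /q; ring.
have -> : Lambda * ((2 * g * (E * (2 * h * k))) ^+ 2 * (4 * r)) =
    2 * (g ^+ 2 * H) * ((128 * Lambda * k) * E * (r / 4)) by rewrite /H; field.
rewrite -mulrBr -/q.
have r1 : 0 <= r / 4 <= 1 by apply/andP; split; lra.
have b1 : (128 * Lambda * k) * E * (r / 4) <= q * E.
  case/andP: r1 => r1 r2; rewrite -[leRHS]mulr1 ler_pM//.
    by rewrite !mulr_ge0// ltW.
  by rewrite ler_wpM2r.
have b2 : - (m * q) <= g * q - (128 * Lambda * k) * E * (r / 4).
  apply: (@le_trans _ _ (g * q - q * E)); last by rewrite lerD2l lerN2.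
  have : 0 <= q * (g - (E - m)) by rewrite mulr_ge0 ?subr_ge0// ltW.
  lra.
have c1 : 0 <= g ^+ 2 * H <= 1.
  by rewrite mulr_ge0 ?sqr_ge0//= -[leRHS]mulr1 ler_pM ?sqr_ge0// exprn_ile1.
case/andP: c1 => c1 c2.
have mq : 0 <= m * q by rewrite mulr_ge0// ltW.
apply: (@le_trans _ _ (2 * (g ^+ 2 * H) * - (m * q))); last by rewrite ler_wpM2l// mulr_ge0.
have : 0 <= (1 - g ^+ 2 * H) * (m * q) by rewrite mulr_ge0// subr_ge0.
lra.
Qed.

Lemma barrier_inequality (s : T) (y : R) : 0 < s.2 < tau -> sq s.1 + y ^+ 2 < 4 ->
  - (2 * level / tau) <= etab (s, y) * etabt (s, y) - Lambda * \sum_i etabd i (s, y) ^+ 2.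
Proof.
move=> /andP[s0 st] r4.
set w := (s, y); set r := rad w.
pose g := Num.max (gauss r s.2 - level) 0; pose E := gauss r s.2.
pose h := Num.max (r - 1) 0; pose k := kf s.2.
have r0 : 0 <= r.
  by rewrite addr_ge0 ?sqr_ge0//; apply: sumr_ge0 => i _; exact: sqr_ge0.
have E0 : 0 < E by exact: expR_gt0.
(* z exp (- z) <= 1 with z = h^2 k, the exponent of [gauss]. *)
have EH : E * (h ^+ 2 * k) <= 1.
  rewrite (_ : E = expR (- (h ^+ 2 * k)))//; move: (h ^+ 2 * k) => z.
  rewrite expRN mulrC ler_pdivrMr ?expR_gt0// mul1r.
  by have := expR_ge1Dx z; apply: le_trans; rewrite lerDr.
have Lk : 128 * Lambda * k <= tau^-1.
  have -> : 128 * Lambda * k = expR (- s.2 / tau) / tau.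
    by rewrite /k /kf; field; rewrite !gt_eqF.
  rewrite -[leRHS]mul1r ler_pM2r ?invr_gt0// -expR0 ler_expR.
  by rewrite mulNr oppr_le0 divr_ge0// ltW.
have gE : E - level <= g by rewrite /g le_max lexx.
have r4' : 0 <= r <= 4 by rewrite r0 ltW.
have := barrier_arith (g01 r s.2) (ltW E0) (ltW (kf_gt0 s.2)) tau0 r4' gE (ltW level_gt0) EH Lk.
move=> /le_trans; apply; rewrite le_eqVlt; apply/orP; left; apply/eqP.
congr (_ - Lambda * _).
  rewrite /etab /etabt /bar /dbar -/r /possq -/g -/h -/k -/E /=; ring.
have Er : \sum_i (rV_snoc (s.1, y) 0 i) ^+ 2 = r by rewrite -/(sq _) sq_snoc.
transitivity ((2 * g * (E * (2 * h * k))) ^+ 2 * (4 * \sum_i (rV_snoc (s.1, y) 0 i) ^+ 2)).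
  by rewrite Er.
have Ed i : etabd i w = 2 * g * (E * (possq (r - 1) * k / tau * 0 -
    2 * h * (2 * rV_snoc (s.1, y) 0 i) * k)) by [].
rewrite mulrA mulr_sumr; apply: eq_bigr => i _; rewrite Ed. ring.
Qed.

End barrier.

(** * Integrals of functions not known to be measurable *)

Section null_slice.
Import HBNNSimple.
Local Open Scope ereal_scope.
Context d (T : measurableType d) (R : realType) (mu : {measure set T -> \bar R}).

(** The lower integral by simple functions. For non-negative functions the integral is this supremum
    by definition, measurable or not. *)
Let nn (f : T -> \bar R) := ereal_sup [set sintegral mu h |
  h in [set h : {nnsfun T >-> R} | forall x : T, (h x)%:E <= f x]].

Let integral_nn (D : set T) (f : T -> \bar R) : (forall x, 0 <= f x) ->
  \int[mu]_(x in D) f x = nn (f \_ D).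
Proof. by move=> f0; rewrite ge0_integralE. Qed.

(* f need not be measurable on D: nothing is known about the measurability of U
   on the slice t = 0 of the numerator of theta. *)
Lemma ge0_integral_subset (D Q : set T) (f : T -> \bar R) : (forall x, 0 <= f x) -> Q `<=` D ->
  \int[mu]_(x in Q) f x <= \int[mu]_(x in D) f x.
Proof.
move=> f0 QD; rewrite !integral_nn//; apply: ereal_sup_le => _ [h hf <-]; exists h => // x.
apply: le_trans (hf x) _; rewrite !patchE; case: ifPn => [/set_mem/QD xD|_].
  by rewrite mem_set.
by case: ifP => _; [exact: f0|].
Qed.

(** Off N, a simple function below f on D is below f on Q, and N does not contribute to the integral
    of a simple function. *)
Lemma ge0_integral_null_extension (D Q N : set T) (f : T -> \bar R) : (forall x, 0 <= f x) ->
  measurable Q -> measurable_fun Q f -> measurable N -> mu N = 0 -> D `<=` Q `|` N ->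
  \int[mu]_(x in D) f x <= \int[mu]_(x in Q) f x.
Proof.
move=> f0 mQ mf mN N0 DQN; rewrite (integral_nn D)//; apply: ge_ereal_sup => _ [h hf <-].
rewrite -integralT_nnsfun.
have mh : measurable_fun setT (EFin \o h) by exact/measurable_EFinP.
have -> : integral mu setT (fun x : T => (h x)%:E) = integral mu (~` N) (fun x : T => (h x)%:E).
  rewrite (@ge0_negligible_integral _ _ _ mu setT N) ?setTD// => x _.
  by rewrite lee_fin.
rewrite integral_mkcond [leRHS]integral_mkcond; apply: ge0_le_integral => //.
- by move=> x _; rewrite patchE; case: ifP => // _; rewrite lee_fin.
- apply/(measurable_restrictT _ (measurableC mN)).
  exact: measurable_funS mh.
- exact/(measurable_restrictT _ mQ).
move=> x _; rewrite !patchE; case: ifPn => [/set_mem xN|_]; last by case: ifP => // _; exact: f0.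
case: ifPn => xQ; last first.
  apply: le_trans (hf x) _; rewrite patchE; case: ifPn => // /set_mem/DQN[xQ'|//].
  by move: xQ; rewrite notin_setE.
by apply: le_trans (hf x) _; rewrite patchE; case: ifP => // _; exact: f0.
Qed.

End null_slice.

(** * The choice of N *)

Section arithmetic.
Variable R : realType.

(** For t <= 1 / (N L), L = log (N theta), half of the exponent c / t beats log (N theta) and the
    other half beats 1 / t. The loss is therefore of order 1 / N, and one N serves all theta >=
    th0. *)
Lemma final_arith (c th0 : R) : 0 < c -> 0 < th0 ->
  exists N : R, 2 < N /\ forall th, th0 <= th -> 1 <= N * ln (N * th) /\
    forall t, 0 < t -> t <= 1 / (N * ln (N * th)) ->
      t <= 1 /\ 1 <= N * ((1 - expR (- (c / t))) ^+ 4 - 4 * expR (- (c / t)) / t * th).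
Proof.
move=> c0 t0.
(* One summand for each requirement: N > 2; c N >= 2, so that c / t >= 2 L; N / 16 - 8 / c >= 1 at
   the end; and N th0 >= e, so that L >= 1. *)
pose N := 3 + 2 / c + 16 * (1 + 8 / c) + expR 1 / th0.
have c1 : 0 < 2 / c by rewrite divr_gt0.
have c8 : 0 < 8 / c by rewrite divr_gt0.
have e0 : 0 < expR 1 / th0 by rewrite divr_gt0// expR_gt0.
have N3 : 3 <= N by rewrite /N; lra.
have Nc : 2 <= c * N.
  have : 2 / c <= N by rewrite /N; lra.
  by rewrite ler_pdivrMr// mulrC.
have N16 : 16 * (1 + 8 / c) <= N by rewrite /N; lra.
have Ne : expR 1 <= N * th0.
  have : expR 1 / th0 <= N by rewrite /N; lra.
  by rewrite ler_pdivrMr.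
have N0 : 0 < N by lra.
exists N; split; first by lra.
move=> th hth; have th_gt0 : 0 < th by exact: lt_le_trans hth.
pose L := ln (N * th).
have NT0 : 0 < N * th by rewrite mulr_gt0.
have L1 : 1 <= L.
  have h : expR 1 <= N * th by apply: le_trans Ne _; rewrite ler_pM2l.
  by rewrite -[leLHS]expRK /L ler_ln ?posrE ?expR_gt0.
have NL : N <= N * L by rewrite ler_peMr// ltW.
have NL0 : 0 < N * L by apply: lt_le_trans NL.
split; first by rewrite -/L; lra.
move=> t tp; rewrite -/L => htL.
have NLt : N * L <= t^-1 by rewrite -[leLHS]invrK lef_pV2 ?posrE ?invr_gt0// -[leRHS]mul1r.
have t1 : t <= 1 by rewrite -[leLHS]invrK invf_le1 ?invr_gt0//; lra.
split => //.
set x := t^-1 in NLt *; have x0 : 0 < x by rewrite invr_gt0.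
have cx : c * (N * L) <= c * x by rewrite ler_pM2l.
have cNL : 2 * L <= c * (N * L) by rewrite mulrA ler_wpM2r//; lra.
pose m := expR (- (c * x)).
have m0 : 0 < m by exact: expR_gt0.
(* c x >= 2 L >= 2, and exp (c x) >= 1 + c x >= 3; so 1 - m >= 1 / 2 and its fourth power is at
   least 1 / 16. *)
have m3 : 3 * m <= 1.
  rewrite /m expRN ler_pdivrMr ?expR_gt0// mul1r.
  by have := expR_ge1Dx (c * x); lra.
(* x exp (- c x) <= (2 / c) exp (- c x / 2) <= (2 / c) exp (- L) *)
have mx : m * x * th <= 2 / c * N^-1.
  have s1 : c * x / 2 <= expR (c * x / 2) by have := expR_ge1Dx (c * x / 2); lra.
  have s2 : m = expR (- (c * x / 2)) * expR (- (c * x / 2)).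
    by rewrite -expRD /m; congr expR; field.
  have s3 : expR (- (c * x / 2)) <= (N * th)^-1.
    rewrite -[N * th]lnK ?posrE// -expRN ler_expR lerN2 -/L.
    by lra.
  have s4 : expR (- (c * x / 2)) * x <= 2 / c.
    rewrite expRN mulrC ler_pdivrMr ?expR_gt0//.
    apply: (@le_trans _ _ (2 / c * (c * x / 2))); last by rewrite ler_wpM2l// ltW.
    have -> : 2 / c * (c * x / 2) = x by field; rewrite gt_eqF.
    exact: lexx.
  have -> : m * x * th = (expR (- (c * x / 2)) * x) * (expR (- (c * x / 2)) * th) by rewrite s2; ring.
  rewrite ler_pM//.
  - by rewrite mulr_ge0 ?expR_ge0// ltW.
  - by rewrite mulr_ge0 ?expR_ge0// ltW.
  - have -> : N^-1 = (N * th)^-1 * th by field; rewrite !gt_eqF.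
    by rewrite ler_wpM2r// ltW.
have -> : expR (- (c / t)) = m by [].
have -> : 4 * m / t * th = 4 * (m * x * th) by rewrite -/x; ring.
have p4 : 16^-1 <= (1 - m) ^+ 4.
  have h : 2^-1 <= 1 - m by lra.
  have -> : 16^-1 = (2^-1 : R) ^+ 4 by field.
  by rewrite lerXn2r ?nnegrE//; lra.
have Ninv : 0 < N^-1 by rewrite invr_gt0.
have NN : N * N^-1 = 1 by rewrite divff// gt_eqF.
have q1 : N * (16^-1 - 4 * (2 / c * N^-1)) = N * 16^-1 - 8 / c.
  by rewrite mulrBr; congr (_ - _); rewrite mulrA mulrC -!mulrA; field; rewrite !gt_eqF.
apply: (@le_trans _ _ (N * (16^-1 - 4 * (2 / c * N^-1)))); last first.
  by rewrite ler_pM2l//; lra.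
by rewrite q1; lra.
Qed.

End arithmetic.

(** Averaging against a fixed unit bump carried by ]1/2, 1[; C is a bound of the bump, increased by
    1 to be positive. *)
Lemma late_average (R : realType) : exists2 C : R, 0 < C &
  forall (F : measurableTypeR R -> R) (LB : R),
    (@lebesgue_measure R).-integrable setT (EFin \o F) -> (forall t, 0 <= F t) ->
    (forall t, 2^-1 < t < 1 -> LB <= F t) ->
    LB <= C * \int[@lebesgue_measure R]_t (between 0 1 t * F t).
Proof.
have h12 : (2^-1 : R) < 1 by lra.
have [rho [crho rho0 srho irho rho1]] := unit_bump h12.
have [C C0 hC] := continuous_bounded_supp crho srho.
exists (C + 1) => [|F LB iF F0 hF]; first by rewrite ltr_wpDl.
have ibF : (@lebesgue_measure R).-integrable setT (EFin \o (fun t => between 0 1 t * F t)).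
  apply: (intg_le _ (intg_norm iF)).
    by apply: measurable_funM; [exact: intg_measurable (intg_ind 1)|exact: intg_measurable iF].
  by move=> t; rewrite normrM ler_piMl// normr_between_le1.
have irF : (@lebesgue_measure R).-integrable setT (EFin \o (fun t => rho t * F t)).
  apply: (intg_le _ (intgZ C (intg_norm iF))).
    by apply: measurable_funM; [exact: intg_measurable irho|exact: intg_measurable iF].
  by move=> t; rewrite normrM ler_wpM2r.
have C10 : 0 <= C + 1 by rewrite addr_ge0.
apply: (@le_trans _ _ (\int[@lebesgue_measure R]_t (rho t * F t))).
  have -> : LB = \int[@lebesgue_measure R]_t (LB * rho t) by rewrite (RintZ _ irho) rho1 mulr1.
  apply: le_Rint => //; first exact: intgZ.
  move=> t; have [h|h] := boolP (2^-1 < t < 1); first by rewrite mulrC ler_wpM2l// hF.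
  by rewrite srho ?mulr0 ?mul0r//; move: h; rewrite negb_and -!leNgt => /orP.
rewrite -(RintZ _ ibF); apply: le_Rint => //; first exact: intgZ.
move=> t; have [h|h] := boolP (2^-1 < t < 1); last first.
  rewrite srho ?mul0r; last by move: h; rewrite negb_and -!leNgt => /orP.
  by rewrite mulr_ge0// mulr_ge0// between_ge0.
rewrite between_in ?mul1r ?ler_wpM2r//.
  by rewrite (le_trans (ler_norm _))// (le_trans (hC t))// lerDl.
by case/andP: h => h1 h2; apply/andP; split; lra.
Qed.

(** At s = tau the exponential in [kf] is 1 / e, so the level is exp (- c / tau) with c depending on
    Lambda only. *)
Lemma levelE (R : realType) (Lambda tau : R) : 0 < Lambda -> 0 < tau ->
  level Lambda tau = expR (- (9 * expR (- 1) / (128 * Lambda) / tau)).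
Proof.
move=> L0 t0; rewrite /level /kf mulNr divff ?gt_eqF//; congr (expR (- _)).
by field; rewrite !gt_eqF.
Qed.

(** * From energies to the masses of the statement *)

Section masses.
Variables (R : realType) (n : nat) (a Lambda K : R) (A : 'rV[R]_n -> 'M[R]_n.+1).
Hypothesis HA : admissible_coef Lambda K A.
Local Notation leb := (@lebesgue_measure R).
Local Notation Y := (measurableTypeR R).
Local Notation T := ('rV[R]_n * measurableTypeR R)%type.
Local Notation V := ('rV[R]_n * R)%type.
Local Notation Z := ('rV[R]_n.+1 * measurableTypeR R)%type.
Local Notation nu := (lebVt R n).
Local Notation Phi := (@Phi R n).
Local Notation Qs := (@Qs R n).
Local Notation Ds := (@Ds R n).
Local Notation b_ := (b_ R).

Variables (U : Z -> R) (G : Z -> 'rV[R]_n.+1) (M : R).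
Hypotheses (ha : -1 < a < 1) (mU : measurable_fun Qs U)
  (mG : forall i, measurable_fun Qs (fun z => G z 0 i))
  (IG : forall i, (\int[lebVt R n.+1]_(z in Qs) (weight a z.1 * (G z 0 i) ^+ 2)%:E < +oo)%E)
  (UM : forall z, Ds z -> `|U z| <= M).
Hypotheses (WG : is_weak_grad Qs U G)
  (WS : forall phi, test_function (cyl (eball 4) `]0, 16[%classic) phi ->
    \int[lebVt R n.+1]_(z in Qs)
      (weight a z.1 * (mxform (A (col' ord_max z.1)) (G z) (grad phi z)
                       + U z * dtime phi z)) = 0).


Hypothesis cU : {within (@Dbar R n), continuous (U : 'rV[R]_n.+1 * R -> R)}.
Local Notation X_ := ('rV[R]_n.+1).
Local Notation leX := (lebV R n.+1).
Local Notation one := (fun _ : T * Y => 1 : R).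

Lemma massE t : mass a U 2 t = \int[leX]_X dens0 a U one t X.
Proof.
rewrite /mass Rintegral_mkcond; apply: eq_Rint => X.
rewrite patchE /dens0 /wB /etaZ expr1n mul1r indicE.
by case: ifPn => h; rewrite ?h ?(negbTE h) ?mulr1// mulr0 mul0r.
Qed.

Lemma mass_unitE : mass a U 1 0 = \int[leX]_X (\1_(eball_plus 1) X * dens0 a U one 0 X).
Proof.
rewrite /mass Rintegral_mkcond; apply: eq_Rint => X.
rewrite patchE /dens0 /wB /etaZ expr1n mul1r !indicE.
case: ifPn => h; last by rewrite mul0r.
have /set_mem [h1 h2] := h.
rewrite mul1r mem_set ?mulr1//; split => //.
by move: h1; rewrite /eball/= => h1; apply: lt_trans h1 _; rewrite ltr1n.
Qed.

Lemma dens0_ge0 eta t X : 0 <= dens0 a U eta t X.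
Proof. by rewrite /dens0 mulr_ge0 ?wB_ge0// mulr_ge0// sqr_ge0. Qed.

Lemma mass_ge0 t : 0 <= mass a U 2 t.
Proof. by rewrite massE; apply: Rint_ge0 => X; exact: dens0_ge0. Qed.

Let c1 := @cst1_continuous R n.
Let n1 := @normr_one_le R n.

Let id0 t : 0 <= t <= 1 -> leX.-integrable setT (EFin \o dens0 a U one t).
Proof. exact: (intg_dens0 ha mU UM cU c1 n1). Qed.

Let i00 : leX.-integrable setT (EFin \o dens0 a U one 0).
Proof. by apply: id0; rewrite lexx ler01. Qed.

Let mB1 : measurable_fun setT (\1_(eball_plus 1) : X_ -> R).
Proof. by apply: measurable_indic; exact: measurable_eball_plus. Qed.

Let i1 : leX.-integrable setT (EFin \o (fun X => \1_(eball_plus 1) X * dens0 a U one 0 X)).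
Proof.
apply: (intg_le _ i00); first by apply: measurable_funM => //; exact: intg_measurable i00.
move=> X; have d0 := dens0_ge0 one 0 X.
have h : 0 <= \1_(eball_plus 1) X :> R by rewrite indicE ler0n.
rewrite (ger0_norm (mulr_ge0 h d0)) indicE.
by rewrite ler_piMl ?dens0_ge0// lern1 leq_b1.
Qed.

Lemma mass_unit_le : mass a U 1 0 <= mass a U 2 0.
Proof.
rewrite massE mass_unitE; apply: (le_Rint i1 i00) => X.
by rewrite /= indicE ler_piMl ?dens0_ge0// lern1 leq_b1.
Qed.

Lemma energyE t : 0 < t < 1 -> energy a U one t = mass a U 2 t.
Proof.
move=> /andP[h1 h2]; rewrite massE; apply: eq_Rint => X; rewrite /dens /dens0 /=.
have [hX|hX] := pselect (B2 X); last by rewrite /wB indicE memNset// mulr0 !mul0r.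
rewrite patchE mem_set//; split => /=; last by rewrite in_itv/= h1; lra.
by case: hX => h3 h4; split => //; rewrite /eball/= (lt_trans h3)// ltr_nat.
Qed.

Lemma energy_ge0 t : 0 <= energy a U one t.
Proof.
apply: Rint_ge0 => X; rewrite /dens; apply: mulr_ge0; first exact: wB_ge0.
by apply: mulr_ge0; exact: sqr_ge0.
Qed.

(** At time 0 eta equals (1 - m)^2 on the unit ball, whence the fourth power; at time tau it is at
    most 1. The barrier inequality gives b0 = 2 m / tau. *)
Lemma mass_estimate tau : 0 < tau <= 1 ->
  (1 - level Lambda tau) ^+ 4 * mass a U 1 0 - 2 * (2 * level Lambda tau / tau) * total_energy a U tau <=
  mass a U 2 tau.
Proof.
move=> t01; have /andP[t0 t1] := t01; have [L0 _ _ _] := HA.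
pose eta : T * Y -> R := etab Lambda tau.
have ce : continuous (eta : V * R -> R) by exact: etab_continuous.
have ne : forall w, `|eta w| <= 1 by move=> w; exact: etab_le1.
have b0 : 0 <= 2 * level Lambda tau / tau by rewrite divr_ge0 ?mulr_ge0 ?(ltW (level_gt0 _ _)) ?ltW.
have := energy_slices HA ha mU mG IG UM WG WS cU t01 b0 ce
  (@etabt_continuous R n Lambda tau) (@etabd_continuous R n Lambda tau) ne
  (@etab_space R n Lambda tau) (@etab_time R n Lambda tau) (@etab_vertical R n Lambda tau)
  (fun s y => @etab_far R n Lambda tau L0 t0 s y) (fun i s y => @etabd_far R n Lambda tau L0 t0 i s y)
  (fun s y => @barrier_inequality R n Lambda tau L0 t0 s y).
have tt01 : 0 <= tau <= 1 by rewrite (ltW t0).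
have h01 : 0 <= (0 : R) <= 1 by rewrite lexx ler01.
have j0 := intg_dens0 ha mU UM cU ce ne h01.
have jt := intg_dens0 ha mU UM cU ce ne tt01.
have le2 : \int[leX]_X dens0 a U eta tau X <= mass a U 2 tau.
  rewrite massE; apply: le_Rint => //; first exact: id0.
  move=> X; rewrite /dens0 ler_wpM2l ?wB_ge0// ler_wpM2r ?sqr_ge0// expr1n.
  by rewrite -real_normK ?num_real// exprn_ile1//; exact: ne.
have le1 : (1 - level Lambda tau) ^+ 4 * mass a U 1 0 <= \int[leX]_X dens0 a U eta 0 X.
  rewrite mass_unitE -(RintZ _ i1); apply: le_Rint => //; first exact: intgZ.
  move=> X; rewrite indicE; have [hX|hX] := boolP (X \in eball_plus 1); last first.
    by rewrite mul0r mulr0 dens0_ge0.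
  rewrite mul1r /dens0 mulrCA ler_wpM2l ?wB_ge0// expr1n mul1r.
  have -> : etaZ eta (X, 0) = (1 - level Lambda tau) ^+ 2.
    apply: etab_initial => //; have [h1 _] := set_mem hX.
    by move: h1; rewrite /eball/= enorm_lt// expr1n (sq_tang (X, 0)).
  by rewrite -exprM.
move: le1 le2; set I1 := \int[leX]_X dens0 a U eta 0 X; set I2 := \int[leX]_X dens0 a U eta tau X.
move: I1 I2 => I1 I2 le1 le2 le3; apply: le_trans le2; apply: le_trans le3.
by rewrite lerD2r.
Qed.

Hypothesis LU : (\int[lebVt R n.+1]_(z in Qs) (weight a z.1 * U z ^+ 2)%:E < +oo)%E.

(** The numerator of theta includes the slice t = 0, where measurability is unknown. Monotonicity of
    the lower integral gives the bound, and the null extension gives the finiteness that [fine]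
    needs. *)
Lemma total_energy_le tau : 0 < tau <= 1 -> total_energy a U tau <=
  \int[lebVt R n.+1]_(z in cyl (eball_plus 4) `[0, 16[%classic) (weight a z.1 * U z ^+ 2).
Proof.
move=> /andP[t0 t1].
have mb := intg_measurable (@intg_ind R tau).
have id1 := intg_dens ha mU UM c1 n1.
have f0 (z : Z) : (0 <= (weight a z.1 * U z ^+ 2)%:E)%E.
  by rewrite lee_fin mulr_ge0 ?powR_ge0 ?sqr_ge0.
have mweight : measurable_fun setT (fun z : Z => weight a z.1).
  apply: (measurableT_comp (measurable_powR _)).
  exact: (measurableT_comp (@measurable_coord R n.+1 ord_max) measurable_fst).
have mQU : measurable_fun Qs (fun z : Z => weight a z.1 * U z ^+ 2).
  by apply: measurable_funM; [exact: measurable_funTS|exact: measurable_funX].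
have mQ := @measurable_Qs R n.
have iQ : (lebVt R n.+1).-integrable Qs (EFin \o (fun z : Z => weight a z.1 * U z ^+ 2)).
  apply/integrableP; split; first exact/measurable_EFinP.
  apply: le_lt_trans LU; rewrite le_eqVlt; apply/orP; left; apply/eqP.
  by apply: eq_integral => z _; exact: (gee0_abs (f0 z)).
have iQ' : (lebVt R n.+1).-integrable setT (EFin \o ((fun z : Z => weight a z.1 * U z ^+ 2) \_ Qs)).
  by have /(integrable_mkcond _ mQ) := iQ; rewrite restrict_EFin.
have QD : Qs `<=` cyl (eball_plus 4) `[0, 16[%classic.
  move=> z [h1 h2]; split => //; move: h2; rewrite /= !in_itv/= => /andP[h2 ->].
  by rewrite ltW.
have lo := @ge0_integral_subset _ _ _ (lebVt R n.+1) _ _ _ f0 QD.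
have mN : measurable ((setT : set X_) `*` [set (0 : Y)]) by apply: measurableX.
have N0 : lebVt R n.+1 ((setT : set X_) `*` [set (0 : Y)]) = 0%E.
  rewrite [LHS](product_measure1E leX leb measurableT (measurable_set1 _)).
  by rewrite [X in (_ * X)%E](_ : _ = 0%E) ?mule0//; exact: lebesgue_measure_set1.
have DQN : cyl (eball_plus 4) `[0, 16[%classic `<=` Qs `|` ((setT : set X_) `*` [set (0 : Y)]).
  move=> z [h1]; rewrite /= in_itv/= le_eqVlt => /andP[/orP[/eqP h2|h2] h3]; first by right.
  by left; split => //; rewrite /= in_itv/= h2.
have mQE : measurable_fun Qs (fun z : Z => (weight a z.1 * U z ^+ 2)%:E) by exact/measurable_EFinP.
have hi := ge0_integral_null_extension f0 mQ mQE mN N0 DQN.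
have E := int_dens_time ha mU UM c1 n1 mb (fun s => normr_between_le1 0 tau s).
rewrite /total_energy -E.
apply: (@le_trans _ _ (\int[lebVt R n.+1]_z ((fun z : Z => weight a z.1 * U z ^+ 2) \_ Qs) z)).
  apply: le_Rint => //.
    apply: (intg_le _ (intg_norm id1)).
      apply: measurable_funM; last exact: intg_measurable id1.
      exact: (measurableT_comp mb measurable_snd).
    by move=> z; rewrite normrM ler_piMl// normr_between_le1.
  move=> z; have P0 : 0 <= ((fun z : Z => weight a z.1 * U z ^+ 2) \_ Qs) z.
    by rewrite patchE; case: ifP => // _; rewrite mulr_ge0 ?powR_ge0 ?sqr_ge0.
  rewrite /dens patchE; case: ifPn => [/set_mem zD|_]; last by rewrite expr0n mulr0 mulr0 mulr0.
  rewrite patchE mem_set; last exact: Ds_Qs.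
  rewrite expr1n mul1r; apply: (@le_trans _ _ (wB a z.1 * U z ^+ 2)).
    rewrite ler_piMl//; first by rewrite mulr_ge0 ?wB_ge0// sqr_ge0.
    by rewrite (le_trans (ler_norm _))// normr_between_le1.
  have w0 : 0 <= weight a z.1 by exact: powR_ge0.
  have b1 : \1_(@B2 R n) z.1 <= 1 :> R by rewrite indicE lern1 leq_b1.
  have wl : wB a z.1 <= weight a z.1 by rewrite /wB ler_piMr.
  by apply: ler_wpM2r => //; exact: sqr_ge0.
rewrite -Rintegral_mkcond /Rintegral; apply: fine_le => //.
- by rewrite ge0_fin_numE ?integral_ge0.
- by rewrite ge0_fin_numE ?integral_ge0//; exact: le_lt_trans hi LU.
Qed.

End masses.

Theorem lemma4p9 (R : realType) (n : nat) (a Lambda K : R)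
    (A : 'rV[R]_n -> 'M[R]_n.+1) :
  (0 < n)%N ->
  -1 < a < 1 ->
  admissible_coef Lambda K A ->
  (exists Gamma, fundamental_solution (tangential A) Gamma /\
                 total_mass_one Gamma) ->
  exists N : R, 2 < N /\
    forall U : 'rV[R]_n.+1 * R -> R,
      weak_solution a A U ->
      continuous_representative U ->
      0 < mass a U 1 0 ->
      1 <= N * ln (N * theta a U) /\
      forall t, 0 <= t <= 1 / (N * ln (N * theta a U)) ->
        mass a U 1 0 <= N * mass a U 2 t.
Proof.
move=> _ ha HA _; have [L0 _ _ _] := HA.
(* All constants are fixed before U: c is the exponent of [levelE], m1 the level at tau = 1. *)
pose c : R := 9 * expR (- 1) / (128 * Lambda).
have c0 : 0 < c by rewrite divr_gt0 ?mulr_gt0 ?expR_gt0.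
pose m1 : R := expR (- c).
have m10 : 0 < m1 by exact: expR_gt0.
have m11 : m1 < 1 by rewrite /m1 -expR0 ltr_expR oppr_lt0.
have [C C0 hC] := late_average R.
(* The lower bound of theta obtained below by averaging: (1 - m1)^4 times the unit mass is at most C
   + 8 m1 times the numerator. *)
pose th0 := (1 - m1) ^+ 4 / (C + 8 * m1).
have d0 : 0 < C + 8 * m1 by rewrite addr_gt0// mulr_gt0.
have th00 : 0 < th0 by rewrite divr_gt0// exprn_gt0// subr_gt0.
have [N [N2 HN]] := final_arith c0 th00.
exists N; split => // U [[mU LU] [G [WG LG WS]]] crep mpos.
have mG i : measurable_fun (@Qs R n) (fun z => G z 0 i) by have [] := LG i.
have IG i : (\int[lebVt R n.+1]_(z in @Qs R n) (weight a z.1 * (G z 0 i) ^+ 2)%:E < +oo)%E.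
  by have [] := LG i.
have cU : {within (@Dbar R n), continuous U}.
  have h3 : 0 < (3 : R) < 4 by apply/andP; split; lra.
  have := crep 3 h3; rewrite (_ : 3 ^+ 2 = 9 :> R)//; ring.
have [M UM] := within_bounded cU.
pose numer := \int[lebVt R n.+1]_(z in cyl (eball_plus 4) `[0, 16[%classic) (weight a z.1 * U z ^+ 2).
have thE : theta a U * mass a U 1 0 = numer by rewrite /theta divfK// gt_eqF.
have est tau : 0 < tau <= 1 -> (1 - expR (- (c / tau))) ^+ 4 * mass a U 1 0 -
    4 * expR (- (c / tau)) / tau * numer <= mass a U 2 tau.
  move=> t01; have /andP[t0 t1] := t01.
  have := mass_estimate HA ha mU mG IG UM WG WS cU t01; rewrite levelE// -/c.
  apply: le_trans; rewrite lerD2l lerN2.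
  have -> : 4 * expR (- (c / tau)) / tau = 2 * (2 * expR (- (c / tau)) / tau) by ring.
  have x0 : 0 <= 2 * (2 * expR (- (c / tau)) / tau).
    apply: mulr_ge0 => //; apply: divr_ge0; last exact: ltW.
    by apply: mulr_ge0 => //; exact: expR_ge0.
  exact: (ler_wpM2l x0 (total_energy_le ha mU UM LU t01)).
have num0 : 0 <= numer.
  by apply: Rintegral_ge0 => z _; rewrite mulr_ge0 ?powR_ge0 ?sqr_ge0.
(* For 1/2 < t < 1, exp (- c / t) <= m1 and 1 / t <= 2, so the estimate holds with coefficients free
   of t; 8 m1 is 4 m1 times 2. *)
have late t : 2^-1 < t < 1 -> (1 - m1) ^+ 4 * mass a U 1 0 - 8 * m1 * numer <= energy a U (fun=> 1) t.
  move=> /andP[h1 h2]; have t0 : 0 < t by lra.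
  rewrite energyE ?t0//.
  have t01 : 0 < t <= 1 by rewrite t0 ltW.
  apply: le_trans (est t t01).
  have tinv : 1 <= t^-1 <= 2.
    by rewrite -[leLHS]invr1 !lef_pV2 ?posrE// ?(ltW h2)//= -[leRHS]invrK lef_pV2 ?posrE ?invr_gt0// ltW.
  case/andP: tinv => tv1 tv2.
  have em : expR (- (c / t)) <= m1 by rewrite /m1 ler_expR lerN2 ler_peMr// ltW.
  have e0 := expR_gt0 (- (c / t)).
  move: em e0; set x := expR _ => em e0.
  apply: lerB; first by rewrite ler_wpM2r ?(ltW mpos)// lerXn2r ?nnegrE ?subr_ge0 ?(ltW m11) ?lerD2l ?lerN2// (le_trans em)// ltW.
  rewrite ler_wpM2r//.
  have -> : 8 * m1 = 4 * m1 * 2 by ring.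
  by rewrite ler_pM// ?mulr_ge0// ?(ltW e0)// ?ler_pM2l// invr_ge0 ltW.
have thge : th0 <= theta a U.
  have ien := intg_energy ha mU UM (@cst1_continuous R n) (@normr_one_le R n).
  have := hC _ _ ien (energy_ge0 a U) late.
  have t11 : 0 < (1 : R) <= 1 by rewrite ltr01 lexx.
  have h1 := total_energy_le ha mU UM LU t11.
  move=> h2; have h3 : (1 - m1) ^+ 4 * mass a U 1 0 - 8 * m1 * numer <= C * numer.
    by apply: le_trans h2 _; rewrite ler_wpM2l// ltW.
  rewrite /th0 ler_pdivrMr// -(ler_pM2r mpos) [leRHS]mulrAC thE.
  by rewrite [leRHS]mulrC mulrDl; lra.
have [NL Nt] := HN _ thge; split => // t /andP[t0 tN].
have N0 : 0 < N by lra.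
(* The estimate divides by t; at t = 0 the claim is monotonicity of the mass in the radius. *)
have [t_gt0|t_le0] := ltP 0 t; last first.
  have -> : t = 0 by apply/eqP; rewrite eq_le t_le0.
  apply: le_trans (mass_unit_le ha mU UM cU) _.
  by rewrite ler_peMl ?mass_ge0//; lra.
have [t1 h] := Nt t t_gt0 tN.
have t01 : 0 < t <= 1 by rewrite t_gt0.
have := est t t01; rewrite -thE => h2.
have := ler_wpM2r (ltW mpos) h; rewrite mul1r => /le_trans; apply.
rewrite -(mulrA N) ler_pM2l//; apply: le_trans h2.
by rewrite mulrBl !mulrA.
Qed.
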